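(* Let $T$, $\mathcal V$, weak solutions, $R$ and $\mu$ be as in the context. Suppose there exists a positive weak solution $\psi_0$ of $T\psi_0=0$ with $\psi_0(r)=r^{-\mu}$ for $r\ge R$. Let $V\in\mathcal V$ be such that $$v:=\int_0^\infty V(r)\psi_0^2(r)\,r\,\mathrm{d}r>0.$$ Then for all sufficiently small $\alpha>0$ the operator $T-\alpha V$ has a unique negative eigenvalue $\lambda_\alpha$, and as $\alpha\to0+$ $$\lambda_\alpha=\begin{cases}-\exp\Big(-\dfrac{2}{\alpha v}\big(1+O(\alpha)\big)\Big), & \mu=0,\\[1ex] -c_\mu(\alpha v)^{1/\mu}\big(1+O(\alpha^{\min\{1,\frac1\mu-1\}})\big), & \mu\in(0,1),\\[1ex] -\dfrac{2\alpha v}{|\ln\alpha|}\Big(1+O\Big(\dfrac{\ln|\ln\alpha|}{|\ln\alpha|}\Big)\Big), & \mu=1,\\[1ex] -\dfrac{\alpha v}{\int_0^\infty\psi_0^2(r)\,r\,\mathrm{d}r}\Big(1+\begin{cases}O(\alpha^{\min\{1,\mu-1\}}),&\mu\ne2\\ O(\alpha|\ln\alpha|),&\mu=2\end{cases}\Big), & \mu>1,\end{cases}$$ where $c_\mu:=\Big(\dfrac{2^{2\mu-1}\Gamma(\mu)}{\Gamma(1-\mu)}\Big)^{1/\mu}$.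
   Context: Standing assumptions: (a) $W\in L_{1,\mathrm{loc}}(0,\infty)$ is real-valued and $W(r)=\mu^2r^{-2}$ for $r\ge R$, for some $R>0$, $\mu\ge0$ (W may have a non-integrable singularity at $0$). (b) For some $0\le a<1$, $M\ge0$ and all $\psi\in C_0^\infty(0,\infty)$: $\int_0^\infty W_-|\psi|^2r\,\mathrm{d}r\le a\int_0^\infty|\psi'|^2r\,\mathrm{d}r+M\int_0^\infty|\psi|^2r\,\mathrm{d}r$, where $W_-=\max\{-W,0\}$. (c) For all $\psi\in C_0^\infty(0,\infty)$: $\int_0^\infty(|\psi'|^2+W|\psi|^2)r\,\mathrm{d}r\ge0$. Let $t$ be the closure of this form in $L_2(\mathbb{R}_+,r\,\mathrm{d}r)$, with domain $\operatorname{dom}t=\{\psi\in L_2(\mathbb{R}_+,r\,\mathrm{d}r):\psi',W_+^{1/2}\psi\in L_2(\mathbb{R}_+,r\,\mathrm{d}r)\}$, and $T\ge0$ the associated self-adjoint operator (acting as $T\psi=-r^{-1}(r\psi')'+W\psi$). $\mathcal V$ is the set of $V\in L_{1,\mathrm{loc}}(0,\infty)$ with compact support such that $(T+1)^{-1/2}V(T+1)^{-1/2}$ is compact; for $V\in\mathcal V$, $T-V$ is defined via its quadratic form on $\operatorname{dom}t$. The local form domain is $\operatorname{dom}_{\mathrm{loc}}t=\{\psi\in L_{2,\mathrm{loc}}([0,\infty),r\,\mathrm{d}r):\psi',W_+^{1/2}\psi\in L_{2,\mathrm{loc}}([0,\infty),r\,\mathrm{d}r)\}$. A function $\psi$ is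 a weak solution of $T\psi=0$ if $\psi\in\operatorname{dom}_{\mathrm{loc}}t$ and $t[\phi,\psi]=0$ for every $\phi\in\operatorname{dom}t$ with compact support in $[0,\infty)$ (so a boundary condition at $0$ is incorporated, but no decay condition at infinity). *)

(* Defs.v *)
From HB Require Import structures.
From mathcomp Require Import all_boot all_order all_algebra.
From mathcomp Require Import all_classical all_reals all_analysis.
Set Implicit Arguments. Unset Strict Implicit. Unset Printing Implicit Defensive.
Import Order.TTheory GRing.Theory Num.Theory.
Import numFieldNormedType.Exports.
Local Open Scope classical_set_scope.
Local Open Scope ring_scope.

Section Defs.
Variable R : realType.
Local Notation leb := (@lebesgue_measure R).

Definition Rp : set R := `]0, +oo[.

Definition wint (f : R -> R) : R := \int[leb]_(x in Rp) (f x * x).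

Definition wintegrable (D : set R) (f : R -> R) : Prop :=
  leb.-integrable D (fun x => (f x * x)%:E).

Definition wL2 (f : R -> R) : Prop := wintegrable Rp (fun x => f x ^+ 2).

Definition locL1 (f : R -> R) : Prop :=
  forall a b, 0 < a -> leb.-integrable `[a, b] (EFin \o f).

(* psi is locally absolutely continuous on (0,oo) with (a.e.) derivative dpsi,
   i.e. dpsi is the weak derivative of psi on (0,oo). *)
Definition hasDeriv (psi dpsi : R -> R) : Prop :=
  locL1 dpsi /\
  forall a b, 0 < a -> a <= b ->
    (\int[leb]_(x in `[a, b]) (dpsi x)%:E = (psi b - psi a)%:E)%E.

Definition posp (W : R -> R) (x : R) : R := Num.max (W x) 0.
Definition negp (W : R -> R) (x : R) : R := Num.max (- W x) 0.

Definition in_domt (W psi dpsi : R -> R) : Prop :=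
  hasDeriv psi dpsi /\ wL2 psi /\ wL2 dpsi /\
  wintegrable Rp (fun x => posp W x * psi x ^+ 2).

Definition in_domloc (W psi dpsi : R -> R) : Prop :=
  hasDeriv psi dpsi /\
  forall b, 0 < b ->
    [/\ wintegrable `]0, b] (fun x => psi x ^+ 2),
        wintegrable `]0, b] (fun x => dpsi x ^+ 2) &
        wintegrable `]0, b] (fun x => posp W x * psi x ^+ 2)].

Definition tform (W phi dphi psi dpsi : R -> R) : R :=
  wint (fun x => dphi x * dpsi x + W x * phi x * psi x).

Definition tnorm2 (W psi dpsi : R -> R) : R :=
  tform W psi dpsi psi dpsi + wint (fun x => psi x ^+ 2).

(* weak solution of T psi = 0 (boundary condition at 0 incorporated,
   no decay condition at infinity) *)
Definition weak_sol (W psi : R -> R) : Prop :=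
  exists dpsi, in_domloc W psi dpsi /\
    forall phi dphi b, in_domt W phi dphi -> (forall x, b <= x -> phi x = 0) ->
      tform W phi dphi psi dpsi = 0.

Definition Cc_inf (psi : R -> R) : Prop :=
  (forall n x, derivable (derive1n n psi) x 1) /\
  exists a b, 0 < a /\ a <= b /\ forall x, (x < a \/ b < x) -> psi x = 0.

(* The class \mathcal V: V in L_{1,loc}(0,oo), with compact (bounded) support,
   such that (T+1)^{-1/2} V (T+1)^{-1/2} is compact.  The latter operator is
   unitarily equivalent (via (T+1)^{1/2} : (dom t, t+1) -> L_2) to the operator
   K on the Hilbert space (dom t, <.,.>_{t+1}) defined by
   <K psi, phi>_{t+1} = int V psi phi r dr; compactness of K is written out:
   every bounded sequence has a subsequence whose images are Cauchy, with
   ||K f|| = sup_{||phi||_{t+1} <= 1} |<K f, phi>_{t+1}|. *)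
Definition in_calV (W V : R -> R) : Prop :=
  [/\ locL1 V,
      exists b, forall x, b <= x -> V x = 0,
      (forall psi dpsi, in_domt W psi dpsi ->
         wintegrable Rp (fun x => V x * psi x ^+ 2)) &
      forall (ps dps : nat -> R -> R) (B : R),
        (forall n, in_domt W (ps n) (dps n) /\ tnorm2 W (ps n) (dps n) <= B) ->
        exists sigma : nat -> nat, (forall n, (sigma n < sigma n.+1)%N) /\
          forall eps, 0 < eps -> exists N : nat, forall k l : nat,
            (N <= k)%N -> (N <= l)%N ->
            forall phi dphi, in_domt W phi dphi -> tnorm2 W phi dphi <= 1 ->
              `| wint (fun x => V x * (ps (sigma k) x - ps (sigma l) x) * phi x) |
                <= eps].

(* lam is a negative eigenvalue of T - alpha V (operator defined via its
   quadratic form t - alpha v on dom t) *)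
Definition neg_eig (W V : R -> R) (alpha lam : R) : Prop :=
  lam < 0 /\
  exists psi dpsi, in_domt W psi dpsi /\ 0 < wint (fun x => psi x ^+ 2) /\
    forall phi dphi, in_domt W phi dphi ->
      tform W phi dphi psi dpsi - alpha * wint (fun x => V x * phi x * psi x)
      = lam * wint (fun x => phi x * psi x).

Definition Gamma (s : R) : R :=
  \int[leb]_(x in `]0, +oo[) (powR x (s - 1) * expR (- x)).

Definition c_mu (mu : R) : R :=
  powR (2 `^ (2 * mu - 1) * Gamma mu / Gamma (1 - mu)) (1 / mu).

End Defs.

(* Main.v *)
Require Import Defs.
From HB Require Import structures.
From mathcomp Require Import all_boot all_order all_algebra.
From mathcomp Require Import all_classical all_reals all_analysis measurable_realfun.
From mathcomp Require Import ring lra.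
Set Implicit Arguments. Unset Strict Implicit. Unset Printing Implicit Defensive.
Import Order.TTheory GRing.Theory Num.Theory.
Import numFieldNormedType.Exports.
Local Open Scope classical_set_scope.
Local Open Scope ring_scope.

(* For a spectral parameter [-s], an eigenfunction of [T - al V] is a combination of two pieces.
   Beyond a radius [c] outside which [V] vanishes and [W r = mu^2 / r^2], it is a multiple of the
   decaying solution [r^(-mu) Phi_mu (s r^2 / 4)] of the radial equation, where
   [Phi_nu s = int_0^oo t^(nu-1) exp (- t - s/t) dt] is a Macdonald function in disguise.  Inside
   [c] it is [psi0 + eta], where [eta] vanishes at [c] and solves an inhomogeneous equation; the
   ground state representation (divide by [psi0]) and a Poincare inequality make the form [t]
   coercive on functions vanishing beyond [c], so [eta] exists by the Riesz theorem and is
   [O(al + s)].  Matching the two pieces at [c] gives one scalar equation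
     [m s + psi0(c)^2 g(s) = al v + O((al + s)^2)],   [m = int_0^c psi0^2 r dr],
   where [g] is a quotient of two functions [Phi].  It has a root [s = O(al)] by the intermediate
   value theorem, and the behaviour of [Phi_nu] at [0] inverts it in the four regimes of [mu].
   There is only one negative eigenvalue because [t - al V] is nonnegative on the functions of the
   form domain that vanish at [c], a subspace of codimension one. *)

(** * Integration *)

(** Two difficulties shape the argument. At the origin [W] may be non-integrable and the bound on
    its negative part is given only for test functions supported away from 0. In dimension two a
    point has zero capacity, but only logarithmically, so general form elements are reached by
    cutoffs built from [ln (ln (1 / r))], once smooth functions have been exchanged for absolutely
    continuous ones. At infinity [psi0] is not square integrable when [mu <= 1], so it is not in the
    form domain; this is why the decaying solution replaces it beyond [c], and its behaviour for
    small [s] is what distinguishes the regimes. Because [psi0] solves the equation at energy zero,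
    [eta] enters the scalar equation only quadratically, through [source al s (eta al s)]. This
    number is the optimal value of a quadratic variational problem, which yields its sign, its size
    and its Lipschitz continuity in [s]; the last is what the intermediate value theorem needs.
    Derivatives are determined only almost everywhere, so form elements are pairs (function,
    derivative) and exceptional null sets are carried explicitly. *)

Ltac pos := repeat match goal with
  | |- _ => solve [done | by apply: ltW]
  | |- is_true (0 < _ - _) => rewrite subr_gt0
  | |- is_true (0 <= _ - _) => rewrite subr_ge0
  | |- is_true (0 < _ + _) => first [lra | apply: addr_gt0]
  | |- is_true (0 <= _ + _) => apply: addr_ge0
  | |- is_true (0 < _ * _) => apply: mulr_gt0
  | |- is_true (0 <= _ * _) => apply: mulr_ge0
  | |- is_true (0 < _^-1) => rewrite invr_gt0
  | |- is_true (0 <= _^-1) => rewrite invr_ge0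
  | |- is_true (0 <= _ ^+ 2) => exact: sqr_ge0
  | |- is_true (0 < _ ^+ _) => apply: exprn_gt0
  | |- is_true (0 <= _ ^+ _) => apply: exprn_ge0
  end; try done; try (by apply: ltW).

Section IntegrationToolkit.
Variable R : realType.
Local Notation leb := (@lebesgue_measure R).

Implicit Types (D E A B : set R) (f g h : R -> R) (a b c k M : R).

(** [I] is the finite part of the extended integral, so the algebraic rules need integrability [J],
    whereas congruence and sign do not. *)
Definition J (D : set R) (f : R -> R) := leb.-integrable D (EFin \o f).
Definition I (D : set R) (f : R -> R) : R := \int[leb]_(x in D) f x.

Lemma J_meas D f : J D f -> measurable_fun D f.
Proof. by move=> /measurable_int /measurable_EFinP. Qed.

Lemma J_le D f g : measurable D -> measurable_fun D f ->
  (forall x, D x -> `|f x| <= g x) -> J D g -> J D f.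
Proof.
move=> mD mf fg; apply: le_integrable => //; first exact/measurable_EFinP.
by move=> x Dx /=; rewrite lee_fin (le_trans (fg _ Dx))// ler_norm.
Qed.

Lemma J_eq D f g : measurable D -> (forall x, D x -> f x = g x) -> J D f -> J D g.
Proof.
by move=> mD fg; apply: eq_integrable => // x /set_mem Dx /=; rewrite fg.
Qed.

Lemma J_add D f g : measurable D -> J D f -> J D g -> J D (fun x => f x + g x).
Proof. by move=> mD jf jg; exact: (@integrableD _ _ R leb D mD _ _ jf jg). Qed.

Lemma J_scale D k f : measurable D -> J D f -> J D (fun x => k * f x).
Proof. by move=> mD jf; exact: (@integrableZl _ _ R leb D mD k _ jf). Qed.

Lemma J_opp D f : measurable D -> J D f -> J D (fun x => - f x).
Proof. by move=> mD jf; apply: (J_eq mD _ (J_scale (-1) mD jf)) => x _; rewrite mulN1r. Qed.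

Lemma J_sub D f g : measurable D -> J D f -> J D g -> J D (fun x => f x - g x).
Proof. by move=> mD jf jg; exact: (@integrableB _ _ R leb D mD _ _ jf jg). Qed.

Lemma J_norm D f : measurable D -> J D f -> J D (fun x => `|f x|).
Proof. by move=> mD jf; exact: integrable_norm. Qed.

Lemma J_set D E f : measurable D -> measurable E -> E `<=` D -> J D f -> J E f.
Proof. by move=> mD mE ED; exact: integrableS. Qed.

Lemma J_bnd D h f M : measurable D -> measurable_fun D h ->
  (forall x, D x -> `|h x| <= M) -> J D f -> J D (fun x => h x * f x).
Proof.
move=> mD mh hM jf; apply: (@J_le _ _ (fun x => M * `|f x|)) => //.
- by apply: measurable_funM => //; exact: J_meas.
- by move=> x Dx; rewrite normrM ler_wpM2r// hM.
- by apply: J_scale => //; exact: J_norm.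
Qed.

Lemma I_eq D f g : (forall x, D x -> f x = g x) -> I D f = I D g.
Proof. by move=> fg; apply: eq_Rintegral => x /set_mem Dx; rewrite fg. Qed.

Lemma I_add D f g : measurable D -> J D f -> J D g ->
  I D (fun x => f x + g x) = I D f + I D g.
Proof. exact: (@RintegralD _ _ R leb D f g). Qed.

Lemma I_sub D f g : measurable D -> J D f -> J D g ->
  I D (fun x => f x - g x) = I D f - I D g.
Proof. exact: (@RintegralB _ _ R leb D f g). Qed.

Lemma I_scale D k f : measurable D -> J D f ->
  I D (fun x => k * f x) = k * I D f.
Proof. by move=> mD jf; exact: RintegralZl. Qed.

Lemma I_opp D f : measurable D -> J D f -> I D (fun x => - f x) = - I D f.
Proof.
move=> mD jf; rewrite -mulN1r -I_scale//.
by apply: I_eq => x _; rewrite mulN1r.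
Qed.

Lemma I_le D f g : measurable D -> J D f -> J D g ->
  (forall x, D x -> f x <= g x) -> I D f <= I D g.
Proof. exact: (@le_Rintegral _ _ R leb D f g). Qed.

Lemma I_ge0 D f : (forall x, D x -> 0 <= f x) -> 0 <= I D f.
Proof. exact: (@Rintegral_ge0 _ _ R leb D f). Qed.

Lemma I_norm D f : measurable D -> J D f -> `|I D f| <= I D (fun x => `|f x|).
Proof. exact: (@le_normr_Rintegral _ _ R leb D f). Qed.

Lemma I_EFin D f : measurable D -> J D f ->
  (\int[leb]_(x in D) (f x)%:E = (I D f)%:E)%E.
Proof. by move=> mD jf; rewrite /I /Rintegral fineK//; exact: integrable_fin_num. Qed.

Lemma I_indic D E f : I (D `&` E) f = I D (fun x => f x * \1_E x).
Proof.
rewrite /I Rintegral_mkcondr; apply: eq_Rintegral => x _.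
by rewrite patchE indicE; case: ifP; rewrite ?mulr1 ?mulr0.
Qed.

Lemma I_indic_sub D E f : E `<=` D -> I E f = I D (fun x => f x * \1_E x).
Proof. by move=> ED; rewrite -I_indic (setIidr ED). Qed.

Lemma J_indic D E f : measurable D -> measurable E ->
  J (D `&` E) f <-> J D (fun x => f x * \1_E x).
Proof.
move=> mD mE; rewrite /J.
have -> : (EFin \o (fun x => f x * \1_E x)) = ((EFin \o f) \_ E).
  apply/funext => x /=; rewrite patchE indicE /=.
  by case: ifP; rewrite ?mulr1 ?mulr0.
exact: integrable_restrict.
Qed.

Lemma J_indic_sub D E f : measurable D -> measurable E -> E `<=` D ->
  J E f <-> J D (fun x => f x * \1_E x).
Proof. by move=> mD mE ED; rewrite -J_indic// (setIidr ED). Qed.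

Lemma I_subset D E f : measurable D -> measurable E -> E `<=` D -> J D f ->
  (forall x, D x -> 0 <= f x) -> I E f <= I D f.
Proof.
move=> mD mE ED jf f0; rewrite (I_indic_sub f ED); apply: I_le => //.
  by apply: (J_indic_sub _ mD mE ED).1; exact: (J_set mD).
move=> x Dx; rewrite indicE; case: (_ \in _); rewrite ?mulr1 ?mulr0//.
exact: f0.
Qed.

Lemma I_setU A B f : measurable A -> measurable B -> J (A `|` B) f ->
  A `&` B = set0 -> I (A `|` B) f = I A f + I B f.
Proof. by move=> mA mB jf AB; apply: Rintegral_setU => //; apply/disj_setPS; rewrite AB. Qed.

Lemma I_split a b c f : a <= c -> c <= b -> J `[a, b] f ->
  I `[a, b] f = I `[a, c] f + I `[c, b] f.
Proof.
move=> ac cb jf; have := @Rintegral_itvB R f (BLeft a) (BRight b) c jf; rewrite !bnd_simp => /(_ ac cb) H.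
rewrite -[LHS](subrK (I `[a, c] f)) addrC; congr (_ + _).
rewrite /I H Rintegral_itv_obnd_cbnd//.
by apply: (J_set _ _ _ jf) => //; apply: subset_itvr; rewrite bnd_simp.
Qed.

Lemma dct D (f_ : nat -> R -> R) f g : measurable D ->
  (forall n, measurable_fun D (f_ n)) ->
  (forall x, D x -> f_ n x @[n --> \oo] --> f x) ->
  J D g -> (forall n x, D x -> `|f_ n x| <= g x) ->
  J D f /\ I D (f_ n) @[n --> \oo] --> I D f.
Proof.
move=> mD mf cf jg fg.
have mfE : measurable_fun D f.
  apply: (measurable_fun_cvg (h := f_)) => //.
have [|||||] := @dominated_convergence _ _ _ leb D mD (fun n x => (f_ n x)%:E) (EFin \o f) (EFin \o g).
- by move=> n; exact: (measurable_EFinP D (f_ n)).2 (mf n).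
- exact: (measurable_EFinP D f).2 mfE.
- apply/aeW => x Dx; apply: cvg_EFin; first exact: nearW.
  exact: cf.
- exact: jg.
- by apply/aeW => x n Dx; rewrite /= lee_fin fg.
move=> jf _ H; split => //.
by apply: fine_cvg; rewrite -(I_EFin mD jf); exact: H.
Qed.

(** Fatou read as a criterion: integrability of the limit is a conclusion. Limits of form elements
    are shown to be integrable in this way. *)
Lemma fatou_I D (f_ : nat -> R -> R) f K : measurable D ->
  (forall n x, D x -> 0 <= f_ n x) -> (forall n, J D (f_ n)) ->
  (forall x, D x -> f_ n x @[n --> \oo] --> f x) ->
  (forall n, I D (f_ n) <= K) -> J D f /\ I D f <= K.
Proof.
move=> mD f0 jf cf fB.
have mfE : measurable_fun D f.
  by apply: (measurable_fun_cvg (h := f_)) => // n; exact: J_meas.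
have fge0 x : D x -> 0 <= f x.
  move=> Dx; rewrite -(cvg_lim _ (cf x Dx))//; apply: limr_ge.
    by apply/cvg_ex; exists (f x); exact: cf.
  by apply: nearW => n; exact: f0.
have H : (\int[leb]_(x in D) (f x)%:E <= K%:E)%E.
  have -> : (\int[leb]_(x in D) (f x)%:E = \int[leb]_(x in D) limn_einf (fun n => (f_ n x)%:E))%E.
    apply: eq_integral => x /set_mem Dx; apply/esym.
    have /cvg_limn_einf_sup[-> _] : (f_ n x)%:E @[n --> \oo] --> (f x)%:E.
      by apply: cvg_EFin; [exact: nearW|exact: cf].
    by [].
  apply: (le_trans (fatou _ _ _ _)) => //.
  - by move=> n; apply: (measurable_EFinP D (f_ n)).2; exact: J_meas.
  rewrite limn_einf_lim; apply: lime_le; first exact: is_cvg_einfs.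
    apply: nearW => n; apply: ereal_inf_le; exists (I D (f_ n))%:E; last by rewrite lee_fin.
    by exists n => //=; rewrite I_EFin.
have jfE : J D f.
  apply/integrableP; split; first exact/measurable_EFinP.
  under eq_integral => x /set_mem Dx do rewrite /= ger0_norm ?fge0//.
  by rewrite (le_lt_trans H)// ltry.
by split => //; rewrite -lee_fin -I_EFin.
Qed.

(** Evaluate at the minimiser [B / C]. If [C = 0] the expression is affine in [t] and the chosen [t]
    makes it [- 1]. The Cauchy-Schwarz inequalities below are instances. *)
Lemma discr (A B C : R) : 0 <= A -> 0 <= C ->
  (forall t, 0 <= A - 2 * t * B + t ^+ 2 * C) -> B ^+ 2 <= A * C.
Proof.
move=> A0 C0 H; have [C00|Cn] := eqVneq C 0.
  rewrite C00 mulr0; have [->|Bn] := eqVneq B 0; first by rewrite expr0n.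
  have := H ((A + 1) / (2 * B)).
  have -> : A - 2 * ((A + 1) / (2 * B)) * B + ((A + 1) / (2 * B)) ^+ 2 * C = -1.
    by rewrite C00; field.
  by rewrite oppr_ge0 ler10.
have Cp : 0 < C by rewrite lt_neqAle eq_sym Cn.
have := H (B / C).
have -> : A - 2 * (B / C) * B + (B / C) ^+ 2 * C = (A * C - B ^+ 2) / C by field.
by rewrite pmulr_lge0 ?invr_gt0// subr_ge0.
Qed.

Lemma J_mul2 D f g : measurable D -> measurable_fun D f -> measurable_fun D g ->
  J D (fun x => f x ^+ 2) -> J D (fun x => g x ^+ 2) -> J D (fun x => f x * g x).
Proof.
move=> mD mf mg jf jg; apply: (@J_le _ _ (fun x => f x ^+ 2 + g x ^+ 2)) => //.
- exact: measurable_funM.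
- move=> x Dx; rewrite normrM -(real_normK (num_real (f x))) -(real_normK (num_real (g x))).
  have := sqr_ge0 (`|f x| - `|g x|); have := normr_ge0 (f x); have := normr_ge0 (g x); nra.
- exact: J_add.
Qed.

Lemma cauchy_schwarz_I D f g : measurable D -> measurable_fun D f -> measurable_fun D g ->
  J D (fun x => f x ^+ 2) -> J D (fun x => g x ^+ 2) ->
  I D (fun x => f x * g x) ^+ 2 <= I D (fun x => f x ^+ 2) * I D (fun x => g x ^+ 2).
Proof.
move=> mD mf mg jf jg; have jfg := J_mul2 mD mf mg jf jg.
apply: discr; [by apply: I_ge0 => x _; exact: sqr_ge0..|] => t.
have : 0 <= I D (fun x => (f x - t * g x) ^+ 2) by apply: I_ge0 => x _; exact: sqr_ge0.
rewrite (@I_eq _ _ (fun x => (f x ^+ 2 + (- (2 * t)) * (f x * g x)) + t ^+ 2 * (g x ^+ 2))).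
  rewrite I_add// ?I_add// ?I_scale//; [by rewrite mulNr|..].
  - exact: J_scale.
  - by apply: J_add => //; exact: J_scale.
  - exact: J_scale.
by move=> x _; ring.
Qed.

End IntegrationToolkit.

(** * Locally absolutely continuous functions *)

Section LocallyAbsolutelyContinuous.
Variable R : realType.
Local Notation leb := (@lebesgue_measure R).
Local Notation Rp := (@Rp R).
Implicit Types (f g h u du w dw : R -> R) (a b c k e x y : R).

Lemma mRp : measurable Rp.
Proof. exact: measurable_itv. Qed.

Lemma RpP x : Rp x <-> 0 < x.
Proof. by rewrite /Defs.Rp /= in_itv/= andbT. Qed.

Lemma itv_Rp a b : 0 < a -> `[a, b] `<=` Rp.
Proof. by move=> a0 x /=; rewrite in_itv/= => /andP[ax _]; apply/RpP/(lt_le_trans a0). Qed.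

Lemma Rp_bigcup : Rp = \bigcup_n `[n.+1%:R^-1, n.+1%:R : R]%classic.
Proof.
apply/seteqP; split => x.
  move=> /RpP x0; pose n := Num.bound (x + x^-1); exists n => //=.
  have xn : x + x^-1 < n.+1%:R.
    rewrite (lt_trans (archi_boundP _)) ?ltr_nat// addr_ge0 ?invr_ge0// ltW//.
  have xi : 0 < x^-1 by rewrite invr_gt0.
  rewrite in_itv/= -[X in _ <= X <= _]invrK lef_pV2 ?posrE// invrK; apply/andP; split; lra.
by move=> [n _]; apply: itv_Rp; rewrite invr_gt0.
Qed.

Lemma locL1_meas f : locL1 f -> measurable_fun Rp f.
Proof.
move=> lf; rewrite Rp_bigcup; apply/measurable_fun_bigcup => n //.
by apply: J_meas; apply: lf; rewrite invr_gt0.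
Qed.

Lemma locL1_eq f g : (forall x, 0 < x -> f x = g x) -> locL1 f -> locL1 g.
Proof.
move=> fg lf a b a0; apply: (@J_eq _ _ f) (lf a b a0) => // x /(itv_Rp a0)/RpP; exact: fg.
Qed.

Lemma locL1_add f g : locL1 f -> locL1 g -> locL1 (fun x => f x + g x).
Proof. by move=> lf lg a b a0; apply: J_add => //; [exact: lf|exact: lg]. Qed.

Lemma locL1_scale k f : locL1 f -> locL1 (fun x => k * f x).
Proof. by move=> lf a b a0; apply: J_scale => //; exact: lf. Qed.

Lemma locL1_norm f : locL1 f -> locL1 (fun x => `|f x|).
Proof. by move=> lf a b a0; apply: J_norm => //; exact: lf. Qed.

Lemma hasDerivP u du : hasDeriv u du <->
  locL1 du /\ forall a b, 0 < a -> a <= b -> I `[a, b] du = u b - u a.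
Proof.
split=> -[ldu H]; split => // a b a0 ab.
  by have := H a b a0 ab; rewrite I_EFin//; [case|exact: ldu].
by rewrite I_EFin//; [rewrite H|exact: ldu].
Qed.

Lemma hd_L1 u du : hasDeriv u du -> locL1 du.
Proof. by case. Qed.

Lemma hd_I u du a b : hasDeriv u du -> 0 < a -> a <= b -> I `[a, b] du = u b - u a.
Proof. by move=> /hasDerivP[_]; apply. Qed.

Lemma I_small_intervals f a b e : J `[a, b] f -> 0 < e ->
  exists2 d, 0 < d & forall x y, a <= x -> x <= y -> y <= b -> y - x < d ->
    I `[x, y] (fun t => `|f t|) <= e.
Proof.
move=> jf e0.
have jf' : leb.-integrable setT (EFin \o (fun x => f x * \1_`[a, b] x)).
  by apply: (@J_indic_sub R setT `[a, b] f _ _ _).1.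
have [d [d0 H]] := integral_normr_continuous jf' e0.
exists d => // x y ax xy yb yxd.
have H' := H `[x, y]%classic.
rewrite (@I_eq R _ _ (fun t => `|f t * \1_`[a, b] t|)).
  apply/ltW/H' => //; rewrite [X in (X < _)%E](_ : _ = leb `[x, y]%classic)//.
  rewrite lebesgue_measure_itv/= lte_fin.
  by case: ifP => //; rewrite -EFinD lte_fin.
move=> t; rewrite /= in_itv/= => /andP[xt ty]; rewrite indicE mem_set ?mulr1//=.
by rewrite in_itv/= (le_trans ax xt) (le_trans ty yb).
Qed.

Lemma hd_uc u du a b e : hasDeriv u du -> 0 < a -> 0 < e ->
  exists2 d, 0 < d & forall x y, a <= x -> x <= y -> y <= b -> y - x < d ->
    `|u y - u x| <= e.
Proof.
move=> hu a0 e0; have [d d0 H] := I_small_intervals (hd_L1 hu b a0) e0.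
exists d => // x y ax xy yb yx; have x0 := lt_le_trans a0 ax.
rewrite -(hd_I hu x0 xy) (le_trans (I_norm _ _))//; last exact: H.
exact: (hd_L1 hu).
Qed.

Lemma hd_cont u du x : hasDeriv u du -> 0 < x -> {for x, continuous u}.
Proof.
move=> hu x0; apply/cvgrPdist_le => /= e e0.
have x20 : 0 < x / 2 by rewrite divr_gt0.
have [d d0 H] := hd_uc (x + 1) hu x20 e0.
apply/nbhs_normP; exists (Num.min d (Num.min (x / 2) 1)) => /=.
  by rewrite !lt_min d0 x20 ltr01.
move=> y /=; rewrite !lt_min => /and3P[y3 y4 y5].
have y1 : x / 2 <= y by have := ler_norm (x - y); lra.
have y2 : y <= x + 1 by have := ler_norm (y - x); rewrite distrC; lra.
have [xy|yx] := leP x y.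
  rewrite distrC; apply: H => //; first lra.
  by move: y3; rewrite distrC ger0_norm// subr_ge0.
apply: H => //; [exact: ltW|lra|].
by move: y3; rewrite gtr0_norm// subr_gt0.
Qed.

Lemma hd_meas u du : hasDeriv u du -> measurable_fun Rp u.
Proof.
move=> hu; apply: open_continuous_measurable_fun; first exact: interval_open.
by move=> x /set_mem/RpP x0; exact: (hd_cont hu).
Qed.

Lemma hd_bnd u du a b : hasDeriv u du -> 0 < a ->
  exists2 K, 0 < K & forall x, a <= x -> x <= b -> `|u x| <= K.
Proof.
move=> hu a0; exists (`|u a| + I `[a, b] (fun t => `|du t|) + 1).
  by rewrite ltr_wpDl// addr_ge0// I_ge0.
move=> x ax xb; have jd := hd_L1 hu b a0.
have jx := hd_L1 hu x a0.
rewrite -[u x](subrK (u a)) -(hd_I hu a0 ax) (le_trans (ler_normD _ _))//.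
have h1 : `|I `[a, x] du| <= I `[a, b] (fun t => `|du t|).
  rewrite (le_trans (I_norm _ jx))//; apply: I_subset => //; last exact: J_norm.
  by apply: subset_itvl; rewrite bnd_simp.
lra.
Qed.

Lemma hd_within u du a b : hasDeriv u du -> 0 < a -> {within `[a, b], continuous u}.
Proof.
move=> hu a0; apply: continuous_in_subspaceT => x /set_mem /(itv_Rp a0)/RpP x0.
exact: hd_cont hu x0.
Qed.

Lemma hd_pos_lb u du a b : hasDeriv u du -> 0 < a -> a <= b -> (forall x, 0 < x -> 0 < u x) ->
  exists2 m, 0 < m & forall x, a <= x -> x <= b -> m <= u x.
Proof.
move=> hu a0 ab u0; have [c] := EVT_min ab (hd_within hu a0).
rewrite in_itv/= => /andP[ac cb] H.
exists (u c); first exact/u0/(lt_le_trans a0).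
by move=> x ax xb; apply: H; rewrite in_itv/= ax.
Qed.

Lemma eps0 (X K : R) : (forall e, 0 < e -> `|X| <= e * K) -> X = 0.
Proof.
move=> H; apply/eqP; rewrite -normr_le0; apply/ler_addgt0Pl => e e0; rewrite addr0.
have K1 : 0 < 1 + `|K| by rewrite ltr_pwDl.
have := H (e / (1 + `|K|)); rewrite divr_gt0// => /(_ isT) /le_trans; apply.
rewrite mulrAC ler_pdivrMr// ler_wpM2l ?ltW//.
by have := ler_norm K; lra.
Qed.

(** Local to global: if on short intervals the increment of [F] is the integral of some [h] with
    [|h - d| <= e k], summing over a partition gives an error of [e] times the integral of [k], and
    [e] is arbitrary. The product and quotient rules follow by freezing factors at endpoints. *)
Lemma hd_criterion (F d k : R -> R) : locL1 d -> locL1 k ->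
  (forall a b e, 0 < a -> 0 < e -> exists2 r, 0 < r &
     forall x y, a <= x -> x <= y -> y <= b -> y - x < r ->
     exists h, [/\ J `[x, y] h, F y - F x = I `[x, y] h &
       forall t, x <= t -> t <= y -> `|h t - d t| <= e * k t]) ->
  hasDeriv F d.
Proof.
move=> ld lk H; apply/hasDerivP; split => // a b a0 ab.
apply/esym/eqP; rewrite -subr_eq0; apply/eqP.
apply: (@eps0 _ (I `[a, b] k)) => e e0.
have [r r0 Hr] := H a b e a0 e0.
have Hloc x y : a <= x -> x <= y -> y <= b -> y - x < r ->
    `|F y - F x - I `[x, y] d| <= e * I `[x, y] k.
  move=> ax xy yb yxr; have x0 := lt_le_trans a0 ax.
  have [h [jh -> hd]] := Hr x y ax xy yb yxr.
  have jd := ld x y x0; have jk := lk x y x0.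
  rewrite -I_sub// -I_scale//; apply: le_trans (I_norm _ _) _ => //; first exact: J_sub.
  apply: I_le => //; [by apply: J_norm => //; exact: J_sub|exact: J_scale|].
  by move=> t /=; rewrite in_itv/= => /andP[xt ty]; exact: hd.
(* Induction on the number of steps of length [r / 2], each short enough for the local estimate. *)
have step n y : a <= y -> y <= b -> y - a < n%:R * (r / 2) ->
    `|F y - F a - I `[a, y] d| <= e * I `[a, y] k.
  elim: n y => [|n IH] y ay yb; first by rewrite mul0r => ?; lra.
  have [yar _|ryar] := ltP (y - a) r; first exact: Hloc.
  rewrite -natr1 mulrDl mul1r => yn; pose z := y - r / 2.
  have az : a <= z by rewrite /z; lra.
  have zy : z <= y by rewrite /z; lra.
  have zb : z <= b by rewrite /z; lra.
  have z0 := lt_le_trans a0 az.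
  have h1 : `|F z - F a - I `[a, z] d| <= e * I `[a, z] k by apply: IH => //; rewrite /z; lra.
  have h2 : `|F y - F z - I `[z, y] d| <= e * I `[z, y] k by apply: Hloc => //; rewrite /z; lra.
  rewrite (@I_split _ _ _ z d)//; last exact: ld.
  rewrite (@I_split _ _ _ z k)//; last exact: lk.
  have -> : F y - F a - (I `[a, z] d + I `[z, y] d) =
    (F z - F a - I `[a, z] d) + (F y - F z - I `[z, y] d) by ring.
  by rewrite mulrDr (le_trans (ler_normD _ _))// lerD.
pose n := Num.bound ((b - a) / (r / 2)).
apply: (step n) => //; rewrite -ltr_pdivrMr ?divr_gt0//.
by apply: archi_boundP; rewrite divr_ge0 ?subr_ge0// divr_ge0// ltW.
Qed.

Lemma hd_add u du w dw : hasDeriv u du -> hasDeriv w dw ->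
  hasDeriv (fun x => u x + w x) (fun x => du x + dw x).
Proof.
move=> hu hw; apply/hasDerivP; split.
  by apply: locL1_add; [exact: hd_L1 hu|exact: hd_L1 hw].
move=> a b a0 ab; rewrite I_add//; [|exact: (hd_L1 hu)|exact: (hd_L1 hw)].
by rewrite (hd_I hu)// (hd_I hw)//; ring.
Qed.

Lemma hd_scale k u du : hasDeriv u du -> hasDeriv (fun x => k * u x) (fun x => k * du x).
Proof.
move=> hu; apply/hasDerivP; split; first exact/locL1_scale/(hd_L1 hu).
by move=> a b a0 ab; rewrite I_scale//; [rewrite (hd_I hu)// mulrBr|exact: (hd_L1 hu)].
Qed.

Lemma hd_eq u du w dw : hasDeriv u du -> (forall x, 0 < x -> u x = w x) ->
  (forall x, 0 < x -> du x = dw x) -> hasDeriv w dw.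
Proof.
move=> hu uw duw; apply/hasDerivP; split; first exact: locL1_eq duw (hd_L1 hu).
move=> a b a0 ab; rewrite -!uw//; last exact: lt_le_trans ab.
by rewrite -(hd_I hu a0 ab); apply: I_eq => x /(itv_Rp a0)/RpP x0; rewrite duw.
Qed.

Lemma hd_cst k : hasDeriv (fun=> k) (fun=> 0).
Proof.
apply/hasDerivP; split; first by move=> a b a0; exact: integrable0.
by move=> a b a0 ab; rewrite /I Rintegral_cst// mul0r subrr.
Qed.

Lemma locL1_bnd h f : measurable_fun Rp h ->
  (forall a b, 0 < a -> exists M, forall x, a <= x -> x <= b -> `|h x| <= M) ->
  locL1 f -> locL1 (fun x => h x * f x).
Proof.
move=> mh hb lf a b a0; have [M HM] := hb a b a0.
apply: (@J_bnd _ _ _ _ M) => //; last exact: lf.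
  by apply: (measurable_funS _ (itv_Rp a0) mh); exact: mRp.
by move=> x /=; rewrite in_itv/= => /andP[ax xb]; exact: HM.
Qed.

Lemma hd_locL1M u du f : hasDeriv u du -> locL1 f -> locL1 (fun x => u x * f x).
Proof.
move=> hu; apply: locL1_bnd; first exact: hd_meas hu.
by move=> a b a0; have [K _ HK] := hd_bnd b hu a0; exists K.
Qed.

Lemma hd_mul u du w dw : hasDeriv u du -> hasDeriv w dw ->
  hasDeriv (fun x => u x * w x) (fun x => du x * w x + u x * dw x).
Proof.
move=> hu hw; have lu := hd_L1 hu; have lw := hd_L1 hw.
apply: (@hd_criterion _ _ (fun x => `|du x| + `|dw x|)).
- apply: locL1_add; last exact: hd_locL1M hu lw.
  by apply: (locL1_eq _ (hd_locL1M hw lu)) => x _; rewrite mulrC.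
- by apply: locL1_add; exact: locL1_norm.
move=> a b e a0 e0.
have [d1 d10 H1] := hd_uc b hu a0 e0; have [d2 d20 H2] := hd_uc b hw a0 e0.
exists (Num.min d1 d2); first by rewrite lt_min d10.
move=> x y ax xy yb; rewrite lt_min => /andP[xy1 xy2]; have x0 := lt_le_trans a0 ax.
have ju := lu x y x0; have jw := lw x y x0.
(* With one factor frozen at each end, the increment of the product is reproduced exactly. *)
exists (fun t => w y * du t + u x * dw t); split.
- by apply: J_add => //; exact: J_scale.
- rewrite I_add//; try exact: J_scale.
  by rewrite !I_scale// (hd_I hu)// (hd_I hw)//; ring.
- move=> t xt ty.
  have -> : w y * du t + u x * dw t - (du t * w t + u t * dw t) =
    du t * (w y - w t) - (u t - u x) * dw t by ring.
  rewrite (le_trans (ler_normB _ _))// !normrM mulrDr (mulrC e); apply: lerD.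
    by rewrite ler_wpM2l// H2//; lra.
  by rewrite ler_wpM2r// H1//; lra.
Qed.

Lemma hd_inv u du : hasDeriv u du -> (forall x, 0 < x -> 0 < u x) ->
  hasDeriv (fun x => (u x)^-1) (fun x => - du x / u x ^+ 2).
Proof.
move=> hu u0; have lu := hd_L1 hu.
have mu := hd_meas hu.
apply: (@hd_criterion _ _ (fun x => `|du x|)).
- have : locL1 (fun x => (u x ^+ 2)^-1 * (- 1 * du x)).
    apply: locL1_bnd; last exact: locL1_scale.
      apply: open_continuous_measurable_fun; first exact: interval_open.
      move=> x /set_mem/RpP x0; have ux2 : u x * u x != 0 by rewrite mulf_neq0// gt_eqF// u0.
      have cu := hd_cont hu x0.
      exact: (@continuousV R R (fun t => u t * u t) x ux2 (continuousM cu cu)).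
    move=> a b a0; have [ab|ba] := leP a b; last by exists 0 => x ax xb; lra.
    have [m m0 Hm] := hd_pos_lb hu a0 ab u0; exists (m ^+ 2)^-1 => x ax xb.
    have mx := Hm x ax xb.
    rewrite ger0_norm ?invr_ge0 ?sqr_ge0// lef_pV2 ?posrE ?exprn_gt0//; last first.
      exact: lt_le_trans mx.
    by rewrite !expr2; nra.
  by apply: locL1_eq => x x0; rewrite mulN1r mulrC.
- exact: locL1_norm.
move=> a b e a0 e0.
have [ab|ba] := leP a b; last by exists 1 => // x y ax xy yb; lra.
have [m m0 Hm] := hd_pos_lb hu a0 ab u0.
(* There are two error terms, each a difference of values of [u] over a product of three values that
   are at least [m]; hence the half and the cube. *)
have e1 : 0 < e * m ^+ 3 / 2 by rewrite divr_gt0// mulr_gt0// exprn_gt0.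
have [d1 d10 H1] := hd_uc b hu a0 e1.
exists d1 => // x y ax xy yb yx; have x0 := lt_le_trans a0 ax.
exists (fun t => (- (u x * u y)^-1) * du t).
have ju := lu x y x0.
have ux : 0 < u x by exact: u0.
have uy : 0 < u y by apply/u0/(lt_le_trans x0).
split; first exact: J_scale.
  by rewrite I_scale// (hd_I hu)//; field; rewrite !gt_eqF.
move=> t xt ty.
have ut : 0 < u t by apply/u0/(lt_le_trans x0).
have mx : m <= u x by apply: Hm => //; clear -xy yb; lra.
have my : m <= u y by apply: Hm => //; clear -ax xy; lra.
have mt : m <= u t by apply: Hm => //; clear -ax xt ty yb; lra.
have h1 : `|u t - u x| <= e * m ^+ 3 / 2 by apply: H1 => //; clear -ax xt ty yb yx; lra.
have h2 : `|u y - u t| <= e * m ^+ 3 / 2 by apply: H1 => //; clear -ax xt ty yb yx; lra.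
have -> : - (u x * u y)^-1 * du t - - du t / u t ^+ 2 =
    ((u y - u t) / (u x * u y * u t) - (u t - u x) / (u x * u t * u t)) * du t.
  by field; rewrite !gt_eqF.
rewrite normrM ler_wpM2r// (le_trans (ler_normB _ _))//.
have bnd p q r z : m <= p -> m <= q -> m <= r -> `|z| <= e * m ^+ 3 / 2 -> `|z / (p * q * r)| <= e / 2.
  move=> mp mq mr hz; have p0 := lt_le_trans m0 mp.
  have q0 := lt_le_trans m0 mq; have r0 := lt_le_trans m0 mr.
  have pqr : m ^+ 3 <= p * q * r.
    have mpq : m * m <= p * q by nra.
    rewrite !exprSr expr0 mul1r; apply: ler_pM => //; last exact: ltW.
    by rewrite mulr_ge0// ltW.
  rewrite normrM normfV (gtr0_norm (_ : 0 < p * q * r)) ?mulr_gt0//.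
  rewrite ler_pdivrMr ?mulr_gt0// (le_trans hz)// mulrAC ler_wpM2l// divr_ge0// ltW//.
by rewrite (splitr e); apply: lerD; apply: bnd.
Qed.

Lemma hd_glue c u du w dw : 0 < c -> hasDeriv u du -> hasDeriv w dw -> u c = w c ->
  hasDeriv (fun x => if x <= c then u x else w x) (fun x => if x <= c then du x else dw x).
Proof.
move=> c0 hu hw uw; have lu := hd_L1 hu; have lw := hd_L1 hw.
pose d x := if x <= c then du x else dw x.
have ld : locL1 d.
  have l1 : locL1 (fun x => \1_(`]-oo, c]%classic : set R) x * du x).
    apply: locL1_bnd lu; first exact: measurable_indic.
    by move=> a b _; exists 1 => x _ _; rewrite indicE; case: (_ \in _); rewrite ?normr1 ?normr0.
  have l2 : locL1 (fun x => \1_(`]c, +oo[%classic : set R) x * dw x).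
    apply: locL1_bnd lw; first exact: measurable_indic.
    by move=> a b _; exists 1 => x _ _; rewrite indicE; case: (_ \in _); rewrite ?normr1 ?normr0.
  apply: (locL1_eq _ (locL1_add l1 l2)) => x _; rewrite !indicE /d.
  case: leP => xc.
    by rewrite mem_set ?memNset/= ?in_itv/= ?mul1r ?mul0r ?addr0//= ?andbT; apply/negP; rewrite -leNgt.
  by rewrite memNset ?mem_set/= ?in_itv/= ?mul1r ?mul0r ?add0r ?andbT//=; apply/negP; rewrite -ltNge.
have HL a b : 0 < a -> b <= c -> I `[a, b] d = I `[a, b] du.
  move=> a0 bc; apply: I_eq => x.
  by rewrite /= in_itv/= => /andP[_ xb]; rewrite /d (le_trans xb bc).
(* For [a = c] the integrands may differ at the left endpoint, so the comparison is made on the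
   half-open interval. *)
have HR a b : 0 < a -> c <= a -> I `[a, b] d = I `[a, b] dw.
  move=> a0 ca.
  have E x : `]a, b]%classic x -> d x = dw x.
    by rewrite /= in_itv/= => /andP[ax _]; rewrite /d leNgt (le_lt_trans ca ax).
  have js f : locL1 f -> J `]a, b] f.
    by move=> lf; apply: J_set (lf a b a0) => //; apply: subset_itvr; rewrite bnd_simp.
  have := I_eq E; rewrite /I !Rintegral_itv_obnd_cbnd//; exact: js.
apply/hasDerivP; split => // a b a0 ab; have [bc|cb] := leP b c.
  by rewrite (HL _ _ a0 bc) (hd_I hu)// (le_trans ab bc).
have [ac|ca] := leP a c; last first.
  by rewrite (HR _ _ a0 (ltW ca)) (hd_I hw).
rewrite (@I_split _ _ _ c)//; [|exact: ltW|exact: ld].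
rewrite HL// HR// (hd_I hu)// (hd_I hw)//; last exact: ltW.
by rewrite uw; ring.
Qed.

Lemma hd_C1 u du : (forall x : R, 0 < x -> is_derive x (1 : R) u (du x)) ->
  (forall x, 0 < x -> {for x, continuous du}) -> hasDeriv u du.
Proof.
move=> hu cu.
have cd a b : 0 < a -> {within `[a, b], continuous du}.
  by move=> a0; apply: continuous_in_subspaceT => x /set_mem /(itv_Rp a0)/RpP; exact: cu.
split.
  move=> a b a0; apply: continuous_compact_integrable; first exact: segment_compact.
  exact: cd.
move=> a b a0; rewrite le_eqVlt => /predU1P[<-|ab].
  by rewrite set_itv1 integral_set1 subrr.
have cu' x : 0 < x -> {for x, continuous u}.
  by move=> x0; apply: differentiable_continuous; apply/derivable1_diffP; case: (hu x x0).
rewrite (@continuous_FTC2 _ du u a b ab (cd a b a0)).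
- by rewrite EFinB.
- split.
  + by move=> x; rewrite in_itv/= => /andP[ax xb]; case: (hu x (lt_trans a0 ax)).
  + by apply: cvg_at_right_filter; exact: cu'.
  + by apply: cvg_at_left_filter; apply: cu'; exact: lt_trans ab.
- move=> x; rewrite in_itv/= => /andP[ax xb].
  by rewrite derive1E; case: (hu x (lt_trans a0 ax)).
Qed.

End LocallyAbsolutelyContinuous.
Arguments mRp {R}.

(** * Smooth step functions *)

Section SmoothFunctions.
Variable R : realType.
Local Notation leb := (@lebesgue_measure R).
Implicit Types (f g : R -> R) (a b c e x y l r s t C : R).

Definition der f x l := is_derive x (1 : R) f l.

Lemma der_eq f g x l l' : der f x l -> (forall y, f y = g y) -> l = l' -> der g x l'.
Proof. by move=> df fg <-; rewrite -(funext fg). Qed.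

Lemma der_near f g x l e : 0 < e -> (forall y, `|x - y| < e -> f y = g y) ->
  der f x l -> der g x l.
Proof.
move=> e0 fg; apply: near_eq_is_derive; apply/nbhs_normP; exists e => //.
Qed.

Lemma der_add f g x (k : R) l : der f x k -> der g x l -> der (fun y => f y + g y) x (k + l).
Proof. by move=> df dg; exact: is_deriveD. Qed.

Lemma der_mul f g x (k : R) l : der f x k -> der g x l ->
  der (fun y => f y * g y) x (k * g x + f x * l).
Proof.
move=> df dg; apply: (der_eq (@is_deriveM _ _ _ _ _ _ _ _ df dg)) => //.
by rewrite /GRing.scale/= addrC (mulrC (g x)).
Qed.

Lemma der_scale (k : R) f x l : der f x l -> der (fun y => k * f y) x (k * l).
Proof. by move=> df; exact: is_deriveZ. Qed.

Lemma der_cst (k : R) x : der (fun=> k) x 0.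
Proof. exact: is_derive_cst. Qed.

Lemma der_id x : der (fun y => y) x 1.
Proof. exact: is_derive_id. Qed.

Lemma der_comp f g x (k : R) l : der f (g x) k -> der g x l -> der (fun y => f (g y)) x (k * l).
Proof. by move=> df dg; exact: (is_derive1_comp df dg). Qed.

Lemma der_exp f x l : der f x l -> der (fun y => expR (f y)) x (expR (f x) * l).
Proof. by move=> df; apply: (der_comp (f := expR)) => //; exact: is_derive_expR. Qed.

Lemma der_inv x : x != 0 -> der (fun y => y^-1) x (- x ^- 2).
Proof.
move=> x0; apply: (der_eq (is_deriveV (f := fun y => y) x0 (is_derive_id x 1))) => //.
by rewrite /GRing.scale/= mulr1.
Qed.

Lemma der_cont f x l : der f x l -> {for x, continuous f}.
Proof.
by move=> [df _]; apply: differentiable_continuous; apply/derivable1_diffP.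
Qed.

Lemma cont_opp f x : {for x, continuous f} -> {for x, continuous (fun y => - f y)}.
Proof. by move=> c; apply: cvgN; exact: c. Qed.

Lemma der_derive1 f x l : der f x l -> derive1 f x = l.
Proof. by move=> [_ <-]; rewrite derive1E. Qed.

(** [n] successive derivatives with explicit witnesses. In this form stability under sums, products
    and affine substitutions is a plain induction; the iterated [derive1n] is recovered only at the
    end. *)
Fixpoint nd n f : Prop :=
  if n is n'.+1 then exists2 g, (forall x, der f x (g x)) & nd n' g else True.

Definition smooth f := forall n, nd n f.

Lemma nd_le n f : nd n.+1 f -> nd n f.
Proof. by elim: n f => [//|n IH] f [g dg ng]; exists g => //; exact: IH. Qed.

Lemma nd_add n f g : nd n f -> nd n g -> nd n (fun x => f x + g x).
Proof.
elim: n f g => [//|n IH] f g [f' df nf] [g' dg ng]; exists (fun x => f' x + g' x).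
  by move=> x; exact: der_add.
exact: IH.
Qed.

Lemma nd_scale n (k : R) f : nd n f -> nd n (fun x => k * f x).
Proof.
elim: n f => [//|n IH] f [f' df nf]; exists (fun x => k * f' x); last exact: IH.
by move=> x; exact: der_scale.
Qed.

Lemma nd_mul n f g : nd n f -> nd n g -> nd n (fun x => f x * g x).
Proof.
elim: n f g => [//|n IH] f g hf hg; have lf := nd_le hf; have lg := nd_le hg.
case: hf => f' df nf; case: hg => g' dg ng.
exists (fun x => f' x * g x + f x * g' x); first by move=> x; exact: der_mul.
by apply: nd_add; exact: IH.
Qed.

Lemma nd_cst n (k : R) : nd n (fun=> k).
Proof. by elim: n k => [//|n IH] k; exists (fun=> 0) => // x; exact: der_cst. Qed.

Lemma nd_affine n (k l : R) f : nd n f -> nd n (fun x => f (k * x + l)).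
Proof.
elim: n f => [//|n IH] f [f' df nf]; exists (fun x => k * f' (k * x + l)).
  move=> x; apply: (der_eq (der_comp (g := fun y => k * y + l) (df _) (der_add (der_scale k (der_id x)) (der_cst l x)))) => //.
  by rewrite mulr1 addr0 mulrC.
by apply: nd_scale; exact: IH.
Qed.

Lemma nd_sum n (F : nat -> R -> R) m : (forall i, nd n (F i)) ->
  nd n (fun x => \sum_(i < m) F i x).
Proof.
move=> HF; elim: m => [|m IH].
  rewrite (_ : (fun x => _) = fun=> 0); first exact: nd_cst.
  by apply/funext => x; rewrite big_ord0.
rewrite (_ : (fun x => _) = fun x => \sum_(i < m) F i x + F m x); first exact: nd_add.
by apply/funext => x; rewrite big_ord_recr.
Qed.

Lemma smooth_derive1n f : smooth f -> forall n x, derivable (derive1n n f) x 1.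
Proof.
move=> sf n; have {sf} := sf n.+1; elim: n f => [|n IH] f [g dg ng] x.
  by rewrite derive1n0; case: (dg x).
rewrite derive1Sn; apply: IH.
by rewrite (_ : derive1 f = g)//; apply/funext => y; exact: der_derive1.
Qed.

(** For points where no differentiation rule applies: the origin for [bumpE], and every positive
    point for the integral [Phi]. *)
Lemma der_of_quadratic_bound f x l C : 0 <= C ->
  (forall y, `|x - y| < 1 -> `|f y - f x - l * (y - x)| <= C * (y - x) ^+ 2) -> der f x l.
Proof.
move=> C0 H.
have cv : (fun h : R => h^-1 *: (f (h *: (1 : R) + x) - f x)) @ 0^' --> l.
  apply/cvgrPdist_le => /= e e0; apply/nbhs_ballP => /=.
  exists (Num.min 1 (e / (C + 1))) => /=; first by rewrite lt_min ltr01/= divr_gt0// ltr_wpDl.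
  move=> h; rewrite /ball/= sub0r normrN lt_min => /andP[h1 he] hn0.
  have := H (h *: 1 + x); rewrite opprD addrCA subrr addr0 normrN /GRing.scale/= mulr1.
  rewrite addrK => /(_ h1) Hh.
  have -> : l - h^-1 * (f (h + x) - f x) = - h^-1 * (f (h + x) - f x - l * h) by field.
  rewrite mulNr normrN normrM normfV mulrC ler_pdivrMr ?normr_gt0// (le_trans Hh)//.
  rewrite -(real_normK (num_real h)) expr2 mulrA ler_wpM2r//.
  move: he; rewrite ltr_pdivlMr ?ltr_wpDl// => he; have := normr_ge0 h; nra.
split; first by apply/cvg_ex; exists l; exact: cv.
by rewrite /derive; apply: cvg_lim => //; exact: cv.
Qed.

(** The functions [t^(-k) exp (- r / t)], extended by 0. The derivative of a member is a linear
    combination of members, so smoothness, including at the origin, is one induction over all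
    [k]. *)
Definition bumpE (r : R) (k : nat) (t : R) : R :=
  if 0 < t then t^-1 ^+ k * expR (- r * t^-1) else 0.

Lemma bumpE_ge0 r k t : 0 <= bumpE r k t.
Proof. by rewrite /bumpE; case: ifP => // t0; rewrite mulr_ge0 ?expR_ge0// exprn_ge0// invr_ge0 ltW. Qed.

(** The term of order [k + 2] of the exponential series alone gives this. Second-order vanishing at
    0 yields the derivative 0 there. *)
Lemma bumpE_le r k t : 0 < r -> 0 < t ->
  bumpE r k t <= (k.+2)`!%:R / r ^+ k.+2 * t ^+ 2.
Proof.
move=> r0 t0; rewrite /bumpE t0.
have ti0 : 0 < t^-1 by rewrite invr_gt0.
rewrite mulNr expRN.
have rt0 : 0 <= r * t^-1 by rewrite mulr_ge0// ltW.
have := @expR_ge1Dxn R (r * t^-1) k.+1 rt0.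
set F := (k.+2)`!%:R; set E := expR _ => H.
have f0 : 0 < F by rewrite ltr0n fact_gt0.
have E0 : 0 < E by exact: expR_gt0.
have rk0 : 0 < r ^+ k.+2 by rewrite exprn_gt0.
have H2 : (r * t^-1) ^+ k.+2 <= E * F by rewrite -ler_pdivrMr// (le_trans _ H)// lerDr.
rewrite ler_pdivrMr//.
have -> : F / r ^+ k.+2 * t ^+ 2 * E = E * F * t ^+ 2 / r ^+ k.+2 by ring.
rewrite ler_pdivlMr//.
have -> : t^-1 ^+ k * r ^+ k.+2 = (r * t^-1) ^+ k.+2 * t ^+ 2.
  by rewrite exprMn -mulrA -[k.+2]addn2 (exprD t^-1) -mulrA -exprMn mulVf ?gt_eqF// expr1n mulr1 mulrC.
by rewrite ler_wpM2r// sqr_ge0.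
Qed.

Lemma der_bumpE r k t : 0 < r ->
  der (bumpE r k) t (r * bumpE r k.+2 t - k%:R * bumpE r k.+1 t).
Proof.
move=> r0; have [t0|t0|->] := ltgtP t 0.
- rewrite /bumpE ltNge (ltW t0)/= !mulr0 subr0.
  apply: (@der_near (fun=> 0) _ _ _ (- t)); [by rewrite oppr_gt0| |exact: der_cst].
  by move=> y; rewrite ltr_norml => /andP[y1 y2]; rewrite ifF//; apply/negbTE; rewrite -leNgt; lra.
- apply: (@der_near (fun t => t^-1 ^+ k * expR (- r * t^-1)) _ _ _ t) => //.
    by move=> y; rewrite ltr_norml => /andP[y1 y2]; rewrite /bumpE ifT//; lra.
  have tn : t != 0 by rewrite gt_eqF.
  have d1 := der_inv tn.
  have d2 : der (fun t => t^-1 ^+ k) t (k%:R * t^-1 ^+ k.-1 * - t ^- 2).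
    have E n y : ((fun y : R => y^-1) ^+ n) y = y^-1 ^+ n.
      by elim: n => [|n IH]; rewrite ?expr0// !exprS -IH.
    exact: (der_eq (is_deriveX k d1)).
  apply: (der_eq (der_mul d2 (der_exp (der_scale (- r) d1)))) => //.
  rewrite /bumpE t0; case: k {d2} => [|k] /=; rewrite !exprS ?expr0; field => //.
- rewrite /bumpE ltxx !mulr0 subrr.
  apply: (@der_of_quadratic_bound _ _ _ ((k.+2)`!%:R / r ^+ k.+2)).
    by rewrite divr_ge0// exprn_ge0// ltW.
  move=> y _; rewrite ltxx !subr0 mul0r subr0; case: ifP => y0; last first.
    by rewrite normr0 mulr_ge0 ?sqr_ge0// divr_ge0// exprn_ge0// ltW.
  by have := bumpE_le k r0 y0; rewrite /bumpE y0 => H; rewrite ger0_norm// mulr_ge0 ?expR_ge0// exprn_ge0// invr_ge0 ltW.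
Qed.

Lemma smooth_bumpE r k : 0 < r -> smooth (bumpE r k).
Proof.
move=> r0 n; elim: n k => [//|n IH] k.
exists (fun t => r * bumpE r k.+2 t - k%:R * bumpE r k.+1 t).
  by move=> t; exact: der_bumpE.
rewrite (_ : (fun t => _) = (fun t => r * bumpE r k.+2 t + (- k%:R) * bumpE r k.+1 t)).
  by apply: nd_add; apply: nd_scale; exact: IH.
by apply/funext => t; rewrite mulNr.
Qed.

(** For small [r] this is close to the indicator of the unit interval and never exceeds it, so its
    mass is close to 1 although its height is at most 1. That keeps the loss of energy in the
    smoothing small. *)
Definition bump (r t : R) : R := bumpE r 0 t * bumpE r 0 (- 1 * t + 1).

Lemma smooth_bump r : 0 < r -> smooth (bump r).
Proof.
by move=> r0 n; apply: nd_mul; [exact: smooth_bumpE|apply: nd_affine; exact: smooth_bumpE].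
Qed.

Lemma bumpE0_le1 r t : 0 < r -> bumpE r 0 t <= 1.
Proof.
move=> r0; rewrite /bumpE; case: ifP => // t0; rewrite expr0 mul1r -expR0 ler_expR.
by rewrite mulNr oppr_le0 divr_ge0// ltW.
Qed.

Lemma bump_ge0 r t : 0 <= bump r t.
Proof. by apply: mulr_ge0; exact: bumpE_ge0. Qed.

Lemma bump_le1 r t : 0 < r -> bump r t <= 1.
Proof. by move=> r0; apply: mulr_ile1; rewrite ?bumpE_ge0 ?bumpE0_le1. Qed.

Lemma bump_out r t : t <= 0 \/ 1 <= t -> bump r t = 0.
Proof.
rewrite /bump /bumpE => -[t0|t1]; first by rewrite ltNge t0 mul0r.
by rewrite [X in _ * X]ifF ?mulr0//; apply/negbTE; rewrite -leNgt; lra.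
Qed.

(** With [r = s^2], each of the two exponents is at least [- s] at distance [s] from the
    endpoints. *)
Lemma bump_lb s t : 0 < s -> s <= t -> t <= 1 - s -> 1 - 2 * s <= bump (s ^+ 2) t.
Proof.
move=> s0 st ts; rewrite /bump /bumpE !ifT; [|lra..].
rewrite !expr0 !mul1r -expRD; apply: le_trans (expR_ge1Dx _).
have h z : s <= z -> - s <= - s ^+ 2 * z^-1.
  move=> sz; have z0 := lt_le_trans s0 sz.
  by rewrite mulNr lerN2 ler_pdivrMr// expr2 ler_pM2l.
have := h t st; have := h (- 1 * t + 1); lra.
Qed.

Lemma J_cst a b (k : R) : J `[a, b] (fun=> k).
Proof.
apply: continuous_compact_integrable; first exact: segment_compact.
by apply: continuous_subspaceT => x; exact: cvg_cst.
Qed.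

Definition stepm (r : R) : R := I `]-oo, 1] (bump r).
(** A smooth step from 0 to 1 across the unit interval whose slope is at most [1 / stepm r], hardly
    steeper than the affine one. *)
Definition stepS (r t : R) : R := I `]-oo, t] (bump r) / stepm r.

Lemma bump_cont r t : 0 < r -> {for t, continuous (bump r)}.
Proof.
by move=> r0; have [g dg _] := smooth_bump r0 1; exact: der_cont (dg t).
Qed.

Lemma bump_J r (D : set R) : 0 < r -> measurable D -> J D (bump r).
Proof.
move=> r0 mD; apply: (@J_set R setT) => //.
have mb : measurable_fun setT (bump r).
  by apply: continuous_measurable_fun => x; exact: bump_cont.
apply: (@J_le _ _ _ (fun x => 1 * \1_`[0, 1]%classic x)) => //.
  move=> x _; rewrite ger0_norm ?bump_ge0// mul1r indicE.
  have [x01|nx] := boolP (x \in _); first exact: bump_le1.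
  rewrite bump_out//; move: nx; rewrite notin_setE/= in_itv/= => /negP.
  by rewrite negb_and -!ltNge => /orP[]; [left|right]; exact: ltW.
by apply: (J_indic_sub _ _ _ _).1 => //; exact: J_cst.
Qed.

Lemma stepm_lb s : 0 < s -> s < 1 / 2 -> (1 - 2 * s) ^+ 2 <= stepm (s ^+ 2).
Proof.
move=> s0 s1; have r0 : 0 < s ^+ 2 by rewrite exprn_gt0.
have : I `[s, 1 - s] (fun=> 1 - 2 * s) <= I `[s, 1 - s] (bump (s ^+ 2)).
  apply: I_le => //; [exact: J_cst|exact: bump_J|].
  by move=> x /=; rewrite in_itv/= => /andP[]; exact: bump_lb.
rewrite {1}/I Rintegral_cst//= lebesgue_measure_itv/= lte_fin ifT; last lra.
rewrite -EFinD /= => H.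
have : I `[s, 1 - s] (bump (s ^+ 2)) <= stepm (s ^+ 2).
  apply: I_subset => //; [|exact: bump_J|by move=> *; exact: bump_ge0].
  by move=> x /=; rewrite !in_itv/=; lra.
by apply: le_trans; apply: le_trans H; rewrite expr2; nra.
Qed.

Lemma der_stepS r t : 0 < r -> der (stepS r) t (bump r t / stepm r).
Proof.
move=> r0.
have [|||d1 d2] := @continuous_FTC1 R (bump r) -oo%O t (t + 1) _ _ _ (bump_cont r0).
- by rewrite ltrDl.
- exact: bump_J.
- exact: ltNyr.
have H : der (fun t => I `]-oo, t] (bump r)) t (bump r t).
  apply: DeriveDef; [exact: d1|rewrite -derive1E; exact: d2].
apply: (der_eq (der_scale (stepm r)^-1 H)); last by rewrite mulrC.
by move=> y; rewrite mulrC.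
Qed.

Lemma smooth_stepS r : 0 < r -> smooth (stepS r).
Proof.
move=> r0 [//|n]; exists (fun t => (stepm r)^-1 * bump r t); last exact/nd_scale/smooth_bump.
by move=> t; apply: (der_eq (der_stepS t r0)) => //; rewrite mulrC.
Qed.

Lemma stepS0 r t : t <= 0 -> stepS r t = 0.
Proof.
move=> t0; rewrite /stepS (@I_eq _ _ _ (fun=> 0)).
  by rewrite /I Rintegral_cst// !mul0r.
by move=> x /=; rewrite in_itv/= => xt; rewrite bump_out//; left; exact: le_trans t0.
Qed.

Lemma stepS1 r t : 0 < r -> 0 < stepm r -> 1 <= t -> stepS r t = 1.
Proof.
move=> r0 m0 t1; rewrite /stepS [I _ _](_ : _ = stepm r) ?divff ?gt_eqF//.
rewrite /stepm (@I_indic_sub _ `]-oo, t]%classic `]-oo, 1]%classic).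
  apply: I_eq => x /=; rewrite !in_itv/= => xt; rewrite indicE.
  have [x1|x1] := boolP (x \in _); first by rewrite mulr1.
  rewrite bump_out ?mul0r//; right; move: x1; rewrite notin_setE/= in_itv/= => /negP.
  by rewrite -ltNge => /ltW.
by move=> x /=; rewrite !in_itv/= => /le_trans; apply.
Qed.

Lemma stepS_bnd r t : 0 < r -> 0 < stepm r -> 0 <= stepS r t <= 1.
Proof.
move=> r0 m0; have [t1|t1] := leP 1 t; first by rewrite stepS1// ler01 lexx.
apply/andP; split.
  by apply: divr_ge0; [apply: I_ge0 => *; exact: bump_ge0|exact: ltW].
rewrite /stepS ler_pdivrMr// mul1r; apply: I_subset => //; last by move=> *; exact: bump_ge0.
  by move=> x /=; rewrite !in_itv/= => /le_trans; apply; exact: ltW.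
exact: bump_J.
Qed.

End SmoothFunctions.

(** * The bound on the negative part for absolutely continuous functions *)

Section WeightedIntegrals.
Variable R : realType.
Local Notation leb := (@lebesgue_measure R).
Local Notation Rp := (@Rp R).
Local Notation wJ := (wintegrable Rp).
Implicit Types (f g h u du w dw : R -> R) (a b c k e x y : R).

Lemma m_id (D : set R) : measurable_fun D (fun x : R => x).
Proof. exact: measurable_id. Qed.

Lemma wJ_le f g : measurable_fun Rp f -> (forall x, 0 < x -> `|f x| <= g x) ->
  wJ g -> wJ f.
Proof.
move=> mf fg; apply: J_le; [exact: mRp|by apply: measurable_funM => //; exact: m_id|].
by move=> x /RpP x0; rewrite normrM (gtr0_norm x0) ler_pM2r// fg.
Qed.

Lemma wJ_eq f g : (forall x, 0 < x -> f x = g x) -> wJ f -> wJ g.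
Proof. by move=> fg; apply: J_eq => [|x /RpP x0]; [exact: mRp|rewrite fg]. Qed.

Lemma wJ_add f g : wJ f -> wJ g -> wJ (fun x => f x + g x).
Proof.
move=> jf jg; apply: (J_eq _ _ (J_add mRp jf jg)); first exact: mRp.
by move=> x _; rewrite mulrDl.
Qed.

Lemma wJ_scale k f : wJ f -> wJ (fun x => k * f x).
Proof.
move=> jf; apply: (J_eq _ _ (J_scale k mRp jf)); first exact: mRp.
by move=> x _; rewrite mulrA.
Qed.

Lemma wJ_sub f g : wJ f -> wJ g -> wJ (fun x => f x - g x).
Proof.
move=> jf jg; apply: (wJ_eq _ (wJ_add jf (wJ_scale (-1) jg))) => x _.
by rewrite mulN1r.
Qed.

Lemma wJ_bnd M h f : measurable_fun Rp h -> (forall x, 0 < x -> `|h x| <= M) ->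
  wJ f -> wJ (fun x => h x * f x).
Proof.
move=> mh hM jf.
have : J Rp (fun x => h x * (f x * x)).
  by apply: (@J_bnd _ _ _ _ M) => // [|x /RpP]; [exact: mRp|exact: hM].
by apply: J_eq => [|x _]; [exact: mRp|rewrite mulrA].
Qed.

Lemma wJ0 : wJ (fun=> 0).
Proof.
apply: (@J_eq R Rp (fun=> 0)); [exact: mRp|by move=> x _; rewrite mul0r|].
exact: integrable0.
Qed.

Lemma wint_eq f g : (forall x, 0 < x -> f x = g x) -> wint f = wint g.
Proof. by move=> fg; apply: I_eq => x /RpP x0; rewrite fg. Qed.

Lemma wint_add f g : wJ f -> wJ g -> wint (fun x => f x + g x) = wint f + wint g.
Proof.
move=> jf jg; rewrite -(I_add mRp jf jg); apply: I_eq => x _; by rewrite mulrDl.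
Qed.

Lemma wint_scale k f : wJ f -> wint (fun x => k * f x) = k * wint f.
Proof.
by move=> jf; rewrite -(I_scale k mRp jf); apply: I_eq => x _; rewrite mulrA.
Qed.

Lemma wint_sub f g : wJ f -> wJ g -> wint (fun x => f x - g x) = wint f - wint g.
Proof.
by move=> jf jg; rewrite -(I_sub mRp jf jg); apply: I_eq => x _; rewrite mulrBl.
Qed.

Lemma wint_le f g : wJ f -> wJ g -> (forall x, 0 < x -> f x <= g x) -> wint f <= wint g.
Proof.
move=> jf jg fg; apply: I_le => //; first exact: mRp.
by move=> x /RpP x0; rewrite ler_pM2r// fg.
Qed.

Lemma wint_ge0 f : (forall x, 0 < x -> 0 <= f x) -> 0 <= wint f.
Proof. by move=> f0; apply: I_ge0 => x /RpP x0; rewrite mulr_ge0 ?f0// ltW. Qed.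

Lemma wint0 : wint (fun=> 0 : R) = 0.
Proof.
rewrite (_ : wint _ = I Rp (fun=> 0)); last by apply: I_eq => x _; rewrite mul0r.
by rewrite /I Rintegral_cst ?mul0r//; exact: mRp.
Qed.

Lemma wint_dct (f_ : nat -> R -> R) f g :
  (forall n, measurable_fun Rp (f_ n)) ->
  (forall x, 0 < x -> f_ n x @[n --> \oo] --> f x) ->
  wJ g -> (forall n x, 0 < x -> `|f_ n x| <= g x) ->
  wJ f /\ wint (f_ n) @[n --> \oo] --> wint f.
Proof.
move=> mf cf jg fg.
apply: (@dct R Rp (fun n x => f_ n x * x) (fun x => f x * x) (fun x => g x * x)) => //.
- exact: mRp.
- by move=> n; apply: measurable_funM => //; exact: m_id.
- by move=> x /RpP x0; apply: cvgM; [exact: cf|exact: cvg_cst].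
- by move=> n x /RpP x0; rewrite normrM (gtr0_norm x0) ler_pM2r// fg.
Qed.

Lemma wint_fatou (f_ : nat -> R -> R) f K :
  (forall n x, 0 < x -> 0 <= f_ n x) -> (forall n, wJ (f_ n)) ->
  (forall x, 0 < x -> f_ n x @[n --> \oo] --> f x) ->
  (forall n, wint (f_ n) <= K) -> wJ f /\ wint f <= K.
Proof.
move=> f0 jf cf fK.
apply: (@fatou_I R Rp (fun n x => f_ n x * x) (fun x => f x * x)) => //.
- exact: mRp.
- by move=> n x /RpP x0; rewrite mulr_ge0 ?f0// ltW.
- by move=> x /RpP x0; apply: cvgM; [exact: cf|exact: cvg_cst].
Qed.

Lemma wJ_mul2 f g : measurable_fun Rp f -> measurable_fun Rp g -> wL2 f -> wL2 g ->
  wJ (fun x => f x * g x).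
Proof.
move=> mf mg jf jg; apply: (wJ_le _ _ (wJ_add jf jg)); first exact: measurable_funM.
move=> x _; rewrite normrM -(real_normK (num_real (f x))) -(real_normK (num_real (g x))).
have := sqr_ge0 (`|f x| - `|g x|); have := normr_ge0 (f x); have := normr_ge0 (g x); nra.
Qed.

Lemma wint_supp f a b : 0 < a -> (forall x, 0 < x -> (x < a \/ b < x) -> f x = 0) ->
  wint f = I `[a, b] (fun x => f x * x).
Proof.
move=> a0 f0; rewrite (I_indic_sub _ (itv_Rp a0)); apply: I_eq => x /RpP x0.
rewrite indicE; have [_|] := boolP (x \in _); first by rewrite mulr1.
rewrite notin_setE/= in_itv/= mulr0 => /negP; rewrite negb_and -!ltNge => /orP H.
by rewrite f0// mul0r.
Qed.

Lemma wJ_supp f a b : 0 < a -> (forall x, 0 < x -> (x < a \/ b < x) -> f x = 0) ->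
  J `[a, b] (fun x => f x * x) -> wJ f.
Proof.
move=> a0 f0 jf; have := (J_indic_sub (fun x => f x * x) mRp (measurable_itv `[a, b]) (itv_Rp a0)).1 jf.
apply: J_eq; first exact: mRp.
move=> x /RpP x0; rewrite indicE; have [_|] := boolP (x \in _); first by rewrite mulr1.
rewrite notin_setE/= in_itv/= mulr0 => /negP; rewrite negb_and -!ltNge => /orP H.
by rewrite f0// mul0r.
Qed.

Lemma wJ_itv f a b : 0 < a -> wJ f -> J `[a, b] (fun x => f x * x).
Proof. by move=> a0; exact: (J_set mRp (measurable_itv _) (itv_Rp a0)). Qed.

Lemma itv_wJ f a b : 0 < a -> measurable_fun Rp f -> J `[a, b] (fun x => f x * x) -> J `[a, b] f.
Proof.
move=> a0 mf jf; apply: (@J_le _ _ _ (fun x => a^-1 * `|f x * x|)) => //.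
- by apply: (measurable_funS _ (itv_Rp a0) mf); exact: mRp.
- move=> x /=; rewrite in_itv/= => /andP[ax _]; have x0 := lt_le_trans a0 ax.
  rewrite normrM (gtr0_norm x0) mulrCA ler_peMr// mulrC ler_pdivlMr// mul1r//.
- by apply: J_scale => //; exact: J_norm.
Qed.

Lemma locL1_wJ f a b : 0 < a -> locL1 f ->
  (forall x, 0 < x -> (x < a \/ b < x) -> f x = 0) -> wJ f.
Proof.
move=> a0 lf f0; apply: (wJ_supp a0 f0).
have : J `[a, b] (fun x => x * f x).
  apply: (@J_bnd R `[a, b]%classic (fun x => x) f b) => //.
    move=> x /=; rewrite in_itv/= => /andP[ax xb]; rewrite ger0_norm// (le_trans _ ax)//; exact: ltW.
  exact: lf.
by apply: J_eq => // x _; rewrite mulrC.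
Qed.

Lemma wL2_locL1 f : measurable_fun Rp f -> wL2 f -> locL1 f.
Proof.
move=> mf jf a b a0.
have mi : measurable_fun `[a, b] f.
  by apply: (measurable_funS _ (itv_Rp a0) mf); exact: mRp.
have j2 : J `[a, b] (fun x => f x ^+ 2).
  by apply: itv_wJ => //; [exact: measurable_funX|exact: wJ_itv].
apply: (@J_le _ _ _ (fun x => f x ^+ 2 + 1)) => //.
  move=> x _; rewrite -(real_normK (num_real (f x))); have := sqr_ge0 (`|f x| - 1); nra.
by apply: J_add => //; exact: J_cst.
Qed.

End WeightedIntegrals.

(** * Smooth interpolation with controlled energy *)

Section FormBound.
Variable R : realType.
Local Notation Rp := (@Rp R).
Implicit Types (u du : R -> R) (x : R).
Variables (r A B : R) (u du : R -> R) (N : nat).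
Hypotheses (r0 : 0 < r) (m0 : 0 < stepm r) (A0 : 0 < A) (AB : A < B) (N0 : (0 < N)%N).
Hypotheses (hu : hasDeriv u du) (uA : forall x, 0 < x -> x <= A -> u x = 0)
  (uB : forall x, B <= x -> u x = 0) (du2 : J `[A, B] (fun x => du x ^+ 2 * x)).

Let d := (B - A) / N%:R.
Let xi (i : nat) := A + i%:R * d.
Let D i := u (xi i.+1) - u (xi i).

Let d0 : 0 < d.
Proof. by rewrite /d divr_gt0 ?ltr0n// subr_gt0. Qed.

Let xi_le i j : (i <= j)%N -> xi i <= xi j.
Proof. by move=> ij; rewrite lerD2l ler_pM2r// ler_nat. Qed.

Let xiS i : xi i.+1 = xi i + d.
Proof. by rewrite /xi -natr1; ring. Qed.

Let xiN : xi N = B.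
Proof. by rewrite /xi /d mulrC divfK ?subrKC// gt_eqF// ltr0n. Qed.

Let xi0 : xi 0 = A.
Proof. by rewrite /xi mul0r addr0. Qed.

Let arg i x := d^-1 * x + (- xi i / d).

Let argE i x : arg i x = (x - xi i) / d.
Proof. by rewrite /arg mulrBl mulNr mulrC. Qed.

(** Interpolates [u] at the nodes [xi i], with a smooth step in place of the affine one. The
    approximant vanishes outside [[A, B]] like [u], and its energy is compared with that of [u] cell
    by cell. *)
Definition step_approx x := \sum_(i < N) D i * stepS r (arg i x).
Definition step_approx' x := \sum_(i < N) D i * (bump r (arg i x) / stepm r * d^-1).

Let arg_ge1 i x : xi i.+1 <= x -> 1 <= arg i x.
Proof. by move=> h; rewrite argE ler_pdivlMr// mul1r lerBrDl -xiS. Qed.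

Let arg_le0 i x : x <= xi i -> arg i x <= 0.
Proof. by move=> h; rewrite argE pmulr_lle0 ?invr_gt0// subr_le0. Qed.

Lemma step_approx_smooth : smooth step_approx.
Proof.
by move=> n; apply: (@nd_sum R n (fun i x => D i * stepS r (arg i x))) => i; apply: nd_scale; apply: nd_affine; exact: smooth_stepS.
Qed.

Lemma der_step_approx x : der step_approx x (step_approx' x).
Proof.
rewrite /step_approx /step_approx'; elim: N => [|n IH].
  by apply: (der_eq (der_cst 0 x)) => [y|]; rewrite big_ord0.
have H : der (fun y => D n * stepS r (arg n y)) x (D n * (bump r (arg n x) / stepm r * d^-1)).
  apply: der_scale; apply: (der_comp (der_stepS _ r0)).
  apply: (der_eq (der_add (der_scale d^-1 (der_id x)) (der_cst (- xi n / d) x))) => //.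
  by rewrite mulr1 addr0.
by apply: (der_eq (der_add IH H)) => [y|]; rewrite big_ord_recr.
Qed.

Lemma step_approx'_cont x : {for x, continuous step_approx'}.
Proof.
have [g dg [g' dg' _]] := step_approx_smooth 2.
have -> : step_approx' = g.
  apply/funext => y; have := der_derive1 (dg y); have := der_derive1 (der_step_approx y).
  by move=> -> ->.
exact: der_cont (dg' x).
Qed.

Let usum0 : u (xi 0) = 0.
Proof. by rewrite xi0 uA. Qed.

Lemma step_approx_cell k x : (k < N)%N -> xi k <= x -> x <= xi k.+1 ->
  step_approx x = u (xi k) + D k * stepS r (arg k x).
Proof.
move=> kN xk1 xk2.
have H m : \sum_(i < m) D i * stepS r (arg i x) =
    if (m <= k)%N then u (xi m) else u (xi k) + D k * stepS r (arg k x).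
  elim: m => [|m IH]; first by rewrite big_ord0 leq0n usum0.
  rewrite big_ord_recr/= IH; have [mk|mk|->] := ltngtP m k.
  - rewrite stepS1// ?mulr1 /D ?subrKC//; apply: arg_ge1.
    by apply: le_trans xk1; exact: xi_le.
  - by rewrite (@stepS0 _ _ (arg m x)) ?mulr0 ?addr0//; apply: arg_le0; apply: le_trans xk2 _; exact: xi_le.
  - by [].
by rewrite /step_approx H leqNgt kN.
Qed.

Lemma step_approx'_cell k x : (k < N)%N -> xi k <= x -> x <= xi k.+1 ->
  step_approx' x = D k * (bump r (arg k x) / stepm r * d^-1).
Proof.
move=> kN xk1 xk2.
rewrite /step_approx' (bigD1 (Ordinal kN))//= big1 ?addr0// => i ik.
have {}ik : (i : nat) != k by apply: contra ik => /eqP ik; apply/eqP/val_inj.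
rewrite bump_out ?mul0r ?mulr0//; move: ik; rewrite neq_ltn => /orP[ik|ik].
  by right; apply: arg_ge1; apply: le_trans xk1; exact: xi_le.
by left; apply: arg_le0; apply: le_trans xk2 _; exact: xi_le.
Qed.

Lemma step_approx_out x : x < A \/ B < x -> step_approx x = 0 /\ step_approx' x = 0.
Proof.
move=> [xA|xB].
  have h i : arg i x <= 0 by apply: arg_le0; rewrite (le_trans (ltW xA))// -xi0 xi_le.
  split; rewrite /step_approx /step_approx' big1// => i _; first by rewrite stepS0 ?mulr0.
  by rewrite bump_out ?mul0r ?mulr0//; left.
split.
  have H m : (m <= N)%N -> \sum_(i < m) D i * stepS r (arg i x) = u (xi m).
    elim: m => [|m IH] mN; first by rewrite big_ord0 usum0.
    rewrite big_ord_recr/= IH ?(ltnW mN)// stepS1// ?mulr1 /D ?subrKC//.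
    by apply: arg_ge1; rewrite (le_trans _ (ltW xB))// -xiN xi_le.
  by rewrite /step_approx H// xiN uB.
rewrite /step_approx' big1// => i _; rewrite bump_out ?mul0r ?mulr0//; right.
by apply: arg_ge1; rewrite (le_trans _ (ltW xB))// -xiN xi_le.
Qed.

Let xi_gt0 i : 0 < xi i.
Proof. by rewrite (lt_le_trans A0)// -xi0 xi_le. Qed.

Let du_meas : measurable_fun Rp du.
Proof. exact: locL1_meas (hd_L1 hu). Qed.

Let sa2J a b : J `[a, b] (fun x => step_approx' x ^+ 2 * x).
Proof.
apply: continuous_compact_integrable; first exact: segment_compact.
apply: continuous_subspaceT => x; apply: (@continuousM _ _ (fun x => step_approx' x ^+ 2)) => //.
have c := step_approx'_cont (x := x).
exact: (@continuousM _ _ step_approx' step_approx' x c c).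
Qed.

(** Since [bump <= 1], the square of the slope is at most the slope times its maximal value, and the
    slope integrates to the increment [D k]. Cauchy-Schwarz bounds [D k ^ 2] by [d] times the
    unweighted energy of [u]. The weight changes over the cell by a factor of at most
    [1 + d / A]. *)
Lemma step_approx_energy_cell k : (k < N)%N ->
  I `[xi k, xi k.+1] (fun x => step_approx' x ^+ 2 * x)
  <= (1 + d / A) / stepm r * I `[xi k, xi k.+1] (fun x => du x ^+ 2 * x).
Proof.
move=> kN; have x0 := xi_gt0 k; have xS := xi_le (leqnSn k).
have x1 := xi_gt0 k.+1.
have Ax : A <= xi k by rewrite -xi0 xi_le.
have xB : xi k.+1 <= B by rewrite -xiN xi_le.
have sub : `[xi k, xi k.+1]%classic `<=` `[A, B]%classic.
  by apply: subset_itvScc; rewrite bnd_simp.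
have jdu : J `[xi k, xi k.+1] (fun x => du x ^+ 2 * x) by apply: J_set du2.
have jdu2 : J `[xi k, xi k.+1] (fun x => du x ^+ 2).
  by apply: itv_wJ => //; exact: measurable_funX.
have hS : hasDeriv (fun x => stepS r (arg k x)) (fun x => bump r (arg k x) / stepm r * d^-1).
  apply: hd_C1 => x _.
    apply: (der_comp (der_stepS _ r0)).
    apply: (der_eq (der_add (der_scale d^-1 (der_id x)) (der_cst (- xi k / d) x))) => //.
    by rewrite mulr1 addr0.
  have [g dg _] := nd_scale ((stepm r)^-1 * d^-1) (nd_affine d^-1 (- xi k / d) (smooth_bump r0 1)).
  rewrite (_ : (fun x => _) = (fun x => (stepm r)^-1 * d^-1 * bump r (arg k x))).
    exact: der_cont (dg x).
  by apply/funext => y; ring.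
have jS := hd_L1 hS (xi k.+1) x0.
have D2 : D k ^+ 2 <= d * (xi k)^-1 * I `[xi k, xi k.+1] (fun x => du x ^+ 2 * x).
  rewrite /D -(hd_I hu x0 xS).
  have := @cauchy_schwarz_I R `[xi k, xi k.+1]%classic (fun=> 1) du (measurable_itv _).
  rewrite (@I_eq _ _ (fun x => 1 * du x) du); last by move=> *; rewrite mul1r.
  rewrite (@I_eq _ _ (fun=> 1 ^+ 2) (fun=> 1)); last by move=> *; rewrite expr1n.
  rewrite {2}/I Rintegral_cst//= mul1r lebesgue_measure_itv/= lte_fin xiS ltrDl d0 -EFinD/= -xiS.
  have -> : xi k.+1 - xi k = d by rewrite xiS; ring.
  move=> H; apply: (le_trans (H _ _ _ _)) => //.
  - by apply: (measurable_funS _ (itv_Rp x0) du_meas); exact: mRp.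
  - exact: J_cst.
  rewrite -mulrA ler_pM2l// -I_scale//; apply: I_le => //; first exact: J_scale.
  move=> x /=; rewrite in_itv/= => /andP[kx _].
  by rewrite mulrC -mulrA ler_peMr ?sqr_ge0// ler_pdivlMr// mul1r.
have E1 : I `[xi k, xi k.+1] (fun x => step_approx' x ^+ 2 * x)
    <= I `[xi k, xi k.+1] (fun x => xi k.+1 * D k ^+ 2 / (stepm r * d) * (bump r (arg k x) / stepm r * d^-1)).
  apply: I_le => //; first exact: J_scale.
  move=> x /=; rewrite in_itv/= => /andP[kx xk].
  rewrite (step_approx'_cell kN)//.
  have b0 := bump_ge0 r (arg k x); have b1 := bump_le1 (arg k x) r0.
  set b := bump r _ in b0 b1 *.
  have -> : (D k * (b / stepm r / d)) ^+ 2 * x = b * b * x * (D k ^+ 2 / (stepm r * d) / (stepm r * d)).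
    by field; rewrite !gt_eqF.
  have -> : xi k.+1 * D k ^+ 2 / (stepm r * d) * (b / stepm r / d) =
      b * 1 * xi k.+1 * (D k ^+ 2 / (stepm r * d) / (stepm r * d)) by field; rewrite !gt_eqF.
  have q0 : 0 <= D k ^+ 2 / (stepm r * d) / (stepm r * d).
    by apply: divr_ge0; [apply: divr_ge0|]; rewrite ?sqr_ge0// mulr_ge0// ltW.
  apply: ler_wpM2r => //.
  apply: ler_pM => //; [by rewrite mulr_ge0|by rewrite (le_trans (ltW x0))|].
  by rewrite ler_wpM2l.
apply: (le_trans E1); rewrite I_scale// (hd_I hS)// stepS1//; last exact: arg_ge1.
rewrite stepS0 ?subr0 ?mulr1; last exact: arg_le0.
have I0 : 0 <= I `[xi k, xi k.+1] (fun x => du x ^+ 2 * x).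
  apply: I_ge0 => x /=; rewrite in_itv/= => /andP[kx _].
  by rewrite mulr_ge0 ?sqr_ge0// (le_trans (ltW x0)).
set Q := I _ _ in D2 I0 *.
apply: (@le_trans _ _ (xi k.+1 * (d * (xi k)^-1 * Q) / (stepm r * d))).
  apply: ler_wpM2r; first by rewrite invr_ge0 mulr_ge0// ltW.
  by apply: ler_wpM2l => //; exact: ltW.
have -> : xi k.+1 * (d / xi k * Q) / (stepm r * d) = (xi k.+1 / xi k) / stepm r * Q.
  by field; rewrite !gt_eqF.
rewrite ler_wpM2r// ler_pM2r ?invr_gt0// xiS mulrDl divff ?gt_eqF// lerD2l.
by rewrite ler_pM2l// lef_pV2.
Qed.

Lemma step_approx_energy :
  wint (fun x => step_approx' x ^+ 2) <= (1 + d / A) / stepm r * I `[A, B] (fun x => du x ^+ 2 * x).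
Proof.
rewrite (@wint_supp _ _ A B)//; last by move=> x _ /step_approx_out[_ ->]; rewrite expr0n.
have H m : (m <= N)%N -> I `[A, xi m] (fun x => step_approx' x ^+ 2 * x) <=
    (1 + d / A) / stepm r * I `[A, xi m] (fun x => du x ^+ 2 * x).
  elim: m => [|m IH] mN.
    by rewrite xi0 set_itv1 /I !Rintegral_set1 mulr0.
  have h1 : A <= xi m by rewrite -xi0 xi_le.
  have h2 := xi_le (leqnSn m).
  rewrite (I_split h1 h2); last exact: sa2J.
  rewrite [X in _ <= _ * X](I_split h1 h2); last first.
    by apply: J_set du2 => //; apply: subset_itvl; rewrite bnd_simp -xiN xi_le.
  by rewrite mulrDr lerD ?IH ?(ltnW mN)// step_approx_energy_cell.
by have := H N (leqnn N); rewrite xiN.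
Qed.

Lemma step_approx_close (e : R) : (forall x y, A <= x -> x <= y -> y <= B -> y - x <= d -> `|u y - u x| <= e) ->
  forall x, 0 < x -> `|step_approx x - u x| <= 2 * e.
Proof.
move=> He x x0.
have e0 : 0 <= e by apply: le_trans (normr_ge0 _) (He A A _ _ _ _) => //; [exact: ltW|rewrite subrr ltW].
have [xA|Ax] := ltP x A.
  by rewrite (step_approx_out (or_introl xA)).1 uA ?subrr ?normr0 ?mulr_ge0// ltW.
have [Bx|xB] := ltP B x.
  by rewrite (step_approx_out (or_intror Bx)).1 uB ?subrr ?normr0 ?mulr_ge0// ltW.
have [k kN /andP[xk1 xk2]] : exists2 k, (k < N)%N & xi k <= x <= xi k.+1.
  have cell n : (0 < n)%N -> x <= xi n -> exists2 k, (k < n)%N & xi k <= x <= xi k.+1.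
    elim: n => [//|n IH] _ xn; have [x1|x1] := leP (xi n) x; first by exists n => //; rewrite x1 xn.
    case: n IH xn x1 => [|n] IH xn x1; first by move: x1; rewrite xi0 ltNge Ax.
    by have [k kn h] := IH isT (ltW x1); exists k => //; exact: leqW.
  by apply: cell => //; rewrite xiN.
have h1 : A <= xi k by rewrite -xi0 xi_le.
have h2 : xi k.+1 <= B by rewrite -xiN xi_le.
have h3 : xi k.+1 - xi k = d by rewrite xiS; ring.
rewrite (step_approx_cell kN)//.
have -> : u (xi k) + D k * stepS r (arg k x) - u x = D k * stepS r (arg k x) - (u x - u (xi k)) by ring.
rewrite (le_trans (ler_normB _ _))// mulr_natl mulr2n lerD//.
  have /andP[s0 s1] := stepS_bnd (arg k x) r0 m0.
  rewrite normrM (ger0_norm s0) (@le_trans _ _ (`|D k| * 1))// ?ler_wpM2l// mulr1 He//.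
    exact: xi_le.
  by rewrite h3.
by apply: He => //; rewrite -h3 lerD2r.
Qed.

End FormBound.

(** * From smooth to absolutely continuous functions *)

Section NegativePartBound.
Variable R : realType.
Local Notation Rp := (@Rp R).
Local Notation wJ := (wintegrable Rp).

Lemma le_eps (X Y C : R) : 0 <= C -> (forall e, 0 < e -> e <= 1 -> X <= Y + e * C) -> X <= Y.
Proof.
move=> C0 H; apply/ler_addgt0Pr => e e0.
have C1 : 0 < C + 1 by rewrite ltr_wpDl.
have := H (Num.min 1 (e / (C + 1))); rewrite lt_min ltr01 divr_gt0// ge_min lexx => /(_ isT isT).
move=> /le_trans; apply; rewrite lerD2l.
apply: (@le_trans _ _ (e / (C + 1) * C)); first by rewrite ler_wpM2r// ge_min lexx orbT.
by rewrite mulrAC ler_pdivrMr// ler_wpM2l ?ltW// ltrDl.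
Qed.

Lemma negp_ge0 (W : R -> R) x : 0 <= negp W x.
Proof. by rewrite /negp le_max lexx orbT. Qed.

Lemma posp_ge0 (W : R -> R) x : 0 <= posp W x.
Proof. by rewrite /posp le_max lexx orbT. Qed.

Lemma posp_negp (W : R -> R) x : W x = posp W x - negp W x.
Proof. by rewrite /posp /negp; case: (leP (W x) 0) => h; case: (leP (- W x) 0) => h'; lra. Qed.

Lemma posp_meas (W : R -> R) : locL1 W -> measurable_fun Rp (posp W).
Proof. by move=> /locL1_meas mW; exact: measurable_maxr. Qed.

Lemma negp_meas (W : R -> R) : locL1 W -> measurable_fun Rp (negp W).
Proof.
move=> /locL1_meas mW; apply: measurable_maxr => //; exact: measurable_funN.
Qed.

Lemma negp_locL1 (W : R -> R) : locL1 W -> locL1 (negp W).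
Proof.
move=> lW a b a0; apply: (@J_le _ _ _ (fun x => `|W x|)) => //.
- apply: (measurable_funS _ (itv_Rp a0)); [exact: mRp|exact: negp_meas].
- move=> x _; rewrite ger0_norm ?negp_ge0// /negp ge_max normr_ge0 andbT -normrN; exact: ler_norm.
- exact: locL1_norm.
Qed.

Lemma posp_locL1 (W : R -> R) : locL1 W -> locL1 (posp W).
Proof.
move=> lW; apply: (@locL1_eq R (fun x => W x + negp W x)); last exact/locL1_add/negp_locL1.
by move=> x _; have := posp_negp W x; lra.
Qed.

(** The smooth bound is applied to the interpolants. The mesh tends to 0 while [r] stays fixed,
    which leaves the coefficient [a / stepm r]; all that matters later is that it can be kept below
    1. *)
Lemma negp_bound_ac (W : R -> R) (a M r A B : R) (u du : R -> R) :
  locL1 W -> 0 <= a -> 0 <= M -> 0 < r -> 0 < stepm r -> 0 < A -> A < B ->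
  (forall psi, Cc_inf psi -> wint (fun x => negp W x * psi x ^+ 2)
     <= a * wint (fun x => (derive1 psi x) ^+ 2) + M * wint (fun x => psi x ^+ 2)) ->
  hasDeriv u du -> (forall x, 0 < x -> x <= A -> u x = 0) -> (forall x, B <= x -> u x = 0) ->
  wL2 du ->
  wint (fun x => negp W x * u x ^+ 2)
    <= a / stepm r * wint (fun x => du x ^+ 2) + M * wint (fun x => u x ^+ 2).
Proof.
move=> lW a0 M0 r0 m0 A0 AB Hb hu uA uB du2.
have du2' : J `[A, B] (fun x => du x ^+ 2 * x) by exact: wJ_itv.
have [K K0 HK] := hd_bnd B hu A0.
have uK x : 0 < x -> `|u x| <= K.
  move=> x0; have [xA|Ax] := leP x A; first by rewrite uA// normr0 ltW.
  have [xB|Bx] := leP x B; first by apply: HK => //; exact: ltW.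
  by rewrite uB ?normr0; exact: ltW.
(* The indicator of the support, an integrable majorant that turns uniform closeness of the squares
   into closeness of both integrals. *)
pose ch x : R := \1_(`[A, B]%classic : set R) x.
have ch_out x : x < A \/ B < x -> ch x = 0.
  move=> h; rewrite /ch indicE memNset//= in_itv/= => /andP[h1 h2]; case: h => ?; lra.
have ch_in x : A <= x -> x <= B -> ch x = 1.
  by move=> h1 h2; rewrite /ch indicE mem_set//= in_itv/= h1 h2.
have ch01 x : 0 <= ch x by rewrite /ch indicE.
have mch : measurable_fun Rp ch by apply: measurable_indic.
have lch : locL1 ch.
  move=> p q p0; apply: (@J_le _ _ _ (fun=> 1)) => //; last exact: J_cst.
    exact: (measurable_funS mRp (itv_Rp p0) mch).
  by move=> x _; rewrite /ch indicE; case: (_ \in _); rewrite ?normr1 ?normr0.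
have lnch : locL1 (fun x => ch x * negp W x).
  apply: locL1_bnd => //; last exact: negp_locL1.
  by move=> p q p0; exists 1 => x _ _; rewrite /ch indicE; case: (_ \in _); rewrite ?normr1 ?normr0.
have jch : wJ ch by apply: (@locL1_wJ _ _ A B) => // x _; exact: ch_out.
have jnch : wJ (fun x => ch x * negp W x).
  by apply: (@locL1_wJ _ _ A B) => // x _ h; rewrite ch_out ?mul0r.
have jb (f : R -> R) : measurable_fun Rp f -> (forall x, 0 < x -> (x < A \/ B < x) -> f x = 0) ->
    (exists L, forall x, 0 < x -> `|f x| <= L) -> wJ f /\ wJ (fun x => negp W x * f x).
  move=> mf f0 [L fL].
  have E x : 0 < x -> f x * ch x = f x.
    move=> x0; have [xA|Ax] := ltP x A; first by rewrite f0 ?mul0r//; left.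
    have [Bx|xB] := ltP B x; first by rewrite f0 ?mul0r//; right.
    by rewrite ch_in ?mulr1.
  split; first exact: (wJ_eq E (wJ_bnd mf fL jch)).
  by apply: (wJ_eq _ (wJ_bnd mf fL jnch)) => x x0; rewrite mulrA E// mulrC.
have mu := hd_meas hu.
have uout x : 0 < x -> x < A \/ B < x -> u x = 0.
  by move=> x0 [h|h]; [apply: uA => //|apply: uB]; exact: ltW.
have [ju2 jnu2] : wJ (fun x => u x ^+ 2) /\ wJ (fun x => negp W x * u x ^+ 2).
  apply: jb; first exact: measurable_funX.
    by move=> x x0 h; rewrite uout ?expr0n.
  by exists (K ^+ 2) => x x0; rewrite normrX; have := uK x x0; have := normr_ge0 (u x); nra.
set T := wint (fun x => negp W x * u x ^+ 2); set Du := wint (fun x => du x ^+ 2).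
have Du0 : 0 <= Du by apply: wint_ge0 => x _; exact: sqr_ge0.
have P0 : 0 <= wint ch by apply: wint_ge0.
have Q0 : 0 <= wint (fun x => ch x * negp W x).
  by apply: wint_ge0 => x _; rewrite mulr_ge0// negp_ge0.
apply: (@le_eps _ _ (a / stepm r * Du + (2 * K + 1) * (M * wint ch + wint (fun x => ch x * negp W x)))).
  by pos.
move=> e e0 e1.
have e2 : 0 < e / 2 by rewrite divr_gt0.
have [del del0 Hdel] := hd_uc B hu A0 e2.
(* A mesh below [del] gives uniform closeness; a mesh below [A * e] makes [1 + d / A] at most
   [1 + e]. *)
pose N := (Num.bound ((B - A) / Num.min del (A * e))).+1.
have dm0 : 0 < Num.min del (A * e) by rewrite lt_min del0 mulr_gt0.
have BA : 0 < B - A by rewrite subr_gt0.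
have Nb : (B - A) / Num.min del (A * e) < N%:R.
  apply: lt_le_trans (archi_boundP _) _; first by rewrite divr_ge0 ?ltW.
  by rewrite ler_nat /N.
have dN : (B - A) / N%:R < Num.min del (A * e).
  by rewrite ltr_pdivrMr ?ltr0n// mulrC -ltr_pdivrMr.
move: (dN); rewrite lt_min => /andP[dN1 dN2].
have N0 : (0 < N)%N by [].
pose ap := step_approx r A B u N; pose ap' := step_approx' r A B u N.
have Hcl x : 0 < x -> `|ap x - u x| <= e.
  move=> x0; have := @step_approx_close R r A B u N r0 m0 A0 AB N0 uA uB (e / 2) _ x x0.
  rewrite (_ : 2 * (e / 2) = e); last by field.
  apply => p q Ap pq qB pqd; apply: Hdel => //.
  exact: le_lt_trans dN1.
have Hout x := @step_approx_out R r A B u N r0 m0 A0 AB N0 uA uB x.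
have Hs : smooth ap by exact: step_approx_smooth.
have Hcc : Cc_inf ap.
  split; first exact: smooth_derive1n.
  by exists A, B; split=> //; split; [exact: ltW|move=> x /Hout[]].
have map : measurable_fun Rp ap.
  apply: open_continuous_measurable_fun; first exact: interval_open.
  by move=> x _; exact: der_cont (der_step_approx _ _ _ _ r0 x).
have apK x : 0 < x -> `|ap x| <= K + 1.
  by move=> x0; have := Hcl x x0; have := uK x x0; have := ler_normD (ap x - u x) (u x); rewrite subrK; lra.
have [ja2 jna2] : wJ (fun x => ap x ^+ 2) /\ wJ (fun x => negp W x * ap x ^+ 2).
  apply: jb; first exact: measurable_funX.
    by move=> x x0 /Hout[]; rewrite -/ap => -> _; rewrite expr0n.
  exists ((K + 1) ^+ 2) => x x0; rewrite normrX; have := apK x x0; have := normr_ge0 (ap x); nra.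
have Hsq x : 0 < x -> `|ap x ^+ 2 - u x ^+ 2| <= e * (2 * K + 1) * ch x.
  have out : 0 < x -> x < A \/ B < x -> `|ap x ^+ 2 - u x ^+ 2| <= e * (2 * K + 1) * ch x.
    move=> x0 h; rewrite (ch_out x h) (uout x x0 h); have /Hout[+ _] := h; rewrite -/ap => ->.
    by rewrite subrr normr0 mulr0.
  move=> x0; have [xA|Ax] := ltP x A; first by apply: out => //; left.
  have [Bx|xB] := ltP B x; first by apply: out => //; right.
  rewrite ch_in// mulr1 subr_sqr normrM; apply: ler_pM => //; first exact: Hcl.
  by rewrite (le_trans (ler_normD _ _))//; have := apK x x0; have := uK x x0; lra.
have h1 : T <= wint (fun x => negp W x * ap x ^+ 2) + e * (2 * K + 1) * wint (fun x => ch x * negp W x).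
  rewrite -wint_scale// -wint_add//; last exact: wJ_scale.
  apply: wint_le => //; first by apply: wJ_add => //; exact: wJ_scale.
  move=> x x0; have := Hsq x x0; rewrite ler_norml => /andP[h _].
  have h' : u x ^+ 2 <= ap x ^+ 2 + e * (2 * K + 1) * ch x by lra.
  by have := ler_wpM2l (negp_ge0 W x) h'; lra.
have h2 : wint (fun x => ap x ^+ 2) <= wint (fun x => u x ^+ 2) + e * (2 * K + 1) * wint ch.
  rewrite -wint_scale// -wint_add//; last exact: wJ_scale.
  apply: wint_le => //; first by apply: wJ_add => //; exact: wJ_scale.
  by move=> x x0; have := Hsq x x0; rewrite ler_norml => /andP[_ h]; lra.
have h3 : wint (fun x => derive1 ap x ^+ 2) <= (1 + e) / stepm r * Du.
  rewrite (@wint_eq _ _ (fun x => ap' x ^+ 2)); last first.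
    by move=> x _; rewrite (der_derive1 (der_step_approx _ _ _ _ r0 x)).
  apply: (le_trans (@step_approx_energy R r A B u du N r0 m0 A0 AB N0 hu uA uB du2')).
  apply: ler_pM.
  - by pos.
  - apply: I_ge0 => x /(itv_Rp A0)/RpP x0; by rewrite mulr_ge0 ?sqr_ge0// ltW.
  - apply: ler_wpM2r; first by rewrite invr_ge0 ltW.
    by rewrite lerD2l ler_pdivrMr// [leRHS]mulrC; exact: ltW.
  - apply: I_subset => //; [exact: mRp|exact: itv_Rp|].
    by move=> x /RpP x0; rewrite mulr_ge0 ?sqr_ge0// ltW.
have h4 := Hb ap Hcc.
apply: (le_trans h1).
have h5 : a * wint (fun x => derive1 ap x ^+ 2) <= a * ((1 + e) / stepm r * Du) by rewrite ler_wpM2l.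
have h6 : M * wint (fun x => ap x ^+ 2) <= M * (wint (fun x => u x ^+ 2) + e * (2 * K + 1) * wint ch) by rewrite ler_wpM2l.
apply: (le_trans (lerD (le_trans h4 (lerD h5 h6)) (lexx _))).
by rewrite le_eqVlt; apply/orP; left; apply/eqP; ring.
Qed.

End NegativePartBound.

(** * Logarithmic cutoffs at the origin *)

Section LogCutoff.
Variable R : realType.
Local Notation Rp := (@Rp R).
Local Notation wJ := (wintegrable Rp).
Implicit Types (u du : R -> R) (x y T e s C : R) (n : nat).

Lemma der_ln x : 0 < x -> der (@ln R) x x^-1.
Proof. by move=> x0; exact: is_derive1_ln. Qed.

Lemma inv_cont x : 0 < x -> {for x, continuous (fun y : R => y^-1)}.
Proof. by move=> x0; exact: der_cont (der_inv (lt0r_neq0 x0)). Qed.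

Lemma hd_ln : hasDeriv (@ln R) (fun x => x^-1).
Proof. by apply: hd_C1 => x x0; first [exact: inv_cont|exact: der_ln]. Qed.

(** Cauchy-Schwarz for [sqrt t * du] against [1 / sqrt t], read off the discriminant of the integral
    of [t (du - s / t)^2]. In dimension two finite energy allows growth like the root of a
    logarithm, and no more. *)
Lemma growth u du x y : hasDeriv u du -> wL2 du -> 0 < x -> x <= y ->
  (u y - u x) ^+ 2 <= wint (fun x => du x ^+ 2) * (ln y - ln x).
Proof.
move=> hu du2 x0 xy; have ju := hd_L1 hu y x0; have jl := hd_L1 hd_ln y x0.
have jd : J `[x, y] (fun t => du t ^+ 2 * t) by exact: wJ_itv.
have lnxy : 0 <= ln y - ln x by rewrite subr_ge0 ler_ln// posrE (lt_le_trans x0).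
apply: (@le_trans _ _ (I `[x, y] (fun t => du t ^+ 2 * t) * (ln y - ln x))).
  apply: discr => // [|s]; first by apply: I_ge0 => t /(itv_Rp x0)/RpP t0; pos.
  rewrite -(hd_I hu x0 xy) -(hd_I hd_ln x0 xy).
  have : 0 <= I `[x, y] (fun t => t * (du t - s * t^-1) ^+ 2).
    by apply: I_ge0 => t /(itv_Rp x0)/RpP t0; pos.
  rewrite (@I_eq _ _ _ (fun t => (du t ^+ 2 * t - (2 * s) * du t) + s ^+ 2 * t^-1)).
    rewrite I_add// ?I_sub// ?I_scale//; [exact: J_scale|apply: J_sub => //|]; exact: J_scale.
  by move=> t /(itv_Rp x0)/RpP t0; field; rewrite gt_eqF.
rewrite ler_wpM2r//; apply: I_subset => //; [exact: mRp|exact: itv_Rp|].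
by move=> t /RpP t0; pos.
Qed.

(** A substitute for [- ln x] with the same behaviour at 0 but positive on the whole half-line, so
    that its logarithm is defined everywhere. *)
Definition Lg x : R := ln (1 + x^-1).

Lemma Lg_gt0 x : 0 < x -> 0 < Lg x.
Proof. by move=> x0; rewrite ln_gt0// ltrDl invr_gt0. Qed.

Lemma der_Lg x : 0 < x -> der Lg x (- (x * (1 + x))^-1).
Proof.
move=> x0; have i0 : 0 < 1 + x^-1 by pos.
apply: (der_eq (der_comp (g := fun y => 1 + y^-1) (der_ln i0) (der_add (der_cst 1 x) (der_inv (lt0r_neq0 x0))))) => //.
by field; rewrite !gt_eqF//=; lra.
Qed.

Definition lLg x : R := ln (Lg x).
Definition dlLg x : R := - (x * (1 + x) * Lg x)^-1.

Lemma hd_lLg : hasDeriv lLg dlLg.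
Proof.
apply: hd_C1 => x x0; have L0 := Lg_gt0 x0.
  apply: (der_eq (der_comp (der_ln L0) (der_Lg x0))) => //.
  by rewrite /dlLg; field; rewrite !gt_eqF//=; lra.
have d1 := der_mul (der_mul (der_id x) (der_add (der_cst 1 x) (der_id x))) (der_Lg x0).
have c1 := der_cont d1.
have n0 : x * (1 + x) * Lg x != 0 by rewrite gt_eqF//; pos.
exact: cont_opp (@continuousV R R (fun y => y * (1 + y) * Lg y) x n0 c1).
Qed.

(** The radius at which the double logarithm equals [T]. *)
Definition xT T : R := (expR (expR T) - 1)^-1.

Lemma xT_gt0 T : 0 < xT T.
Proof. by rewrite invr_gt0 subr_gt0 -expR0 ltr_expR expR_gt0. Qed.

Lemma lLg_xT T : lLg (xT T) = T.
Proof. by rewrite /lLg /Lg /xT invrK subrKC !expRK. Qed.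

Lemma xT_le T : 0 <= T -> xT T <= (1 + T)^-1.
Proof.
move=> T0; have e1 := expR_ge1Dx T; have e2 := expR_ge1Dx (expR T).
rewrite lef_pV2 ?posrE; lra.
Qed.

Lemma xT_le2 T : 0 <= T -> xT (2 * T) <= xT T.
Proof.
move=> T0; have e1 := expR_ge1Dx T; have e2 := expR_ge1Dx (expR T).
have e3 := expR_ge1Dx (2 * T); have e4 := expR_ge1Dx (expR (2 * T)).
rewrite lef_pV2 ?posrE ?lerD2r ?ler_expR; clear -T0 e1 e2 e3 e4; lra.
Qed.

(* The double logarithm makes the Dirichlet integral of [chi T * u] over the
   transition zone of order [1 / T] although [u ^+ 2] may grow like [ln (1 / x)]. *)
Definition chi T x : R :=
  if x <= xT (2 * T) then 0 else if x <= xT T then 2 - T^-1 * lLg x else 1.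
Definition dchi T x : R :=
  if x <= xT (2 * T) then 0 else if x <= xT T then - T^-1 * dlLg x else 0.

Lemma hd_chi T : 0 < T -> hasDeriv (chi T) (dchi T).
Proof.
move=> T0.
have h1 : hasDeriv (fun x => 2 - T^-1 * lLg x) (fun x => - T^-1 * dlLg x).
  by apply: (hd_eq (hd_add (hd_cst 2) (hd_scale (- T^-1) hd_lLg))) => x _; ring.
apply: (hd_glue (xT_gt0 (2 * T)) (hd_cst 0) (hd_glue (xT_gt0 T) h1 (hd_cst 1) _)).
  by rewrite lLg_xT; field; rewrite gt_eqF.
by rewrite xT_le2 ?ltW// lLg_xT; field; rewrite gt_eqF.
Qed.

Lemma chi_lo T x : x <= xT (2 * T) -> chi T x = 0.
Proof. by rewrite /chi => ->. Qed.

Lemma chi_hi T x : 0 < T -> xT T < x -> chi T x = 1 /\ dchi T x = 0.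
Proof.
move=> T0 h.
have F1 : (x <= xT (2 * T)) = false.
  by apply/negbTE; rewrite -ltNge (le_lt_trans _ h)// xT_le2// ltW.
have F2 : (x <= xT T) = false by apply/negbTE; rewrite -ltNge.
by rewrite /chi /dchi F1 F2.
Qed.

Lemma lLg_le x y : 0 < x -> x <= y -> lLg y <= lLg x.
Proof.
move=> x0 xy; have y0 := lt_le_trans x0 xy.
rewrite ler_ln ?posrE ?Lg_gt0// ler_ln ?posrE ?lerD2l ?lef_pV2 ?posrE//; pos.
Qed.

Lemma chi01 T x : 0 < T -> 0 < x -> 0 <= chi T x <= 1.
Proof.
move=> T0 x0; rewrite /chi; case: (leP x (xT (2 * T))) => h1; first by rewrite lexx ler01.
case: (leP x (xT T)) => h2; last by rewrite ler01 lexx.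
have l1 := lLg_le x0 h2; have l2 := lLg_le (xT_gt0 (2 * T)) (ltW h1).
move: l1 l2; rewrite !lLg_xT => l1 l2.
have -> : 2 - T^-1 * lLg x = (2 * T - lLg x) / T by field; rewrite gt_eqF.
by rewrite divr_ge0 ?subr_ge0//= ?(ltW T0)// ler_pdivrMr//; lra.
Qed.

Lemma dchi_meas T : 0 < T -> measurable_fun Rp (dchi T).
Proof. by move=> T0; exact: locL1_meas (hd_L1 (hd_chi T0)). Qed.

(** On [(0, 1]] the growth bound gives [u^2 <= C Lg]. In the transition zone the integrand is then
    at most [C / T^2] times [- dlLg], because [x Lg dlLg^2 <= - dlLg]; and [- dlLg] integrates to
    [T] over that zone. *)
Lemma dchi_energy u du : hasDeriv u du -> wL2 du -> exists2 C, 0 <= C & forall T, 0 < T ->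
  wJ (fun x => (dchi T x * u x) ^+ 2) /\ wint (fun x => (dchi T x * u x) ^+ 2) <= C / T.
Proof.
move=> hu du2; set D := wint (fun x => du x ^+ 2).
have D0 : 0 <= D by apply: wint_ge0 => x _; pos.
have ln20 : 0 < ln (2 : R) by rewrite ln_gt0// ltr1n.
(* From [u^2 <= 2 u(1)^2 + 2 (u(1) - u)^2]; the constant [u(1)^2] is absorbed using [Lg >= ln 2] on
   [(0, 1]]. *)
pose C := 2 * u 1 ^+ 2 / ln 2 + 2 * D.
have C0 : 0 <= C by rewrite /C; pos.
have uC x : 0 < x -> x <= 1 -> u x ^+ 2 <= C * Lg x.
  move=> x0 x1; have := growth hu du2 x0 x1; rewrite ln1 sub0r -/D => g.
  have h1 : - ln x <= Lg x.
    by rewrite -lnV// ler_ln ?posrE ?lerDr//; pos.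
  have h2 : ln 2 <= Lg x.
    rewrite ler_ln ?posrE//; last by pos.
    have : 1 <= x^-1 by rewrite invf_ge1.
    lra.
  have h3 : u x ^+ 2 <= 2 * u 1 ^+ 2 + 2 * (u 1 - u x) ^+ 2.
    by have := sqr_ge0 (2 * u 1 - u x); lra.
  have h4 : D * (- ln x) <= D * Lg x by rewrite ler_wpM2l.
  have h5 : u 1 ^+ 2 <= u 1 ^+ 2 / ln 2 * Lg x.
    by rewrite mulrAC ler_pdivlMr// ler_wpM2l// sqr_ge0.
  rewrite /C mulrDl.
  have -> : 2 * u 1 ^+ 2 / ln 2 * Lg x = 2 * (u 1 ^+ 2 / ln 2 * Lg x) by ring.
  lra.
exists C => // T T0.
have a0 := xT_gt0 (2 * T); have ab := xT_le2 (ltW T0); have b0 := xT_gt0 T.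
have b1 : xT T <= 1 by apply: le_trans (xT_le (ltW T0)) _; rewrite invf_le1; clear -T0; lra.
have out x : 0 < x -> x < xT (2 * T) \/ xT T < x -> dchi T x = 0.
  move=> x0 [h|h]; first by rewrite /dchi (ltW h).
  exact: (chi_hi T0 h).2.
have mf : measurable_fun Rp (fun x => (dchi T x * u x) ^+ 2).
  by apply/measurable_funX/measurable_funM; [exact: dchi_meas|exact: hd_meas hu].
have ldl := hd_L1 hd_lLg (xT T) a0.
have bd x : xT (2 * T) <= x -> x <= xT T -> `|(dchi T x * u x) ^+ 2 * x| <= C / T ^+ 2 * - dlLg x.
  move=> h1 h2; have x0 := lt_le_trans a0 h1; have x1 := le_trans h2 b1.
  have L0 := Lg_gt0 x0; have u2 := uC x x0 x1.
  rewrite ger0_norm; last by pos.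
  have d2 : dchi T x ^+ 2 <= (T^-1 * dlLg x) ^+ 2.
    rewrite /dchi; case: ifP => _; first by rewrite expr0n sqr_ge0.
    by rewrite h2 mulNr sqrrN.
  apply: (@le_trans _ _ ((T^-1 * dlLg x) ^+ 2 * (C * Lg x) * x)).
    by rewrite ler_wpM2r ?(ltW x0)// exprMn ler_pM// ?sqr_ge0.
  rewrite /dlLg.
  have -> : (T^-1 * - (x * (1 + x) * Lg x)^-1) ^+ 2 * (C * Lg x) * x =
     C / T ^+ 2 * (x * (1 + x) * Lg x)^-1 * (1 + x)^-1.
    by field; rewrite !gt_eqF//=; clear -x0; lra.
  rewrite opprK ler_piMr//; first by pos; lra.
  by rewrite invf_le1; clear -x0; lra.
have jw : wJ (fun x => (dchi T x * u x) ^+ 2).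
  apply: (wJ_supp a0); first by move=> x x0 h; rewrite (out x x0 h) mul0r expr0n.
  apply: (@J_le _ _ _ (fun x => C / T ^+ 2 * - dlLg x)) => //.
  - apply: measurable_funM => //; exact: (measurable_funS mRp (itv_Rp a0) mf).
  - by move=> x /=; rewrite in_itv/= => /andP[]; exact: bd.
  - by apply: J_scale => //; exact: J_opp.
split => //.
rewrite (@wint_supp _ _ _ (xT T) a0); last by move=> x x0 h; rewrite (out x x0 h) mul0r expr0n.
apply: (@le_trans _ _ (I `[xT (2 * T), xT T] (fun x => C / T ^+ 2 * - dlLg x))).
  apply: I_le => //; [exact: wJ_itv|by apply: J_scale => //; exact: J_opp|].
  move=> x /=; rewrite in_itv/= => /andP[h1 h2]; exact: le_trans (ler_norm _) (bd x h1 h2).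
rewrite I_scale//; last exact: J_opp.
rewrite I_opp// (hd_I hd_lLg a0 ab) !lLg_xT le_eqVlt; apply/orP; left; apply/eqP.
by field; rewrite gt_eqF.
Qed.

Definition cutu T u x := chi T x * u x.
Definition dcutu T u du x := dchi T x * u x + chi T x * du x.

Lemma hd_cutu T u du : 0 < T -> hasDeriv u du -> hasDeriv (cutu T u) (dcutu T u du).
Proof. by move=> T0 hu; exact: hd_mul (hd_chi T0) hu. Qed.

Lemma cutu_meas T u du : 0 < T -> hasDeriv u du -> measurable_fun Rp (cutu T u).
Proof. by move=> T0 hu; exact: hd_meas (hd_cutu T0 hu). Qed.

Lemma cutu_le T u x : 0 < T -> 0 < x -> cutu T u x ^+ 2 <= u x ^+ 2.
Proof.
move=> T0 x0; rewrite /cutu exprMn ler_piMl ?sqr_ge0// expr_le1//;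
by have /andP[] := chi01 T0 x0.
Qed.

Lemma cutu_cvg u x : 0 < x -> cutu n.+1%:R u x @[n --> \oo] --> u x.
Proof.
move=> x0; apply: cvg_near_cst.
exists (Num.bound x^-1) => //= n /= xn.
have T0 : (0 : R) < n.+1%:R by rewrite ltr0n.
rewrite /cutu (chi_hi T0 _).1 ?mul1r//.
rewrite (le_lt_trans (xT_le (ltW T0)))// invf_plt ?posrE; [|pos..].
apply: lt_le_trans (archi_boundP _) _; first by pos.
by rewrite nat1r ler_nat (leq_trans xn)// ltnW.
Qed.

(** Young's inequality with a free [s]: the factor in front of the energy of [u] can be brought
    arbitrarily close to 1, the price being paid by the vanishing term [C / T]. *)
Lemma dcutu_energy u du : hasDeriv u du -> wL2 du -> exists2 C, 0 <= C & forall T s, 0 < T -> 0 < s ->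
  wL2 (dcutu T u du) /\
  wint (fun x => dcutu T u du x ^+ 2) <= (1 + s) * wint (fun x => du x ^+ 2) + (1 + s^-1) * (C / T).
Proof.
move=> hu du2; have [C C0 HC] := dchi_energy hu du2; exists C => // T s T0 s0.
have [j1 w1] := HC T T0.
have md : measurable_fun Rp du by exact: locL1_meas (hd_L1 hu).
have bd x : 0 < x -> dcutu T u du x ^+ 2 <= (1 + s) * du x ^+ 2 + (1 + s^-1) * (dchi T x * u x) ^+ 2.
  move=> x0; rewrite /dcutu; set p := dchi T x * u x; have /andP[c0 c1] := chi01 T0 x0.
  have h : (chi T x * du x) ^+ 2 <= du x ^+ 2.
    by rewrite exprMn ler_piMl ?sqr_ge0// expr_le1.
  set q := chi T x * du x in h *.
  have : (p + q) ^+ 2 <= (1 + s) * q ^+ 2 + (1 + s^-1) * p ^+ 2.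
    have : 0 <= (s * q - p) ^+ 2 / s by pos.
    have -> : (s * q - p) ^+ 2 / s = s * q ^+ 2 - 2 * p * q + s^-1 * p ^+ 2 by field; rewrite gt_eqF.
    lra.
  have : (1 + s) * q ^+ 2 <= (1 + s) * du x ^+ 2 by rewrite ler_wpM2l//; pos.
  lra.
have jr : wJ (fun x => (1 + s) * du x ^+ 2 + (1 + s^-1) * (dchi T x * u x) ^+ 2).
  by apply: wJ_add; exact: wJ_scale.
have md2 : measurable_fun Rp (dcutu T u du) by exact: locL1_meas (hd_L1 (hd_cutu T0 hu)).
have jl : wL2 (dcutu T u du).
  apply: (wJ_le _ _ jr); first exact: measurable_funX.
  by move=> x x0; rewrite ger0_norm ?sqr_ge0// bd.
split => //; apply: (le_trans (wint_le jl jr bd)).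
rewrite wint_add; [|exact: wJ_scale..]; rewrite !wint_scale// lerD2l ler_wpM2l//; pos.
Qed.

Lemma bigT (C e : R) : 0 <= C -> 0 < e -> exists N, forall n, (N <= n)%N -> C / n.+1%:R <= e.
Proof.
move=> C0 e0; exists (Num.bound (C / e)) => n nN.
rewrite ler_pdivrMr ?ltr0n// mulrC -ler_pdivrMr// ltW//.
apply: lt_le_trans (archi_boundP _) _; first by pos.
by rewrite ler_nat (leq_trans nN).
Qed.

Lemma dcutu_energy_eps u du e : hasDeriv u du -> wL2 du -> 0 < e -> exists N, forall n, (N <= n)%N ->
  wL2 (dcutu n.+1%:R u du) /\ wint (fun x => dcutu n.+1%:R u du x ^+ 2) <= wint (fun x => du x ^+ 2) + e.
Proof.
move=> hu du2 e0; have [C C0 HC] := dcutu_energy hu du2.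
set D := wint (fun x => du x ^+ 2) in HC *.
have D0 : 0 <= D by apply: wint_ge0 => x _; pos.
pose s := e / (2 * (D + 1)); have s0 : 0 < s by rewrite /s; pos; lra.
have e2 : 0 < e / 2 by pos.
have c0 : 0 <= (1 + s^-1) * C by pos.
have [N HN] := bigT c0 e2; exists N => n /HN hn.
have T0 : (0 : R) < n.+1%:R by rewrite ltr0n.
have [j w] := HC n.+1%:R s T0 s0; split => //; apply: (le_trans w).
have sD : s * D <= e / 2.
  rewrite /s mulrAC ler_pdivrMr; last by pos; lra.
  by nra.
have -> : (1 + s^-1) * (C / n.+1%:R) = (1 + s^-1) * C / n.+1%:R by rewrite mulrA.
by rewrite mulrDl mul1r -addrA lerD2l (splitr e) lerD.
Qed.

End LogCutoff.

(** * The ground state representation *)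

(* [c] is a radius beyond which [W] is exactly [mu^2/r^2] and [V] vanishes.  The constant [a] is
   slightly larger than in assumption (b): the price for passing from smooth to absolutely
   continuous functions in [md_neg]. *)
Record model (R : realType) (W psi0 dpsi0 : R -> R) (c mu a M : R) : Prop := Model {
  md_c : 0 < c;
  md_mu : 0 <= mu;
  md_W : locL1 W;
  md_Wc : forall r, c <= r -> W r = mu ^+ 2 / r ^+ 2;
  md_a0 : 0 <= a;
  md_a1 : a < 1;
  md_M : 0 <= M;
  md_neg : forall (u du : R -> R) (A B : R), 0 < A -> A < B -> hasDeriv u du ->
    (forall x, 0 < x -> x <= A -> u x = 0) -> (forall x, B <= x -> u x = 0) -> wL2 du ->
    wint (fun x => negp W x * u x ^+ 2)
      <= a * wint (fun x => du x ^+ 2) + M * wint (fun x => u x ^+ 2);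
  md_loc : in_domloc W psi0 dpsi0;
  md_weak : forall phi dphi b, in_domt W phi dphi -> (forall x, b <= x -> phi x = 0) ->
    tform W phi dphi psi0 dpsi0 = 0;
  md_pos : forall r, 0 < r -> 0 < psi0 r;
  md_psi0 : forall r, c <= r -> psi0 r = r `^ (- mu) }.

Section FormDomain.
Variable R : realType.
Local Notation Rp := (@Rp R).
Local Notation wJ := (wintegrable Rp).
Variables (W psi0 dpsi0 : R -> R) (c mu a M : R).
Hypothesis H : model W psi0 dpsi0 c mu a M.
Implicit Types (u du w dw f g : R -> R) (x y A B b e K T : R).
Local Notation tf := (tform W).

(** The logarithmic derivative of [psi0]; thus [du - u * lgd] is [psi0] times the derivative of
    [u / psi0]. *)
Definition lgd x := dpsi0 x / psi0 x.

Let hp : hasDeriv psi0 dpsi0.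
Proof. exact: (md_loc H).1. Qed.
Let p0 x : 0 < x -> 0 < psi0 x.
Proof. exact: @md_pos _ _ _ _ _ _ _ _ H x. Qed.
Let mdp : measurable_fun Rp dpsi0.
Proof. exact: locL1_meas (hd_L1 hp). Qed.
Let mp : measurable_fun Rp psi0.
Proof. exact: hd_meas hp. Qed.
Let mW : measurable_fun Rp W.
Proof. exact: locL1_meas (md_W H). Qed.
Let mneg : measurable_fun Rp (negp W).
Proof. exact: negp_meas (md_W H). Qed.
Let mpos : measurable_fun Rp (posp W).
Proof. exact: posp_meas (md_W H). Qed.

Lemma locL1_1 : locL1 (fun=> 1 : R).
Proof. by move=> a' b _; exact: J_cst. Qed.

Lemma wJ_cpt g f A B L : 0 < A -> locL1 g -> measurable_fun Rp f ->
  (forall x, 0 < x -> (x < A \/ B < x) -> f x = 0) -> (forall x, 0 < x -> `|f x| <= L) ->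
  wJ (fun x => g x * f x).
Proof.
move=> A0 lg mf f0 fL; apply: (@locL1_wJ _ _ A B) => //; last first.
  by move=> x x0 h; rewrite f0// mulr0.
apply: (@locL1_eq R (fun x => f x * g x)); first by move=> x _; rewrite mulrC.
apply: locL1_bnd => // p q pp; exists L => x px _; apply: fL; exact: lt_le_trans px.
Qed.

Lemma domt_hd u du : in_domt W u du -> hasDeriv u du. Proof. by case. Qed.
Lemma domt_L2 u du : in_domt W u du -> wL2 u. Proof. by case=> _ []. Qed.
Lemma domt_dL2 u du : in_domt W u du -> wL2 du. Proof. by case=> _ [_ []]. Qed.
Lemma domt_posJ u du : in_domt W u du -> wJ (fun x => posp W x * u x ^+ 2).
Proof. by case=> _ [_ []]. Qed.
Lemma domt_meas u du : in_domt W u du -> measurable_fun Rp u.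
Proof. by move=> /domt_hd; exact: hd_meas. Qed.
Lemma domt_dmeas u du : in_domt W u du -> measurable_fun Rp du.
Proof. by move=> /domt_hd/hd_L1; exact: locL1_meas. Qed.

Lemma cpt_bnd u du A B : 0 < A -> hasDeriv u du ->
  (forall x, 0 < x -> (x < A \/ B < x) -> u x = 0) -> exists2 K, 0 < K & forall x, 0 < x -> `|u x| <= K.
Proof.
move=> A0 hu u0; have [K K0 HK] := hd_bnd B hu A0; exists K => // x x0.
have [xA|Ax] := ltP x A; first by rewrite u0 ?normr0 ?(ltW K0)//; left.
have [Bx|xB] := ltP B x; first by rewrite u0 ?normr0 ?(ltW K0)//; right.
exact: HK.
Qed.

Lemma cpt_sqJ u du A B g : 0 < A -> hasDeriv u du -> locL1 g ->
  (forall x, 0 < x -> (x < A \/ B < x) -> u x = 0) -> wJ (fun x => g x * u x ^+ 2).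
Proof.
move=> A0 hu lg u0; have [K K0 HK] := cpt_bnd A0 hu u0.
apply: (@wJ_cpt _ _ A B (K ^+ 2)) => //.
- by apply: measurable_funX; exact: hd_meas hu.
- by move=> x x0 h; rewrite u0// expr0n.
- by move=> x x0; rewrite normrX; have := HK x x0; have := normr_ge0 (u x); nra.
Qed.

Lemma cpt_domt u du A B : 0 < A -> hasDeriv u du -> wL2 du ->
  (forall x, 0 < x -> (x < A \/ B < x) -> u x = 0) -> in_domt W u du.
Proof.
move=> A0 hu du2 u0; split => //; split; last split => //.
  by apply: (wJ_eq _ (cpt_sqJ A0 hu locL1_1 u0)) => x _; rewrite mul1r.
exact: (@cpt_sqJ u du A B (posp W) A0 hu (posp_locL1 (md_W H)) u0).
Qed.

Lemma cutu_out T u b x : 0 < T -> (forall x, b <= x -> u x = 0) -> 0 < x ->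
  (x < xT (2 * T) \/ b < x) -> cutu T u x = 0.
Proof.
move=> T0 ub x0 [h|h]; first by rewrite /cutu chi_lo ?mul0r// ltW.
by rewrite /cutu ub ?mulr0// ltW.
Qed.

Lemma wint_cutu_le T u du g : 0 < T -> hasDeriv u du -> (forall x, 0 < x -> 0 <= g x) ->
  measurable_fun Rp g -> wJ (fun x => g x * u x ^+ 2) ->
  wJ (fun x => g x * cutu T u x ^+ 2) /\
  wint (fun x => g x * cutu T u x ^+ 2) <= wint (fun x => g x * u x ^+ 2).
Proof.
move=> T0 hu g0 mg j.
have le x : 0 < x -> g x * cutu T u x ^+ 2 <= g x * u x ^+ 2.
  by move=> x0; rewrite ler_wpM2l ?g0// cutu_le.
have j' : wJ (fun x => g x * cutu T u x ^+ 2).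
  apply: (wJ_le _ _ j).
    by apply: measurable_funM => //; apply: measurable_funX; exact: cutu_meas T0 hu.
  move=> x x0; rewrite ger0_norm ?le//; by rewrite mulr_ge0 ?g0// sqr_ge0.
by split => //; exact: wint_le.
Qed.

Lemma cutu_bound u du b e : hasDeriv u du -> wL2 u -> wL2 du -> (forall x, b <= x -> u x = 0) ->
  0 < e -> exists N, forall n, (N <= n)%N ->
  wJ (fun x => negp W x * cutu n.+1%:R u x ^+ 2) /\
  wint (fun x => negp W x * cutu n.+1%:R u x ^+ 2)
    <= a * wint (fun x => du x ^+ 2) + M * wint (fun x => u x ^+ 2) + e.
Proof.
move=> hu u2 du2 ub e0; have [N HN] := dcutu_energy_eps hu du2 e0.
exists N => n /HN[j2 hj]; have T0 : (0 : R) < n.+1%:R by rewrite ltr0n.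
have hc := hd_cutu T0 hu; have A0 := xT_gt0 (2 * (n.+1%:R : R)).
have out := cutu_out T0 ub.
split; first by apply: (cpt_sqJ A0 hc _ out); exact: negp_locL1 (md_W H).
pose B := Num.max b (xT (2 * n.+1%:R) + 1).
have AB : xT (2 * n.+1%:R) < B by rewrite lt_max ltrDl ltr01 orbT.
have := md_neg H A0 AB hc _ _ j2.
move=> /(_ _ _)/le_trans; apply.
- by move=> x x0 h; rewrite /cutu chi_lo ?mul0r.
- by move=> x; rewrite ge_max => /andP[h _]; rewrite /cutu ub ?mulr0.
have h1 : wint (fun x => cutu n.+1%:R u x ^+ 2) <= wint (fun x => u x ^+ 2).
  have u2' : wJ (fun x => 1 * u x ^+ 2) by apply: (wJ_eq _ u2) => x _; rewrite mul1r.
  have [_] := wint_cutu_le T0 hu (fun _ _ => ler01) (@measurable_cst _ _ _ _ _ _) u2'.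
  have E f : wint (fun x => 1 * f x ^+ 2) = wint (fun x => f x ^+ 2) by apply: wint_eq => x _; rewrite mul1r.
  by rewrite !E.
have a0 := md_a0 H; have a1 := md_a1 H.
have h2 : a * wint (fun x => dcutu n.+1%:R u du x ^+ 2) <= a * (wint (fun x => du x ^+ 2) + e) by rewrite ler_wpM2l.
have h3 : M * wint (fun x => cutu n.+1%:R u x ^+ 2) <= M * wint (fun x => u x ^+ 2) by rewrite ler_wpM2l// (md_M H).
have h4 : a * e <= e by rewrite ler_piMl// ltW.
lra.
Qed.

Lemma sq_cvg (f_ : nat -> R) (l : R) : f_ n @[n --> \oo] --> l -> f_ n ^+ 2 @[n --> \oo] --> l ^+ 2.
Proof. by move=> h; rewrite expr2; under eq_fun do rewrite expr2; exact: cvgM. Qed.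

(** Fatou along the logarithmic cutoffs: [u] need no longer vanish near the origin, and
    integrability of the left side is part of the result. *)
Lemma negp_dom u du b : hasDeriv u du -> wL2 u -> wL2 du -> (forall x, b <= x -> u x = 0) ->
  wJ (fun x => negp W x * u x ^+ 2) /\
  wint (fun x => negp W x * u x ^+ 2) <= a * wint (fun x => du x ^+ 2) + M * wint (fun x => u x ^+ 2).
Proof.
move=> hu u2 du2 ub.
have main e : 0 < e -> wJ (fun x => negp W x * u x ^+ 2) /\
  wint (fun x => negp W x * u x ^+ 2) <= a * wint (fun x => du x ^+ 2) + M * wint (fun x => u x ^+ 2) + e.
  move=> e0; have [N HN] := cutu_bound hu u2 du2 ub e0.
  apply: (@wint_fatou R (fun n x => negp W x * cutu (n + N).+1%:R u x ^+ 2)).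
  - by move=> n x x0; rewrite mulr_ge0 ?negp_ge0 ?sqr_ge0.
  - by move=> n; exact: (HN (n + N)%N (leq_addl _ _)).1.
  - move=> x x0; apply: cvgM; first exact: cvg_cst.
    apply: sq_cvg; have := @cutu_cvg R u x x0; rewrite -(cvg_shiftn N); exact.
  - by move=> n; exact: (HN (n + N)%N (leq_addl _ _)).2.
split; first exact: (main 1 ltr01).1.
by apply/ler_addgt0Pr => e /main[].
Qed.

Definition theta x : R := if x <= c then 1 else if x <= c + 1 then c + 1 - x else 0.
Definition dtheta x : R := if x <= c then 0 else if x <= c + 1 then -1 else 0.

Let c0 : 0 < c.
Proof. exact: md_c H. Qed.

Lemma hd_theta : hasDeriv theta dtheta.
Proof.
have h1 : hasDeriv (fun x : R => c + 1 - x) (fun=> -1).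
  apply: hd_C1 => x _; last exact: cvg_cst.
  by apply: (der_eq (der_add (der_cst (c + 1) x) (der_scale (-1) (der_id x)))) => [y|]; ring.
have c1 : 0 < c + 1 by rewrite addr_gt0.
apply: (hd_glue c0 (hd_cst 1) (hd_glue c1 h1 (hd_cst 0) _)); first by rewrite subrr.
by rewrite lerDl ler01; ring.
Qed.

Lemma theta_in x : x <= c -> theta x = 1 /\ dtheta x = 0.
Proof. by rewrite /theta /dtheta => ->. Qed.

Lemma theta_out x : c + 1 <= x -> theta x = 0.
Proof.
move=> h; rewrite /theta ifF; last by apply/negbTE; rewrite -ltNge; lra.
by case: ifP => // h'; lra.
Qed.

Lemma theta01 x : 0 <= theta x <= 1.
Proof.
rewrite /theta; case: ifP => [_|/negbT]; first by rewrite ler01 lexx.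
rewrite -ltNge => h; case: ifP => h'; last by rewrite lexx ler01.
by apply/andP; split; lra.
Qed.

Lemma dtheta_le1 x : `|dtheta x| <= 1.
Proof. by rewrite /dtheta; case: ifP => _; [|case: ifP => _]; rewrite ?normr0 ?normrN ?normr1. Qed.

Lemma theta_domt u du : in_domt W u du ->
  in_domt W (fun x => theta x * u x) (fun x => dtheta x * u x + theta x * du x).
Proof.
move=> hu; have hd := hd_mul hd_theta (domt_hd hu).
have mt := hd_meas hd_theta; have mdt : measurable_fun Rp dtheta := locL1_meas (hd_L1 hd_theta).
have mfu := domt_meas hu; have mdu := domt_dmeas hu.
have t2 x : theta x ^+ 2 <= 1 by have /andP[? ?] := theta01 x; rewrite expr_le1.
have dt2 x : dtheta x ^+ 2 <= 1 by rewrite -real_normK ?num_real// expr_le1// dtheta_le1.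
have le (g : R) x : 0 <= g -> `|g * (theta x * u x) ^+ 2| <= g * u x ^+ 2.
  move=> g0; rewrite ger0_norm; last by pos.
  by rewrite ler_wpM2l// exprMn ler_piMl// sqr_ge0.
split => //; split; last split.
- apply: (wJ_le _ _ (domt_L2 hu)); first by apply/measurable_funX/measurable_funM.
  by move=> x x0; have := le 1 x ler01; rewrite !mul1r.
- apply: (wJ_le _ _ (wJ_add (wJ_scale 2 (domt_L2 hu)) (wJ_scale 2 (domt_dL2 hu)))).
    by apply/measurable_funX/measurable_funD; exact: measurable_funM.
  move=> x x0; rewrite ger0_norm ?sqr_ge0//.
  have h1 : (dtheta x * u x) ^+ 2 <= u x ^+ 2 by rewrite exprMn ler_piMl// sqr_ge0.
  have h2 : (theta x * du x) ^+ 2 <= du x ^+ 2 by rewrite exprMn ler_piMl// sqr_ge0.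
  have := sqr_ge0 (dtheta x * u x - theta x * du x); lra.
- apply: (wJ_le _ _ (domt_posJ hu)); last by move=> x x0; apply: le; exact: posp_ge0.
  by apply: measurable_funM => //; apply/measurable_funX/measurable_funM.
Qed.

Lemma W_ge0_out x : c <= x -> 0 <= W x.
Proof. by move=> cx; rewrite (md_Wc H)// divr_ge0// sqr_ge0. Qed.

Lemma negp_out x : c <= x -> negp W x = 0.
Proof. by move=> /W_ge0_out h; apply/max_idPr; lra. Qed.

(** Beyond [c] the negative part of [W] is zero, so multiplying by [theta] reduces the claim to
    functions vanishing for large [x]. *)
Lemma domt_negJ u du : in_domt W u du -> wJ (fun x => negp W x * u x ^+ 2).
Proof.
move=> hu; have ht := theta_domt hu.
have [|j _] := negp_dom (b := c + 1) (domt_hd ht) (domt_L2 ht) (domt_dL2 ht).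
  by move=> x /theta_out ->; rewrite mul0r.
apply: (wJ_eq _ j) => x x0; have [xc|cx] := leP x c; first by rewrite (theta_in xc).1 mul1r.
by rewrite negp_out ?mul0r// ltW.
Qed.

Lemma domt_WJ u du w dw : in_domt W u du -> in_domt W w dw -> wJ (fun x => W x * u x * w x).
Proof.
move=> hu hw.
have j : wJ (fun x => (posp W x * u x ^+ 2 + posp W x * w x ^+ 2) +
    (negp W x * u x ^+ 2 + negp W x * w x ^+ 2)).
  apply: wJ_add; apply: wJ_add;
  by [exact: domt_posJ hu|exact: domt_posJ hw|exact: domt_negJ hu|exact: domt_negJ hw].
apply: (wJ_le _ _ j).
  by apply: measurable_funM; [apply: measurable_funM => //; exact: domt_meas hu|exact: domt_meas hw].
move=> x x0; rewrite !normrM.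
have -> : posp W x * u x ^+ 2 + posp W x * w x ^+ 2 + (negp W x * u x ^+ 2 + negp W x * w x ^+ 2)
   = (posp W x + negp W x) * (u x ^+ 2 + w x ^+ 2) by ring.
rewrite -mulrA; apply: ler_pM => //.
  rewrite {1}(posp_negp W x) (le_trans (ler_normB _ _))// !ger0_norm ?posp_ge0 ?negp_ge0//.
have := sqr_ge0 (`|u x| - `|w x|); have := normr_ge0 (u x); have := normr_ge0 (w x).
rewrite -[u x ^+ 2]real_normK ?num_real// -[w x ^+ 2]real_normK ?num_real//; nra.
Qed.

Lemma domt_uwJ u du w dw : in_domt W u du -> in_domt W w dw -> wJ (fun x => u x * w x).
Proof.
move=> hu hw; apply: wJ_mul2; [exact: domt_meas hu|exact: domt_meas hw|exact: domt_L2 hu|exact: domt_L2 hw].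
Qed.

Lemma domt_duwJ u du w dw : in_domt W u du -> in_domt W w dw -> wJ (fun x => du x * dw x).
Proof.
move=> hu hw; apply: wJ_mul2; [exact: domt_dmeas hu|exact: domt_dmeas hw|exact: domt_dL2 hu|exact: domt_dL2 hw].
Qed.

Lemma domt_tJ u du w dw : in_domt W u du -> in_domt W w dw ->
  wJ (fun x => du x * dw x + W x * u x * w x).
Proof. by move=> hu hw; apply: wJ_add; [exact: (domt_duwJ hu hw)|exact: (domt_WJ hu hw)]. Qed.

Lemma tform_diag u du : in_domt W u du -> tf u du u du =
  wint (fun x => du x ^+ 2) + wint (fun x => posp W x * u x ^+ 2) - wint (fun x => negp W x * u x ^+ 2).
Proof.
move=> hu; have j1 := domt_dL2 hu; have j2 := domt_posJ hu; have j3 := domt_negJ hu.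
rewrite -wint_add// -wint_sub//; last exact: wJ_add.
by apply: wint_eq => x _; rewrite (posp_negp W x); ring.
Qed.

Lemma dpsi0_sqJ B : 0 < B -> wJ (fun x => dpsi0 x ^+ 2 * \1_(`]0, B]%classic : set R) x).
Proof.
move=> B0; have [_ j _] := (md_loc H).2 B B0.
have sub : `]0, B]%classic `<=` Rp by move=> x; rewrite /= in_itv/= => /andP[h _]; apply/RpP.
have := (J_indic_sub (fun x => dpsi0 x ^+ 2 * x) mRp (measurable_itv `]0, B]) sub).1 j.
by apply: J_eq; [exact: mRp|move=> x _; rewrite mulrAC].
Qed.

(** Test the weak equation of [psi0] with [u^2 / psi0]: pointwise, the integrand is that of the form
    of [u] minus [(du - u * lgd)^2]. Vanishing near 0 and near infinity makes the test function
    admissible, since [psi0] is bounded below on [[A, B]]. *)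
Lemma ground_state_identity u du A B : 0 < A -> A < B -> hasDeriv u du -> wL2 du ->
  (forall x, 0 < x -> (x < A \/ B < x) -> u x = 0) ->
  wJ (fun x => (du x - u x * lgd x) ^+ 2) /\
  tf u du u du = wint (fun x => (du x - u x * lgd x) ^+ 2).
Proof.
move=> A0 AB hu du2 u0; have B0 := lt_trans A0 AB.
have [K K0 HK] := cpt_bnd A0 hu u0.
have [m m0 Hm] := hd_pos_lb hp A0 (ltW AB) p0.
have mdu : measurable_fun Rp du := locL1_meas (hd_L1 hu).
have mfu := hd_meas hu.
have hi := hd_inv hp p0; have mi := hd_meas hi.
have hphi := hd_mul (hd_mul hu hu) hi.
set phi := (fun x => u x * u x * (psi0 x)^-1) in hphi.
set dphi := (fun x => _ + _) in hphi.
have phi0 x : 0 < x -> (x < A \/ B < x) -> phi x = 0 by move=> x0 h; rewrite /phi u0// !mul0r.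
have uq2 x : 0 < x -> (u x * lgd x) ^+ 2 <= (K / m) ^+ 2 * (dpsi0 x ^+ 2 * \1_(`]0, B]%classic : set R) x).
  move=> x0; have i0 : (0 : R) <= \1_(`]0, B]%classic : set R) x by rewrite indicE.
  have [xA|Ax] := ltP x A.
    by rewrite (u0 x x0 (or_introl xA)) mul0r expr0n /=; apply: mulr_ge0; [exact: sqr_ge0|apply: mulr_ge0; [exact: sqr_ge0|exact: i0]].
  have [Bx|xB] := ltP B x.
    by rewrite (u0 x x0 (or_intror Bx)) mul0r expr0n /=; apply: mulr_ge0; [exact: sqr_ge0|apply: mulr_ge0; [exact: sqr_ge0|exact: i0]].
  rewrite indicE mem_set/= ?in_itv/= ?x0 ?xB// mulr1 /lgd.
  have -> : (u x * (dpsi0 x / psi0 x)) ^+ 2 = (u x / psi0 x) ^+ 2 * dpsi0 x ^+ 2 by ring.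
  rewrite ler_wpM2r ?sqr_ge0// -[leLHS]real_normK ?num_real// ler_sqr ?nnegrE//; last by pos.
  have px := p0 x0; rewrite normrM normfV (gtr0_norm px) ler_pM// ?invr_ge0 ?(ltW px)// ?HK//.
  by rewrite lef_pV2 ?posrE// Hm.
have mq : measurable_fun Rp lgd.
  exact: measurable_funM.
have juq : wL2 (fun x => u x * lgd x).
  apply: (wJ_le _ _ (wJ_scale ((K / m) ^+ 2) (dpsi0_sqJ B0))).
    by apply/measurable_funX/measurable_funM.
  by move=> x x0; rewrite ger0_norm ?sqr_ge0// uq2.
have jd : wJ (fun x => (du x - u x * lgd x) ^+ 2).
  apply: (wJ_le _ _ (wJ_add (wJ_scale 2 du2) (wJ_scale 2 juq))).
    by apply/measurable_funX/measurable_funB => //; exact: measurable_funM.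
  move=> x x0; rewrite ger0_norm ?sqr_ge0//; have := sqr_ge0 (du x + u x * lgd x); lra.
have hdom : in_domt W u du by exact: (cpt_domt A0 hu du2 u0).
have jt := domt_tJ hdom hdom.
have Kin x : 0 < x -> `|u x / psi0 x| <= K / m.
  move=> x0; have [xA|Ax] := ltP x A; first by rewrite (u0 x x0 (or_introl xA)) mul0r normr0; pos.
  have [Bx|xB] := ltP B x; first by rewrite (u0 x x0 (or_intror Bx)) mul0r normr0; pos.
  have px := p0 x0; rewrite normrM normfV (gtr0_norm px) ler_pM// ?invr_ge0 ?(ltW px)// ?HK//.
  by rewrite lef_pV2 ?posrE// Hm.
have dphiE x : 0 < x -> dphi x = 2 * (u x / psi0 x) * du x - (u x / psi0 x) * (u x * lgd x).
  by move=> x0; rewrite /dphi /lgd; field; rewrite gt_eqF// p0.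
have dphi2 : wL2 dphi.
  apply: (wJ_le _ _ (wJ_add (wJ_scale (8 * (K / m) ^+ 2) du2) (wJ_scale (2 * (K / m) ^+ 2) juq))).
    by apply: measurable_funX; exact: locL1_meas (hd_L1 hphi).
  move=> x x0; rewrite ger0_norm ?sqr_ge0// dphiE//.
  set s := u x / psi0 x; set q := u x * lgd x.
  have s2 : s ^+ 2 <= (K / m) ^+ 2.
    by rewrite -[leLHS]real_normK ?num_real// ler_sqr ?nnegrE//; [exact: Kin|pos].
  have h1 := ler_wpM2r (sqr_ge0 (du x)) s2; have h2 := ler_wpM2r (sqr_ge0 q) s2.
  have := sqr_ge0 (2 * s * du x + s * q); lra.
have hdomphi : in_domt W phi dphi by exact: (cpt_domt A0 hphi dphi2 phi0).
have wk := md_weak H hdomphi (b := B + 1).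
have {}wk : tf phi dphi psi0 dpsi0 = 0.
  by apply: wk => x Bx; apply: phi0; [|right]; lra.
have E x : 0 < x -> dphi x * dpsi0 x + W x * phi x * psi0 x =
    (du x * du x + W x * u x * u x) - (du x - u x * lgd x) ^+ 2.
  by move=> x0; rewrite dphiE// /phi /lgd; field; rewrite gt_eqF// p0.
split => //; apply/eqP; rewrite -subr_eq0 -wint_sub//; apply/eqP.
by rewrite -[RHS]wk; apply/esym/wint_eq.
Qed.

(** Apply the identity to cutoffs of [u], which coincide with [u] on [[A, B]] once the cutoff radius
    is below [A]. The cutoff raises the energy by at most [e], does not raise the part with
    [posp W], and changes the part with [negp W] by at most [e], by dominated convergence. *)
Lemma ground_state_bound u du b A B : in_domt W u du -> (forall x, b <= x -> u x = 0) -> 0 < A ->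
  J `[A, B] (fun x => (du x - u x * lgd x) ^+ 2 * x) /\
  I `[A, B] (fun x => (du x - u x * lgd x) ^+ 2 * x) <= tf u du u du.
Proof.
move=> hu ub A0; have hd := domt_hd hu; have u2 := domt_L2 hu; have du2 := domt_dL2 hu.
have jneg := domt_negJ hu; have jpos := domt_posJ hu.
have cvn : wint (fun x => negp W x * cutu n.+1%:R u x ^+ 2) @[n --> \oo] -->
    wint (fun x => negp W x * u x ^+ 2).
  refine (proj2 (@wint_dct R (fun n x => negp W x * cutu n.+1%:R u x ^+ 2)
   (fun x => negp W x * u x ^+ 2) (fun x => negp W x * u x ^+ 2) _ _ jneg _)).
  - move=> n; apply: measurable_funM => //; apply: measurable_funX; apply: cutu_meas hd.
    by rewrite ltr0n.
  - by move=> x x0; apply: cvgM; [exact: cvg_cst|apply: sq_cvg; exact: cutu_cvg].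
  - move=> n x x0; rewrite ger0_norm; last by rewrite mulr_ge0 ?negp_ge0// sqr_ge0.
    apply: ler_wpM2l; first exact: negp_ge0.
    by apply: cutu_le => //; rewrite ltr0n.
have main e : 0 < e -> J `[A, B] (fun x => (du x - u x * lgd x) ^+ 2 * x) /\
    I `[A, B] (fun x => (du x - u x * lgd x) ^+ 2 * x) <= tf u du u du + e + e.
  move=> e0; have [N1 HN1] := dcutu_energy_eps hd du2 e0.
  have [N2 HN2] := bigT ler01 A0.
  move/cvgrPdist_le : cvn => /(_ e e0)[N3 _ HN3].
  pose n := (N1 + N2 + N3)%N.
  have [j2 h2] : _ := HN1 n (leq_trans (leq_addr N2 N1) (leq_addr N3 _)).
  have n2 := HN2 n (leq_trans (leq_addl N1 N2) (leq_addr N3 _)).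
  have n3 := HN3 n (leq_addl _ _).
  have T0 : (0 : R) < n.+1%:R by rewrite ltr0n.
  have hc := hd_cutu T0 hd; have A10 := xT_gt0 (2 * (n.+1%:R : R)).
  have out x := @cutu_out _ _ b x T0 ub.
  pose B' := Num.max b (xT (2 * n.+1%:R) + 1).
  have AB' : xT (2 * n.+1%:R) < B' by rewrite lt_max ltrDl ltr01 orbT.
  have out' x : 0 < x -> x < xT (2 * n.+1%:R) \/ B' < x -> cutu n.+1%:R u x = 0.
    move=> x0 [h|h]; apply: out => //; [by left|right].
    by move: h; rewrite gt_max => /andP[].
  have [jg Eg] := ground_state_identity A10 AB' hc j2 out'.
  have domc : in_domt W (cutu n.+1%:R u) (dcutu n.+1%:R u du) by exact: (cpt_domt A10 hc j2 out').
  have Exq x : A <= x -> (du x - u x * lgd x) ^+ 2 * x =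
      (dcutu n.+1%:R u du x - cutu n.+1%:R u x * lgd x) ^+ 2 * x.
    move=> Ax; have [-> ->] : dcutu n.+1%:R u du x = du x /\ cutu n.+1%:R u x = u x; last by [].
    have h : xT n.+1%:R < x.
      apply: le_lt_trans (xT_le (ltW T0)) _; apply: lt_le_trans Ax.
      apply: lt_le_trans n2; rewrite div1r ltf_pV2 ?posrE//; first [lra|pos].
    by have [c1 c2] := chi_hi T0 h; rewrite /dcutu /cutu c1 c2; split; ring.
  have jAB : J `[A, B] (fun x => (dcutu n.+1%:R u du x - cutu n.+1%:R u x * lgd x) ^+ 2 * x).
    exact: wJ_itv.
  have E x : `[A, B]%classic x -> (dcutu n.+1%:R u du x - cutu n.+1%:R u x * lgd x) ^+ 2 * x =
     (du x - u x * lgd x) ^+ 2 * x.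
    by rewrite /= in_itv/= => /andP[Ax _]; rewrite Exq.
  split; first exact: (J_eq (measurable_itv _) E jAB).
  rewrite -(I_eq E); apply: (@le_trans _ _ (tf (cutu n.+1%:R u) (dcutu n.+1%:R u du) (cutu n.+1%:R u) (dcutu n.+1%:R u du))).
    rewrite Eg; apply: I_subset => //; [exact: mRp|exact: itv_Rp|].
    by move=> x /RpP x0; pos.
  rewrite (tform_diag domc) (tform_diag hu).
  have [_ h4] := wint_cutu_le T0 hd (fun x _ => posp_ge0 W x) mpos jpos.
  move: n3; rewrite ler_norml => /andP[_ n3].
  lra.
split; first exact: (main 1 ltr01).1.
apply/ler_addgt0Pr => e e0; have e2 : 0 < e / 2 by pos.
by have [_] := main _ e2; lra.
Qed.

Local Ltac flra := clear -H hp p0 mdp mp mW mneg mpos c0; intros; lra.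

(** The mass is split at a small [e]. On [[e, c]], [psi0] is bounded below, and [u / psi0] vanishes
    at [c], so the ground state bound controls it. Near 0, where no lower bound on [psi0] is known,
    the growth estimate gives a mass of at most [c * e] times the Dirichlet integral; this is in
    turn controlled by the form plus [M] times the mass, and [e] is small enough to absorb the
    circularity. *)
Lemma poincare : exists2 K, 0 < K & forall u du, in_domt W u du -> (forall x, c <= x -> u x = 0) ->
  wint (fun x => u x ^+ 2) <= K * tf u du u du.
Proof.
have a0 := md_a0 H; have a1 := md_a1 H; have M0 := md_M H.
(* Chosen so that [c * e * (M + 1) <= (1 - a) / 2]. *)
pose e := Num.min c ((1 - a) / (2 * c * (M + 1))).
have M1 : 0 < M + 1 by lra.
have a10 : 0 < 1 - a by lra.
have e0 : 0 < e by rewrite lt_min c0/=; pos.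
have ec : e <= c by rewrite ge_min lexx.
have e1 : c * e * (M + 1) <= (1 - a) / 2.
  have : e <= (1 - a) / (2 * c * (M + 1)) by rewrite ge_min lexx orbT.
  rewrite ler_pdivlMr; last by pos.
  lra.
have [m m0 Hm] := hd_pos_lb hp e0 ec p0.
have [Kp Kp0 HKp] := hd_bnd c hp e0.
pose K1 := Kp ^+ 2 * (c / (m ^+ 2 * e)) * (c * c).
have K10 : 0 <= K1 by rewrite /K1; pos.
exists (1 + 2 * (K1 + 1)); first by lra.
move=> u du hu uc; have hd := domt_hd hu; have du2 := domt_dL2 hu; have u2 := domt_L2 hu.
set T := tf u du u du; set D := wint (fun x => du x ^+ 2); set S := wint (fun x => u x ^+ 2).
have [jg hg] := ground_state_bound c hu uc e0.
rewrite -/T in hg.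
have T0 : 0 <= T.
  by apply: le_trans hg; apply: I_ge0 => x /(itv_Rp e0)/RpP x0; pos.
have D0 : 0 <= D by apply: wint_ge0 => x _; pos.
have S0 : 0 <= S by apply: wint_ge0 => x _; pos.
have hDT : (1 - a) * D <= T + M * S.
  have [_ hn] := negp_dom hd u2 du2 uc.
  have hp0 : 0 <= wint (fun x => posp W x * u x ^+ 2) by apply: wint_ge0 => x _; rewrite mulr_ge0 ?posp_ge0// sqr_ge0.
  by rewrite /T tform_diag// -/D -/S in hn *; lra.
have near0 x : 0 < x -> x <= c -> u x ^+ 2 * x <= D * c.
  move=> x0 xc; have := growth hd du2 x0 xc; rewrite (uc c)// sub0r sqrrN -/D => h.
  have h2 : ln c - ln x <= c / x.
    rewrite -ln_div ?posrE//; have cx : 0 < c / x by pos.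
    exact: ltW (ln_sublinear cx).
  apply: (@le_trans _ _ (D * (c / x) * x)).
    by rewrite ler_wpM2r ?(ltW x0)// (le_trans h)// ler_wpM2l.
  by rewrite -mulrA divfK ?gt_eqF.
pose f x := u x * (psi0 x)^-1.
have hf := hd_mul hd (hd_inv hp p0).
set df := (fun x => _ + _) in hf.
have dfE x : 0 < x -> df x = (du x - u x * lgd x) / psi0 x.
  by move=> x0; rewrite /df /lgd; field; rewrite gt_eqF// p0.
have mdf : measurable_fun Rp df := locL1_meas (hd_L1 hf).
have df2 x : e <= x -> x <= c -> df x ^+ 2 <= (m ^+ 2 * e)^-1 * ((du x - u x * lgd x) ^+ 2 * x).
  move=> ex xc; have x0 := lt_le_trans e0 ex; rewrite dfE//.
  have px := p0 x0; have mx := Hm x ex xc.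
  set q := du x - _; have -> : (q / psi0 x) ^+ 2 = q ^+ 2 * (psi0 x ^+ 2)^-1 by rewrite exprMn exprVn.
  have -> : (m ^+ 2 * e)^-1 * (q ^+ 2 * x) = q ^+ 2 * (x / (m ^+ 2 * e)) by ring.
  apply: ler_wpM2l; first exact: sqr_ge0.
  rewrite -[leLHS]mul1r ler_pdivrMr; last by pos.
  have -> : x / (m ^+ 2 * e) * psi0 x ^+ 2 = (x / e) * (psi0 x / m) ^+ 2 by field; rewrite !gt_eqF.
  rewrite -[leLHS]mulr1; apply: ler_pM => //; first by rewrite ler_pdivlMr// mul1r.
  by rewrite -[leLHS](expr1n _ 2) ler_sqr ?nnegrE//; [rewrite ler_pdivlMr// mul1r|pos].
have jdf2 x : e <= x -> J `[x, c] (fun t => df t ^+ 2).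
  move=> ex; have x0 := lt_le_trans e0 ex.
  apply: (@J_le _ _ _ (fun t => (m ^+ 2 * e)^-1 * ((du t - u t * lgd t) ^+ 2 * t))) => //.
  - by apply: measurable_funX; exact: (measurable_funS mRp (itv_Rp x0) mdf).
  - by move=> t /=; rewrite in_itv/= => /andP[xt tc]; rewrite ger0_norm ?sqr_ge0// df2// (le_trans ex).
  - by apply: J_scale => //; apply: J_set jg => //; apply: subset_itvr; rewrite bnd_simp.
have far x : e <= x -> x <= c -> u x ^+ 2 <= Kp ^+ 2 * (c / (m ^+ 2 * e)) * T.
  move=> ex xc; have x0 := lt_le_trans e0 ex; have px := p0 x0.
  have uf : u x = psi0 x * f x by rewrite /f mulrCA mulfV ?mulr1// gt_eqF.
  have f2 : f x ^+ 2 <= c / (m ^+ 2 * e) * T.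
    have Ef : I `[x, c] df = - f x by rewrite (hd_I hf x0 xc) /f (uc c)// mul0r sub0r.
    have := @cauchy_schwarz_I R `[x, c]%classic (fun=> 1) df (measurable_itv _).
    rewrite (@I_eq _ _ (fun x => 1 * df x) df); last by move=> *; rewrite mul1r.
    rewrite (@I_eq _ _ (fun=> 1 ^+ 2) (fun=> 1)); last by move=> *; rewrite expr1n.
    rewrite Ef sqrrN => CS; apply: le_trans (CS _ _ _ _) _ => //.
    - exact: (measurable_funS mRp (itv_Rp x0) mdf).
    - exact: J_cst.
    - exact: jdf2.
    have I1 : I `[x, c] (fun=> 1) <= c.
      rewrite /I Rintegral_cst//= mul1r lebesgue_measure_itv/= lte_fin.
      by case: ifP => _ /=; move: x0 (c0); flra.
    have I2 : I `[x, c] (fun t => df t ^+ 2) <= (m ^+ 2 * e)^-1 * T.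
      apply: (@le_trans _ _ (I `[x, c] (fun t => (m ^+ 2 * e)^-1 * ((du t - u t * lgd t) ^+ 2 * t)))).
        apply: I_le => //; [exact: jdf2| |].
          by apply: J_scale => //; apply: J_set jg => //; apply: subset_itvr; rewrite bnd_simp.
        by move=> t /=; rewrite in_itv/= => /andP[xt tc]; rewrite df2// (le_trans ex).
      rewrite I_scale//; last by apply: J_set jg => //; apply: subset_itvr; rewrite bnd_simp.
      rewrite ler_wpM2l//; first by pos.
      apply: le_trans hg; apply: I_subset => //; first by apply: subset_itvr; rewrite bnd_simp.
      by move=> t /(itv_Rp e0)/RpP t0; pos.
    rewrite -mulrA; apply: ler_pM => //; apply: I_ge0 => t _; pos.
  rewrite uf exprMn -mulrA; apply: ler_pM => //; [pos|pos|].
  by rewrite -[leLHS]real_normK ?num_real// ler_sqr ?nnegrE// ?HKp// ltW.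
have jS0 : J Rp (fun x => u x ^+ 2 * x) by exact: u2.
have JE : J `]0, c] (fun x => u x ^+ 2 * x).
  apply: J_set jS0 => //; first exact: mRp.
  by move=> x /=; rewrite in_itv/= => /andP[x0 _]; apply/RpP.
have SE : S = I `]0, c] (fun x => u x ^+ 2 * x).
  rewrite /S /wint (@I_indic_sub _ Rp `]0, c]%classic); last first.
    by move=> x /=; rewrite in_itv/= => /andP[x0 _]; apply/RpP.
  apply: I_eq => x /RpP x0; rewrite indicE; have [|] := boolP (x \in _); first by rewrite mulr1.
  rewrite notin_setE/= in_itv/= x0/= => /negP; rewrite -ltNge => cx.
  by rewrite uc ?expr0n ?mul0r ?mulr0// ltW.
have split_S : S = I `]0, e] (fun x => u x ^+ 2 * x) + I `]e, c] (fun x => u x ^+ 2 * x).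
  have U : `]0, c]%classic = `]0, e]%classic `|` `]e, c]%classic.
    by rewrite -itv_bndbnd_setU// bnd_simp ?(ltW e0).
  rewrite SE {1}U I_setU//; first by rewrite -U.
  apply/seteqP; split => x //=; rewrite !in_itv/= => -[/andP[_ xe] /andP[ex _]].
  by move: (lt_le_trans ex xe); rewrite ltxx.
have S1 : I `]0, e] (fun x => u x ^+ 2 * x) <= D * c * e.
  apply: (@le_trans _ _ (I `]0, e] (fun=> D * c))).
    apply: I_le => //.
    - by apply: J_set JE => //; apply: subset_itvl; rewrite bnd_simp.
    - by apply: J_set (J_cst 0 e (D * c)) => //; apply: subset_itvr; rewrite bnd_simp.
    - by move=> x /=; rewrite in_itv/= => /andP[x0 xe]; apply: near0 => //; exact: le_trans ec.
  by rewrite /I Rintegral_cst//= lebesgue_measure_itv/= lte_fin e0 -EFinD /= subr0.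
have S2 : I `]e, c] (fun x => u x ^+ 2 * x) <= K1 * T.
  apply: (@le_trans _ _ (I `]e, c] (fun=> Kp ^+ 2 * (c / (m ^+ 2 * e)) * T * c))).
    apply: I_le => //.
    - by apply: J_set JE => //; apply: subset_itvr; rewrite bnd_simp ltW.
    - by apply: J_set (J_cst e c _) => //; apply: subset_itvr; rewrite bnd_simp.
    - move=> x /=; rewrite in_itv/= => /andP[ex xc]; apply: ler_pM => //; [pos| |].
      + by rewrite (le_trans (ltW e0))// ltW.
      + by apply: far => //; exact: ltW.
  rewrite /I Rintegral_cst//= lebesgue_measure_itv/= lte_fin.
  have E : Kp ^+ 2 * (c / (m ^+ 2 * e)) * T * c * c = K1 * T by rewrite /K1; ring.
  case: ifP => _ /=; last by rewrite mulr0; pos.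
  rewrite -E ler_wpM2l//; [pos|move: e0; flra].
have S3 : S <= D * c * e + K1 * T by move: split_S S1 S2; flra.
have D1 : D * c * e * (M + 1) <= (1 - a) * D / 2.
  have := ler_wpM2l D0 e1; flra.
have De0 : 0 <= D * c * e by pos.
(* Absorption: [D * c * e * (M + 1)] is at most half of [T + M * S], so the mass [S] on the right is
   dominated by the one on the left. *)
move: S3 D1 De0 hDT M0 S0 D0 T0 K10 a10; clear -H hp p0 mdp mp mW mneg mpos c0; nra.
Qed.

(** The negative part costs at most the fraction [a] of the Dirichlet integral plus [M] times the
    mass, and the Poincare inequality bounds the latter by the form. *)
Lemma coercive : exists2 K, 0 < K & forall u du, in_domt W u du -> (forall x, c <= x -> u x = 0) ->
  wint (fun x => du x ^+ 2) + wint (fun x => posp W x * u x ^+ 2) + wint (fun x => u x ^+ 2)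
    <= K * tf u du u du.
Proof.
have a0 := md_a0 H; have a1 := md_a1 H; have M0 := md_M H.
have [K K0 HK] := poincare.
have a10 : 0 < 1 - a by lra.
have MK : 0 < 1 + M * K by rewrite ltr_pwDl//; pos.
exists ((1 + M * K) / (1 - a) + K); first by pos.
move=> u du hu uc; have hd := domt_hd hu; have du2 := domt_dL2 hu; have u2 := domt_L2 hu.
have S1 := HK u du hu uc.
have [_ hn] := negp_dom hd u2 du2 uc.
have P0 : 0 <= wint (fun x => posp W x * u x ^+ 2) by apply: wint_ge0 => x _; rewrite mulr_ge0 ?posp_ge0// sqr_ge0.
have D0 : 0 <= wint (fun x => du x ^+ 2) by apply: wint_ge0 => x _; pos.
have := tform_diag hu; move: S1 hn P0 D0.
set T := tf u du u du; set D := wint (fun x => du x ^+ 2); set S := wint (fun x => u x ^+ 2).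
set P := wint (fun x => posp W x * u x ^+ 2); set N := wint _ => S1 hn P0 D0 TE.
have MS : M * S <= M * (K * T) by rewrite ler_wpM2l.
have h1 : (1 - a) * (D + P) <= (1 + M * K) * T by nra.
rewrite mulrDl; apply: lerD => //.
by rewrite mulrAC ler_pdivlMr// mulrC.
Qed.

End FormDomain.

(** * Quadratic forms and the Riesz theorem *)

Section BilinearForms.
Variables (R : realType) (E : lmodType R) (D : E -> Prop).
Hypothesis Dlin : forall x y (k : R), D x -> D y -> D (x + k *: y).
Implicit Types (b : E -> E -> R) (x y z : E) (e : R).

(** Relative to a predicate, because the same forms are used on the form domain and on several of
    its subspaces. *)
Definition bilinear_on b :=
  (forall x y, D x -> D y -> b x y = b y x) /\
  (forall x y z (k : R), D x -> D y -> D z -> b (x + k *: y) z = b x z + k * b y z).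

Lemma bilinear_on_comb b1 b2 (k : R) : bilinear_on b1 -> bilinear_on b2 ->
  bilinear_on (fun x y => b1 x y + k * b2 x y).
Proof.
move=> [s1 l1] [s2 l2]; split=> [x y dx dy|x y z k' dx dy dz]; first by rewrite s1// s2.
by rewrite l1// l2//; ring.
Qed.

Lemma bilinear_on_quad b x y (k : R) : bilinear_on b -> D x -> D y ->
  b (x + k *: y) (x + k *: y) = b x x + 2 * k * b x y + k ^+ 2 * b y y.
Proof.
move=> [s l] dx dy; have dz : D (x + k *: y) by exact: Dlin.
by rewrite l// (s x)// (s y (x + _))// !l// (s y x)//; ring.
Qed.

Lemma bilinear_on_CS b x y : bilinear_on b -> (forall z, D z -> 0 <= b z z) -> D x -> D y ->
  b x y ^+ 2 <= b x x * b y y.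
Proof.
move=> hb b0 dx dy; apply: discr; [exact: b0..|] => t.
have := b0 _ (Dlin (- t) dx dy); rewrite (bilinear_on_quad _ hb)// => h.
have -> : b x x - 2 * t * b x y + t ^+ 2 * b y y = b x x + 2 * - t * b x y + (- t) ^+ 2 * b y y by ring.
exact: h.
Qed.

(** Polarisation: the quadratic bound at [x + t y] and at [x - t y], averaged, gives a nonnegative
    quadratic in [t]. *)
Lemma bilinear_on_bounded v b (B : R) : bilinear_on v -> bilinear_on b -> 0 <= B ->
  (forall z, D z -> 0 <= b z z) -> (forall z, D z -> `|v z z| <= B * b z z) ->
  forall x y, D x -> D y -> v x y ^+ 2 <= B ^+ 2 * (b x x * b y y).
Proof.
move=> hv hb B0 b0 vb x y dx dy.
have h t : 0 <= B * b x x - 2 * t * v x y + t ^+ 2 * (B * b y y).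
  have d1 := Dlin t dx dy; have d2 := Dlin (- t) dx dy.
  have := vb _ d1; have := vb _ d2.
  rewrite !(bilinear_on_quad _ hv)// !(bilinear_on_quad _ hb)// !ler_norml => /andP[h1 h2] /andP[h3 h4].
  have -> : B * b x x - 2 * t * v x y + t ^+ 2 * (B * b y y) =
    ((B * (b x x + 2 * t * b x y + t ^+ 2 * b y y) - (v x x + 2 * t * v x y + t ^+ 2 * v y y))
    + (B * (b x x + 2 * - t * b x y + (- t) ^+ 2 * b y y) + (v x x + 2 * - t * v x y + (- t) ^+ 2 * v y y))) / 2.
    by field.
  rewrite divr_ge0//; lra.
have := discr _ _ h; rewrite !mulr_ge0 ?b0// => /(_ isT isT).
by have -> : B ^+ 2 * (b x x * b y y) = B * b x x * (B * b y y) by ring.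
Qed.

(** Direct method: minimise [b x x - 2 L x]. Midpoints make a minimising sequence Cauchy, and
    near-minimality in the direction [y] gives the equation. Completeness is a hypothesis and [b] is
    only semidefinite, as pairs that differ on a null set are at distance 0. *)
Lemma riesz b (L : E -> R) (K : R) : bilinear_on b -> (forall z, D z -> 0 <= b z z) ->
  D 0 -> 0 <= K ->
  (forall x y (k : R), D x -> D y -> L (x + k *: y) = L x + k * L y) ->
  (forall x, D x -> L x ^+ 2 <= K * b x x) ->
  (forall xn : nat -> E, (forall n, D (xn n)) ->
     (forall e, 0 < e -> exists N, forall k l : nat, (N <= k)%N -> (N <= l)%N ->
        b (xn k + (-1) *: xn l) (xn k + (-1) *: xn l) <= e) ->
     exists2 x, D x & forall e, 0 < e -> exists N, forall n, (N <= n)%N ->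
        b (xn n + (-1) *: x) (xn n + (-1) *: x) <= e) ->
  exists2 u, D u & forall x, D x -> b u x = L x.
Proof.
move=> hb b0 D0 K0 Llin Lb compl.
have [sb lb] := hb.
pose Jf x := b x x - 2 * L x.
have JK x : D x -> - K <= Jf x.
  move=> dx; rewrite /Jf; have := Lb x dx; have := b0 x dx.
  set B := b x x; set l := L x => B0 lB; rewrite lerNl opprB.
  have [//|h] := leP (2 * l - B) K.
  have h1 : 0 < 2 * l - (B + K) by lra.
  have h2 : 0 <= B + K by lra.
  have : (B + K) ^+ 2 < (2 * l) ^+ 2 by rewrite ltr_sqr ?nnegrE; lra.
  by have := sqr_ge0 (B - K); nra.
pose S := [set r | exists2 x, D x & r = Jf x].
have hS : has_inf S.
  split; first by exists (Jf 0), 0.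
  by exists (- K) => _ [x dx ->]; exact: JK.
pose j := inf S.
have jle x : D x -> j <= Jf x.
  by move=> dx; apply: (inf_lbound hS.2); exists x.
have /choice[xn Hxn] : forall n : nat, exists x, D x /\ Jf x < j + n.+1%:R^-1.
  move=> n; have n0 : 0 < n.+1%:R^-1 :> R by rewrite invr_gt0 ltr0n.
  by have [_ [x dx ->] h] := inf_adherent n0 hS; exists x.
have Dxn n : D (xn n) by case: (Hxn n).
have small (e : R) : 0 < e -> exists N, forall n, (N <= n)%N -> n.+1%:R^-1 <= e.
  by move=> e0; have [N HN] := bigT ler01 e0; exists N => n /HN; rewrite div1r.
have cau e : 0 < e -> exists N, forall k l : nat, (N <= k)%N -> (N <= l)%N ->
    b (xn k + (-1) *: xn l) (xn k + (-1) *: xn l) <= e.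
  move=> e0; have e4 : 0 < e / 4 by lra.
  have [N HN] := small _ e4; exists N => k l /HN k1 /HN l1.
  have dz : D (xn k + (-1) *: xn l) by exact: Dlin.
  (* The midpoint: comparing its value with the infimum bounds a quarter of [b z z] by the mean of
     the two excesses. *)
  have dm : D (xn l + 2^-1 *: (xn k + (-1) *: xn l)) by exact: Dlin.
  have := jle _ dm; have [_ hk] := Hxn k; have [_ hl] := Hxn l.
  have Ek : xn k = xn l + 1 *: (xn k + (-1) *: xn l).
    by rewrite scale1r scaleN1r addrC subrK.
  set z := xn k + _ in dz dm Ek *.
  have {}hk : Jf (xn l + 1 *: z) < j + k.+1%:R^-1 by rewrite -Ek.
  move: hk hl k1 l1; rewrite /Jf !(bilinear_on_quad _ hb)// !Llin// expr1n.
  have -> : (2^-1 : R) ^+ 2 = 4^-1 by field.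
  move: (k.+1%:R^-1) (l.+1%:R^-1) (b (xn l) (xn l)) (b (xn l) z) (b z z) (L z) (L (xn l)) => *.
  lra.
have [x dx Hx] := compl xn Dxn cau.
exists x => // y dy; apply/esym/eqP; rewrite -subr_eq0 -sqrf_eq0; apply/eqP.
apply: (@eps0 _ _ (4 * b y y)) => e e0.
have [N1 HN1] := small e e0; have [N2 HN2] := Hx e e0.
pose n := (N1 + N2)%N; have n1 := HN1 n (leq_addr _ _); have n2 := HN2 n (leq_addl _ _).
clearbody n; have by0 := b0 y dy.
(* Moving from [xn n] by [t y] cannot lower the functional by more than the excess [1 / (n + 1)],
   for any [t]; the discriminant gives this. *)
have h1 : (L y - b (xn n) y) ^+ 2 <= n.+1%:R^-1 * b y y.
  apply: discr => // t.
  have := jle _ (Dlin t (Dxn n) dy); rewrite /Jf (bilinear_on_quad _ hb)// Llin//.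
  have [_] := Hxn n; rewrite /Jf.
  move: (n.+1%:R^-1) (b (xn n) (xn n)) (b (xn n) y) (b y y) (L y) (L (xn n)) => *; lra.
have d2 : D (xn n + (-1) *: x) by exact: Dlin.
have h2 : b (xn n + (-1) *: x) y ^+ 2 <= e * b y y.
  by apply: le_trans (bilinear_on_CS hb b0 d2 dy) _; rewrite ler_wpM2r.
have h3 : n.+1%:R^-1 * b y y <= e * b y y by rewrite ler_wpM2r.
rewrite lb// in h2.
rewrite ger0_norm ?sqr_ge0//.
move: (le_trans h1 h3) h2; clear - R.
move: (b (xn n) y) (b x y) (L y) (b y y) => p q l w h1 h2.
by have := sqr_ge0 ((l - p) - (p + -1 * q)); lra.
Qed.

End BilinearForms.

(** * Null sets and almost everywhere convergence *)

Section NullSets.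
Variable R : realType.
Local Notation leb := (@lebesgue_measure R).
Local Notation Rp := (@Rp R).
Local Notation wJ := (wintegrable Rp).
Implicit Types (f g u du : R -> R) (D Z : set R).

Lemma indicC_mul Z f x : ~ Z x -> f x * \1_(~` Z) x = f x.
Proof. by move=> h; rewrite indicE mem_set// mulr1. Qed.

Lemma indicC_mul0 Z f x : Z x -> f x * \1_(~` Z) x = 0.
Proof. by move=> h; rewrite indicE memNset ?mulr0//= => /(_ h). Qed.

Lemma J_null D Z f : measurable D -> measurable Z -> J D f -> J D (fun x => f x * \1_(~` Z) x).
Proof.
move=> mD mZ jf; apply: (J_indic _ mD (measurableC mZ)).1.
apply: (J_set mD) jf; last exact: subIsetl.
exact: measurableI _ _ mD (measurableC mZ).
Qed.

Lemma I_null D Z f : measurable D -> measurable Z -> leb Z = 0 -> J D f ->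
  I D (fun x => f x * \1_(~` Z) x) = I D f.
Proof.
move=> mD mZ Z0 jf; rewrite -I_indic /I /Rintegral.
by rewrite (@negligible_integral _ _ R leb D Z (EFin \o f) mZ mD jf Z0) setDE.
Qed.

Lemma hd_null Z u du : measurable Z -> leb Z = 0 -> hasDeriv u du ->
  hasDeriv u (fun x => du x * \1_(~` Z) x).
Proof.
move=> mZ Z0 hu; apply/hasDerivP; split.
  by move=> a b a0; apply: J_null => //; exact: (hd_L1 hu).
move=> a b a0 ab; rewrite I_null//; first exact: hd_I.
exact: (hd_L1 hu).
Qed.

(** On [(0, c]] the weighted measure is finite, so square distances of order [4^(-n)] give summable
    mean distances; the series of absolute increments then has a finite integral and converges
    almost everywhere. *)
Lemma ae_cvg_fast (c : R) (g_ : nat -> R -> R) : 0 < c ->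
  (forall n, measurable_fun Rp (g_ n)) ->
  (forall n x, c < x -> g_ n x = 0) ->
  (forall n, wJ (fun x => (g_ n.+1 x - g_ n x) ^+ 2)) ->
  (forall n, wint (fun x => (g_ n.+1 x - g_ n x) ^+ 2) <= (4 ^+ n)^-1) ->
  exists Z, [/\ measurable Z, leb Z = 0 & forall x, 0 < x -> ~ Z x -> cvgn (g_ ^~ x)].
Proof.
move=> c0 mg gc jg hg.
pose d n x := g_ n.+1 x - g_ n x.
have md n : measurable_fun Rp (d n) by exact: measurable_funB.
pose ch x : R := \1_(`]0, c]%classic : set R) x.
have subc : `]0, c]%classic `<=` Rp by move=> x; rewrite /= in_itv/= => /andP[h _]; apply/RpP.
have jch : wJ ch.
  have : J `]0, c] (fun x => x).
    apply: (@J_le _ _ _ (fun=> c)) => //.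
      by move=> x; rewrite /= in_itv/= => /andP[x0 xc]; rewrite gtr0_norm.
    by apply: J_set (J_cst 0 c c) => //; apply: subset_itvr; rewrite bnd_simp.
  move=> /(J_indic_sub _ mRp (measurable_itv _) subc).1.
  by apply: J_eq; [exact: mRp|move=> x _; rewrite mulrC].
have p2 n : 0 < (2 : R) ^+ n by rewrite exprn_gt0.
(* From [2^n (z - 2^(-n))^2 >= 0], which trades the mean for the mean square. *)
have dle n (x : R) : 0 < x -> `|d n x| <= (2 ^+ n)^-1 * ch x + 2 ^+ n * d n x ^+ 2.
  move=> x0; have [xc|cx] := leP x c; last first.
    rewrite /d !gc// subrr normr0 expr0n mulr0 addr0; apply: mulr_ge0; first by rewrite invr_ge0 ltW.
    by rewrite /ch indicE.
  rewrite /ch indicE mem_set/= ?in_itv/= ?x0 ?xc// mulr1 -[d n x ^+ 2]real_normK ?num_real//.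
  set z := `|d n x|; have z0 : 0 <= z by exact: normr_ge0.
  have i2 : (2 ^+ n)^-1 * 2 ^+ n = 1 :> R by rewrite mulVf// gt_eqF.
  have : 0 <= 2 ^+ n * (z - (2 ^+ n)^-1) ^+ 2 by rewrite mulr_ge0 ?sqr_ge0// ltW.
  have -> : 2 ^+ n * (z - (2 ^+ n)^-1) ^+ 2 = 2 ^+ n * z ^+ 2 - 2 * ((2 ^+ n)^-1 * 2 ^+ n) * z + (2 ^+ n)^-1 * ((2 ^+ n)^-1 * 2 ^+ n) by ring.
  by rewrite i2; lra.
have jd n : wJ (fun x => `|d n x|).
  apply: (wJ_le _ _ (wJ_add (wJ_scale (2 ^+ n)^-1 jch) (wJ_scale (2 ^+ n) (jg n)))).
    by apply: measurableT_comp => //; exact: measurable_normr.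
  by move=> x x0; rewrite normr_id dle.
have hd n : wint (fun x => `|d n x|) <= (wint ch + 1) * (2 ^+ n)^-1.
  apply: le_trans (wint_le (jd n) (wJ_add (wJ_scale (2 ^+ n)^-1 jch) (wJ_scale (2 ^+ n) (jg n))) (dle n)) _.
  rewrite wint_add; [|exact: wJ_scale..]; rewrite !wint_scale// mulrDl mul1r mulrC lerD2l.
  have := ler_wpM2l (ltW (p2 n)) (hg n); move=> /le_trans; apply.
  have -> : (4 : R) ^+ n = 2 ^+ n * 2 ^+ n by rewrite -exprMn; congr (_ ^+ _); ring.
  by rewrite invfM mulrA mulfV ?mul1r// gt_eqF.
pose F n x := (`|d n x| * x)%:E.
have mF n : measurable_fun Rp (F n).
  by apply: (measurable_EFinP Rp (fun x => `|d n x| * x)).2; exact: J_meas (jd n).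
have F0 n x : Rp x -> (0 <= F n x)%E by move=> /RpP x0; rewrite lee_fin mulr_ge0// ltW.
have fin : (\int[leb]_(x in Rp) (\sum_(0 <= n <oo) F n x) < +oo)%E.
  rewrite (@integral_nneseries _ _ R leb Rp mRp F mF F0).
  apply: (@le_lt_trans _ _ (\sum_(0 <= n <oo) ((wint ch + 1) * (2 ^+ n)^-1)%:E)%E).
    apply: lee_nneseries => n *; first by apply: (@integral_ge0 _ _ R leb) => x; exact: F0.
    by rewrite (I_EFin mRp (jd n)) lee_fin hd.
  have w0 : 0 <= wint ch + 1.
    by rewrite addr_ge0// wint_ge0// => x _; rewrite /ch indicE.
  apply: le_lt_trans (ltry (2 * (wint ch + 1))); apply: lime_le.
    by apply: is_cvg_nneseries => n _ _; rewrite lee_fin; apply: mulr_ge0 => //; rewrite invr_ge0 ltW.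
  apply: nearW => n; rewrite sumEFin lee_fin -mulr_sumr mulrC ler_wpM2r//.
  have E : \sum_(0 <= i < n) (2 ^+ i : R)^-1 = 2 - 2 * (2 ^+ n)^-1.
    elim: n => [|n IH]; first by rewrite big_geq// expr0 invr1 mulr1 subrr.
    by rewrite big_nat_recr//= IH exprS; field; rewrite gt_eqF.
  by rewrite E gerBl mulr_ge0// invr_ge0 ltW.
have jF : leb.-integrable Rp (fun x => \sum_(0 <= n <oo) F n x)%E.
  apply/integrableP; split.
    exact: (@ge0_emeasurable_sum _ _ R Rp F xpredT (fun n x h _ => F0 n x h) (fun n _ => mF n)).
  suff -> : (\int[leb]_(x in Rp) `|\sum_(0 <= n <oo) F n x| =
      \int[leb]_(x in Rp) (\sum_(0 <= n <oo) F n x))%E by [].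
  apply: eq_integral => x /set_mem hx.
  by rewrite gee0_abs//; apply: nneseries_ge0 => n _ _; exact: F0.
have [Z [mZ Z0 HZ]] := @integrable_ae _ _ R leb Rp mRp _ jF.
exists Z; split => // x x0 nZ.
have fx : (\sum_(0 <= n <oo) F n x)%E \is a fin_num.
  by apply: contrapT => h; apply: nZ; apply: HZ => /= /(_ ((RpP x).2 x0)).
have cs : cvgn (series (fun n => `|d n x| * x)).
  apply: nnseries_is_cvg; first by move=> n; rewrite mulr_ge0// ltW.
  by move: fx; rewrite fin_numElt => /andP[].
have cd : cvgn (series (fun n => d n x)).
  apply: normed_cvg.
  have -> : [normed series (fun n => d n x)] = (fun n => x^-1 * series (fun n => `|d n x| * x) n).
    apply/funext => n; rewrite /series/= mulr_sumr; apply: eq_bigr => i _.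
    by rewrite mulrC mulfK// gt_eqF.
  by apply: is_cvgM => //; exact: is_cvg_cst.
have -> : g_ ^~ x = (fun n => g_ 0%N x + series (fun n => d n x) n).
  apply/funext => n; rewrite /series/=; elim: n => [|n IH]; first by rewrite big_geq// addr0.
  by rewrite big_nat_recr//= addrA -IH /d subrKC.
by apply: is_cvgD => //; exact: is_cvg_cst.
Qed.

End NullSets.

(** * The form space *)

Section FormSpace.
Variable R : realType.
Local Notation leb := (@lebesgue_measure R).
Local Notation Rp := (@Rp R).
Local Notation wJ := (wintegrable Rp).
Local Notation E := ((R -> R) * (R -> R))%type.
Variables (W psi0 dpsi0 : R -> R) (c mu a M : R).
Hypothesis H : model W psi0 dpsi0 c mu a M.
Implicit Types (p q : E) (x y e : R).

(** Pairs (function, derivative), with the vector space structure of the product. *)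
Definition DT p := in_domt W p.1 p.2.
(** The inner space, with a Dirichlet condition at [c]. The second component vanishes beyond [c] at
    every point, so that products with functions supported outside vanish pointwise. *)
Definition X0 p := [/\ DT p, forall x, c <= x -> p.1 x = 0 & forall x, c < x -> p.2 x = 0].
(** The unit margin is the width of the cutoff [theta]; this space contains [X0] and the cut-off
    ground state. *)
Definition cptD p := DT p /\ forall x, c + 1 <= x -> p.1 x = 0.

(** The density of the form norm with [W] replaced by its positive part. It is nonnegative at each
    point, which Fatou requires. *)
Definition Nf p x := p.2 x ^+ 2 + (posp W x + 1) * p.1 x ^+ 2.
Definition tE p q := tform W p.1 p.2 q.1 q.2.
Definition mform p q := wint (fun x => p.1 x * q.1 x).
Definition vform V p q := wint (fun x => V x * p.1 x * q.1 x).

Let mpos : measurable_fun Rp (posp W).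
Proof. exact: posp_meas (md_W H). Qed.

Lemma Nf_ge0 p x : 0 <= Nf p x.
Proof. by rewrite /Nf; have := posp_ge0 W x; have := sqr_ge0 (p.1 x); have := sqr_ge0 (p.2 x); nra. Qed.

Lemma Nf_J p : DT p -> wJ (Nf p).
Proof.
move=> dp; apply: wJ_add; first exact: domt_dL2 dp.
by apply: (wJ_eq _ (wJ_add (domt_posJ dp) (domt_L2 dp))) => x _; ring.
Qed.

Lemma NfE p : DT p -> wint (Nf p) =
  wint (fun x => p.2 x ^+ 2) + wint (fun x => posp W x * p.1 x ^+ 2) + wint (fun x => p.1 x ^+ 2).
Proof.
move=> dp; have j1 := domt_dL2 dp; have j2 := domt_posJ dp; have j3 := domt_L2 dp.
rewrite -wint_add// -wint_add//; last exact: wJ_add.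
by apply: wint_eq => x _; rewrite /Nf; ring.
Qed.

Lemma Nf_meas p : measurable_fun Rp p.1 -> measurable_fun Rp p.2 -> measurable_fun Rp (Nf p).
Proof.
move=> m1 m2; apply: measurable_funD; first exact: measurable_funX.
apply: measurable_funM; last exact: measurable_funX.
exact: measurable_funD.
Qed.

Lemma DT_Nf p : hasDeriv p.1 p.2 -> wJ (Nf p) -> DT p.
Proof.
move=> hd j; have m1 := hd_meas hd; have m2 := locL1_meas (hd_L1 hd).
have b x : [/\ 0 <= posp W x * p.1 x ^+ 2, 0 <= p.1 x ^+ 2 & 0 <= p.2 x ^+ 2].
  by split; [apply: mulr_ge0; [exact: posp_ge0|]| |]; exact: sqr_ge0.
split => //; split; last split; apply: (wJ_le _ _ j).
- exact: measurable_funX.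
- by move=> x _; have [? ? ?] := b x; rewrite ger0_norm// /Nf; lra.
- exact: measurable_funX.
- by move=> x _; have [? ? ?] := b x; rewrite ger0_norm// /Nf; lra.
- by apply: measurable_funM => //; exact: measurable_funX.
- by move=> x _; have [? ? ?] := b x; rewrite ger0_norm// /Nf; lra.
Qed.

Lemma Nf_lin p q (k : R) x : Nf (p + k *: q) x <= 2 * Nf p x + 2 * k ^+ 2 * Nf q x.
Proof.
rewrite /Nf /=; have -> : (p.1 + k *: q.1) x = p.1 x + k * q.1 x by [].
have -> : (p.2 + k *: q.2) x = p.2 x + k * q.2 x by [].
have h (s t : R) : (s + k * t) ^+ 2 <= 2 * s ^+ 2 + 2 * k ^+ 2 * t ^+ 2.
  by have := sqr_ge0 (s - k * t); lra.
have p0 : 0 <= posp W x + 1 by have := posp_ge0 W x; lra.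
have h1 := h (p.2 x) (q.2 x); have h2 := ler_wpM2l p0 (h (p.1 x) (q.1 x)); lra.
Qed.

Lemma hd_lin p q (k : R) : hasDeriv p.1 p.2 -> hasDeriv q.1 q.2 ->
  hasDeriv (p + k *: q).1 (p + k *: q).2.
Proof. by move=> h1 h2; exact: hd_add h1 (hd_scale k h2). Qed.

Lemma DT_lin p q (k : R) : DT p -> DT q -> DT (p + k *: q).
Proof.
move=> dp dq; have hd := hd_lin k (domt_hd dp) (domt_hd dq).
apply: DT_Nf => //.
apply: (wJ_le _ _ (wJ_add (wJ_scale 2 (Nf_J dp)) (wJ_scale (2 * k ^+ 2) (Nf_J dq)))).
  by apply: Nf_meas; [exact: hd_meas hd|exact: locL1_meas (hd_L1 hd)].
by move=> x _; rewrite ger0_norm ?Nf_ge0// Nf_lin.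
Qed.

Lemma X0_DT p : X0 p -> DT p. Proof. by case. Qed.
Lemma cptD_DT p : cptD p -> DT p. Proof. by case. Qed.
Lemma X0_cptD p : X0 p -> cptD p.
Proof. by move=> [dp p1 _]; split => // x h; apply: p1; lra. Qed.

Lemma X0_lin p q (k : R) : X0 p -> X0 q -> X0 (p + k *: q).
Proof.
move=> [dp p1 p2] [dq q1 q2]; split; first exact: DT_lin.
- by move=> x cx; rewrite [LHS](_ : _ = p.1 x + k * q.1 x)// p1// q1// mulr0 addr0.
- by move=> x cx; rewrite [LHS](_ : _ = p.2 x + k * q.2 x)// p2// q2// mulr0 addr0.
Qed.

Lemma cptD_lin p q (k : R) : cptD p -> cptD q -> cptD (p + k *: q).
Proof.
move=> [dp p1] [dq q1]; split; first exact: DT_lin.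
by move=> x cx; rewrite [LHS](_ : _ = p.1 x + k * q.1 x)// p1// q1// mulr0 addr0.
Qed.

Lemma X0_0 : X0 0.
Proof.
split=> //; apply: DT_Nf; first exact: (hd_cst 0).
by apply: (wJ_eq _ (@wJ0 R)) => x _; rewrite /Nf /= !expr0n mulr0 addr0.
Qed.

Lemma bilinear_on_sub (D D' : E -> Prop) b : (forall p, D' p -> D p) ->
  bilinear_on D b -> bilinear_on D' b.
Proof. by move=> s [h1 h2]; split=> *; [apply: h1|apply: h2]; exact: s. Qed.

Lemma tE_bil : bilinear_on DT tE.
Proof.
split=> [p q dp dq|p q r k dp dq dr]; first by apply: wint_eq => x _; ring.
have j1 := domt_tJ H dp dr; have j2 := domt_tJ H dq dr.
rewrite /tE /tform -wint_scale// -wint_add//; last exact: wJ_scale.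
apply: wint_eq => x _; have -> : (p + k *: q).1 x = p.1 x + k * q.1 x by [].
by have -> : (p + k *: q).2 x = p.2 x + k * q.2 x by []; ring.
Qed.

Lemma nE_bil : bilinear_on DT mform.
Proof.
split=> [p q dp dq|p q r k dp dq dr]; first by apply: wint_eq => x _; ring.
have j1 := domt_uwJ dp dr; have j2 := domt_uwJ dq dr.
rewrite /mform -wint_scale// -wint_add//; last exact: wJ_scale.
by apply: wint_eq => x _; have -> : (p + k *: q).1 x = p.1 x + k * q.1 x by []; ring.
Qed.

Lemma nE_ge0 p : 0 <= mform p p.
Proof. by apply: wint_ge0 => x _; rewrite -expr2 sqr_ge0. Qed.

Lemma nE_Nf p : DT p -> mform p p <= wint (Nf p).
Proof.
move=> dp; apply: wint_le; [exact: (domt_uwJ dp dp)|exact: Nf_J|].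
move=> x _; rewrite /Nf; have := posp_ge0 W x; have := sqr_ge0 (p.1 x); have := sqr_ge0 (p.2 x); nra.
Qed.

Lemma tE_Nf p : DT p -> tE p p <= wint (Nf p).
Proof.
move=> dp; rewrite /tE (tform_diag H dp) NfE//.
have : 0 <= wint (fun x => negp W x * p.1 x ^+ 2).
  by apply: wint_ge0 => x _; rewrite mulr_ge0 ?negp_ge0 ?sqr_ge0.
have : 0 <= wint (fun x => p.1 x ^+ 2) by apply: wint_ge0 => x _; exact: sqr_ge0.
lra.
Qed.

Lemma tE_ge0 p : cptD p -> 0 <= tE p p.
Proof.
move=> [dp p1]; have [_] := ground_state_bound H 1 dp p1 ltr01.
by apply: le_trans; apply: I_ge0 => x /(itv_Rp ltr01)/RpP x0; pos.
Qed.

Lemma wJ_null Z f : measurable Z -> wJ f -> wJ (fun x => f x * \1_(~` Z) x).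
Proof.
move=> mZ j; have := J_null mRp mZ j; apply: J_eq; first exact: mRp.
by move=> x _; rewrite mulrAC.
Qed.

Lemma wint_null Z f : measurable Z -> leb Z = 0 -> wJ f ->
  wint (fun x => f x * \1_(~` Z) x) = wint f.
Proof.
move=> mZ Z0 j; rewrite -[RHS](I_null mRp mZ Z0 j); apply: I_eq => x _; by rewrite mulrAC.
Qed.

(** Along a fast subsequence the derivatives converge outside a null set, on which they are reset to
    0. The limit function is recovered by integrating the limit derivative from [c], where all
    members vanish, and Fatou along the subsequence bounds the distances to it. *)
Lemma X0_complete (pn : nat -> E) : (forall n, X0 (pn n)) ->
  (forall e, 0 < e -> exists N, forall k l : nat, (N <= k)%N -> (N <= l)%N ->
     wint (Nf (pn k + (-1) *: pn l)) <= e) ->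
  exists2 p, X0 p & forall e, 0 < e -> exists N, forall n, (N <= n)%N ->
     wint (Nf (pn n + (-1) *: p)) <= e.
Proof.
move=> Xp cau; have c0 := md_c H.
have /choice[Nk HNk] : forall k : nat, exists N, forall m l : nat, (N <= m)%N -> (N <= l)%N ->
     wint (Nf (pn m + (-1) *: pn l)) <= (4 ^+ k)^-1.
  by move=> k; apply: cau; rewrite invr_gt0 exprn_gt0.
(* Partial sums give indices that are monotone, beyond [Nk k], and at least [k]. *)
pose s (k : nat) := (\sum_(i < k.+1) (Nk i).+1)%N.
have sN k : (Nk k <= s k)%N by rewrite /s big_ord_recr/= (leq_trans (leqnSn _))// leq_addl.
have sid k : (k <= s k)%N.
  by elim: k => [//|k IH]; rewrite /s big_ord_recr/= -/(s k) addnS ltnS (leq_trans IH)// leq_addr.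
have sS k : (s k <= s k.+1)%N by rewrite /s [X in (_ <= X)%N]big_ord_recr/= leq_addr.
have sub1 m l x : (pn m + (-1) *: pn l).1 x = (pn m).1 x - (pn l).1 x.
  by rewrite [LHS](_ : _ = (pn m).1 x + (-1) * (pn l).1 x)// mulN1r.
have sub2 m l x : (pn m + (-1) *: pn l).2 x = (pn m).2 x - (pn l).2 x.
  by rewrite [LHS](_ : _ = (pn m).2 x + (-1) * (pn l).2 x)// mulN1r.
have DTs m l : DT (pn m + (-1) *: pn l) by apply: DT_lin; exact: X0_DT.
have DTn n : DT (pn n) by exact: X0_DT.
have d2N m l : wint (fun x => ((pn m).2 x - (pn l).2 x) ^+ 2) <= wint (Nf (pn m + (-1) *: pn l)).
  apply: wint_le; [|exact: Nf_J|].
    by have := domt_dL2 (DTs m l); apply: wJ_eq => x _; rewrite sub2.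
  move=> x _; rewrite /Nf sub2 lerDl mulr_ge0 ?sqr_ge0//; have := posp_ge0 W x; lra.
pose g k := (pn (s k)).2.
have [||||Z [mZ Z0 cZ]] := @ae_cvg_fast R c g c0.
- by move=> n; exact: domt_dmeas (DTn _).
- by move=> n x cx; have [_ _] := Xp (s n); apply.
- by move=> n; have := domt_dL2 (DTs (s n.+1) (s n)); apply: wJ_eq => x _; rewrite sub2.
- move=> n; apply: (le_trans (d2N _ _)); apply: HNk; last exact: sN.
  exact: leq_trans (sN n) (sS n).
pose ch x : R := \1_(~` Z) x.
have chsq x : ch x ^+ 2 = ch x by rewrite /ch indicE; case: (_ \in _); rewrite ?expr1n ?expr0n.
pose qk k x := g k x * ch x.
pose q x := limn (qk ^~ x).
have cq x : 0 < x -> qk k x @[k --> \oo] --> q x.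
  move=> x0; suff : cvgn (qk ^~ x) by [].
  have [zx|nz] := pselect (Z x).
    have -> : qk ^~ x = fun=> 0 by apply/funext => k; exact: (indicC_mul0 (g k) zx).
    exact: is_cvg_cst.
  have -> : qk ^~ x = g ^~ x by apply/funext => k; exact: (indicC_mul (g k) nz).
  exact: cZ.
have mch : measurable_fun Rp ch by apply: measurable_indic; exact: measurableC.
have mqk k : measurable_fun Rp (qk k) by apply: measurable_funM => //; exact: domt_dmeas (DTn _).
have mq : measurable_fun Rp q.
  by apply: (measurable_fun_cvg (h := qk)) => // x /RpP; exact: cq.
have hqk k : hasDeriv (pn (s k)).1 (qk k) by exact: hd_null mZ Z0 (domt_hd (DTn _)).
have qk0 k x : c < x -> qk k x = 0.
  by move=> cx; rewrite /qk /g; have [_ _ ->] := Xp (s k); rewrite ?mul0r.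
have sle k l : (k <= l)%N -> (s k <= s l)%N.
  by move=> /subnKC <-; elim: (l - k)%N => [|j IH]; rewrite ?addn0// addnS (leq_trans IH).
have far e : 0 < e -> exists N, forall n : nat, (N <= n)%N -> exists K, forall l : nat, (K <= l)%N ->
    wint (Nf (pn n + (-1) *: pn (s l))) <= e.
  move=> e0; have [N HN] := cau e e0.
  have [K0 HK0] : exists K, forall l, (K <= l)%N -> (4 ^+ l : R)^-1 <= e.
    have [K HK] := bigT ler01 e0; exists K => l /HK; rewrite div1r => /(le_trans _); apply.
    rewrite lef_pV2 ?posrE ?exprn_gt0// -natrX ler_nat; exact: ltn_expl.
  exists (maxn N (Nk K0)) => n; rewrite geq_max => /andP[nN nK].
  exists K0 => l lK; apply: (le_trans _ (HK0 K0 (leqnn _))).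
  by apply: HNk => //; exact: leq_trans (sN K0) (sle _ _ lK).
(* The zero at [c] fixes the constant of integration. *)
pose u x := - I `[x, c] q.
have q2 n e : 0 < e -> (exists K, forall l : nat, (K <= l)%N ->
    wint (Nf (pn n + (-1) *: pn (s l))) <= e) ->
    wJ (fun x => ((pn n).2 x * ch x - q x) ^+ 2) /\
    wint (fun x => ((pn n).2 x * ch x - q x) ^+ 2) <= e.
  move=> e0 [K HK].
  have j l : wJ (fun x => ((pn n).2 x - (pn l).2 x) ^+ 2).
    by have := domt_dL2 (DTs n l); apply: wJ_eq => x _; rewrite sub2.
  apply: (@wint_fatou R (fun l x => ((pn n).2 x * ch x - qk (l + K)%N x) ^+ 2)).
  - by move=> l x _; exact: sqr_ge0.
  - move=> l; apply: (wJ_eq _ (wJ_null mZ (j (s (l + K)%N)))) => x _.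
    by rewrite /qk /g -mulrBl exprMn chsq.
  - move=> x x0; apply: sq_cvg; apply: cvgB; first exact: cvg_cst.
    by have := cq x x0; rewrite -(cvg_shiftn K); exact.
  - move=> l; apply: le_trans (HK (l + K)%N (leq_addl _ _)); apply: le_trans (d2N _ _).
    rewrite -(wint_null mZ Z0 (j (s (l + K)%N))) le_eqVlt; apply/orP; left; apply/eqP.
    by apply: wint_eq => x _; rewrite /qk /g -mulrBl exprMn chsq.
have lq : locL1 q.
  have [N HN] := far 1 ltr01; have [j _] := q2 N 1 ltr01 (HN N (leqnn _)).
  have m1 : measurable_fun Rp (fun x => (pn N).2 x * ch x - q x).
    by apply: measurable_funB => //; apply: measurable_funM => //; exact: domt_dmeas (DTn _).
  have l1 := wL2_locL1 m1 j.
  have l2 : locL1 (fun x => (pn N).2 x * ch x) by exact: (hd_L1 (hd_null mZ Z0 (domt_hd (DTn N)))).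
  by apply: (locL1_eq _ (locL1_add l2 (locL1_scale (-1) l1))) => x _; ring.
(* Weighted mean-square convergence implies convergence of integrals over intervals bounded away
   from 0, by Cauchy-Schwarz; the factor [x^-1] removes the weight. *)
have cvI x y : 0 < x -> I `[x, y] (qk k) @[k --> \oo] --> I `[x, y] q.
  move=> x0; have [xy|yx] := leP x y; last first.
    rewrite set_itv_ge ?bnd_simp -?ltNge// /I Rintegral_set0.
    by under eq_fun do rewrite Rintegral_set0; exact: cvg_cst.
  apply/cvgrPdist_le => /= e e0.
  have e2 : 0 < e ^+ 2 * x / (y - x + 1) by pos; lra.
  have [N HN] := far _ e2.
  have [K HK] : exists K, forall k, (K <= k)%N -> (N <= s k)%N.
    by exists N => k kN; exact: leq_trans (sid k).
  exists K => // k /HK kN.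
  have [j w] := q2 (s k) _ e2 (HN _ kN).
  have jq := lq x y x0; have jk : J `[x, y] (qk k) := hd_L1 (hqk k) y x0.
  rewrite -I_sub// -ler_sqr ?nnegrE ?(ltW e0)// real_normK ?num_real//.
  have j' : J `[x, y] (fun t => (q t - qk k t) ^+ 2).
    apply: itv_wJ => //; first by apply/measurable_funX/measurable_funB.
    by apply: wJ_itv => //; apply: (wJ_eq _ j) => t _; rewrite -/(qk k t) -sqrrN opprB.
  have := @cauchy_schwarz_I R `[x, y]%classic (fun=> 1) (fun t => q t - qk k t) (measurable_itv _).
  rewrite (@I_eq _ _ (fun t => 1 * (q t - qk k t)) (fun t => q t - qk k t)); last by move=> *; rewrite mul1r.
  rewrite (@I_eq _ _ (fun=> 1 ^+ 2) (fun=> 1)); last by move=> *; rewrite expr1n.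
  move=> CS; apply: le_trans (CS _ _ _ _) _ => //.
  - apply: (measurable_funS mRp (itv_Rp x0)); exact: measurable_funB.
  - exact: J_cst.
  have I1 : I `[x, y] (fun=> 1) <= y - x + 1.
    rewrite /I Rintegral_cst//= mul1r lebesgue_measure_itv/= lte_fin.
    by case: ifP => _ /=; lra.
  have I2 : I `[x, y] (fun t => (q t - qk k t) ^+ 2) <= x^-1 * (e ^+ 2 * x / (y - x + 1)).
    apply: (@le_trans _ _ (I `[x, y] (fun t => x^-1 * ((q t - qk k t) ^+ 2 * t)))).
      apply: I_le => //.
        apply: J_scale => //; apply: wJ_itv => //; apply: (wJ_eq _ j) => t _.
        by rewrite -/(qk k t) -sqrrN opprB.
      move=> t; rewrite /= in_itv/= => /andP[xt _].
      by rewrite mulrCA ler_peMr ?sqr_ge0// mulrC ler_pdivlMr// mul1r.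
    have jw : wJ (fun t => (q t - qk k t) ^+ 2).
      by apply: (wJ_eq _ j) => t _; rewrite -/(qk k t) -sqrrN opprB.
    rewrite I_scale//; last exact: wJ_itv.
    rewrite ler_wpM2l ?invr_ge0 ?(ltW x0)//; apply: le_trans w.
    rewrite (@wint_eq _ _ (fun t => (q t - qk k t) ^+ 2)); last first.
      by move=> t _; rewrite -/(qk k t) -sqrrN opprB.
    by apply: I_subset => //; [exact: mRp|exact: itv_Rp|move=> t /RpP t0; pos].
  have I10 : 0 <= I `[x, y] (fun=> 1) by apply: I_ge0.
  have I20 : 0 <= I `[x, y] (fun t => (q t - qk k t) ^+ 2) by apply: I_ge0 => t _; exact: sqr_ge0.
  apply: le_trans (ler_pM I10 I20 I1 I2) _; rewrite le_eqVlt; apply/orP; left; apply/eqP.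
  by field; rewrite !gt_eqF//=; lra.
have cu x : 0 < x -> (pn (s k)).1 x @[k --> \oo] --> u x.
  move=> x0.
  have -> : (fun k => (pn (s k)).1 x) = (fun k => - I `[x, c] (qk k)).
    apply/funext => k; have [_ p1 _] := Xp (s k); have [xc|cx] := leP x c.
      by rewrite (hd_I (hqk k) x0 xc) (p1 c (lexx c)) sub0r opprK.
    by rewrite p1 ?(ltW cx)// set_itv_ge ?bnd_simp -?ltNge// /I Rintegral_set0 oppr0.
  by apply: cvgN; exact: cvI.
have hu : hasDeriv u q.
  apply/hasDerivP; split => // x y x0 xy; have y0 := lt_le_trans x0 xy.
  have c1 := cvI x y x0.
  have c2 : (pn (s k)).1 y - (pn (s k)).1 x @[k --> \oo] --> u y - u x by apply: cvgB; exact: cu.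
  have E1 : (fun k => I `[x, y] (qk k)) = (fun k => (pn (s k)).1 y - (pn (s k)).1 x).
    by apply/funext => k; rewrite (hd_I (hqk k) x0 xy).
  by rewrite E1 in c1; exact: (cvg_unique _ c1 c2).
have muu := hd_meas hu.
pose Fn n x := ((pn n).2 x * ch x - q x) ^+ 2 + (posp W x + 1) * ((pn n).1 x - u x) ^+ 2.
have lim n e : 0 < e -> (exists K, forall l : nat, (K <= l)%N ->
    wint (Nf (pn n + (-1) *: pn (s l))) <= e) -> wJ (Fn n) /\ wint (Fn n) <= e.
  move=> e0 [K HK].
  pose fl l x := ((pn n).2 x * ch x - qk l x) ^+ 2 + (posp W x + 1) * ((pn n).1 x - (pn (s l)).1 x) ^+ 2.
  have fl0 l x : 0 <= fl l x.
    apply: addr_ge0; first exact: sqr_ge0.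
    apply: mulr_ge0; last exact: sqr_ge0.
    by have := posp_ge0 W x; lra.
  have flJ l : wJ (fl l) /\ wint (fl l) <= wint (Nf (pn n + (-1) *: pn (s l))).
    have d := DTs n (s l).
    have j1 := domt_dL2 d; have j1' := wJ_null mZ j1.
    have j2 : wJ (fun x => (posp W x + 1) * (pn n + (-1) *: pn (s l)).1 x ^+ 2).
      by apply: (wJ_eq _ (wJ_add (domt_posJ d) (domt_L2 d))) => x _; ring.
    have E1 x : 0 < x -> (pn n + (-1) *: pn (s l)).2 x ^+ 2 * \1_(~` Z) x +
        (posp W x + 1) * (pn n + (-1) *: pn (s l)).1 x ^+ 2 = fl l x.
      by move=> _; rewrite sub1 sub2 /fl /qk /g -mulrBl exprMn chsq.
    split; first exact: (wJ_eq E1 (wJ_add j1' j2)).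
    rewrite -(wint_eq E1) wint_add// (wint_null mZ Z0 j1) -wint_add//.
  apply: (@wint_fatou R (fun l => fl (l + K)%N)).
  - by move=> l x _; exact: fl0.
  - by move=> l; exact: (flJ _).1.
  - move=> x x0; apply: cvgD.
      apply: sq_cvg; apply: cvgB; first exact: cvg_cst.
      by have := cq x x0; rewrite -(cvg_shiftn K); exact.
    apply: cvgM; first exact: cvg_cst.
    apply: sq_cvg; apply: cvgB; first exact: cvg_cst.
    by have := cu x x0; rewrite -(cvg_shiftn K); exact.
  - by move=> l; apply: le_trans (flJ _).2 (HK _ (leq_addl _ _)).
have hdn n : hasDeriv (pn n).1 (fun x => (pn n).2 x * ch x) by exact: hd_null mZ Z0 (domt_hd (DTn n)).
have DTp : DT (u, q).
  apply: DT_Nf => //.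
  have [N HN] := far 1 ltr01; have [jF _] := lim N 1 ltr01 (HN N (leqnn _)).
  have jn := Nf_J (DTn N).
  apply: (wJ_le _ _ (wJ_add (wJ_scale 2 jF) (wJ_scale 2 jn))); first exact: Nf_meas.
  move=> x _; rewrite ger0_norm ?Nf_ge0// /Nf /Fn /=.
  have h (v w : R) : v ^+ 2 <= 2 * (w - v) ^+ 2 + 2 * w ^+ 2 by have := sqr_ge0 (2 * w - v); lra.
  have p0 : 0 <= posp W x + 1 by have := posp_ge0 W x; lra.
  have h1 := h (q x) ((pn N).2 x * ch x); have h2 := ler_wpM2l p0 (h (u x) ((pn N).1 x)).
  have h3 : ((pn N).2 x * ch x) ^+ 2 <= (pn N).2 x ^+ 2.
    rewrite /ch indicE; case: (_ \in _); rewrite ?mulr1 ?mulr0 ?expr0n ?sqr_ge0//.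
  lra.
have Xup : X0 (u, q).
  split => //= x cx.
    rewrite /u; move: cx; rewrite le_eqVlt => /predU1P[<-|cx].
      by rewrite set_itv1 /I Rintegral_set1 oppr0.
    by rewrite set_itv_ge ?bnd_simp -?ltNge// /I Rintegral_set0 oppr0.
  rewrite /q (_ : (fun k => qk k x) = fun=> 0); first by rewrite lim_cst.
  by apply/funext => k; exact: qk0.
exists (u, q) => // e e0; have [N HN] := far e e0; exists N => n /HN hn.
have [jF wF] := lim n e e0 hn; apply: le_trans wF.
have dd : DT (pn n + (-1) *: (u, q)) by exact: DT_lin.
rewrite -(wint_null mZ Z0 (Nf_J dd)); apply: wint_le => //; first exact: wJ_null (Nf_J dd).
move=> x _; rewrite /Nf /Fn.
have -> : (pn n + (-1) *: (u, q)).1 x = (pn n).1 x - u x.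
  by rewrite [LHS](_ : _ = (pn n).1 x + (-1) * u x)// mulN1r.
have -> : (pn n + (-1) *: (u, q)).2 x = (pn n).2 x - q x.
  by rewrite [LHS](_ : _ = (pn n).2 x + (-1) * q x)// mulN1r.
have p0 : 0 <= posp W x + 1 by have := posp_ge0 W x; lra.
rewrite /ch indicE; case: (_ \in _); rewrite ?mulr1 ?mulr0//.
by apply: addr_ge0; [exact: sqr_ge0|apply: mulr_ge0 => //; exact: sqr_ge0].
Qed.

End FormSpace.

(** * The inner problem *)

Section InnerProblem.
Variable R : realType.
Local Notation leb := (@lebesgue_measure R).
Local Notation Rp := (@Rp R).
Local Notation wJ := (wintegrable Rp).
Local Notation E := ((R -> R) * (R -> R))%type.
Variables (W psi0 dpsi0 V : R -> R) (c mu a M : R).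
Hypothesis H : model W psi0 dpsi0 c mu a M.
Hypothesis HV : in_calV W V.
Implicit Types (p q : E) (x y e al s : R).
Local Notation DT := (DT W).
Local Notation X0 := (X0 W c).
Local Notation cptD := (cptD W c).
Local Notation tE := (tE W).
Local Notation vE := (vform V).
Local Notation nE := (@mform R).
Local Notation Nf := (Nf W).

Let lV : locL1 V. Proof. by case: HV. Qed.
Let mV : measurable_fun Rp V. Proof. exact: locL1_meas. Qed.

Lemma VJ p : DT p -> wJ (fun x => `|V x| * p.1 x ^+ 2).
Proof.
move=> dp; have [_ _ jV _] := HV; have := J_norm mRp (jV _ _ dp).
apply: J_eq; first exact: mRp.
by move=> x /RpP x0; rewrite -mulrA normrM [X in _ * X]ger0_norm ?mulrA// mulr_ge0 ?sqr_ge0 ?ltW.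
Qed.

Lemma VJ2 p q : DT p -> DT q -> wJ (fun x => V x * p.1 x * q.1 x).
Proof.
move=> dp dq; apply: (wJ_le _ _ (wJ_add (VJ dp) (VJ dq))).
  by apply: measurable_funM; [apply: measurable_funM => //|]; [exact: domt_meas dp|exact: domt_meas dq].
move=> x _; rewrite !normrM -mulrA -mulrDr ler_wpM2l//.
rewrite -[p.1 x ^+ 2]real_normK ?num_real// -[q.1 x ^+ 2]real_normK ?num_real//.
by have := sqr_ge0 (`|p.1 x| - `|q.1 x|); have := normr_ge0 (p.1 x); have := normr_ge0 (q.1 x); nra.
Qed.

Lemma vE_bil : bilinear_on DT vE.
Proof.
split=> [p q dp dq|p q r k dp dq dr]; first by apply: wint_eq => x _; ring.
have j1 := VJ2 dp dr; have j2 := VJ2 dq dr.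
rewrite /vform -wint_scale// -wint_add//; last exact: wJ_scale.
by apply: wint_eq => x _; have -> : (p + k *: q).1 x = p.1 x + k * q.1 x by []; ring.
Qed.

(** The form of [T + 1]; the coefficient 1 is written out to match the linear combinations of
    [bilinear_on_comb]. *)
Definition bE p q := tE p q + 1 * nE p q.

Lemma bE_bil : bilinear_on DT bE.
Proof. apply: bilinear_on_comb; [exact: (tE_bil H)|exact: nE_bil]. Qed.

Lemma bE_ge0 p : cptD p -> 0 <= bE p p.
Proof. by move=> dp; rewrite /bE mul1r addr_ge0 ?nE_ge0// (tE_ge0 H). Qed.

Lemma bil_scale0 (b : E -> E -> R) p k : bilinear_on DT b -> DT p -> b (0 + k *: p) (0 + k *: p) = k ^+ 2 * b p p.
Proof.
move=> hb dp; have d0 : DT 0 by exact: (X0_DT (X0_0 H)).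
rewrite (bilinear_on_quad (fun p q k => @DT_lin _ _ _ _ _ _ _ _ H p q k) k hb d0 dp).
have b0 q : DT q -> b 0 q = 0.
  move=> dq; have := hb.2 0 0 q 1 d0 d0 dq; rewrite scaler0 addr0 mul1r => h; lra.
by rewrite !b0// mulr0 !add0r.
Qed.

(* Otherwise the normalised functions on which the form of [V] is unbounded would contradict compactness. *)
Lemma V_unit_bounded : exists2 B, 0 <= B & forall p, cptD p -> bE p p <= 1 -> `|vE p p| <= B.
Proof.
apply: contrapT => nB.
have /choice[pn Hpn] : forall n : nat, exists p, [/\ cptD p, bE p p <= 1 & n%:R < `|vE p p|].
  move=> n; apply: contrapT => np; apply: nB; exists n%:R => // p dp b1.
  by rewrite leNgt; apply/negP => h; apply: np; exists p.
have dpn n : DT (pn n) by have [[]] := Hpn n.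
have [_ _ _ comp] := HV.
have [|sg [sgS Hsg]] := comp (fun n => (pn n).1) (fun n => (pn n).2) 1.
  move=> n; split; first exact: dpn.
  by have [_] := Hpn n; rewrite /bE mul1r.
have [N HN] := Hsg 1 ltr01.
have sgk k : (k <= sg k)%N by elim: k => // k IH; exact: leq_ltn_trans (sgS k).
have vsub k l q : DT q -> wint (fun x => V x * ((pn k).1 x - (pn l).1 x) * q.1 x) = vE (pn k) q - vE (pn l) q.
  by move=> dq; rewrite -wint_sub; [apply: wint_eq => x _; ring|exact: VJ2..].
have b1 n : tnorm2 W (pn n).1 (pn n).2 <= 1.
  by have [_] := Hpn n; rewrite /bE mul1r.
pose C := 2 + `|vE (pn (sg N)) (pn (sg N))|.
have bd k : (N <= k)%N -> `|vE (pn (sg k)) (pn (sg k))| <= C.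
  move=> kN.
  have h1 := HN k N kN (leqnn N) _ _ (dpn (sg k)) (b1 _).
  have h2 := HN k N kN (leqnn N) _ _ (dpn (sg N)) (b1 _).
  rewrite vsub// in h1; rewrite vsub// in h2.
  have sy : vE (pn (sg N)) (pn (sg k)) = vE (pn (sg k)) (pn (sg N)) by apply: vE_bil.1.
  rewrite sy in h1; rewrite /C.
  move: h1 h2; move: (vE _ _) (vE _ _) (vE _ _) => v1 v2 v3 h1 h2.
  have := ler_normD (v3 - v2) v2; rewrite subrK; have := ler_normD (v2 - v1) v1; rewrite subrK; lra.
have C0 : 0 <= C by rewrite /C addr_ge0.
pose k := maxn N (Num.bound C).
have := bd k (leq_maxl _ _); rewrite leNgt => /negP; apply.
have [_ _] := Hpn (sg k); apply: le_lt_trans.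
apply: le_trans (ltW (archi_boundP C0)) _; rewrite ler_nat.
exact: leq_trans (leq_maxr _ _) (sgk k).
Qed.

(** Rescale to the unit ball. The divisor is the root of [bE p p + e], which is positive even where
    [bE p p] vanishes, and [e] tends to 0. *)
Lemma V_bounded : exists2 B, 0 <= B & forall p, cptD p -> `|vE p p| <= B * bE p p.
Proof.
have [B B0 HB] := V_unit_bounded; exists B => // p dp.
have b0 := bE_ge0 dp; have dDT := cptD_DT dp.
apply: (@le_eps _ _ _ B) => // e e0 _; rewrite (mulrC e) -mulrDr.
pose t := bE p p + e; have t0 : 0 < t by rewrite /t; lra.
pose k := (Num.sqrt t)^-1.
have k2 : k ^+ 2 = t^-1 by rewrite /k exprVn sqr_sqrtr// ltW.
have d0 : cptD 0 by exact: X0_cptD (X0_0 H).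
have := HB (0 + k *: p) (cptD_lin H k d0 dp).
rewrite (bil_scale0 k bE_bil dDT) (bil_scale0 k vE_bil dDT) k2.
rewrite normrM gtr0_norm ?invr_gt0// mulrC ler_pdivrMr// mul1r => /(_ _).
rewrite mulrC ler_pdivrMr// -/t; apply; rewrite /t; lra.
Qed.

(** [psi0] need not lie in the form domain, so it is cut off; tested on [X0] only its values up to
    [c] are seen. *)
Definition Psi0 : E := (fun x => theta c x * psi0 x, fun x => dtheta c x * psi0 x + theta c x * dpsi0 x).

Lemma Psi0_cptD : cptD Psi0.
Proof.
have c0 := md_c H; have c10 : 0 < c + 1 by rewrite addr_gt0.
have [hp loc] := md_loc H; have ht := hd_theta H.
have hd := hd_mul ht hp.
have [j1 j2 j3] := loc (c + 1) c10.
have sub : `]0, (c + 1)]%classic `<=` Rp.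
  by move=> x; rewrite /= in_itv/= => /andP[h _]; apply/RpP.
pose ch x : R := \1_(`]0, (c + 1)]%classic : set R) x.
have jm f : wintegrable `]0, (c + 1)] f -> wJ (fun x => f x * ch x).
  move=> j; have := (J_indic_sub _ mRp (measurable_itv _) sub).1 j; apply: J_eq; first exact: mRp.
  by move=> x _; rewrite mulrAC.
have chE x : 0 < x -> x <= c + 1 -> ch x = 1 by move=> h1 h2; rewrite /ch indicE mem_set//= in_itv/= h1.
have ch0 x : 0 <= ch x by rewrite /ch indicE.
have mt := hd_meas ht; have mdt : measurable_fun Rp (dtheta c) := locL1_meas (hd_L1 ht).
have mp := hd_meas hp; have mdp : measurable_fun Rp dpsi0 := locL1_meas (hd_L1 hp).
have mpos := posp_meas (md_W H).
have le1 (g : R) x : 0 <= g -> 0 < x -> `|g * (theta c x * psi0 x) ^+ 2| <= g * psi0 x ^+ 2 * ch x.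
  move=> g0 x0; have [xc|cx] := leP x (c + 1).
    rewrite chE// mulr1 ger0_norm; last by rewrite mulr_ge0 ?sqr_ge0.
    rewrite ler_wpM2l// exprMn ler_piMl ?sqr_ge0//.
    by have /andP[? ?] := theta01 c x; rewrite expr_le1.
  rewrite theta_out ?(ltW cx)// mul0r expr0n mulr0 normr0; apply: mulr_ge0 => //; apply: mulr_ge0 => //; exact: sqr_ge0.
split; last by move=> x cx; rewrite /= theta_out ?mul0r.
split => //; split; last split.
- apply: (wJ_le _ _ (jm _ j1)); first by apply/measurable_funX/measurable_funM.
  by move=> x x0; have := le1 1 x ler01 x0; rewrite !mul1r.
- apply: (wJ_le _ _ (wJ_add (wJ_scale 2 (jm _ j1)) (wJ_scale 2 (jm _ j2)))).
    by apply/measurable_funX/measurable_funD; exact: measurable_funM.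
  move=> x x0 /=; rewrite ger0_norm ?sqr_ge0//; have [xc|cx] := leP x (c + 1).
    rewrite chE// !mulr1; set s1 := dtheta c x; set s2 := theta c x.
    have t2 : s2 ^+ 2 <= 1 by have /andP[? ?] := theta01 c x; rewrite expr_le1.
    have t1 : s1 ^+ 2 <= 1 by rewrite -real_normK ?num_real// expr_le1// dtheta_le1.
    have h1 : (s1 * psi0 x) ^+ 2 <= psi0 x ^+ 2 by rewrite exprMn ler_piMl ?sqr_ge0.
    have h2 : (s2 * dpsi0 x) ^+ 2 <= dpsi0 x ^+ 2 by rewrite exprMn ler_piMl ?sqr_ge0.
    by have := sqr_ge0 (s1 * psi0 x - s2 * dpsi0 x); lra.
  rewrite theta_out ?(ltW cx)// mul0r addr0 /dtheta.
  rewrite ifF; last by apply/negbTE; rewrite -ltNge; lra.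
  rewrite ifF; last by apply/negbTE; rewrite -ltNge.
  rewrite mul0r expr0n; have := sqr_ge0 (psi0 x); have := sqr_ge0 (dpsi0 x); have := ch0 x.
  by move=> h1 h2 h3; apply: addr_ge0; apply: mulr_ge0 => //; apply: mulr_ge0.
- apply: (wJ_le _ _ (jm _ j3)).
    by apply: measurable_funM => //; apply/measurable_funX/measurable_funM.
  by move=> x x0; apply: le1 => //; exact: posp_ge0.
Qed.

Definition perturbed al s p q := tE p q + (- al) * vE p q + s * nE p q.
(** The functional of [(al V - s) psi0]. As [psi0] solves the equation at energy 0,
    [perturbed eta = source] on [X0] says that [psi0 + eta] solves the eigenvalue equation inside
    [c]. *)
Definition source al s q := al * vE Psi0 q - s * nE Psi0 q.

Lemma AE_bil al s : bilinear_on DT (perturbed al s).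
Proof.
apply: bilinear_on_comb; last exact: nE_bil.
by apply: bilinear_on_comb; [exact: (tE_bil H)|exact: vE_bil].
Qed.

Let DTl p q (k : R) : DT p -> DT q -> DT (p + k *: q).
Proof. exact: (DT_lin H). Qed.

Let X0l p q (k : R) : X0 p -> X0 q -> X0 (p + k *: q).
Proof. exact: (X0_lin H). Qed.

Let cptl p q (k : R) : cptD p -> cptD q -> cptD (p + k *: q).
Proof. exact: (cptD_lin H). Qed.

Let bX (b : E -> E -> R) : bilinear_on DT b -> bilinear_on X0 b.
Proof. by apply: bilinear_on_sub => p; exact: X0_DT. Qed.

Let bc (b : E -> E -> R) : bilinear_on DT b -> bilinear_on cptD b.
Proof. by apply: bilinear_on_sub => p; exact: cptD_DT. Qed.

(** Coercivity bounds the full form norm, hence the form of [V] and the mass, by [t] on [X0].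
    Pairing with the fixed vector [Psi0] then leaves the factor [(al + s)^2] in the square of the
    source. *)
Lemma inner_constants : exists K B C : R, [/\ 0 < K, 0 <= B, 0 <= C,
  forall p, X0 p -> wint (Nf p) <= K * tE p p &
  (forall p, X0 p -> `|vE p p| <= B * tE p p) /\
  forall al s p, 0 <= al -> 0 <= s -> X0 p -> source al s p ^+ 2 <= C * (al + s) ^+ 2 * tE p p].
Proof.
have [K K0 HK] := coercive H; have [B B0 HB] := V_bounded.
have hK p : X0 p -> wint (Nf p) <= K * tE p p.
  by move=> xp; rewrite (NfE (X0_DT xp)); have [dp p1 _] := xp; exact: HK.
have hb p : X0 p -> bE p p <= (1 + K) * tE p p.
  move=> xp; rewrite /bE mul1r mulrDl mul1r lerD2l; apply: le_trans (hK p xp).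
  exact: nE_Nf (X0_DT xp).
have t0 p : X0 p -> 0 <= tE p p by move=> xp; apply: (tE_ge0 H); exact: X0_cptD xp.
have P0 := Psi0_cptD; have P0D := cptD_DT P0.
have bP := bE_ge0 P0; have nP := nE_ge0 Psi0.
exists K, (B * (1 + K)), (2 * (B ^+ 2 * bE Psi0 Psi0 * (1 + K) + nE Psi0 Psi0 * K)).
split => //.
- by rewrite mulr_ge0// addr_ge0// ltW.
- by pos; exact: ltW.
split.
- move=> p xp; rewrite -mulrA; apply: le_trans (HB _ (X0_cptD xp)) _.
  by rewrite ler_wpM2l// hb.
- move=> al s p al0 s0 xp.
  have v2 : vE Psi0 p ^+ 2 <= B ^+ 2 * bE Psi0 Psi0 * (1 + K) * tE p p.
    have := bilinear_on_bounded cptl (bc vE_bil) (bc bE_bil) B0 bE_ge0 HB P0 (X0_cptD xp).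
    move=> /le_trans; apply; apply: le_trans (ler_wpM2l (sqr_ge0 B) (ler_wpM2l bP (hb p xp))) _.
    by rewrite [leRHS](_ : _ = B ^+ 2 * (bE Psi0 Psi0 * ((1 + K) * tE p p)))//; ring.
  have n2 : nE Psi0 p ^+ 2 <= nE Psi0 Psi0 * K * tE p p.
    have := bilinear_on_CS DTl (nE_bil W) (fun z _ => nE_ge0 z) P0D (X0_DT xp).
    move=> /le_trans; apply; rewrite -mulrA ler_wpM2l//; apply: le_trans (hK p xp).
    exact: nE_Nf (X0_DT xp).
  have [X XE] : exists X, X = B ^+ 2 * bE Psi0 Psi0 * (1 + K) * tE p p by eexists.
  have [Y YE] : exists Y, Y = nE Psi0 Psi0 * K * tE p p by eexists.
  have -> : 2 * (B ^+ 2 * bE Psi0 Psi0 * (1 + K) + nE Psi0 Psi0 * K) * (al + s) ^+ 2 * tE p p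
     = 2 * (X + Y) * (al + s) ^+ 2 by rewrite XE YE; ring.
  rewrite /source; rewrite -XE in v2; rewrite -YE in n2; move: v2 n2.
  move: (vE _ p) (nE _ p) => v n v2 n2.
  have X0' : 0 <= X by apply: le_trans v2; exact: sqr_ge0.
  have Y0' : 0 <= Y by apply: le_trans n2; exact: sqr_ge0.
  have h1 : (al * v - s * n) ^+ 2 <= 2 * al ^+ 2 * v ^+ 2 + 2 * s ^+ 2 * n ^+ 2.
    by have := sqr_ge0 (al * v + s * n); lra.
  have h2 := ler_wpM2l (sqr_ge0 al) v2; have h3 := ler_wpM2l (sqr_ge0 s) n2.
  have h4 : al ^+ 2 * X + s ^+ 2 * Y <= (X + Y) * (al + s) ^+ 2.
    have : 0 <= al * s * (X + Y) by pos.
    have := mulr_ge0 (sqr_ge0 al) Y0'; have := mulr_ge0 (sqr_ge0 s) X0'; lra.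
  lra.
Qed.

(** For [al <= a0] the potential uses up at most half of [t], so the perturbed form is coercive and
    Riesz applies. The value [source (eta)] is the maximum of [2 source p - perturbed p p] over
    [X0]; inserting the maximiser for one [s] into the problem for another compares the two values,
    whence the Lipschitz bound in [s]. *)
Lemma inner_solution : exists a0 C : R, exists eta : R -> R -> E, [/\ 0 < a0, 0 < C,
  forall al s, 0 < al -> al <= a0 -> 0 <= s ->
    [/\ X0 (eta al s), forall q, X0 q -> perturbed al s (eta al s) q = source al s q,
        0 <= source al s (eta al s) & source al s (eta al s) <= C * (al + s) ^+ 2],
  forall al s1 s2, 0 < al -> al <= a0 -> 0 <= s1 -> s1 <= 1 -> 0 <= s2 -> s2 <= 1 ->
    `|source al s1 (eta al s1) - source al s2 (eta al s2)| <= C * `|s1 - s2| &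
  forall al p, 0 < al -> al <= a0 -> X0 p -> al * vE p p <= tE p p / 2].
Proof.
have [K [B [C [K0 B0 C0 hN [hv hL]]]]] := inner_constants.
(* Ensures [al * B <= 1 / 2]; the cap 1 gives [al + s <= 2] in the Lipschitz estimate. *)
pose a0 := Num.min 1 (2 * (B + 1))^-1.
have B1 : 0 < 2 * (B + 1) by rewrite mulr_gt0// ltr_wpDl.
have a00 : 0 < a0 by rewrite lt_min ltr01 invr_gt0.
have t0 p : X0 p -> 0 <= tE p p by move=> xp; apply: (tE_ge0 H); exact: X0_cptD xp.
have hv2 al p : 0 < al -> al <= a0 -> X0 p -> al * `|vE p p| <= tE p p / 2.
  move=> al0 ala xp; have ala' : al * (2 * (B + 1)) <= 1.
    have : al <= (2 * (B + 1))^-1 by apply: le_trans ala _; rewrite ge_min lexx orbT.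
    by rewrite -[X in al <= X]mul1r ler_pdivlMr.
  have h1 := ler_wpM2l (ltW al0) (hv p xp).
  have h2 := ler_wpM2r (t0 p xp) ala'.
  have h3 : 0 <= al * tE p p by rewrite mulr_ge0 ?t0// ltW.
  by lra.
have Apos al s p : 0 < al -> al <= a0 -> 0 <= s -> X0 p -> tE p p / 2 + s * nE p p <= perturbed al s p p.
  move=> al0 ala s0 xp; have := hv2 al p al0 ala xp; rewrite /perturbed.
  have := ler_norm (vE p p); set v := vE p p => h1 h2.
  have h3 := ler_wpM2l (ltW al0) h1; lra.
have Apos2 al s p : 0 < al -> al <= a0 -> 0 <= s -> X0 p -> tE p p / 2 <= perturbed al s p p.
  move=> al0 ala s0 xp; have := Apos al s p al0 ala s0 xp.
  have : 0 <= s * nE p p by rewrite mulr_ge0 ?nE_ge0.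
  lra.
have Aup al s p : 0 < al -> al <= a0 -> 0 <= s -> X0 p -> perturbed al s p p <= (2 + s) * wint (Nf p).
  move=> al0 ala s0 xp; have := hv2 al p al0 ala xp; rewrite /perturbed.
  have := tE_Nf H (X0_DT xp); have := ler_wpM2l s0 (nE_Nf (X0_DT xp)).
  have := ler_norm (- vE p p); rewrite normrN; have := t0 p xp.
  set v := vE p p; set t := tE p p; set N := wint _; set n := s * mform _ _ => h1 h2 h3 h4 h5.
  have h6 := ler_wpM2l (ltW al0) h2; lra.
have ex al s : 0 < al -> al <= a0 -> 0 <= s -> exists2 eta, X0 eta & forall q, X0 q -> perturbed al s eta q = source al s q.
  move=> al0 ala s0; have A0 p : X0 p -> 0 <= perturbed al s p p.
    by move=> xp; apply: le_trans (Apos2 al s p al0 ala s0 xp); rewrite divr_ge0 ?t0.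
  have PD := cptD_DT Psi0_cptD.
  apply: (riesz X0l (bX (AE_bil al s)) A0 (X0_0 H) (K := C * (al + s) ^+ 2 * 2)).
  - by apply: mulr_ge0 => //; apply: mulr_ge0 => //; exact: sqr_ge0.
  - move=> p q k xp xq; rewrite /source.
    have dp := X0_DT xp; have dq := X0_DT xq; have dk := DTl k dp dq.
    rewrite !(vE_bil.1 Psi0)// !((nE_bil W).1 Psi0)// vE_bil.2// (nE_bil W).2//; ring.
  - move=> p xp; apply: le_trans (hL al s p (ltW al0) s0 xp) _.
    have := Apos2 al s p al0 ala s0 xp => h; rewrite -(mulrA _ 2); apply: ler_wpM2l; last by lra.
    by apply: mulr_ge0 => //; exact: sqr_ge0.
  - move=> pn Xpn cau.
    have [|p Xp Hp] := @X0_complete _ _ _ _ _ _ _ _ H pn Xpn.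
      move=> e e0; have e2 : 0 < e / (2 * K) by rewrite divr_gt0// mulr_gt0.
      have [N HN] := cau _ e2; exists N => k l kN lN; have := HN k l kN lN.
      have xk : X0 (pn k + (-1) *: pn l) by exact: X0l.
      move=> /(le_trans (Apos2 al s _ al0 ala s0 xk)); rewrite ler_pdivlMr ?mulr_gt0// => h.
      have := hN _ xk => /le_trans; apply; lra.
    exists p => // e e0; have e2 : 0 < e / (2 + s) by rewrite divr_gt0// ltr_wpDr.
    have [N HN] := Hp _ e2; exists N => n /HN hn.
    have xk : X0 (pn n + (-1) *: p) by exact: X0l.
    apply: le_trans (Aup al s _ al0 ala s0 xk) _.
    by move: hn; rewrite ler_pdivlMr ?ltr_wpDr// mulrC.
(* One function of both parameters is needed; outside the admissible range it takes the value 0. *)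
have /choice[eta0 Heta0] : forall z : R * R, exists eta, (0 < z.1 -> z.1 <= a0 -> 0 <= z.2 ->
    X0 eta /\ forall q, X0 q -> perturbed z.1 z.2 eta q = source z.1 z.2 q).
  move=> [al s] /=; have [[al0 [ala s0]]|h] := pselect (0 < al /\ al <= a0 /\ 0 <= s).
    by have [eta xe he] := ex al s al0 ala s0; exists eta.
  by exists 0 => al0 ala s0; exfalso; apply: h.
pose eta al s := eta0 (al, s).
have Heta al s : 0 < al -> al <= a0 -> 0 <= s -> X0 (eta al s) /\ forall q, X0 q -> perturbed al s (eta al s) q = source al s q.
  by move=> al0 ala s0; exact: (Heta0 (al, s)).
have rho0 al s : 0 < al -> al <= a0 -> 0 <= s -> tE (eta al s) (eta al s) <= 2 * source al s (eta al s).
  move=> al0 ala s0; have [xe he] := Heta al s al0 ala s0.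
  by rewrite -he//; have := Apos2 al s _ al0 ala s0 xe; lra.
have rho1 al s : 0 < al -> al <= a0 -> 0 <= s -> source al s (eta al s) <= 2 * C * (al + s) ^+ 2.
  move=> al0 ala s0; have [xe he] := Heta al s al0 ala s0.
  have h1 := rho0 al s al0 ala s0; have h2 := t0 _ xe.
  have h3 := hL al s _ (ltW al0) s0 xe.
  set l := source al s _ in h1 h3 *; set t := tE _ _ in h1 h2 h3.
  have [l0|l0] := leP l 0; first by apply: le_trans l0 _; apply: mulr_ge0; [exact: mulr_ge0|exact: sqr_ge0].
  have D0 : 0 <= C * (al + s) ^+ 2 by apply: mulr_ge0 => //; exact: sqr_ge0.
  have h4 := ler_wpM2l D0 h1.
  rewrite -(ler_pM2r l0); lra.
(* [2 * C] serves the quadratic bound; the next terms dominate [2 |m| + n], where [n <= 16 K C] is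
   the mass of [eta] and [m] its pairing with [Psi0]. *)
pose C2 := 2 * C + 2 * nE Psi0 Psi0 + 60 * (K * C) + 1.
have nP := nE_ge0 Psi0.
have KC : 0 <= K * C by rewrite mulr_ge0// ltW.
have C20 : 0 < C2 by rewrite /C2; lra.
exists a0, C2, eta; split => //.
- move=> al s al0 ala s0; have [xe he] := Heta al s al0 ala s0; split => //.
    by have := rho0 al s al0 ala s0; have := t0 _ xe; lra.
  apply: le_trans (rho1 al s al0 ala s0) _; rewrite ler_wpM2r ?sqr_ge0// /C2; lra.
- move=> al s1 s2 al0 ala.
  have one s s' : 0 <= s -> s <= 1 -> 0 <= s' -> s' <= 1 ->
      source al s (eta al s) - source al s' (eta al s') <= C2 * `|s - s'|.
    move=> s0 s1' s'0 s'1.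
    have [xe he] := Heta al s al0 ala s0; have [xe' he'] := Heta al s' al0 ala s'0.
    have xd : X0 (eta al s + (-1) *: eta al s') by exact: X0l.
    have := Apos2 al s' _ al0 ala s'0 xd.
    have := t0 _ xd.
    have bil := bX (AE_bil al s').
    rewrite (bilinear_on_quad X0l (-1) bil)// (bil.1 (eta al s))// he'// he'//.
    have := he _ xe; rewrite {1}/perturbed {1}/perturbed.
    have := rho0 al s al0 ala s0; have := rho1 al s al0 ala s0.
    have := le_trans (nE_Nf (X0_DT xe)) (hN _ xe).
    have CSn := bilinear_on_CS DTl (nE_bil W) (fun z _ => nE_ge0 z) (cptD_DT Psi0_cptD) (X0_DT xe).
    have n0 := nE_ge0 (eta al s).
    have lE : source al s (eta al s) = al * vE Psi0 (eta al s) - s * nE Psi0 (eta al s) by [].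
    have lE' : source al s' (eta al s) = al * vE Psi0 (eta al s) - s' * nE Psi0 (eta al s) by [].
    move: lE lE' n0 CSn; move: (source al s' (eta al s')) (source al s' (eta al s)) (source al s (eta al s)) => rho' l' l.
    move: (nE (eta al s) _) (nE Psi0 (eta al s)) (tE (_ + _) _) (vE (eta al s) _) (vE Psi0 (eta al s)).
    move: (tE (eta al s) (eta al s)) => t n m td v w lE lE' n0 CSn h1 h2 h3 h4 h5 h6.
    have al1 : al <= 1 by apply: le_trans ala _; rewrite ge_min lexx.
    have as4 : (al + s) ^+ 2 <= 4 by nra.
    have h7 : 2 * C * (al + s) ^+ 2 <= 8 * C by have := ler_wpM2l C0 as4; lra.
    have tb : t <= 16 * C by lra.
    have nb : n <= 16 * (K * C) by have := ler_wpM2l (ltW K0) tb; lra.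
    have mb : `|m| <= nE Psi0 Psi0 + n.
      rewrite -ler_sqr ?nnegrE ?addr_ge0// real_normK ?num_real//; nra.
    have key : l - rho' <= - (s - s') * (2 * m + n) by lra.
    apply: le_trans key _; apply: le_trans (ler_norm _) _; rewrite normrM normrN mulrC ler_wpM2r//.
    apply: le_trans (ler_normD _ _) _; rewrite normrM (ger0_norm n0) ger0_norm// /C2.
    lra.
  move=> h1 h2 h3 h4; rewrite ler_norml; apply/andP; split; last exact: one.
  by have := one s2 s1 h3 h4 h1 h2; rewrite distrC; lra.
- move=> al p al0 ala xp; apply: le_trans (hv2 al p al0 ala xp).
  by rewrite ler_wpM2l ?(ltW al0)// ler_norm.
Qed.

End InnerProblem.

(** * The functions Phi *)

Section PowerFunctions.
Variable R : realType.
Local Notation leb := (@lebesgue_measure R).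
Local Notation Rp := (@Rp R).
Implicit Types (nu p s t x y e : R) (f g : R -> R).

(** The inequality [x / p <= exp (x / p)] raised to the power [p]. *)
Lemma powR_exp_le p x : 0 < p -> 0 <= x -> x `^ p <= p `^ p * expR x.
Proof.
move=> p0 x0; have h : x / p <= expR (x / p) by have := expR_ge1Dx (x / p); lra.
have := ge0_ler_powR (ltW p0) (_ : x / p \is Num.nneg) (_ : expR (x / p) \is Num.nneg) h.
rewrite !nnegrE => /(_ (divr_ge0 x0 (ltW p0)) (expR_ge0 _)).
rewrite -expRM divfK ?gt_eqF// powRM ?invr_ge0 ?(ltW p0)// => h1.
have -> : x `^ p = p `^ p * (x `^ p * p^-1 `^ p).
  rewrite -powRM ?invr_ge0 ?(ltW p0)// -powRM ?(ltW p0) ?divr_ge0 ?(ltW p0)//; congr (_ `^ _).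
  by rewrite mulrC divfK// gt_eqF.
by rewrite ler_wpM2l ?powR_ge0.
Qed.

Lemma le_powR p x y : 0 <= p -> 0 <= x -> x <= y -> x `^ p <= y `^ p.
Proof.
by move=> p0 x0 xy; apply: (ge0_ler_powR p0) => //; rewrite nnegrE//; exact: le_trans xy.
Qed.

Lemma J_exhaust f (C : R) : (forall x, 0 < x -> 0 <= f x) -> locL1 f ->
  (forall n : nat, I `[n.+1%:R^-1, n.+1%:R] f <= C) -> J Rp f /\ I Rp f <= C.
Proof.
move=> f0 lf hI; pose A n : set R := `[n.+1%:R^-1, n.+1%:R]%classic.
have sub n : A n `<=` Rp by apply: itv_Rp; rewrite invr_gt0.
apply: (@fatou_I _ _ (fun n x => f x * \1_(A n) x)) => //; first exact: mRp.
- by move=> n x /RpP x0; rewrite mulr_ge0 ?f0// indicE.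
- move=> n; apply/(J_indic_sub _ mRp (measurable_itv _) (sub n)); apply: lf.
  by rewrite invr_gt0.
- move=> x Rx; apply: cvg_near_cst.
  have : (\bigcup_n A n) x by rewrite /A -Rp_bigcup.
  case=> m _; rewrite /A /= in_itv/= => /andP[h1 h2]; exists m => // n /= mn.
  rewrite indicE mem_set ?mulr1//= in_itv/=; apply/andP; split.
    by apply: le_trans h1; rewrite lef_pV2 ?posrE// ler_nat.
  by apply: le_trans h2 _; rewrite ler_nat.
- by move=> n; rewrite -(I_indic_sub _ (sub n)); exact: hI.
Qed.

Lemma I_exhaust f : J Rp f ->
  I `[n.+1%:R^-1, n.+1%:R] f @[n --> \oo] --> I Rp f.
Proof.
move=> jf; pose A n : set R := `[n.+1%:R^-1, n.+1%:R]%classic.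
have sub n : A n `<=` Rp by apply: itv_Rp; rewrite invr_gt0.
have -> : (fun n => I `[n.+1%:R^-1, n.+1%:R] f) = (fun n => I Rp (fun x => f x * \1_(A n) x)).
  by apply/funext => n; rewrite -I_indic_sub.
have [||||//] := @dct _ _ (fun n x => f x * \1_(A n) x) f (fun x => `|f x|) mRp.
- move=> n; apply: measurable_funM; first exact: J_meas jf.
  by apply: measurable_indic; exact: measurable_itv.
- move=> x Rx; apply: cvg_near_cst.
  have : (\bigcup_n A n) x by rewrite /A -Rp_bigcup.
  case=> m _; rewrite /A /= in_itv/= => /andP[h1 h2]; exists m => // n /= mn.
  rewrite indicE mem_set ?mulr1//= in_itv/=; apply/andP; split.
    by apply: le_trans h1; rewrite lef_pV2 ?posrE// ler_nat.
  by apply: le_trans h2 _; rewrite ler_nat.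
- exact: J_norm mRp jf.
- by move=> n x _; rewrite normrM ler_piMr// indicE; case: (_ \in _); rewrite ?normr1 ?normr0.
Qed.

Lemma der_powR nu x : 0 < x -> der (fun y => y `^ nu) x (nu * x `^ (nu - 1)).
Proof. by move=> x0; exact: is_derive1_powR. Qed.

Lemma powR_cont nu x : 0 < x -> {for x, continuous (fun y => y `^ nu)}.
Proof. by move=> x0; apply: der_cont (der_powR nu x0). Qed.

Lemma hd_powR nu : hasDeriv (fun y => y `^ nu) (fun y => nu * y `^ (nu - 1)).
Proof.
apply: (hd_C1 (der_powR nu)) => x x0.
by apply: cvgM; [exact: cvg_cst|exact: powR_cont].
Qed.

Lemma powRDx x nu p : 0 < x -> x `^ (nu + p) = x `^ nu * x `^ p.
Proof. by move=> x0; rewrite powRD// (gt_eqF x0) implybT. Qed.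

Lemma powRS x nu : 0 < x -> x `^ (nu - 1) * x = x `^ nu.
Proof. by move=> x0; rewrite -{2}(powRr1 (ltW x0)) -powRDx// subrK. Qed.

Definition phi nu s t : R := t `^ (nu - 1) * expR (- t - s / t).

End PowerFunctions.

(* [Phi nu s = 2 * s^(nu/2) * K_nu (2 * sqrt s)], where [K_nu] is the Macdonald function; [Phi nu 0]
   is the Gamma function. *)
HB.lock Definition Phi (R : realType) (nu s : R) : R := I (@Rp R) (phi nu s).

(** * Convergence, positivity and decay of [Phi] *)

Section BesselIntegral.
Variable R : realType.
Local Notation leb := (@lebesgue_measure R).
Local Notation Rp := (@Rp R).
Implicit Types (nu p s t x y e : R) (f g : R -> R).

Lemma PhiE nu s : Phi nu s = I Rp (phi nu s).
Proof. by rewrite Phi.unlock. Qed.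

Lemma Phi_Gamma nu : Phi nu 0 = Gamma nu.
Proof. by rewrite PhiE; apply: I_eq => t _; rewrite /phi mul0r subr0. Qed.

Lemma phi_ge0 nu s t : 0 <= phi nu s t.
Proof. by rewrite mulr_ge0 ?powR_ge0 ?expR_ge0. Qed.

Lemma der_expst s t : 0 < t -> der (fun y => expR (- y - s / y)) t (expR (- t - s / t) * (-1 + s / t ^+ 2)).
Proof.
move=> t0; apply: der_exp; have t1 : t != 0 by rewrite gt_eqF.
apply: (der_eq (der_add (der_scale (-1) (der_id t)) (der_scale (- s) (der_inv t1)))).
  by move=> y; rewrite mulN1r mulNr.
by rewrite mulr1 mulrNN.
Qed.

Lemma phi_cont nu s t : 0 < t -> {for t, continuous (phi nu s)}.
Proof. by move=> t0; apply: cvgM; [exact: powR_cont|exact: der_cont (der_expst s t0)]. Qed.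

Lemma cont_locL1 f : (forall x, 0 < x -> {for x, continuous f}) -> locL1 f.
Proof.
move=> cf a b a0; apply: continuous_compact_integrable; first exact: segment_compact.
apply: continuous_in_subspaceT => x; rewrite inE/= in_itv/= => /andP[ax _]; apply: cf.
exact: lt_le_trans ax.
Qed.

Lemma phi_locL1 nu s : locL1 (phi nu s).
Proof. by apply: cont_locL1 => x; exact: phi_cont. Qed.

Lemma phi_meas nu s : measurable_fun Rp (phi nu s).
Proof. exact: locL1_meas (phi_locL1 nu s). Qed.

(** The majorant is the derivative of [(t / (1 + t))^nu], which has a bounded primitive and the same
    singularity at 0; the exponential is smaller than the power [(1 + t)^(- nu - 1)] up to a
    constant. *)
Lemma phi0_J nu : 0 < nu -> J Rp (phi nu 0).
Proof.
move=> nu0; pose F t := (t / (1 + t)) `^ nu; pose f t := nu * (t `^ (nu - 1) * (1 + t) `^ (- nu - 1)).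
have dF t : 0 < t -> der F t (f t).
  move=> t0; have t1 : 0 < 1 + t by lra.
  have tt : 0 < t / (1 + t) by rewrite divr_gt0.
  have d1 : der (fun y => 1 + y) t 1.
    by apply: (der_eq (der_add (der_cst 1 t) (der_id t))) => //; rewrite add0r.
  have d2 : der (fun y => y / (1 + y)) t ((1 + t) ^- 2).
    have t1n : 1 + t != 0 by rewrite gt_eqF.
    apply: (der_eq (der_mul (der_id t) (@der_comp _ _ (fun y => 1 + y) t _ _ (der_inv t1n) d1))) => //.
    by field.
  apply: (der_eq (@der_comp _ _ (fun y => y / (1 + y)) t _ _ (der_powR nu tt) d2)) => //.
  rewrite /f -mulrA; congr (_ * _); rewrite powRM ?invr_ge0 ?(ltW t0) ?(ltW t1)// -mulrA; congr (_ * _).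
  rewrite -powR_inv1 ?(ltW t1)// -powRrM.
  have -> : (1 + t) ^- 2 = (1 + t) `^ (- 2).
    by rewrite powRN (powR_mulrn 2) ?(ltW t1).
  by rewrite -powRDx//; congr (_ `^ _); ring.
have cf t : 0 < t -> {for t, continuous f}.
  move=> t0; apply: cvgM; first exact: cvg_cst.
  apply: cvgM; first exact: powR_cont.
  have t1 : 0 < 1 + t by lra.
  have d1 : der (fun y => 1 + y) t 1.
    by apply: (der_eq (der_add (der_cst 1 t) (der_id t))) => //; rewrite add0r.
  exact: der_cont (@der_comp _ _ (fun y => 1 + y) t _ _ (der_powR (- nu - 1) t1) d1).
have hF := hd_C1 dF cf.
have f0 x : 0 < x -> 0 <= f x.
  by move=> x0; rewrite mulr_ge0 ?(ltW nu0)// mulr_ge0 ?powR_ge0.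
have [|jf _] := @J_exhaust R f 1 f0 (hd_L1 hF).
  move=> n; rewrite (hd_I hF) ?invr_gt0//; last first.
    by rewrite (@le_trans _ _ 1)// ?invf_le1// ler1n.
  apply: (@le_trans _ _ (F n.+1%:R)); first by rewrite lerBlDr lerDl powR_ge0.
  have -> : 1 = 1 `^ nu :> R by rewrite powR1.
  apply: le_powR; rewrite ?(ltW nu0) ?divr_ge0 ?addr_ge0//.
  by rewrite ler_pdivrMr ?ltr_pwDl// mul1r lerDr.
pose C := (nu + 1) `^ (nu + 1) * expR 1 / nu.
apply: (J_le mRp (phi_meas _ _) _ (J_scale C mRp jf)) => x /RpP x0.
rewrite ger0_norm ?phi_ge0// /phi mul0r subr0 /f.
have x1 : 0 < 1 + x by lra.
have h := @powR_exp_le R (nu + 1) (1 + x) _ (ltW x1).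
rewrite (_ : C * _ = x `^ (nu - 1) * ((nu + 1) `^ (nu + 1) * expR 1 * (1 + x) `^ (- nu - 1))); last first.
  by rewrite /C; field; rewrite gt_eqF.
rewrite ler_wpM2l ?powR_ge0// expRN -[leLHS]div1r ler_pdivrMr ?expR_gt0//.
rewrite mulrAC -(mulrA _ (expR 1)) -expRD.
have := h (_ : 0 < nu + 1); rewrite -(ler_pM2r (powR_gt0 (- nu - 1) x1)) -powRDx//.
by rewrite (_ : nu + 1 + (- nu - 1) = 0) ?powRr0; [apply; lra|ring].
Qed.

(** The bound [exp (- s / t) <= p^p (t / s)^p] trades decay in [s] for a shift of the index. *)
Lemma phi_le nu p s t : 0 < p -> 0 < s -> 0 < t -> phi nu s t <= p `^ p * s `^ (- p) * phi (nu + p) 0 t.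
Proof.
move=> p0 s0 t0; rewrite /phi mul0r subr0 expRD.
have st : 0 < s / t by rewrite divr_gt0.
have h := powR_exp_le p0 (ltW st).
have -> : nu + p - 1 = (nu - 1) + p by ring.
rewrite (powRDx (nu - 1) p t0) [leRHS](_ : _ = t `^ (nu - 1) * (expR (- t) * (p `^ p * (s `^ (- p) * t `^ p)))); last by ring.
rewrite ler_wpM2l ?powR_ge0// ler_wpM2l ?expR_ge0// expRN -[leLHS]div1r ler_pdivrMr ?expR_gt0//.
have -> : s `^ (- p) * t `^ p = ((s / t) `^ p)^-1.
  rewrite powRM ?(ltW s0) ?invr_ge0 ?(ltW t0)// -(powR_inv1 (ltW t0)) -powRrM mulN1r !powRN.
  by field; rewrite !gt_eqF ?powR_gt0.
by rewrite mulrAC ler_pdivlMr ?powR_gt0// mul1r.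
Qed.

Lemma phi_J nu s : 0 < s -> J Rp (phi nu s).
Proof.
move=> s0; pose p := `|nu| + 1; have p0 : 0 < p by rewrite /p ltr_wpDl.
have np : 0 < nu + p by have := ler_norm (- nu); rewrite normrN /p; lra.
apply: (J_le mRp (phi_meas _ _) _ (J_scale (p `^ p * s `^ (- p)) mRp (phi0_J np))) => x /RpP x0.
by rewrite ger0_norm ?phi_ge0// phi_le.
Qed.

Lemma phi_Jn nu s : 0 <= s -> (s = 0 -> 0 < nu) -> J Rp (phi nu s).
Proof. by rewrite le_eqVlt => /predU1P[<- /(_ erefl)|s0 _]; [exact: phi0_J|exact: phi_J]. Qed.

Lemma Phi_decay nu p s : 0 < p -> 0 < nu + p -> 0 < s -> Phi nu s <= p `^ p * s `^ (- p) * Phi (nu + p) 0.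
Proof.
move=> p0 np s0; rewrite !PhiE -(I_scale _ mRp (phi0_J np)).
apply: (I_le mRp (phi_J _ s0)); first exact: J_scale mRp (phi0_J np).
by move=> x /RpP x0; exact: phi_le.
Qed.

Lemma Phi_gt0 nu s : 0 <= s -> (s = 0 -> 0 < nu) -> 0 < Phi nu s.
Proof.
move=> s0 h; rewrite PhiE; have jp := phi_Jn s0 h.
have mi : measurable (`[1, 2]%classic : set R) by exact: measurable_itv.
have sub : `[1, 2]%classic `<=` Rp by apply: itv_Rp; exact: ltr01.
apply: lt_le_trans (I_subset mRp mi sub jp (fun t _ => phi_ge0 nu s t)).
pose m := Num.min 1 (2 `^ (nu - 1)) * expR (- 2 - s).
have m0 : 0 < m by rewrite mulr_gt0 ?expR_gt0// lt_min ltr01 powR_gt0.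
have Im : I (`[1, 2]%classic : set R) (fun=> m) = m.
  rewrite /I Rintegral_cst//= lebesgue_measure_itv/= lte_fin ifT; last by rewrite ltr1n.
  by rewrite -EFinD/= (_ : 2 + -1 = 1 :> R) ?mulr1//; ring.
apply: lt_le_trans m0 _; rewrite -[X in X <= _]Im.
apply: I_le => //; [exact: J_cst|exact: J_set mRp mi sub jp|].
move=> t; rewrite /= in_itv/= => /andP[t1 t2]; rewrite /m /phi; apply: ler_pM.
- by rewrite le_min ler01 powR_ge0.
- exact: expR_ge0.
- have [n1|n1] := leP 0 (nu - 1).
    rewrite ge_min; apply/orP; left; rewrite (_ : 1 <= _)//.
    have := @le_powR R (nu - 1) 1 t n1 ler01 t1; by rewrite powR1.
  rewrite ge_min; apply/orP; right; rewrite -[nu - 1]opprK !(powRN _ (- (nu - 1))) lef_pV2 ?posrE ?powR_gt0//; last by lra.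
  by apply: le_powR => //; lra.
- rewrite ler_expR; have : s / t <= s by rewrite ler_pdivrMr ?ler_peMr//; lra.
  lra.
Qed.

End BesselIntegral.

(** * Derivative, recurrence, reflection and behaviour of [Phi] at 0 *)

Section BesselTheory.
Variable R : realType.
Local Notation leb := (@lebesgue_measure R).
Local Notation Rp := (@Rp R).
Implicit Types (nu p s t x y e m th X Y K C l : R) (f g : R -> R).

(* From [1 - (y - x) / t <= exp (- (y - x) / t)]; exchanging [x] and [y] gives two-sided bounds on the
   difference quotients. *)
Lemma Phi_convex nu x y : 0 <= x -> (x = 0 -> 1 < nu) -> 0 < y ->
  Phi nu x - (y - x) * Phi (nu - 1) x <= Phi nu y.
Proof.
move=> x0 hx y0.
have j1 : J Rp (phi nu x) by apply: phi_Jn => // /hx; lra.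
have j2 : J Rp (phi (nu - 1) x) by apply: phi_Jn => // /hx; lra.
have j3 := J_scale (y - x) mRp j2.
rewrite !PhiE -(I_scale _ mRp j2) -(I_sub mRp j1 j3).
apply: (I_le mRp (J_sub mRp j1 j3) (phi_J _ y0)) => t /RpP t0.
have -> : phi nu y t = phi nu x t * expR (- ((y - x) / t)).
  by rewrite /phi -mulrA -expRD; congr (_ * expR _); ring.
have -> : phi (nu - 1) x t = phi nu x t / t.
  by rewrite /phi -(powRS (nu - 1) t0); field; rewrite gt_eqF.
have h := ler_wpM2l (phi_ge0 nu x t) (expR_ge1Dx (- ((y - x) / t))).
by apply: le_trans h; rewrite le_eqVlt; apply/orP; left; apply/eqP; ring.
Qed.

Lemma Phi_decr nu x y : 0 <= x -> (x = 0 -> 0 < nu) -> x <= y -> Phi nu y <= Phi nu x.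
Proof.
move=> x0 hx xy; rewrite !PhiE; apply: (I_le mRp).
- apply: phi_Jn => [|y0]; first exact: le_trans xy.
  by apply: hx; apply/eqP; rewrite eq_le x0 andbT -y0.
- exact: phi_Jn.
- move=> t /RpP t0; rewrite /phi ler_wpM2l ?powR_ge0// ler_expR lerD2l lerN2 ler_wpM2r// invr_ge0 ltW//.
Qed.

Lemma Phi_lip nu m x y : 0 < m -> m <= x -> m <= y ->
  `|Phi nu y - Phi nu x| <= `|y - x| * Phi (nu - 1) m.
Proof.
move=> m0; wlog xy : x y / x <= y => [hw|] mx my.
  by have [/hw|/ltW/hw] := leP x y; [apply|rewrite distrC (distrC y); apply].
have x0 : 0 < x by apply: lt_le_trans mx.
have y0 : 0 < y by apply: lt_le_trans my.
have h1 : Phi nu y <= Phi nu x by apply: Phi_decr => //; [exact: ltW|move=> h; move: x0; rewrite h ltxx].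
rewrite distrC !ger0_norm ?subr_ge0//.
have x0' : (x = 0 -> 1 < nu) by move=> h; move: x0; rewrite h ltxx.
have h2 := Phi_convex (ltW x0) x0' y0.
have h3 : Phi (nu - 1) x <= Phi (nu - 1) m.
  by apply: Phi_decr => //; [exact: ltW|move=> h; move: m0; rewrite h ltxx].
have yx : 0 <= y - x by rewrite subr_ge0.
have h4 := ler_wpM2l yx h3; lra.
Qed.

(** The convexity inequality used in both directions traps the remainder between 0 and a quadratic,
    so no differentiation under the integral is required. *)
Lemma der_Phi nu x : 0 < x -> der (Phi nu) x (- Phi (nu - 1) x).
Proof.
move=> x0; have x2 : 0 < x / 2 by rewrite divr_gt0.
(* Agrees with [Phi] near [x] and with its tangent elsewhere, so that the quadratic bound holds on
   the whole unit ball around [x]. *)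
pose f y := if `|x - y| < x / 2 then Phi nu y else Phi nu x + - Phi (nu - 1) x * (y - x).
pose C := Phi (nu - 1 - 1) (x / 2).
have C0 : 0 <= C by rewrite /C PhiE; apply: I_ge0 => t _; exact: phi_ge0.
apply: (@der_near _ f _ _ _ (x / 2)) => //; first by move=> y h; rewrite /f h.
have fx : f x = Phi nu x by rewrite /f subrr normr0 x2.
apply: (der_of_quadratic_bound C0) => y _; rewrite fx {1}/f; case: ifPn => [h|_]; last first.
  rewrite (_ : _ - _ = 0); last by ring.
  by rewrite normr0 mulr_ge0// sqr_ge0.
have [y0 y2] : 0 < y /\ x / 2 <= y by move: h; rewrite ltr_norml => /andP[]; lra.
have xx : x / 2 <= x by lra.
have h1 := @Phi_convex nu x y (ltW x0); have h2 := @Phi_convex nu y x (ltW y0).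
have x0' : (x = 0 -> 1 < nu) by move=> e; move: x0; rewrite e ltxx.
have y0' : (y = 0 -> 1 < nu) by move=> e; move: y0; rewrite e ltxx.
have {}h1 := h1 x0' y0; have {}h2 := h2 y0' x0.
have h3 := @Phi_lip (nu - 1) (x / 2) x y x2 xx y2; rewrite -/C in h3.
have h4 : Phi nu y - Phi nu x - - Phi (nu - 1) x * (y - x) <= (y - x) * (Phi (nu - 1) x - Phi (nu - 1) y) by lra.
rewrite ger0_norm; last by lra.
apply: le_trans h4 _; apply: le_trans (ler_norm _) _; rewrite normrM distrC.
rewrite (distrC (Phi _ x)) (distrC x); apply: le_trans (ler_wpM2l (normr_ge0 _) h3) _.
by rewrite mulrA -expr2 real_normK ?num_real// mulrC.
Qed.

Lemma Phi_cont nu x : 0 < x -> {for x, continuous (Phi nu)}.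
Proof. by move=> x0; exact: der_cont (der_Phi nu x0). Qed.

Lemma hd_Phi nu : hasDeriv (Phi nu) (fun x => - Phi (nu - 1) x).
Proof.
apply: (hd_C1 (@der_Phi nu)) => x x0; apply: cont_opp; exact: Phi_cont.
Qed.

Lemma I_Rp_FTC (F f : R -> R) l C th : hasDeriv F f -> J Rp f -> 0 < th ->
  (forall t, 1 <= t -> `|F t| <= C / t `^ th) ->
  (forall t, 0 < t -> t <= 1 -> `|F t - l| <= C * t `^ th) -> I Rp f = - l.
Proof.
move=> hF jf th0 h1 h2.
have C0 : 0 <= C by have := h1 1 (lexx _); rewrite powR1 invr1 mulr1; exact: le_trans.
have cv := I_exhaust jf.
suff cl : I `[n.+1%:R^-1, n.+1%:R] f @[n --> \oo] --> - l by exact: cvg_unique cv cl.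
apply/cvgrPdist_le => /= e e0.
pose N := Num.bound ((2 * (C + 1) / e) `^ th^-1); exists N => // n /= Nn.
have n1 : 1 <= n.+1%:R :> R by rewrite ler1n.
have n0 : 0 < n.+1%:R :> R by rewrite ltr0n.
have ni : n.+1%:R^-1 <= 1 :> R by rewrite invf_le1.
rewrite (hd_I hF) ?invr_gt0//; last exact: le_trans ni n1.
have e1 := h1 _ n1; have := h2 n.+1%:R^-1 _ ni; rewrite invr_gt0 => /(_ n0) e2.
have e3 : (n.+1%:R^-1) `^ th = (n.+1%:R `^ th)^-1 :> R.
  by rewrite -(powR_inv1 (ltW n0)) -powRrM mulN1r powRN.
rewrite e3 in e2.
have e4 : 2 * (C + 1) / e <= n.+1%:R `^ th.
  have K0 : 0 <= 2 * (C + 1) / e by rewrite divr_ge0 ?(ltW e0)// mulr_ge0// addr_ge0.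
  rewrite -[leLHS](powRr1 K0) -[X in _ `^ X <= _](mulVf (lt0r_neq0 th0)) powRrM.
  apply: le_powR; rewrite ?(ltW th0) ?powR_ge0//.
  apply: le_trans (ltW (archi_boundP (powR_ge0 _ _))) _; rewrite ler_nat.
  exact: leq_trans Nn (leqnSn n).
have P0 : 0 < n.+1%:R `^ th :> R by rewrite powR_gt0.
have e5 : 2 * C / n.+1%:R `^ th <= e.
  by rewrite ler_pdivrMr//; move: e4; rewrite ler_pdivrMr// mulrC; lra.
move: e1 e2 e5; rewrite -mulrA; move: (C / _) => z.
move: (F n.+1%:R) (F _) => A B; rewrite !ler_norml => /andP[? ?] /andP[? ?] ?; lra.
Qed.

Lemma phi_deriv nu s : hasDeriv (phi (nu + 1) s) (fun t => nu * phi nu s t - phi (nu + 1) s t + s * phi (nu - 1) s t).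
Proof.
apply: hd_C1 => t t0; last first.
  apply: cvgD; last by apply: cvgM; [exact: cvg_cst|exact: phi_cont].
  apply: cvgD; first by apply: cvgM; [exact: cvg_cst|exact: phi_cont].
  by apply: cont_opp; exact: phi_cont.
have d := der_mul (der_powR (nu + 1 - 1) t0) (der_expst s t0).
apply: (der_eq d) => //; rewrite /phi addrK -(powRS nu t0) -(powRS (nu - 1) t0).
by field; rewrite gt_eqF.
Qed.

Lemma phi_small_at0 nu s : 0 < s -> exists C, forall t, 0 < t -> t <= 1 -> phi nu s t <= C * t.
Proof.
move=> s0; pose p := `|nu| + 2; have p0 : 0 < p by rewrite /p ltr_wpDl.
exists (p `^ p * s `^ (- p)) => t t0 t1; apply: le_trans (phi_le nu p0 s0 t0) _.
rewrite ler_wpM2l ?mulr_ge0 ?powR_ge0// /phi mul0r subr0.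
have h : 1 <= nu + p - 1 by have := ler_norm (- nu); rewrite normrN /p; lra.
apply: (@le_trans _ _ (t `^ (nu + p - 1))).
  by rewrite ler_piMr ?powR_ge0// expR_le1 oppr_le0 ltW.
by apply: ge1r_powR => //; rewrite t0.
Qed.

Lemma phi_small_atoo nu s : 0 <= s -> exists C, forall t, 1 <= t -> phi nu s t <= C / t.
Proof.
move=> s0; pose p := `|nu| + 1; have p0 : 0 < p by rewrite /p ltr_wpDl.
exists (p `^ p) => t t1; have t0 : 0 < t by apply: lt_le_trans t1.
rewrite ler_pdivlMr// /phi mulrAC powRS//.
apply: (@le_trans _ _ (t `^ p * expR (- t))).
  apply: ler_pM; rewrite ?powR_ge0 ?expR_ge0//.
    by apply: ler_powR => //; have := ler_norm nu; rewrite /p; lra.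
  by rewrite ler_expR gerBl divr_ge0// ltW.
by rewrite expRN ler_pdivrMr ?expR_gt0// powR_exp_le// ltW.
Qed.

(** The recurrence of the Macdonald functions: the derivative of [phi (nu + 1) s] is integrated, and
    its boundary values vanish. *)
Lemma Phi_rec nu s : 0 < s -> Phi (nu + 1) s = nu * Phi nu s + s * Phi (nu - 1) s.
Proof.
move=> s0; have j1 := phi_J nu s0; have j2 := phi_J (nu + 1) s0; have j3 := phi_J (nu - 1) s0.
have ja := J_sub mRp (J_scale nu mRp j1) j2.
have jj := J_add mRp ja (J_scale s mRp j3).
have [C1 H1] := phi_small_at0 (nu + 1) s0; have [C2 H2] := phi_small_atoo (nu + 1) (ltW s0).
pose C := Num.max C1 C2.
have := @I_Rp_FTC _ _ 0 C 1 (phi_deriv nu s) jj ltr01.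
rewrite (I_add mRp ja (J_scale s mRp j3)) (I_sub mRp (J_scale nu mRp j1) j2) !(I_scale _ mRp)//.
rewrite -!PhiE oppr0 => h.
suff : nu * Phi nu s - Phi (nu + 1) s + s * Phi (nu - 1) s = 0 by lra.
apply: h => t.
- move=> t1; have t0 : 0 < t by apply: lt_le_trans t1.
  rewrite ger0_norm ?phi_ge0// powRr1 ?(ltW t0)//; apply: le_trans (H2 t t1) _.
  by rewrite ler_wpM2r ?invr_ge0 ?(ltW t0)// le_max lexx orbT.
- move=> t0 t1; rewrite addr0 ger0_norm ?phi_ge0// powRr1 ?(ltW t0)//; apply: le_trans (H1 t t0 t1) _.
  by rewrite ler_wpM2r ?(ltW t0)// le_max lexx.
Qed.

(** Treated apart from [s > 0]: the factor [exp (- s / t)] no longer tames the origin, and the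
    boundary value there decays only like [t^nu]. *)
Lemma Gamma_rec nu : 0 < nu -> Phi (nu + 1) 0 = nu * Phi nu 0.
Proof.
move=> n0; have n1 : 0 < nu + 1 by lra.
have j1 := phi0_J n0; have j2 := phi0_J n1; have jj := J_sub mRp (J_scale nu mRp j1) j2.
have hd : hasDeriv (phi (nu + 1) 0) (fun x => nu * phi nu 0 x - phi (nu + 1) 0 x).
  by apply: (hd_eq (phi_deriv nu 0)) => // x _; rewrite mul0r addr0.
pose C := Num.max 1 ((2 * nu) `^ (2 * nu)).
have := @I_Rp_FTC _ _ 0 C nu hd jj n0.
rewrite (I_sub mRp (J_scale nu mRp j1) j2) (I_scale _ mRp)// oppr0 -!PhiE => h.
suff : nu * Phi nu 0 - Phi (nu + 1) 0 = 0 by lra.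
apply: h => t.
- move=> t1; have t0 : 0 < t by apply: lt_le_trans t1.
  rewrite ger0_norm ?phi_ge0// /phi mul0r subr0 addrK ler_pdivlMr ?powR_gt0//.
  rewrite mulrAC -powRDx// expRN ler_pdivrMr ?expR_gt0//.
  have := @powR_exp_le R (2 * nu) t; rewrite (_ : nu + nu = 2 * nu); last by ring.
  move=> /(_ _ (ltW t0)) h1; apply: le_trans (h1 _) _; first by rewrite mulr_gt0.
  by rewrite ler_wpM2r ?expR_ge0// le_max lexx orbT.
- move=> t0 t1; rewrite addr0 ger0_norm ?phi_ge0// /phi mul0r subr0 addrK mulrC.
  apply: ler_pM; rewrite ?expR_ge0 ?powR_ge0//.
  by rewrite le_max (_ : expR (- t) <= 1)// expR_le1 oppr_le0 ltW.
Qed.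

Lemma Gamma1 : Phi 1 0 = 1 :> R.
Proof.
have j := phi0_J (@ltr01 R).
have hd : hasDeriv (fun t => - expR (- t)) (phi 1 0).
  apply: hd_C1 => t t0; last exact: phi_cont.
  have d : der (fun y => - y) t (-1).
    by apply: (der_eq (der_scale (-1) (der_id t))) => [y|]; rewrite ?mulN1r ?mulr1.
  apply: (der_eq (der_scale (-1) (der_exp d))) => [y|]; first by rewrite mulN1r.
  by rewrite /phi subrr powRr0 mul0r subr0; ring.
rewrite PhiE (@I_Rp_FTC _ _ (-1) 1 1 hd j ltr01) ?opprK//.
- move=> t t1; have t0 : 0 < t by apply: lt_le_trans t1.
  rewrite normrN ger0_norm ?expR_ge0// powRr1 ?(ltW t0)// mul1r expRN lef_pV2 ?posrE ?expR_gt0//.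
  by have := expR_ge1Dx t; lra.
- move=> t t0 t1; rewrite powRr1 ?(ltW t0)// mul1r addrC ger0_norm.
    by have := expR_ge1Dx (- t); lra.
  by rewrite subr_ge0 expR_le1 oppr_le0 ltW.
Qed.

(* The substitution [t -> s / t]; the converse inequality is the same one for [- nu]. *)
Lemma Phi_refl_le nu s : 0 < s -> s `^ (- nu) * Phi nu s <= Phi (- nu) s.
Proof.
move=> s0; have j := phi_J nu s0.
rewrite (PhiE nu) -(I_scale _ mRp j).
have [] // := @J_exhaust R (fun x => s `^ (- nu) * phi nu s x) (Phi (- nu) s).
- by move=> x _; rewrite mulr_ge0 ?powR_ge0 ?phi_ge0.
- exact: locL1_scale (phi_locL1 nu s).
move=> n; set a : R := n.+1%:R^-1; set b : R := n.+1%:R.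
have b0 : 0 < b by rewrite ltr0n.
have a0 : 0 < a by rewrite invr_gt0.
have ab : a <= b by rewrite (@le_trans _ _ 1)// ?invf_le1// ler1n.
pose F x := s / x; pose G := phi (- nu) s.
have dF x : 0 < x -> der F x (s * - x ^- 2).
  by move=> x0; apply: (der_scale s); apply: der_inv; rewrite gt_eqF.
have F0 x : 0 < x -> 0 < F x by move=> x0; rewrite divr_gt0.
have cF x : 0 < x -> {for x, continuous (derive1 F)}.
  move=> x0; rewrite /prop_for /continuous_at.
  have -> : derive1 F x = s * - x ^- 2 by exact: der_derive1 (dF x x0).
  have : (s * - y ^- 2) @[y --> x] --> s * - x ^- 2.
    apply: cvgM; first exact: cvg_cst.
    apply: cvgN; apply: cvgV; first by rewrite expf_neq0// gt_eqF.
    exact: exprn_continuous.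
  apply: cvg_trans; apply: near_eq_cvg; exists x => //= y; rewrite /ball_/= ltr_norml => /andP[_ h].
  by rewrite (der_derive1 (dF y _))//; lra.
have h : (\int[leb]_(x in `[F b, F a]) (G x)%:E =
    \int[leb]_(x in `[a, b]) (((G \o F) * - derive1 F) x)%:E)%E.
  apply: integration_by_substitution_decreasing => //.
  - move=> x y; rewrite !in_itv/= => /andP[ax _] /andP[ay _] xy.
    by rewrite /F ltr_pM2l// ltf_pV2 ?posrE//; [exact: lt_le_trans ax|exact: lt_le_trans ay].
  - move=> x; rewrite in_itv/= => /andP[ax _]; apply: cF; exact: lt_trans ax.
  - by apply: cvgP; apply: cvg_at_right_filter; exact: cF.
  - by apply: cvgP; apply: cvg_at_left_filter; exact: cF.
  - split.
    + move=> x; rewrite in_itv/= => /andP[ax _]; have := dF x (lt_trans a0 ax); by case.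
    + by apply: cvg_at_right_filter; exact: der_cont (dF a a0).
    + by apply: cvg_at_left_filter; exact: der_cont (dF b b0).
  - apply: continuous_in_subspaceT => x; rewrite inE/= in_itv/= => /andP[h1 _].
    by apply: phi_cont; apply: lt_le_trans h1; exact: F0.
have -> : I `[a, b] (fun x => s `^ (- nu) * phi nu s x) = I `[F b, F a] G.
  rewrite [RHS](_ : _ = I `[a, b] (fun x => ((G \o F) * - derive1 F) x)); last by rewrite /I /Rintegral h.
  apply: I_eq => x; rewrite /= in_itv/= => /andP[ax _].
  have x0 : 0 < x by exact: lt_le_trans ax.
  rewrite [RHS](_ : _ = G (F x) * - derive1 F x)// (der_derive1 (dF x x0)) /G /F /phi.
  have -> : - (s / x) - s / (s / x) = - x - s / x by field; rewrite !gt_eqF.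
  have -> : (s / x) `^ (- nu - 1) = s `^ (- nu) / s * (x `^ (nu - 1) * x ^+ 2).
    rewrite powRM ?invr_ge0 ?(ltW s0) ?(ltW x0)// -(powR_inv1 (ltW x0)) -powRrM.
    rewrite -(powRS (- nu) s0) -(powR_mulrn 2 (ltW x0)) -powRDx//.
    rewrite (_ : -1 * (- nu - 1) = nu - 1 + 2%:R); last by ring.
    by field; rewrite gt_eqF.
  by field; rewrite !gt_eqF.
rewrite PhiE; apply: (I_subset mRp) => //; [exact: itv_Rp (F0 b b0)|exact: phi_J|].
by move=> x _; exact: phi_ge0.
Qed.

Lemma Phi_refl nu s : 0 < s -> Phi (- nu) s = s `^ (- nu) * Phi nu s.
Proof.
move=> s0; apply/eqP; rewrite eq_le Phi_refl_le// andbT.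
have := @Phi_refl_le (- nu) s s0; rewrite !opprK => h.
have := ler_wpM2l (powR_ge0 s (- nu)) h.
by rewrite mulrA -powRDx// addNr powRr0 mul1r.
Qed.

(** Integrates [1 - z^th <= exp (- z)] at [z = s / t]. It gives continuity at [s = 0] with a rate,
    for an exponent of choice. *)
Lemma Phi_interp nu th s : 0 <= th -> th <= 1 -> th < nu -> 0 < s ->
  Phi nu 0 - s `^ th * Phi (nu - th) 0 <= Phi nu s.
Proof.
move=> t0 t1 tn s0; have n0 : 0 < nu by lra.
have nt : 0 < nu - th by lra.
have j1 := phi0_J n0; have j2 := J_scale (s `^ th) mRp (phi0_J nt).
rewrite !PhiE -(I_scale _ mRp (phi0_J nt)) -(I_sub mRp j1 j2).
apply: (I_le mRp (J_sub mRp j1 j2) (phi_J _ s0)) => t /RpP tt.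
have st : 0 < s / t by rewrite divr_gt0.
have -> : phi nu s t = phi nu 0 t * expR (- (s / t)) by rewrite /phi mul0r subr0 expRD mulrA.
have -> : s `^ th * phi (nu - th) 0 t = phi nu 0 t * (s / t) `^ th.
  rewrite /phi powRM ?invr_ge0 ?(ltW s0) ?(ltW tt)// -(powR_inv1 (ltW tt)) -powRrM mulN1r.
  by rewrite (_ : nu - th - 1 = nu - 1 + - th) ?powRDx//; ring.
suff h : 1 - (s / t) `^ th <= expR (- (s / t)).
  have := ler_wpM2l (phi_ge0 nu 0 t) h; lra.
have [h|h] := leP (s / t) 1.
  have : s / t <= (s / t) `^ th by apply: ger1_powR; rewrite ?st.
  by have := expR_ge1Dx (- (s / t)); lra.
have : 1 <= (s / t) `^ th by have := @le_powR R th 1 (s / t) t0 ler01 (ltW h); rewrite powR1.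
by have := expR_ge0 (- (s / t)); lra.
Qed.

Lemma hd_compare (f df g dg : R -> R) x y : hasDeriv f df -> hasDeriv g dg -> 0 < x -> x <= y ->
  (forall t, x <= t -> t <= y -> df t <= dg t) -> f y - f x <= g y - g x.
Proof.
move=> hf hg x0 xy h; rewrite -(hd_I hf x0 xy) -(hd_I hg x0 xy).
apply: I_le; [exact: measurable_itv|exact: (hd_L1 hf)|exact: (hd_L1 hg)|].
by move=> t; rewrite /= in_itv/= => /andP[? ?]; exact: h.
Qed.

Lemma le_of_powR_eps X Y K th s : 0 < s -> 0 < th -> 0 <= K ->
  (forall e, 0 < e -> e <= s -> X <= Y + e `^ th * K) -> X <= Y.
Proof.
move=> s0 t0 K0 h; apply/ler_addgt0Pr => d d0.
pose e := Num.min s ((d / (K + 1)) `^ th^-1).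
have K1 : 0 < K + 1 by lra.
have dk : 0 < d / (K + 1) by rewrite divr_gt0.
have e0 : 0 < e by rewrite lt_min s0 powR_gt0.
have es : e <= s by rewrite ge_min lexx.
apply: le_trans (h e e0 es) _; rewrite lerD2l.
have h1 : e `^ th <= d / (K + 1).
  rewrite -[leRHS](powRr1 (ltW dk)) -[X in _ <= _ `^ X](mulVf (lt0r_neq0 t0)) powRrM.
  by apply: le_powR; rewrite ?(ltW t0) ?(ltW e0)// ge_min lexx orbT.
apply: le_trans (ler_wpM2r K0 h1) _.
by rewrite mulrAC ler_pdivrMr// ler_pM2l// lerDl.
Qed.

(** By reflection the derivative of [Phi nu] is [- s^(nu - 1) Phi (1 - nu) s], dominated by that of
    a multiple of [s^nu]. The comparison runs over [[e, s]], and the piece below [e] is removed by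
    [Phi_interp]. *)
Lemma Phi_near0_lt1 nu s : 0 < nu -> nu < 1 -> 0 < s ->
  Phi nu 0 - Phi nu s <= Phi (1 - nu) 0 / nu * s `^ nu.
Proof.
move=> n0 n1 s0; have n2 : 0 < nu / 2 by rewrite divr_gt0.
have G0 : 0 < Phi (nu / 2) 0 by apply: Phi_gt0.
have G1 : 0 < Phi (1 - nu) 0 by apply: Phi_gt0 => // _; lra.
apply: (@le_of_powR_eps _ _ (Phi (nu / 2) 0) (nu / 2) s s0 n2 (ltW G0)) => e e0 es.
have h1 : Phi nu 0 - e `^ (nu / 2) * Phi (nu / 2) 0 <= Phi nu e.
  have := @Phi_interp nu (nu / 2) e (ltW n2); rewrite (_ : nu - nu / 2 = nu / 2); last by field.
  by apply => //; lra.
have h2 := @hd_compare _ _ _ _ e s (hd_scale (- (Phi (1 - nu) 0 / nu)) (hd_powR nu)) (hd_Phi nu) e0 es.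
have {}h2 : Phi (1 - nu) 0 / nu * (e `^ nu) - Phi (1 - nu) 0 / nu * (s `^ nu) <= Phi nu s - Phi nu e.
  apply: le_trans (h2 _) => [|t et ts]; first by rewrite !mulNr opprK addrC.
  have t0 : 0 < t by exact: lt_le_trans et.
  rewrite mulNr lerN2 (_ : nu - 1 = - (1 - nu)); last by ring.
  rewrite Phi_refl// mulrA divfK ?gt_eqF// [leRHS]mulrC ler_wpM2l ?powR_ge0//.
  by apply: Phi_decr => //; [move=> _; lra|exact: ltW].
have : 0 <= Phi (1 - nu) 0 / nu * (e `^ nu) by rewrite mulr_ge0 ?powR_ge0// divr_ge0// ltW.
lra.
Qed.

Lemma Phi_near0_gt1 nu s : 1 < nu -> 0 < s -> Phi nu 0 - Phi nu s <= s * Phi (nu - 1) 0.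
Proof.
by move=> n1 s0; have := @Phi_convex nu 0 s (lexx _) (fun=> n1) s0; rewrite subr0; lra.
Qed.

(** The derivative of [Phi 0] is [- Phi 1 s / s], and [Phi 1] lies between [1 - s^(1/2) Gamma (1/2)]
    and 1; integrate from [s] to 1. *)
Lemma Phi0_bounds s : 0 < s -> s <= 1 ->
  Phi 0 1 - ln s - 2 * Phi (1 / 2) 0 <= Phi 0 s /\ Phi 0 s <= Phi 0 1 - ln s.
Proof.
move=> s0 s1; have hl := hd_ln R.
have P1 x : 0 < x -> Phi (0 - 1) x = Phi 1 x / x.
  by move=> x0; have := Phi_rec 0 x0; rewrite add0r mul0r add0r => ->; rewrite mulrC mulKf ?gt_eqF.
have h12 : 0 < 1 / 2 :> R by rewrite divr_gt0.
have c1 x : 0 < x -> Phi 1 x <= 1.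
  by move=> x0; have := @Phi_decr 1 0 x (lexx _) (fun=> ltr01) (ltW x0); rewrite Gamma1.
have c2 x : 0 < x -> 1 - x `^ (1 / 2) * Phi (1 / 2) 0 <= Phi 1 x.
  move=> x0; have := @Phi_interp 1 (1 / 2) x (ltW h12); rewrite Gamma1 (_ : 1 - 1 / 2 = 1 / 2); last by field.
  by apply => //; lra.
split.
- have hg := hd_add (hd_scale (-1) hl) (hd_scale (2 * Phi (1 / 2) 0) (hd_powR (1 / 2))).
  have := hd_compare (hd_Phi 0) hg s0 s1; rewrite ln1 powR1 mulr0 mulr1 => h.
  have : 0 <= 2 * Phi (1 / 2) 0 * s `^ (1 / 2).
    by rewrite mulr_ge0 ?powR_ge0// mulr_ge0// ltW// Phi_gt0.
  suff : Phi 0 1 - Phi 0 s <= 0 + 2 * Phi (1 / 2) 0 - (-1 * ln s + 2 * Phi (1 / 2) 0 * s `^ (1 / 2)) by lra.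
  apply: h => t st t1; have t0 : 0 < t by exact: lt_le_trans st.
  rewrite P1// -mulNr.
  have -> : -1 * t^-1 + 2 * Phi (1 / 2) 0 * (1 / 2 * t `^ (1 / 2 - 1)) =
     (-1 + t `^ (1 / 2) * Phi (1 / 2) 0) / t.
    by rewrite -(powRS (1 / 2) t0); field; rewrite gt_eqF.
  by rewrite ler_wpM2r ?invr_ge0 ?(ltW t0)//; have := c2 t t0; lra.
- have := hd_compare (hd_scale (-1) hl) (hd_Phi 0) s0 s1; rewrite ln1 mulr0 => h.
  suff : 0 - (-1 * ln s) <= Phi 0 1 - Phi 0 s by lra.
  apply: h => t st t1; have t0 : 0 < t by exact: lt_le_trans st.
  by rewrite P1// mulN1r lerN2 ler_pdivrMr// mulVf ?gt_eqF// c1.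
Qed.

(** [Phi 1] has derivative [- Phi 0], which is only logarithmically singular; integrating the upper
    bound for [Phi 0] gives the term [s ln s]. *)
Lemma Phi1_near0 s : 0 < s -> s <= 1 -> 1 - Phi 1 s <= s * (Phi 0 1 + 1 - ln s).
Proof.
move=> s0 s1; have h12 : 0 < 1 / 2 :> R by rewrite divr_gt0.
have G0 : 0 < Phi (1 / 2 : R) 0 by apply: Phi_gt0.
have F0 : 0 < Phi (0 : R) 1 by apply: Phi_gt0 => // /eqP; rewrite oner_eq0.
apply: (@le_of_powR_eps _ _ (Phi (1 / 2) 0) (1 / 2) s s0 h12 (ltW G0)) => e e0 es.
have h1 : 1 - e `^ (1 / 2) * Phi (1 / 2) 0 <= Phi 1 e.
  have := @Phi_interp 1 (1 / 2) e (ltW h12); rewrite Gamma1 (_ : 1 - 1 / 2 = 1 / 2); last by field.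
  by apply => //; lra.
have hid : hasDeriv (fun x : R => x) (fun=> 1).
  by apply: (hd_C1 (fun x _ => der_id x)) => x _; exact: cvg_cst.
have hg := hd_add (hd_scale (- (Phi 0 1 + 1)) hid) (hd_mul hid (hd_ln R)).
have := hd_compare hg (hd_Phi 1) e0 es => h2.
have {}h2 : - (Phi 0 1 + 1) * s + s * ln s - (- (Phi 0 1 + 1) * e + e * ln e) <= Phi 1 s - Phi 1 e.
  apply: h2 => t et ts; have t0 : 0 < t by exact: lt_le_trans et.
  rewrite subrr mulfV ?gt_eqF// mulr1 mul1r.
  by have [_] := Phi0_bounds t0 (le_trans ts s1); lra.
have h3 : e * ln e <= 0 by rewrite mulr_ge0_le0 ?(ltW e0)// ln_le0// (le_trans es).
have h4 : 0 <= (Phi 0 1 + 1) * e by rewrite mulr_ge0 ?(ltW e0)//; lra.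
lra.
Qed.

End BesselTheory.

(** * Tails *)

Section Tails.
Variable R : realType.
Local Notation leb := (@lebesgue_measure R).
Local Notation Rp := (@Rp R).
Local Notation wJ := (wintegrable Rp).
Implicit Types (f g u du h dh : R -> R) (c x y e C : R).

(** The difference of the two derivatives has zero integral over every interval, so it vanishes
    almost everywhere by the Lebesgue differentiation theorem. *)
Lemma hd_unique u d1 d2 : hasDeriv u d1 -> hasDeriv u d2 ->
  exists Z, [/\ measurable Z, leb Z = 0 & forall x, 0 < x -> ~ Z x -> d1 x = d2 x].
Proof.
move=> h1 h2; pose d x := d1 x - d2 x.
have jd a b : 0 < a -> J `[a, b] d.
  by move=> a0; apply: J_sub; [exact: measurable_itv|exact: (hd_L1 h1)|exact: (hd_L1 h2)].
have d0 a b : 0 < a -> I `[a, b] d = 0.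
  move=> a0; have [ab|ba] := leP a b; last by rewrite set_itv_ge -?ltNge// /I Rintegral_set0.
  rewrite /d I_sub; [|exact: measurable_itv|exact: (hd_L1 h1)|exact: (hd_L1 h2)].
  by rewrite (hd_I h1)// (hd_I h2)// subrr.
have ae0 n : leb.-negligible [set x | (`]n.+1%:R^-1, n.+1%:R[%classic : set R) x /\ d x != 0].
  set a : R := n.+1%:R^-1; set b : R := n.+1%:R.
  have a0 : 0 < a by rewrite invr_gt0.
  pose f x := d x * \1_(`[a, b]%classic : set R) x.
  have jf : J setT f.
    apply/(J_indic_sub d measurableT (measurable_itv _) (@subsetT _ _)); exact: jd.
  have F0 x : \int[leb]_(t in `]-oo, x]) f t = 0.
    rewrite -[LHS]/(I `]-oo, x] f) /f -I_indic.
    have -> : `]-oo, x]%classic `&` `[a, b]%classic = `[a, Num.min x b]%classic.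
      apply/seteqP; split => y /=; rewrite !in_itv/= le_min.
        by case=> -> /andP[-> ->].
      by case/andP=> -> /andP[-> ->].
    exact: d0.
  have [] := @FTC1Ny R f.
  - move=> y; apply: (J_set measurableT (measurable_itv _) (@subsetT _ _) jf).
  - by apply: open_integrable_locally => //; exact: openT.
  move=> Z [mZ Z0 sZ]; exists Z; split => //; apply: subset_trans sZ => x /= [xab dx].
  move=> [_]; rewrite (_ : (fun x0 => _) = fun=> 0); last by apply/funext => y; exact: F0.
  rewrite derive1_cst /f indicE mem_set ?mulr1.
    by move=> e; move: dx; rewrite -e eqxx.
  by move: xab; rewrite /= !in_itv/= => /andP[/ltW -> /ltW ->].
have /negligible_bigcup [Z [mZ Z0 sZ]] := ae0.
exists Z; split => // x x0 nZ; apply/eqP; rewrite -subr_eq0; apply: contrapT => /negP dx; apply: nZ; apply: sZ.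
have : Rp x by apply/RpP.
pose N := maxn (Num.bound x) (Num.bound x^-1).
exists N => //=; split => //; rewrite in_itv/=; apply/andP; split.
  rewrite invf_plt ?posrE//; apply: lt_le_trans (archi_boundP _) _; rewrite ?invr_ge0 ?(ltW x0)//.
  by rewrite ler_nat (leq_trans (leq_maxr _ _) (leqnSn _)).
apply: lt_le_trans (archi_boundP (ltW x0)) _.
by rewrite ler_nat (leq_trans (leq_maxl _ _) (leqnSn _)).
Qed.

Lemma wint_ae Z f g : measurable Z -> leb Z = 0 -> measurable_fun Rp f -> measurable_fun Rp g ->
  (forall x, 0 < x -> ~ Z x -> f x = g x) -> wint f = wint g.
Proof.
move=> mZ Z0 mf mg fg; rewrite /wint /Rintegral; congr fine; apply: ae_eq_integral.
- exact: mRp.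
- by apply/measurable_EFinP; apply: measurable_funM => //; exact: m_id.
- by apply/measurable_EFinP; apply: measurable_funM => //; exact: m_id.
- exists Z; split => // x /= nx; apply: contrapT => zx; apply: nx => /RpP x0.
  by rewrite fg.
Qed.

Lemma inv1p_J : J Rp (fun x => (1 + x) ^- 2).
Proof.
have d x : 0 < x -> der (fun y => - (1 + y)^-1) x ((1 + x) ^- 2).
  move=> x0; have x1 : 1 + x != 0 by rewrite gt_eqF// ltr_pwDl// ltW.
  have d1 : der (fun y => 1 + y) x 1.
    by apply: (der_eq (der_add (der_cst 1 x) (der_id x))) => //; rewrite add0r.
  apply: (der_eq (der_scale (-1) (@der_comp _ _ (fun y => 1 + y) x _ _ (der_inv x1) d1))) => [y|].
    by rewrite mulN1r.
  by rewrite mulr1 mulN1r opprK.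
have ct x : 0 < x -> {for x, continuous (fun y : R => (1 + y) ^- 2)}.
  move=> x0; have x1 : 1 + x != 0 by rewrite gt_eqF// ltr_pwDl// ltW.
  apply: cvgV; first by rewrite expf_neq0.
  by apply: cvgM; (apply: cvgD; [exact: cvg_cst|exact: cvg_id]).
have hd := hd_C1 d ct.
have [] // := @J_exhaust R (fun x => (1 + x) ^- 2) 1 _ (hd_L1 hd).
  by move=> x x0; rewrite invr_ge0 sqr_ge0.
move=> n; rewrite (hd_I hd) ?invr_gt0//; last by rewrite (@le_trans _ _ 1)// ?invf_le1// ler1n.
have h1 : (1 + n.+1%:R^-1)^-1 <= 1 :> R by rewrite invf_le1 ?lerDl ?invr_ge0// ltr_pwDl// invr_ge0.
have h2 : 0 <= (1 + n.+1%:R)^-1 :> R by rewrite invr_ge0 addr_ge0.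
lra.
Qed.

Lemma wJ_tail f c C : 0 < c -> measurable_fun Rp f -> (forall x, 0 < x -> x <= c -> f x = 0) ->
  (forall x, c < x -> `|f x| <= C / x ^+ 3) -> wJ f.
Proof.
move=> c0 mf f0 fC; pose K := `|C| * ((1 + c) / c) ^+ 2.
apply: (@J_le _ _ _ (fun x => K * (1 + x) ^- 2)); [exact: mRp| | |].
- by apply: measurable_funM => //; exact: m_id.
- move=> x /RpP x0; have K0 : 0 <= K by rewrite mulr_ge0 ?sqr_ge0.
  have [xc|cx] := leP x c; first by rewrite f0// mul0r normr0 mulr_ge0// invr_ge0 sqr_ge0.
  rewrite normrM (gtr0_norm x0); apply: (@le_trans _ _ (`|C| / x ^+ 2)).
    have := ler_wpM2r (ltW x0) (fC x cx) => /le_trans; apply.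
    rewrite (_ : C / x ^+ 3 * x = C / x ^+ 2); last by field; rewrite gt_eqF.
    by rewrite ler_wpM2r ?ler_norm// invr_ge0 sqr_ge0.
  rewrite /K -mulrA ler_wpM2l// -exprVn -exprVn -exprMn.
  apply: lerXn2r; rewrite ?nnegrE ?invr_ge0 ?(ltW x0)//.
    by rewrite mulr_ge0 ?invr_ge0 ?divr_ge0 ?addr_ge0 ?(ltW x0) ?(ltW c0).
  rewrite -div1r ler_pdivrMr// mulrAC ler_pdivlMr ?addr_gt0// mul1r mulrC mulrA ler_pdivlMr//; lra.
- exact: J_scale mRp inv1p_J.
Qed.

Lemma I_closed_left c b f g : c <= b -> J `[c, b] f -> J `[c, b] g ->
  (forall x, c < x -> x <= b -> f x = g x) -> I `[c, b] f = I `[c, b] g.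
Proof.
move=> cb jf jg fg.
have j h : J `[c, b] h -> I `[c, b] h = I `]c, b] h.
  move=> jh; rewrite /I Rintegral_itv_obnd_cbnd//.
  by apply: (J_set _ _ _ jh) => // x; rewrite /= !in_itv/= => /andP[/ltW -> ->].
rewrite !j//; apply: I_eq => x; rewrite /= in_itv/= => /andP[h1 h2]; exact: fg.
Qed.

Lemma wint_tail h dh f c C : 0 < c -> hasDeriv h dh -> wJ f ->
  (forall x, 0 < x -> x <= c -> f x = 0) -> (forall x, c < x -> f x * x = dh x) ->
  (forall x, c <= x -> `|h x| <= C / x) -> wint f = - h c.
Proof.
move=> c0 hh jf f0 fd hC.
have cv := I_exhaust jf.
suff cl : I `[n.+1%:R^-1, n.+1%:R] (fun x => f x * x) @[n --> \oo] --> - h c by exact: cvg_unique cv cl.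
apply/cvgrPdist_le => /= e e0.
have C0 : 0 <= C.
  by have := le_trans (normr_ge0 _) (hC c (lexx c)); rewrite ler_pdivlMr// mul0r.
pose N := maxn (maxn (Num.bound c) (Num.bound c^-1)) (Num.bound (C / e)); exists N => // n /= Nn.
have Nc : c < n.+1%:R.
  apply: lt_le_trans (archi_boundP (ltW c0)) _; rewrite ler_nat.
  by apply: leq_trans (leqW Nn); rewrite !leq_max leqnn.
have Nc' : n.+1%:R^-1 < c.
  rewrite invf_plt ?posrE//; apply: lt_le_trans (archi_boundP _) _; rewrite ?invr_ge0 ?(ltW c0)//.
  by rewrite ler_nat; apply: leq_trans (leqW Nn); rewrite !leq_max leqnn orbT.
have Ne : C / e < n.+1%:R.
  apply: lt_le_trans (archi_boundP _) _; rewrite ?divr_ge0 ?(ltW e0)//.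
  by rewrite ler_nat; apply: leq_trans (leqW Nn); rewrite !leq_max leqnn !orbT.
have n0 : 0 < n.+1%:R :> R by [].
have ni : 0 < n.+1%:R^-1 :> R by rewrite invr_gt0.
have jj := wJ_itv n.+1%:R ni jf.
rewrite (I_split (ltW Nc') (ltW Nc))//.
rewrite (@I_eq _ _ _ (fun=> 0)); last first.
  move=> x; rewrite /= in_itv/= => /andP[h1 h2]; rewrite f0 ?mul0r//; exact: lt_le_trans h1.
have -> : I `[n.+1%:R^-1, c] (fun=> 0) = 0 by rewrite /I Rintegral_cst// mul0r.
rewrite add0r (@I_closed_left _ _ _ dh (ltW Nc)).
- rewrite (hd_I hh)// ?(ltW Nc)// [X in `|X|](_ : _ = - h n.+1%:R) ?normrN; last by ring.
  apply: le_trans (hC _ (ltW Nc)) _; rewrite ler_pdivrMr// mulrC -ler_pdivrMr//.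
  exact: ltW.
- exact: wJ_itv.
- exact: (hd_L1 hh).
- by move=> x h1 _; exact: fd.
Qed.

End Tails.

(** * The outer solution and matching *)

Section OuterSolution.
Variable R : realType.

Lemma ler_sq (x y : R) : 0 <= x -> x <= y -> x ^+ 2 <= y ^+ 2.
Proof. by move=> x0 xy; rewrite ler_sqr ?nnegrE// (le_trans x0). Qed.

Variables (mu s : R).
Hypotheses (mu0 : 0 <= mu) (s0 : 0 < s).
Implicit Types (r x y C : R).

Definition sig r : R := s / 4 * r ^+ 2.
Definition uo r : R := r `^ (- mu) * Phi mu (sig r).
(** The term that differentiating [Phi mu] contributes to the derivative of [uo], up to the factor
    [- s / (2 r)]. *)
Definition zo r : R := r `^ (2 - mu) * Phi (mu - 1) (sig r).
(* the flux [r * uo' r] *)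
Definition qo r : R := - mu * uo r - s / 2 * zo r.

Lemma sig_gt0 r : 0 < r -> 0 < sig r.
Proof. by move=> r0; rewrite /sig; pos. Qed.

Lemma der_sig r : der sig r (s / 2 * r).
Proof.
apply: (der_eq (der_scale (s / 4) (der_mul (der_id r) (der_id r)))) => //.
by field.
Qed.

Let pw2 r : 0 < r -> r `^ (2 - mu) = r `^ (- mu) * r ^+ 2.
Proof. by move=> r0; rewrite -(powR_mulrn 2 (ltW r0)) -powRDx// addrC. Qed.

Lemma der_uo r : 0 < r -> der uo r (qo r / r).
Proof.
move=> r0; have d := der_mul (der_powR (- mu) r0) (@der_comp _ _ sig r _ _ (der_Phi mu (sig_gt0 r0)) (der_sig r)).
apply: (der_eq d) => //; rewrite /qo /zo /uo pw2// -(powRS (- mu) r0).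
by field; rewrite gt_eqF.
Qed.

Lemma der_zo r : 0 < r -> der zo r (r `^ (- mu) * ((2 - mu) * r * Phi (mu - 1) (sig r)
   - s / 2 * r ^+ 3 * Phi (mu - 1 - 1) (sig r))).
Proof.
move=> r0; have d := der_mul (der_powR (2 - mu) r0) (@der_comp _ _ sig r _ _ (der_Phi (mu - 1) (sig_gt0 r0)) (der_sig r)).
apply: (der_eq d) => //; rewrite pw2//.
have -> : r `^ (2 - mu - 1) = r `^ (- mu) * r.
  by rewrite (_ : 2 - mu - 1 = (- mu + 1 + 1) - 1); [rewrite addrK -(powRS (- mu + 1) r0) addrK|ring].
by ring.
Qed.

(** The radial equation [(r u')' = (mu^2 / r + s r) u]; it is the three-term recurrence of [Phi] in
    disguise. *)
Lemma der_qo r : 0 < r -> der qo r ((mu ^+ 2 / r + s * r) * uo r).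
Proof.
move=> r0; have d := der_add (der_scale (- mu) (der_uo r0)) (der_scale (- (s / 2)) (der_zo r0)).
apply: (der_eq d) => [y|]; first by rewrite /qo !mulNr.
have rc : Phi mu (sig r) = (mu - 1) * Phi (mu - 1) (sig r) + sig r * Phi (mu - 1 - 1) (sig r).
  by have := Phi_rec (mu - 1) (sig_gt0 r0); rewrite subrK.
rewrite /qo /zo /uo pw2// rc.
move: (Phi (mu - 1) (sig r)) (Phi (mu - 1 - 1) (sig r)) (r `^ _) => A B P; rewrite /sig.
by field; rewrite gt_eqF.
Qed.

Lemma hd_uo : hasDeriv uo (fun r => qo r / r).
Proof.
apply: (hd_C1 der_uo) => r r0; apply: cvgM; first exact: der_cont (der_qo r0).
exact: inv_cont.
Qed.

Lemma hd_qo : hasDeriv qo (fun r => (mu ^+ 2 / r + s * r) * uo r).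
Proof.
apply: (hd_C1 der_qo) => r r0; apply: cvgM; last exact: der_cont (der_uo r0).
apply: cvgD; first by apply: cvgM; [exact: cvg_cst|exact: inv_cont].
by apply: cvgM; [exact: cvg_cst|exact: cvg_id].
Qed.

Lemma Phi_gt0' nu x : 0 < x -> 0 < Phi nu x.
Proof. by move=> x0; apply: Phi_gt0; [exact: ltW|move=> h; move: x0; rewrite h ltxx]. Qed.

Lemma uo_gt0 r : 0 < r -> 0 < uo r.
Proof. by move=> r0; rewrite mulr_gt0 ?powR_gt0// Phi_gt0'// sig_gt0. Qed.

Lemma zo_gt0 r : 0 < r -> 0 < zo r.
Proof. by move=> r0; rewrite mulr_gt0 ?powR_gt0// Phi_gt0'// sig_gt0. Qed.

(** The decay estimate with exponent 2 gives [r^(-4)], of which [r^(-2)] survives the factor [r^2]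
    in [zo]. This suffices for integrability and for the boundary terms. *)
Lemma outer_decay (c : R) : 0 < c -> exists2 C : R, 0 < C & forall r, c <= r -> uo r <= C / r ^+ 2 /\ `|qo r| <= C / r ^+ 2.
Proof.
move=> c0; have k1 : 0 < mu + 2 by rewrite ltr_wpDl.
have k2 : 0 < mu - 1 + 2 by rewrite (_ : mu - 1 + 2 = mu + 1); [rewrite ltr_wpDl|ring].
have two0 : 0 < 2 :> R by [].
pose K nu : R := 2 `^ 2 * (16 / s ^+ 2) * Phi (nu + 2) 0.
have bd (nu r : R) : 0 < nu + 2 -> 0 < r -> Phi nu (sig r) <= K nu / r ^+ 4.
  move=> n2 r0; apply: le_trans (Phi_decay two0 n2 (sig_gt0 r0)) _.
  rewrite powRN (powR_mulrn 2 (ltW (sig_gt0 r0))) /K /sig le_eqVlt; apply/orP; left; apply/eqP.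
  by field; rewrite !gt_eqF.
have K0 (nu : R) : 0 < nu + 2 -> 0 < K nu.
  by move=> n2; rewrite /K mulr_gt0 ?Phi_gt0// mulr_gt0 ?powR_gt0// divr_gt0// exprn_gt0.
pose P : R := c `^ (- mu); have P0 : 0 < P by rewrite powR_gt0.
pose C1 := P * K mu / c ^+ 2; pose C2 := P * K (mu - 1).
have C10 : 0 < C1 by rewrite divr_gt0 ?exprn_gt0// mulr_gt0// K0.
have C20 : 0 < C2 by rewrite mulr_gt0// K0.
have b1 r : c <= r -> uo r <= C1 / r ^+ 2 /\ zo r <= C2 / r ^+ 2.
  move=> cr; have r0 : 0 < r by exact: lt_le_trans cr.
  have Pr : r `^ (- mu) <= P by rewrite /P !powRN lef_pV2 ?posrE ?powR_gt0// le_powR// ltW.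
  split.
    apply: (@le_trans _ _ (P * (K mu / r ^+ 4))).
      by apply: ler_pM; rewrite ?powR_ge0 ?bd// ltW// Phi_gt0'// sig_gt0.
    rewrite /C1 (_ : P * (K mu / r ^+ 4) = P * K mu / r ^+ 2 / r ^+ 2); last by field; rewrite gt_eqF.
    apply: ler_wpM2r; first by rewrite invr_ge0 sqr_ge0.
    apply: ler_wpM2l; first by apply: mulr_ge0; apply: ltW => //; exact: K0.
    by rewrite lef_pV2 ?posrE ?exprn_gt0// ler_sq ?(ltW c0).
  rewrite /zo pw2//; apply: (@le_trans _ _ (P * r ^+ 2 * (K (mu - 1) / r ^+ 4))).
    apply: ler_pM; last exact: bd.
    - by apply: mulr_ge0; [exact: powR_ge0|exact: sqr_ge0].
    - by apply: ltW; apply: Phi_gt0'; exact: sig_gt0.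
    - by apply: ler_wpM2r => //; exact: sqr_ge0.
  by rewrite /C2 le_eqVlt; apply/orP; left; apply/eqP; field; rewrite gt_eqF.
exists (C1 + mu * C1 + s / 2 * C2).
  have h1 : 0 <= mu * C1 by rewrite mulr_ge0// ltW.
  have h2 : 0 < s / 2 * C2 by rewrite mulr_gt0// divr_gt0.
  lra.
move=> r cr; have r0 : 0 < r by exact: lt_le_trans cr.
have [h1 h2] := b1 r cr; have i0 : 0 < (r ^+ 2)^-1 by rewrite invr_gt0 exprn_gt0.
move: h1 h2; move: i0; move: (_^-1) => i i0 h1 h2.
have c1 : 0 <= C1 * i by rewrite mulr_ge0 ?ltW.
have c2 : 0 <= C2 * i by rewrite mulr_ge0 ?ltW.
have c3 := ler_wpM2l mu0 h1; have s2 : 0 <= s / 2 by rewrite divr_ge0 ?ltW.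
have c4 := ler_wpM2l s2 h2.
have u0 := uo_gt0 r0; have z0 := zo_gt0 r0.
have c5 := mulr_ge0 mu0 (ltW u0); have c6 := mulr_ge0 s2 (ltW z0).
have c7 := mulr_ge0 mu0 c1; have c8 := mulr_ge0 s2 c2.
split; first by lra.
by rewrite ler_norml; apply/andP; split; rewrite /qo; lra.
Qed.

End OuterSolution.

(** * Gluing inner and outer solutions at [c] *)

Section Matching.
Variable R : realType.
Local Notation leb := (@lebesgue_measure R).
Local Notation Rp := (@Rp R).
Local Notation wJ := (wintegrable Rp).
Local Notation E := ((R -> R) * (R -> R))%type.
Variables (W psi0 dpsi0 : R -> R) (c mu a M : R).
Hypothesis H : model W psi0 dpsi0 c mu a M.
Hypothesis Hd : forall x, c < x -> dpsi0 x = - mu * x `^ (- mu - 1).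
Implicit Types (p q : E) (x y e s C : R).
Local Notation DT := (DT W).
Local Notation tE := (tE W).

Definition inner_part (f : R -> R) x : R := if x <= c then f x else 0.
Definition outer_part (f : R -> R) x : R := if x <= c then 0 else f x.

Let c0 : 0 < c. Proof. exact: md_c H. Qed.
Let mu0 : 0 <= mu. Proof. exact: md_mu H. Qed.

Let itvE x : 0 < x -> \1_(`]0, c]%classic : set R) x = (if x <= c then 1 else 0) :> R.
Proof.
move=> x0; rewrite indicE; case: ifPn => h; first by rewrite mem_set//= in_itv/= x0.
by rewrite memNset//= in_itv/= x0/= => h'; rewrite h' in h.
Qed.

Let nle x : c < x -> (x <= c) = false. Proof. by move=> h; apply/negbTE; rewrite -ltNge. Qed.

Let mind : measurable_fun Rp (fun x => \1_(`]0, c]%classic : set R) x : R).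
Proof. by apply: measurable_indic; exact: measurable_itv. Qed.

Lemma inn_wJ f : wJ f -> wJ (inner_part f).
Proof.
move=> j; apply: (wJ_eq _ (@wJ_bnd R 1 _ f mind _ j)) => x x0.
- by rewrite itvE// /inner_part; case: ifP => _; rewrite ?mul1r ?mul0r.
- by rewrite itvE//; case: ifP => _; rewrite ?normr1 ?normr0.
Qed.

Lemma out_wJ f : wJ f -> wJ (outer_part f).
Proof.
move=> j; apply: (wJ_eq _ (wJ_sub j (inn_wJ j))) => x _.
by rewrite /outer_part /inner_part; case: ifP => _; rewrite ?subrr ?subr0.
Qed.

Lemma wint_inn_out f : wJ f -> wint f = wint (inner_part f) + wint (outer_part f).
Proof.
move=> j; rewrite -wint_add; [|exact: inn_wJ|exact: out_wJ].
by apply: wint_eq => x _; rewrite /outer_part /inner_part; case: ifP => _; rewrite ?add0r ?addr0.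
Qed.

Lemma wJ_glue f f0 C : measurable_fun Rp f -> wintegrable `]0, c] f0 ->
  (forall x, x <= c -> f x = f0 x) -> (forall x, c < x -> `|f x| <= C / x ^+ 3) -> wJ f.
Proof.
move=> mf j f1 f2.
have sub : `]0, c]%classic `<=` Rp by move=> x; rewrite /= in_itv/= => /andP[h _]; apply/RpP.
have j1 : wJ (inner_part f).
  have := (J_indic_sub _ mRp (measurable_itv _) sub).1 j; apply: J_eq; first exact: mRp.
  move=> x /RpP x0; rewrite itvE// /inner_part; case: ifP => h; last by rewrite mulr0 mul0r.
  by rewrite mulr1 f1.
have mo : measurable_fun Rp (outer_part f).
  apply: (eq_measurable_fun (fun x => (1 - \1_(`]0, c]%classic : set R) x) * f x)).
    move=> x; rewrite inE => /RpP x0; rewrite itvE// /outer_part; case: ifP => _.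
      by rewrite subrr mul0r.
    by rewrite subr0 mul1r.
  by apply: measurable_funM => //; apply: measurable_funB.
have j2 : wJ (outer_part f).
  apply: (wJ_tail (c := c) (C := C)) => //.
    by move=> x _ h; rewrite /outer_part h.
  by move=> x h; rewrite /outer_part nle//; exact: f2.
apply: (wJ_eq _ (wJ_add j1 j2)) => x _.
by rewrite /outer_part /inner_part; case: ifP => _; rewrite ?add0r ?addr0.
Qed.

Definition kap s : R := psi0 c / uo mu s c.
(** A trial function with a kink at [c]: the zero-energy solution inside, the decaying solution at
    energy [- s] outside. *)
Definition Psi s : E := (fun x => if x <= c then psi0 x else kap s * uo mu s x,
  fun x => if x <= c then dpsi0 x else kap s * (qo mu s x / x)).

Lemma Psi_c s : (Psi s).1 c = psi0 c.
Proof. by rewrite /= lexx. Qed.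

Lemma kap_gt0 s : 0 < s -> 0 < kap s.
Proof. by move=> s0; rewrite divr_gt0 ?(md_pos H)// uo_gt0. Qed.

Lemma Psi_DT s : 0 < s -> DT (Psi s).
Proof.
move=> s0; have [hp loc] := md_loc H; have [j1 j2 j3] := loc c c0.
have k0 := kap_gt0 s0.
have hd : hasDeriv (Psi s).1 (Psi s).2.
  apply: (hd_glue c0 hp (hd_scale (kap s) (hd_uo mu s0))).
  by rewrite /kap divfK// gt_eqF// uo_gt0.
have [C C0 dec] := outer_decay mu0 s0 c0.
have m1 := hd_meas hd; have m2 := locL1_meas (hd_L1 hd).
have bu x : c < x -> (kap s * uo mu s x) ^+ 2 <= (kap s * C) ^+ 2 / x ^+ 4.
  move=> cx; have x0 : 0 < x by exact: lt_trans cx.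
  have [h _] := dec x (ltW cx); rewrite (_ : _ / x ^+ 4 = (kap s * (C / x ^+ 2)) ^+ 2); last by field; rewrite gt_eqF.
  apply: ler_sq; last by apply: ler_wpM2l => //; exact: ltW.
  by apply: mulr_ge0; apply: ltW => //; exact: uo_gt0.
have x34 x : c < x -> forall K, 0 <= K -> K / x ^+ 4 <= K / c / x ^+ 3.
  move=> cx K K0; have x0 : 0 < x by exact: lt_trans cx.
  rewrite (_ : K / x ^+ 4 = K / x / x ^+ 3); last by field; rewrite gt_eqF.
  rewrite ler_wpM2r ?invr_ge0 ?exprn_ge0 ?(ltW x0)// ler_wpM2l// lef_pV2 ?posrE// ltW//.
split => //; split; [|split].
- apply: (wJ_glue (C := (kap s * C) ^+ 2 / c) _ j1); first exact: measurable_funX.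
    by move=> x h; rewrite /= h.
  move=> x cx; rewrite /= nle// ger0_norm ?sqr_ge0//.
  by apply: le_trans (bu x cx) _; apply: x34; rewrite ?sqr_ge0.
- apply: (wJ_glue (C := (kap s * C) ^+ 2 / c / c ^+ 2) _ j2); first exact: measurable_funX.
    by move=> x h; rewrite /= h.
  move=> x cx; have x0 : 0 < x by exact: lt_trans cx.
  rewrite /= nle// ger0_norm ?sqr_ge0//; have [_ h] := dec x (ltW cx).
  have h2 : (kap s * (qo mu s x / x)) ^+ 2 <= (kap s * C) ^+ 2 / x ^+ 4 / x ^+ 2.
    rewrite (_ : _ / x ^+ 2 = (kap s * (C / x ^+ 2 / x)) ^+ 2); last by field; rewrite gt_eqF.
    rewrite -[leLHS]real_normK ?num_real//; apply: ler_sq => //.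
    rewrite normrM (gtr0_norm k0) ler_wpM2l ?(ltW k0)// normrM normfV (gtr0_norm x0).
    by rewrite ler_wpM2r// invr_ge0 ltW.
  apply: le_trans h2 _; apply: (@le_trans _ _ ((kap s * C) ^+ 2 / x ^+ 4 / c ^+ 2)).
    rewrite ler_wpM2l ?divr_ge0 ?sqr_ge0 ?exprn_ge0 ?(ltW x0)//.
    by rewrite lef_pV2 ?posrE ?exprn_gt0// ler_sq ?(ltW c0) ?(ltW cx).
  rewrite [leRHS]mulrAC ler_wpM2r ?invr_ge0 ?sqr_ge0//.
  by apply: x34; rewrite ?sqr_ge0.
- apply: (wJ_glue (C := mu ^+ 2 / c ^+ 2 * ((kap s * C) ^+ 2 / c)) _ j3).
  + by apply: measurable_funM; [exact: posp_meas (md_W H)|exact: measurable_funX].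
  + by move=> x h; rewrite /= h.
  move=> x cx; have x0 : 0 < x by exact: lt_trans cx.
  have Wx : posp W x <= mu ^+ 2 / c ^+ 2.
    rewrite /posp (md_Wc H (ltW cx)) ge_max divr_ge0 ?sqr_ge0// andbT ler_wpM2l ?sqr_ge0//.
    by rewrite lef_pV2 ?posrE ?exprn_gt0// ler_sq ?(ltW c0) ?(ltW cx).
  rewrite /= nle// ger0_norm; last by rewrite mulr_ge0 ?posp_ge0 ?sqr_ge0.
  rewrite -mulrA; apply: ler_pM; rewrite ?posp_ge0 ?sqr_ge0//.
  by apply: le_trans (bu x cx) _; apply: x34; rewrite ?sqr_ge0.
Qed.

(* Test the weak equation with the cutoff of [p] and integrate by parts on [c, c + 1]. *)
Lemma inner_flux p : DT p ->
  wint (inner_part (fun x => p.2 x * dpsi0 x + W x * p.1 x * psi0 x)) = - mu * p.1 c * psi0 c.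
Proof.
move=> dp; have dth := theta_domt H dp.
pose th1 x := theta c x * p.1 x; pose th2 x := dtheta c x * p.1 x + theta c x * p.2 x.
have w0 : tform W th1 th2 psi0 dpsi0 = 0.
  apply: (md_weak H (b := c + 1) dth) => x h; by rewrite theta_out ?mul0r.
pose F x := th2 x * dpsi0 x + W x * th1 x * psi0 x.
have E1 x : x <= c -> F x = p.2 x * dpsi0 x + W x * p.1 x * psi0 x.
  by move=> h; have [t1 t2] := theta_in (c := c) h; rewrite /F /th1 /th2 t1 t2 mul0r add0r !mul1r.
have s1 : 0 < 1 :> R by [].
have j1 : wJ (inner_part (fun x => p.2 x * dpsi0 x + W x * p.1 x * psi0 x)).
  apply: (wJ_eq _ (inn_wJ (domt_tJ H dp (Psi_DT s1)))) => x _; rewrite /inner_part; case: ifP => //= h.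
  by rewrite h.
have hQ := hd_scale (- mu) (hd_powR (- mu)).
have hh := hd_mul (domt_hd dth) hQ.
pose h x := th1 x * (- mu * x `^ (- mu)).
pose dh x := th2 x * (- mu * x `^ (- mu)) + th1 x * (- mu * (- mu * x `^ (- mu - 1))).
have {}hh : hasDeriv h dh := hh.
have Fx x : c < x -> F x * x = dh x.
  move=> cx; have x0 : 0 < x by exact: lt_trans cx.
  rewrite /F /dh Hd// (md_psi0 H (ltW cx)) (md_Wc H (ltW cx)) -(powRS (- mu) x0).
  by field; rewrite gt_eqF.
have Fout x : c + 1 < x -> F x = 0.
  move=> cx; have cx' : c < x by lra.
  rewrite /F /th1 /th2 theta_out ?(ltW cx)// /dtheta.
  rewrite ifF; last by apply/negbTE; rewrite -ltNge.
  rewrite ifF; last by apply/negbTE; rewrite -ltNge.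
  by ring.
have j2 : wJ (outer_part F).
  apply: (locL1_wJ (a := c) (b := c + 1)) => //; last first.
    move=> x x0 [xc|cx]; rewrite /outer_part; first by rewrite (ltW xc).
    by rewrite Fout//; case: ifP.
  have li : locL1 (fun x => x^-1 * dh x).
    by apply: (hd_locL1M (du := fun x => - x ^- 2)) (hd_L1 hh); apply: hd_C1 => x x0;
      [apply: der_inv; rewrite gt_eqF|apply: cont_opp; apply: cvgV; [rewrite expf_neq0// gt_eqF|exact: exprn_continuous]].
  apply: (locL1_eq _ (@locL1_bnd R (fun x => 1 - \1_(`]0, c]%classic : set R) x) _ _ _ li)).
  - move=> x x0; rewrite itvE// /outer_part; case: ifP => h1; first by rewrite subrr mul0r.
    have cx : c < x by rewrite ltNge h1.
    by rewrite subr0 mul1r -Fx// mulrC mulfK// gt_eqF.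
  - by apply: measurable_funB.
  - move=> a' b' a0; exists 1 => x ax _; rewrite itvE ?(lt_le_trans a0)//.
    by case: ifP => _; rewrite ?subrr ?subr0 ?normr0 ?normr1.
have FE : wint F = wint (inner_part (fun x => p.2 x * dpsi0 x + W x * p.1 x * psi0 x)) + wint (outer_part F).
  rewrite -wint_add//; apply: wint_eq => x _; rewrite /inner_part /outer_part; case: ifP => h1; last by rewrite add0r.
  by rewrite addr0 E1.
have [K K0 HK] := hd_bnd (c + 1) hh c0.
have o : wint (outer_part F) = - h c.
  apply: (wint_tail (C := K * (c + 1)) c0 hh j2).
  - by move=> x _ h1; rewrite /outer_part h1.
  - by move=> x cx; rewrite /outer_part nle// Fx.
  - move=> x cx; have x0 : 0 < x by exact: lt_le_trans cx.
    rewrite ler_pdivlMr//; have [h1|h1] := leP x (c + 1).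
      by apply: ler_pM; rewrite ?(ltW x0)// HK.
    rewrite /h /th1 theta_out ?(ltW h1)// !mul0r normr0 mul0r mulr_ge0 ?(ltW K0)//.
    by rewrite addr_ge0 ?(ltW c0).
have [t1 _] := theta_in (c := c) (lexx c).
have {}w0 : wint F = 0 := w0.
move: w0; rewrite FE o /h /th1 t1 -(md_psi0 H (lexx c)); lra.
Qed.

(** [mu + gs s] is minus the logarithmic derivative [c uo'(c) / uo(c)]. The summand [mu] belongs to
    [psi0], so [gs s] measures the kink of [Psi s]. *)
Definition gs s : R := s / 2 * c ^+ 2 * Phi (mu - 1) (sig s c) / Phi mu (sig s c).

(** Linear growth is crude but enough: against the quadratic decay of the flux it makes the boundary
    term at infinity vanish. *)
Lemma DT_growth p : DT p -> exists2 C : R, 0 < C & forall x, c <= x -> `|p.1 x| <= C * x.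
Proof.
move=> dp; have hd := domt_hd dp; have d2 := domt_dL2 dp.
pose D := wint (fun x => p.2 x ^+ 2); have D0 : 0 <= D by apply: wint_ge0 => x _; exact: sqr_ge0.
pose K := (2 * p.1 c ^+ 2 + 2 * D) / c ^+ 2.
have K0 : 0 <= K by rewrite /K; pos.
exists (K + 1); first by lra.
move=> x cx; have x0 : 0 < x by exact: lt_le_trans cx.
have g := growth hd d2 c0 cx; rewrite -/D in g.
have xc1 : 1 <= x / c by rewrite ler_pdivlMr// mul1r.
have lx : ln x - ln c <= (x / c) ^+ 2.
  rewrite -ln_div ?posrE//; apply: le_trans (ltW (ln_sublinear _)) _; first by rewrite divr_gt0.
  by rewrite expr2 ler_peMr// (le_trans ler01).
have h1 : (p.1 x - p.1 c) ^+ 2 <= D * (x / c) ^+ 2 by apply: le_trans g _; rewrite ler_wpM2l.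
have h2 : p.1 x ^+ 2 <= 2 * (p.1 x - p.1 c) ^+ 2 + 2 * p.1 c ^+ 2.
  by have := sqr_ge0 (p.1 x - 2 * p.1 c); lra.
have h3 : p.1 c ^+ 2 <= p.1 c ^+ 2 * (x / c) ^+ 2 by rewrite ler_peMr ?sqr_ge0// expr_ge1// (le_trans ler01).
have h4 : p.1 x ^+ 2 <= K * x ^+ 2.
  rewrite (_ : K * x ^+ 2 = 2 * (D * (x / c) ^+ 2) + 2 * (p.1 c ^+ 2 * (x / c) ^+ 2)); last by rewrite /K; field; rewrite gt_eqF.
  by lra.
have k1 : 0 <= (K + 1) * x by rewrite mulr_ge0 ?(ltW x0)//; lra.
rewrite -ler_sqr ?nnegrE// real_normK ?num_real//; apply: le_trans h4 _.
by rewrite exprMn ler_wpM2r ?sqr_ge0//; nra.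
Qed.

Lemma outer_flux p s : 0 < s -> DT p ->
  wint (outer_part (fun x => p.2 x * (Psi s).2 x + W x * p.1 x * (Psi s).1 x + s * (p.1 x * (Psi s).1 x)))
  = (mu + gs s) * p.1 c * psi0 c.
Proof.
move=> s0 dp; have dP := Psi_DT s0.
have jj := out_wJ (wJ_add (domt_tJ H dp dP) (wJ_scale s (domt_uwJ dp dP))).
have hh := hd_mul (domt_hd dp) (hd_scale (kap s) (hd_qo mu s0)).
have [C1 C10 b1] := DT_growth dp; have [C2 C20 b2] := outer_decay mu0 s0 c0.
have k0 := kap_gt0 s0.
rewrite (wint_tail (C := C1 * (kap s * C2)) c0 hh jj).
- have u0 : uo mu s c != 0 by rewrite gt_eqF// uo_gt0.
  rewrite /kap /qo /gs mulrBr.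
  have -> : zo mu s c = uo mu s c * (c ^+ 2 * Phi (mu - 1) (sig s c) / Phi mu (sig s c)).
    rewrite /zo /uo; have -> : c `^ (2 - mu) = c `^ (- mu) * c ^+ 2.
      by rewrite -(powR_mulrn 2 (ltW c0)) -powRDx// addrC.
    by field; rewrite gt_eqF// Phi_gt0'// sig_gt0.
  have F0 : Phi mu (sig s c) != 0 by rewrite gt_eqF// Phi_gt0'// sig_gt0.
  by field; rewrite u0 F0.
- by move=> x _ h; rewrite /outer_part h.
- move=> x cx; have x0 : 0 < x by exact: lt_trans cx.
  have nl : (x <= c) = false by apply/negbTE; rewrite -ltNge.
  by rewrite /outer_part /= nl (md_Wc H (ltW cx)); field; rewrite gt_eqF.
- move=> x cx; have x0 : 0 < x by exact: lt_le_trans cx.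
  have [_ h2] := b2 x cx; have h1 := b1 x cx.
  rewrite normrM [X in _ * X]normrM (gtr0_norm k0).
  apply: le_trans (ler_pM _ _ h1 (ler_wpM2l (ltW k0) h2)) _ => //.
    by rewrite mulr_ge0 ?(ltW k0).
  by rewrite le_eqVlt; apply/orP; left; apply/eqP; field; rewrite gt_eqF.
Qed.

(** Integration by parts on both sides of [c]: the two fluxes carry [mu] with opposite signs, and
    only [gs] remains. *)
Lemma matching p s : 0 < s -> DT p ->
  tE p (Psi s) + s * mform p (Psi s) = s * wint (inner_part (fun x => p.1 x * psi0 x)) + gs s * p.1 c * psi0 c.
Proof.
move=> s0 dp; have dP := Psi_DT s0.
have j1 := domt_tJ H dp dP; have j2 := wJ_scale s (domt_uwJ dp dP).
have -> : tE p (Psi s) + s * mform p (Psi s) =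
    wint (fun x => p.2 x * (Psi s).2 x + W x * p.1 x * (Psi s).1 x + s * (p.1 x * (Psi s).1 x)).
  by rewrite (wint_add j1 j2) (wint_scale s (domt_uwJ dp dP)).
rewrite (wint_inn_out (wJ_add j1 j2)).
rewrite outer_flux//.
have j3 : wJ (inner_part (fun x => p.1 x * psi0 x)).
  by apply: (wJ_eq _ (inn_wJ (domt_uwJ dp dP))) => x _; rewrite /inner_part; case: ifP => //= ->.
have j4 : wJ (inner_part (fun x => p.2 x * dpsi0 x + W x * p.1 x * psi0 x)).
  by apply: (wJ_eq _ (inn_wJ j1)) => x _; rewrite /inner_part; case: ifP => //= ->.
have -> : wint (inner_part (fun x => p.2 x * (Psi s).2 x + W x * p.1 x * (Psi s).1 x + s * (p.1 x * (Psi s).1 x)))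
   = wint (inner_part (fun x => p.2 x * dpsi0 x + W x * p.1 x * psi0 x)) + s * wint (inner_part (fun x => p.1 x * psi0 x)).
  rewrite -wint_scale// -wint_add//; last exact: wJ_scale.
  by apply: wint_eq => x _; rewrite /inner_part; case: ifP => /= [->//|_]; rewrite mulr0 addr0.
rewrite inner_flux//; lra.
Qed.

End Matching.

(** * Eigenvalues *)

Section Eigenvalues.
Variable R : realType.
Local Notation leb := (@lebesgue_measure R).
Local Notation Rp := (@Rp R).
Local Notation wJ := (wintegrable Rp).
Local Notation E := ((R -> R) * (R -> R))%type.
Variables (W psi0 dpsi0 V : R -> R) (c mu a M : R).
Hypothesis H : model W psi0 dpsi0 c mu a M.
Hypothesis Hd : forall x, c < x -> dpsi0 x = - mu * x `^ (- mu - 1).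
Hypothesis HV : in_calV W V.
Hypothesis Vc : forall x, c <= x -> V x = 0.
Implicit Types (p q : E) (x y e s al : R).
Local Notation DT := (DT W).
Local Notation X0 := (X0 W c).
Local Notation tE := (tE W).
Local Notation vE := (vform V).
Local Notation nE := (@mform R).
Local Notation AE := (perturbed W V).
Local Notation LE := (source psi0 dpsi0 V c).
Local Notation Psi0 := (Psi0 psi0 dpsi0 c).
Local Notation Psi := (Psi psi0 dpsi0 c mu).
Local Notation inn := (inner_part c).
Local Notation out := (outer_part c).
Local Notation gs := (gs c mu).

Let c0 : 0 < c. Proof. exact: md_c H. Qed.

Let bil al s : bilinear_on DT (AE al s). Proof. exact: (AE_bil H HV). Qed.

Let nle x : c < x -> (x <= c) = false. Proof. by move=> h; apply/negbTE; rewrite -ltNge. Qed.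

Lemma linE p q (k : R) x : (p + k *: q).1 x = p.1 x + k * q.1 x /\ (p + k *: q).2 x = p.2 x + k * q.2 x.
Proof. by []. Qed.

Lemma split_at p : DT p -> p.1 c = 0 -> exists w1 w2, [/\ X0 w1, DT w2,
  forall x, x <= c -> w2.1 x = 0 /\ w2.2 x = 0 & p = w1 + 1 *: w2].
Proof.
move=> dp pc; exists (inn p.1, inn p.2), (out p.1, out p.2).
have h0 := hd_cst (0 : R).
have jN := Nf_J dp.
split.
- split.
  + apply: (DT_Nf H) => /=.
      by apply: (hd_glue c0 (domt_hd dp) h0).
    apply: (wJ_eq _ (inn_wJ c jN)) => x _; rewrite /Nf /inner_part /=; case: ifP => // _.
    by rewrite !expr0n mulr0 addr0.
  + move=> x; rewrite /= /inner_part le_eqVlt => /predU1P[<-|/nle ->//]; by rewrite lexx.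
  + by move=> x /nle; rewrite /= /inner_part => ->.
- apply: (DT_Nf H) => /=.
    by apply: (hd_glue c0 h0 (domt_hd dp)).
  apply: (wJ_eq _ (out_wJ c jN)) => x _; rewrite /Nf /outer_part /=; case: ifP => // _.
  by rewrite !expr0n mulr0 addr0.
- by move=> x h; rewrite /= /outer_part h.
- have e (f : R -> R) : f = inn f + 1 *: out f.
    apply/funext => x; rewrite [RHS](_ : _ = inn f x + 1 * out f x)// mul1r /inner_part /outer_part.
    by case: ifP; rewrite ?addr0 ?add0r.
  by case: p {dp pc jN} => p1 p2 /=; rewrite {1}(e p1) {1}(e p2).
Qed.

Lemma AE_disjoint al s p q : (forall x, x <= c -> p.1 x = 0 /\ p.2 x = 0) ->
  (forall x, c < x -> q.1 x = 0 /\ q.2 x = 0) -> AE al s p q = 0.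
Proof.
move=> hp hq.
have pq x : p.1 x * q.1 x = 0 /\ p.2 x * q.2 x = 0.
  by have [/hp[-> ->]|/hq[-> ->]] := leP x c; rewrite !(mul0r, mulr0).
have t0 : tE p q = 0.
  rewrite -[RHS](wint0 R); apply: wint_eq => x _; have [h1 h2] := pq x.
  by rewrite h2 -mulrA h1 mulr0 addr0.
have v0 : vE p q = 0.
  by rewrite -[RHS](wint0 R); apply: wint_eq => x _; have [h1 _] := pq x; rewrite -mulrA h1 mulr0.
have n0 : nE p q = 0.
  by rewrite -[RHS](wint0 R); apply: wint_eq => x _; have [h1 _] := pq x.
by rewrite /perturbed t0 v0 n0 !mulr0 !addr0.
Qed.

Lemma AE_Psi al s p : 0 < s -> DT p -> AE al s p (Psi s) =
  s * wint (inn (fun x => p.1 x * psi0 x)) + gs s * p.1 c * psi0 c - al * vE p (Psi s).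
Proof.
by move=> s0 dp; rewrite -(matching H Hd s0 dp) /perturbed; ring.
Qed.

Lemma X0_at p : X0 p -> p.1 c = 0. Proof. by case=> _ h _; exact: h. Qed.

(** Tests from [X0] do not see the kink. The sign is such that [Psi s + eta] is annihilated by all
    of them. *)
Lemma LE_Psi al s p : 0 < s -> X0 p -> AE al s p (Psi s) = - LE al s p.
Proof.
move=> s0 xp; rewrite (AE_Psi al s0 (X0_DT xp)) (X0_at xp) mulr0 mul0r addr0 /source.
have [_ p1 _] := xp.
have -> : vE Psi0 p = vE p (Psi s).
  apply: wint_eq => x _; have [h|h] := leP x c; last by rewrite Vc ?(ltW h)// !mul0r.
  have [t _] := theta_in (c := c) h; rewrite /= t h mul1r; ring.
have -> : nE Psi0 p = wint (inn (fun x => p.1 x * psi0 x)).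
  apply: wint_eq => x _; rewrite /inner_part; have [h|h] := leP x c; last by rewrite p1 ?mulr0// ltW.
  have [t _] := theta_in (c := c) h; rewrite /= t mul1r; ring.
ring.
Qed.

Lemma AE_PsiPsi al s : 0 < s -> AE al s (Psi s) (Psi s) =
  s * wint (inn (fun x => psi0 x ^+ 2)) + gs s * psi0 c ^+ 2 - al * wint (fun x => V x * psi0 x ^+ 2).
Proof.
move=> s0; rewrite (AE_Psi _ s0 (Psi_DT H s0)) Psi_c -mulrA -expr2; congr (_ * _ + _ - _ * _).
  by apply: wint_eq => x _; rewrite /inner_part; case: ifP => //= ->.
apply: wint_eq => x _; have [h|h] := leP x c; last by rewrite Vc ?(ltW h)// !mul0r.
by rewrite /= h -mulrA.
Qed.

(** A zero at [c] decouples the two sides. Inside, [al V] is dominated by [t]; outside, [V = 0] and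
    [W >= 0]. *)
Lemma form_nonneg a0 al p : (forall al p, 0 < al -> al <= a0 -> X0 p -> al * vE p p <= tE p p / 2) ->
  0 < al -> al <= a0 -> DT p -> p.1 c = 0 -> 0 <= AE al 0 p p.
Proof.
move=> hv al0 ala dp pc; have [w1 [w2 [x1 d2 z2 pE]]] := split_at dp pc.
have [dw1 w1a w1b] := x1.
have dis : AE al 0 w2 w1 = 0.
  by apply: AE_disjoint => // x cx; split; [apply: w1a; exact: ltW|exact: w1b].
rewrite pE (bilinear_on_quad (fun p q k => @DT_lin _ _ _ _ _ _ _ _ H p q k) 1 (bil al 0) dw1 d2).
rewrite ((bil al 0).1 w1 w2 dw1 d2) dis mulr0 addr0 expr1n mul1r; apply: addr_ge0.
  have := hv al w1 al0 ala x1; have := tE_ge0 H (X0_cptD x1); rewrite /perturbed mul0r; lra.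
rewrite /perturbed mul0r addr0.
have -> : vE w2 w2 = 0.
  rewrite -[RHS](wint0 R); apply: wint_eq => x _; have [h|h] := leP x c.
    by have [-> _] := z2 x h; rewrite mulr0.
  by rewrite Vc ?mul0r// ltW.
rewrite mulr0 addr0; apply: wint_ge0 => x x0; have [h|h] := leP x c.
  by have [-> ->] := z2 x h; rewrite !mulr0 addr0.
have := W_ge0_out H (ltW h); have := sqr_ge0 (w2.1 x); have := sqr_ge0 (w2.2 x).
by move=> h1 h2 h3; rewrite -mulrA -!expr2 addr_ge0// mulr_ge0.
Qed.

Lemma neg_eigE al l : neg_eig W V al l <-> l < 0 /\ exists p, [/\ DT p, 0 < nE p p &
  forall q, DT q -> AE al 0 q p = l * nE q p].
Proof.
split=> [[l0 [f [df [df' [f0 h]]]]]|[l0 [p [dp p0 h]]]]; split => //.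
  exists (f, df); split => //= q dq.
  have := h q.1 q.2 dq; rewrite /perturbed mul0r addr0 mulNr; exact.
exists p.1, p.2; split => //; split => // q dq hq.
by have := h (q, dq) hq; rewrite /perturbed mul0r addr0 mulNr.
Qed.

(** Eigenfunctions of distinct eigenvalues are orthogonal, so the form is negative on any
    combination containing the second one; but some such combination vanishes at [c]. *)
Lemma neg_eig_unique a0 al l1 l2 : (forall al p, 0 < al -> al <= a0 -> X0 p -> al * vE p p <= tE p p / 2) ->
  0 < al -> al <= a0 -> neg_eig W V al l1 -> neg_eig W V al l2 -> l1 = l2.
Proof.
move=> hv al0 ala /neg_eigE[n1 [p1 [d1 q1 h1]]] /neg_eigE[n2 [p2 [d2 q2 h2]]].
have pos := form_nonneg hv al0 ala.
have [p1c|p1c] := eqVneq (p1.1 c) 0.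
  by have := pos p1 d1 p1c; rewrite h1//; nra.
apply: contrapT => /eqP ne.
(* By symmetry the mixed form value equals both [l1] and [l2] times the inner product. *)
have o : nE p1 p2 = 0.
  have e1 := h2 p1 d1; have e2 := h1 p2 d2.
  rewrite ((bil al 0).1 p2 p1 d2 d1) ((nE_bil W).1 p2 p1 d2 d1) e1 in e2.
  have /eqP : (l2 - l1) * nE p1 p2 = 0 by rewrite mulrBl e2 subrr.
  by rewrite mulf_eq0 subr_eq0 (eq_sym l2) (negbTE ne) => /eqP.
pose k := - (p2.1 c / p1.1 c).
have du := DT_lin H k d2 d1.
have uc : (p2 + k *: p1).1 c = 0 by have [-> _] := linE p2 p1 k c; rewrite /k mulNr divfK// subrr.
have := pos _ du uc.
rewrite (bilinear_on_quad (fun p q k => @DT_lin _ _ _ _ _ _ _ _ H p q k) k (bil al 0) d2 d1).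
rewrite h2// h1// h1// ((nE_bil W).1 p2 p1 d2 d1) o mulr0 mulr0 addr0.
have k2 := sqr_ge0 k; have e1 : l2 * nE p2 p2 < 0 by rewrite pmulr_llt0.
have e2 : l1 * nE p1 p1 < 0 by rewrite pmulr_llt0.
have e3 : k ^+ 2 * (l1 * nE p1 p1) <= 0 by rewrite mulr_ge0_le0// ltW.
lra.
Qed.

(** [Psi s + eta] is annihilated by [X0] by construction of [eta], by functions supported outside
    because [Psi s] solves the equation there, and by [Psi s] itself exactly when the scalar
    equation holds. Together these span the form domain. *)
Lemma eigen_root (eta : E) al s : 0 < s -> X0 eta ->
  (forall q, X0 q -> AE al s eta q = LE al s q) ->
  s * wint (inn (fun x => psi0 x ^+ 2)) + gs s * psi0 c ^+ 2 - al * wint (fun x => V x * psi0 x ^+ 2)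
    - LE al s eta = 0 -> neg_eig W V al (- s).
Proof.
move=> s0 xe he root; apply/neg_eigE; split; first by rewrite oppr_lt0.
have dP := Psi_DT H s0; have de := X0_DT xe.
pose f := Psi s + 1 *: eta; have df : DT f by exact: (DT_lin H 1 dP de).
have [_ e1 e2] := xe.
have Af q : DT q -> AE al s q f = AE al s q (Psi s) + AE al s q eta.
  move=> dq; rewrite ((bil al s).1 q f dq df) /f (bil al s).2// mul1r.
  by rewrite ((bil al s).1 (Psi s) q dP dq) ((bil al s).1 eta q de dq).
have AX w : X0 w -> AE al s w f = 0.
  move=> xw; rewrite (Af _ (X0_DT xw)) (LE_Psi al s0 xw) ((bil al s).1 w eta (X0_DT xw) de) he// addNr//.
have Aout w : DT w -> (forall x, x <= c -> w.1 x = 0 /\ w.2 x = 0) -> AE al s w f = 0.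
  move=> dw z; rewrite (Af _ dw) (AE_disjoint al s z (q := eta)) ?addr0; last first.
    by move=> x cx; split; [apply: e1; exact: ltW|exact: e2].
  rewrite (AE_Psi al s0 dw); have [-> _] := z c (lexx c); rewrite mulr0 mul0r addr0.
  have -> : vE w (Psi s) = 0.
    rewrite -[RHS](wint0 R); apply: wint_eq => x _; have [h|h] := leP x c.
      by have [-> _] := z x h; rewrite mulr0 mul0r.
    by rewrite Vc ?mul0r// ltW.
  have -> : wint (inn (fun x => w.1 x * psi0 x)) = 0.
    rewrite -[RHS](wint0 R); apply: wint_eq => x _; rewrite /inner_part; case: ifP => // h.
    by have [-> _] := z x h; rewrite mul0r.
  by rewrite !mulr0 subr0.
have AP : AE al s (Psi s) f = 0.
  by rewrite (Af _ dP) (AE_PsiPsi al s0) ((bil al s).1 (Psi s) eta dP de) (LE_Psi al s0 xe).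
have all q : DT q -> AE al s q f = 0.
  move=> dq; have pc : psi0 c != 0 by rewrite gt_eqF// (md_pos H).
  (* Subtracting the right multiple of [Psi s] makes the value at [c] zero, after which the test
     function splits. *)
  pose k := - (q.1 c / psi0 c).
  have du := DT_lin H k dq dP.
  have uc : (q + k *: Psi s).1 c = 0 by have [-> _] := linE q (Psi s) k c; rewrite Psi_c /k mulNr divfK// subrr.
  have [w1 [w2 [x1 d2 z2 uE]]] := split_at du uc.
  have e : AE al s (q + k *: Psi s) f = 0.
    by rewrite uE ((bil al s).2 _ _ _ _ (X0_DT x1) d2 df) (AX _ x1) (Aout _ d2 z2) mulr0 addr0.
  by move: e; rewrite ((bil al s).2 _ _ _ _ dq dP df) AP mulr0 addr0.
exists f; split => //; last first.
  move=> q dq; have := all q dq; rewrite /perturbed mul0r addr0 mulNr => h; lra.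
have k0 := kap_gt0 H s0.
have hu := hd_uo mu s0.
(* The candidate is not zero: beyond [c] only a positive multiple of [uo] is left. *)
have [|||m m0 hm] := hd_pos_lb (a := c + 1) (b := c + 2) hu.
- by rewrite addr_gt0.
- by rewrite lerD2l ler1n.
- by move=> x x0; exact: uo_gt0.
pose K := (kap psi0 c mu s * m) ^+ 2.
have K0 : 0 < K by rewrite exprn_gt0// mulr_gt0.
have c1 : 0 < c + 1 by rewrite addr_gt0.
have j := domt_uwJ df df.
have mi : measurable (`[c + 1, c + 2]%classic : set R) by exact: measurable_itv.
have sub := @itv_Rp R (c + 1) (c + 2) c1.
apply: (@lt_le_trans _ _ (I `[c + 1, c + 2] (fun=> K * (c + 1)))).
  rewrite /I Rintegral_cst//= lebesgue_measure_itv/= lte_fin ifT; last by rewrite ltrD2l ltr1n.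
  have -> : fine ((c + 2)%:E + (- (c + 1))%:E) = 1 by rewrite -EFinD /=; ring.
  by rewrite mulr1 mulr_gt0.
apply: le_trans (I_subset mRp mi sub j _); last first.
  by move=> x /RpP x0; rewrite -expr2 mulr_ge0 ?sqr_ge0// ltW.
apply: I_le => //; [exact: J_cst|exact: (J_set mRp mi sub j)|].
move=> x hx; have /andP[h1 h2] : c + 1 <= x <= c + 2 by move: hx; rewrite /= in_itv.
have cx : c < x by lra.
have -> : f.1 x = kap psi0 c mu s * uo mu s x.
  by have [-> _] := linE (Psi s) eta 1 x; rewrite e1 ?(ltW cx)// mulr0 addr0 /= nle.
apply: ler_pM => //; rewrite ?(ltW K0) ?(ltW c1)// -expr2; apply: ler_sq; first by rewrite mulr_ge0 ?ltW.
by rewrite ler_wpM2l ?(ltW k0)// hm.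
Qed.

End Eigenvalues.

(** * Asymptotics of the secular equation *)

Section Asymptotics.
Variable R : realType.
Variables (m c v K0 D0 : R).
Hypotheses (m0 : 0 < m) (c0 : 0 < c) (v0 : 0 < v) (K00 : 0 < K0) (D00 : 0 <= D0).
Implicit Types (mu s al d e x y p q X Y L C : R).
Local Notation sg s := (sig s c).
Local Ltac slra := clear -m0 c0 v0 K00 D00; intros; try split; lra.
Local Notation G12 := (Phi (1 / 2 : R) 0).

(* [- s] is an eigenvalue iff [secular mu s = al v] up to a term of order [(al + s)^2]. *)
Definition secular mu s : R := m * s + c `^ (- mu) ^+ 2 * gs c mu s.

(** [ln y < y] at [y = s^(-1/2)]. *)
Lemma sqrt_ln s : 0 < s -> s `^ (1 / 2) * (- ln s) <= 2.
Proof.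
move=> s0; have r0 : 0 < s `^ (1 / 2) by rewrite powR_gt0.
have h := ln_sublinear (_ : 0 < (s `^ (1 / 2))^-1); rewrite invr_gt0 in h; have {h} := h r0.
rewrite lnV ?posrE// ln_powR => h.
have h2 : - ln s <= 2 * (s `^ (1 / 2))^-1 by lra.
apply: le_trans (ler_wpM2l (ltW r0) h2) _.
by rewrite mulrCA mulfV ?gt_eqF// mulr1.
Qed.

(** The factor one half, smaller than 1, is what lets the bootstrap for [mu = 1] close. *)
Lemma ln_le_half y : 0 < y -> ln y <= y / 2.
Proof.
move=> y0; have h1 : ln 2 <= 1 :> R.
  by have := @le_ln1Dx R 1; rewrite (_ : 1 + 1 = 2)//; apply; lra.
have y2 : 0 < y / 2 by rewrite divr_gt0.
have : ln (1 + (y / 2 - 1)) <= y / 2 - 1 by apply: le_ln1Dx; lra.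
rewrite addrCA subrr addr0 ln_div ?posrE//; lra.
Qed.

Lemma powR_lip p Y x y : 1 <= p -> 0 < x -> 0 < y -> x <= Y -> y <= Y ->
  `|x `^ p - y `^ p| <= p * Y `^ (p - 1) * `|x - y|.
Proof.
move=> p1; have p0 : 0 <= p by lra.
wlog yx : x y / y <= x => [hw|] x0 y0 xY yY.
  by have [h|/ltW h] := leP y x; [exact: hw|rewrite distrC (distrC x); exact: hw].
have hid : hasDeriv (fun x : R => x) (fun=> 1).
  by apply: (hd_C1 (fun x _ => der_id x)) => z _; exact: cvg_cst.
have h := hd_compare (hd_powR p) (hd_scale (p * Y `^ (p - 1)) hid) y0 yx.
rewrite !ger0_norm ?subr_ge0//; last exact: (le_powR p0 (ltW y0) yx).
rewrite mulrBr; apply: h => t yt tx; rewrite mulr1 ler_wpM2l//.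
by apply: le_powR; [lra|exact: le_trans (ltW y0) yt|exact: le_trans tx xY].
Qed.

Lemma sig_scale s : sg s = s * (c ^+ 2 / 4).
Proof. by rewrite /sig; field. Qed.

Lemma sig_pos s : 0 < s -> 0 < sg s. 
Proof. by move=> s0; exact: (sig_gt0 s0 c0). Qed.

Lemma csq4_gt0 : 0 < c ^+ 2 / 4.
Proof. by rewrite divr_gt0// exprn_gt0. Qed.

Lemma sig_le1 s : s <= (c ^+ 2 / 4)^-1 -> sg s <= 1.
Proof. by have k := csq4_gt0; rewrite sig_scale -(ler_pM2r k) mulVf ?gt_eqF. Qed.

Lemma Phi_ge_at1 nu x : 0 < x -> x <= 1 -> Phi nu 1 <= Phi nu x.
Proof. by move=> x0 x1; apply: Phi_decr => //; [exact: ltW|move=> h; move: x0; rewrite h ltxx]. Qed.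

Lemma Phi_le_Gamma nu x : 0 < nu -> 0 < x -> Phi nu x <= Phi nu 0.
Proof. by move=> n0 x0; apply: Phi_decr => //; exact: ltW. Qed.

Lemma Phi_at1_gt0 nu : 0 < Phi nu 1 :> R.
Proof. by rewrite Phi_gt0'. Qed.

Lemma ln_sig s : 0 < s -> ln (sg s) = ln s + ln (c ^+ 2 / 4).
Proof. by move=> s0; rewrite sig_scale lnM ?posrE// csq4_gt0. Qed.

Lemma Phi0_log : exists2 C, 0 < C & forall s, 0 < s -> s <= (c ^+ 2 / 4)^-1 -> `|Phi 0 (sg s) + ln s| <= C.
Proof.
exists (Phi 0 1 + 2 * G12 + `|ln (c ^+ 2 / 4)| + 1).
  have := Phi_at1_gt0 0; have : 0 <= 2 * G12 by rewrite mulr_ge0// ltW// Phi_gt0//; move=> _; lra.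
  have := normr_ge0 (ln (c ^+ 2 / 4)); lra.
move=> s s0 s1; have [h1 h2] := Phi0_bounds (sig_pos s0) (sig_le1 s1).
rewrite ln_sig// in h1 h2; have := Phi_at1_gt0 0.
have := ler_norm (ln (c ^+ 2 / 4)); have := ler_norm (- ln (c ^+ 2 / 4)); rewrite normrN.
have : 0 <= 2 * G12 by rewrite mulr_ge0// ltW// Phi_gt0//; move=> _; lra.
move: h1 h2; move: (Phi 0 _) (ln (c ^+ 2 / 4)) `|_| (Phi 0 1) (2 * G12) (ln s) => A l n B G L.
by rewrite ler_norml => *; apply/andP; split; lra.
Qed.

Lemma Phi1_sqrt : exists2 C, 0 < C & forall s, 0 < s -> s <= (c ^+ 2 / 4)^-1 ->
  [/\ 1 - Phi 1 (sg s) <= C * s `^ (1 / 2), Phi 1 (sg s) <= 1 & Phi 1 1 <= Phi 1 (sg s)].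
Proof.
exists ((c ^+ 2 / 4) `^ (1 / 2) * G12).
  by rewrite mulr_gt0 ?powR_gt0 ?csq4_gt0// Phi_gt0//; move=> _; lra.
move=> s s0 s1; split.
- have := @Phi_interp R 1 (1 / 2) (sg s); rewrite Gamma1 (_ : 1 - 1 / 2 = 1 / 2); last by field.
  have -> : sg s `^ (1 / 2) = s `^ (1 / 2) * (c ^+ 2 / 4) `^ (1 / 2) by rewrite sig_scale powRM// ltW// csq4_gt0.
  move=> h; have {h} : 1 - s `^ (1 / 2) * (c ^+ 2 / 4) `^ (1 / 2) * G12 <= Phi 1 (sg s).
    by apply: h; rewrite ?sig_pos//; lra.
  lra.
- by have := @Phi_le_Gamma 1 (sg s) ltr01 (sig_pos s0); rewrite Gamma1.
- by apply: Phi_ge_at1; [exact: sig_pos|exact: sig_le1].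
Qed.

(** Here [d] carries the quadratic correction of the scalar equation. With [L = - ln s], multiplying
    [m s + 2 Phi 1 / Phi 0 = al v (1 + d)] by [L] gives [2 + O(al)] on the left: [Phi 0] is
    [L + O(1)], [(1 - Phi 1) L] is bounded, and [L] is at least of order [1 / al]. *)
Lemma asym_mu0 : exists C a1 : R, 0 < a1 /\ forall al s d, 0 < al -> al < a1 -> 0 < s -> s <= K0 * al ->
  0 <= d -> d <= D0 * al -> secular 0 s = al * v * (1 + d) ->
  exists e, `|e| <= C * al /\ - s = - expR (- (2 / (al * v)) * (1 + e)).
Proof.
have D0' := D00; have m0' := m0; have v0' := v0.
have [C1 C10 HA] := Phi0_log; have [C2 C20 HB] := Phi1_sqrt.
pose b := Phi (1 : R) 1; have b0 : 0 < b := Phi_at1_gt0 1.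
have [v' v'E] : exists v', v' = v * (1 + D0) by eexists.
have v'0 : 0 < v' by rewrite v'E mulr_gt0//; lra.
have [C3 C3E] : exists C3, C3 = C2 * 2 + C1 by eexists.
have [C CE] : exists C, C = (m * 4 * v' / b + C3 * v' / b) / 2 + D0 by eexists.
have s10 : 0 < (c ^+ 2 / 4)^-1 by rewrite invr_gt0 csq4_gt0.
(* The second bound gives [sg s <= 1], where the estimates of [Phi] at 0 apply; the third absorbs
   [C1] in the lower bound for [L]. *)
exists C, (Num.min 1 (Num.min ((c ^+ 2 / 4)^-1 / K0) (b / (v' * C1)))).
split; first by rewrite !lt_min ltr01 !divr_gt0// mulr_gt0.
move=> al s d al0; rewrite !lt_min => /andP[al1 /andP[al2 al3]] s0 sK d0 dD.
have s1 : s <= (c ^+ 2 / 4)^-1.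
  by apply: le_trans sK _; move: al2; rewrite ltr_pdivlMr// => /ltW; rewrite mulrC.
have := HA s s0 s1; have [] := HB s s0 s1.
have sl := sqrt_ln s0.
have gE : gs c 0 s = 2 * Phi 1 (sg s) / Phi 0 (sg s).
  have := Phi_rec 0 (sig_pos s0); rewrite add0r mul0r add0r => ->.
  by rewrite /gs; congr (_ / _); rewrite [X in 2 * (X * _)]/sig; field.
have -> : secular 0 s = m * s + 2 * Phi 1 (sg s) / Phi 0 (sg s).
  by rewrite /secular gE oppr0 powRr0 expr1n mul1r.
have A0 : 0 < Phi 0 (sg s) by apply: Phi_gt0'; exact: sig_pos.
have [L source] : exists L, L = - ln s by eexists.
have lsE : ln s = - L by rewrite source opprK.
have sE : s = expR (- L) by rewrite source opprK lnK// posrE.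
have q0 : 0 <= s `^ (1 / 2) by exact: powR_ge0.
have q2 : s `^ (1 / 2) * s `^ (1 / 2) = s.
  by rewrite -powRDx// (_ : 1 / 2 + 1 / 2 = 1) ?powRr1 ?(ltW s0)//; field.
rewrite -source in sl; rewrite lsE; move: A0 q0 q2 sl; rewrite -/b.
move: (s `^ (1 / 2)) (Phi 0 _) (Phi 1 (sg s)) => r A B A0 r0 r2 rL B1 B2 B3.
rewrite ler_norml => /andP[AL1 AL2] eqh.
have hv : al * v * (1 + d) <= al * v'.
  by rewrite v'E -mulrA ler_wpM2l ?(ltW al0)// ler_wpM2l ?(ltW v0)// lerD2l (le_trans dD)// ler_piMr// ltW.
have AB : 2 * b <= al * v' * A.
  have h1 : 2 * B / A <= al * v' by have ms := mulr_ge0 (ltW m0) (ltW s0); move: ms eqh hv; slra.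
  by move: h1; rewrite ler_pdivrMr//; move: B3; slra.
have al3' : al * (v' * C1) <= b by move: al3; rewrite ltr_pdivlMr; [move=> /ltW|exact: mulr_gt0].
have av0 : 0 < al * v' by rewrite mulr_gt0.
have Lb : b <= al * v' * L by have h := ler_wpM2l (ltW av0) AL2; move: h AB al3'; slra.
have L0 : 0 < L by rewrite -(pmulr_rgt0 _ av0); exact: lt_le_trans Lb.
have iL : L^-1 <= al * v' / b by rewrite ler_pdivlMr// mulrC ler_pdivrMr.
have iA : A^-1 <= al * v' / b / 2.
  by rewrite -mulrA -invfM ler_pdivlMr ?mulr_gt0// mulrC ler_pdivrMr//; move: AB; slra.
(* [s L] is the bounded quantity [(s^(1/2) L)^2] divided by [L], hence [O(al)]. *)
have sL : s * L <= 4 * (al * v' / b).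
  have h : (r * L) ^+ 2 <= 4.
    have : 0 <= r * L by rewrite mulr_ge0// ltW.
    by move=> h; have h' := ler_sq h rL; move: h'; slra.
  have -> : s * L = (r * L) ^+ 2 * L^-1 by rewrite -r2; field; rewrite gt_eqF.
  apply: ler_pM => //; rewrite ?sqr_ge0// invr_ge0 ltW//.
have BLA : `|B * L - A| <= C3.
  have h1 : (1 - B) * L <= C2 * 2.
    apply: le_trans (ler_wpM2r (ltW L0) B1) _; rewrite -mulrA ler_wpM2l// ltW//.
  have h2 : 0 <= (1 - B) * L by rewrite mulr_ge0 ?(ltW L0)//; move: B2; slra.
  rewrite ler_norml; apply/andP; move: C3E h1 h2 AL1 AL2; slra.
have hL : `|(m * s + 2 * B / A) * L - 2| <= al * (m * 4 * v' / b + C3 * v' / b).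
  have -> : (m * s + 2 * B / A) * L - 2 = m * (s * L) + (B * L - A) * (2 * A^-1) by field; rewrite gt_eqF.
  apply: le_trans (ler_normD _ _) _; rewrite (normrM (_ - _)).
  have p1 : 0 <= m * (s * L) by apply: mulr_ge0; [exact: ltW|apply: mulr_ge0; exact: ltW].
  have p2 : 0 <= 2 * A^-1 by apply: mulr_ge0 => //; rewrite invr_ge0 ltW.
  rewrite (ger0_norm p1) (ger0_norm p2).
  have h1 := ler_wpM2l (ltW m0) sL.
  have h2 : `|B * L - A| * (2 * A^-1) <= C3 * (al * v' / b).
    by apply: ler_pM => //; move: iA; slra.
  apply: le_trans (lerD h1 h2) _; rewrite le_eqVlt; apply/orP; left; apply/eqP; ring.
exists (al * v * L / 2 - 1); split; last first.
  rewrite {1}sE; congr (- expR _).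
  by field; rewrite !gt_eqF.
have d1 : 0 < 1 + d by move: d0; slra.
have eE : al * v * L / 2 - 1 = ((m * s + 2 * B / A) * L - 2 - 2 * d) / (2 * (1 + d)).
  by rewrite eqh; field; rewrite gt_eqF.
rewrite eE normrM [X in _ * X]ger0_norm; last by rewrite invr_ge0 mulr_ge0// ltW.
rewrite ler_pdivrMr ?mulr_gt0//.
have n1 : `|(m * s + 2 * B / A) * L - 2 - 2 * d| <= 2 * (C * al).
  apply: le_trans (ler_normB _ _) _; rewrite [X in _ + X]ger0_norm; last by rewrite mulr_ge0.
  rewrite CE; move: hL dD; slra.
have Ca : 0 <= C * al.
  by have h := le_trans (normr_ge0 _) n1; move: h; slra.
apply: le_trans n1 _.
have h := mulr_ge0 Ca d0; move: h; slra.
Qed.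

Lemma powRN1_sqr : (c `^ (- 1)) ^+ 2 = (c ^+ 2)^-1.
Proof. by rewrite (powR_inv1 (ltW c0)) exprVn. Qed.

(** The equation reads [s (- ln s + O(1)) = 2 al v (1 + d)], and [ln s] has to be replaced by
    [ln al]. One direction is [s <= K0 al]; for the other, the logarithm of the equation gives [- ln
    s <= - ln al + ln (- ln s + O(1)) + O(1)], and the inner logarithm is [O(ln |ln al|)]. *)
Lemma asym_mu1 : exists C a1 : R, 0 < a1 /\ forall al s d, 0 < al -> al < a1 -> 0 < s -> s <= K0 * al ->
  0 <= d -> d <= D0 * al -> secular 1 s = al * v * (1 + d) ->
  exists e, `|e| <= C * (ln `|ln al| / `|ln al|) /\ - s = - (2 * al * v / `|ln al|) * (1 + e).
Proof.
have D0' := D00; have m0' := m0; have v0' := v0.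
have [C1 C10 HA] := Phi0_log; have [C2 C20 HB] := Phi1_sqrt.
pose b := Phi (1 : R) 1; have b0 : 0 < b := Phi_at1_gt0 1.
have s10 : 0 < (c ^+ 2 / 4)^-1 by rewrite invr_gt0 csq4_gt0.
pose S := Num.min 1 ((c ^+ 2 / 4)^-1); have S0 : 0 < S by rewrite lt_min ltr01.
(* bound for eta, where secular 1 s = s / 2 * (- ln s + eta) *)
have [C3 C3E] : exists C3, C3 = C1 + (2 + C1) * C2 / b + 2 * m by eexists.
have C30 : 0 < C3.
  have : 0 < (2 + C1) * C2 / b by apply: divr_gt0 => //; apply: mulr_gt0 => //; lra.
  rewrite C3E; lra.
have [C4 C4E] : exists C4, C4 = `|ln K0| + C3 by eexists.
have [C5 C5E] : exists C5, C5 = C3 + `|ln (2 * v)| by eexists.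
have [C6 C6E] : exists C6, C6 = `|ln K0| + C3 + C5 + ln 4 + D0 + 1 by eexists.
(* Threshold for [- ln al]: [2 * C4] makes the denominator at least half of it, [C5] closes the
   bootstrap, and [expR 1] gives [ln (- ln al) >= 1]. *)
have [T TE] : exists T, T = 2 * C4 + C5 + expR 1 + 1 by eexists.
exists (2 * (C6 + 1)), (Num.min (S / K0) (expR (- T))).
split; first by rewrite lt_min divr_gt0//= expR_gt0.
move=> al s d al0; rewrite lt_min => /andP[al1 al2] s0 sK d0 dD.
have sS : s <= S by apply: le_trans sK _; move: al1; rewrite ltr_pdivlMr// => /ltW; rewrite mulrC.
have s1 : s <= 1 by apply: le_trans sS _; rewrite ge_min lexx.
have s2 : s <= (c ^+ 2 / 4)^-1 by apply: le_trans sS _; rewrite ge_min lexx orbT.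
have lT : T <= - ln al.
  by rewrite -(expRK T) -lnV ?posrE// ler_ln ?posrE ?expR_gt0 ?invr_gt0//; rewrite -[leLHS]invrK -expRN lef_pV2 ?posrE ?expR_gt0// ltW.
have lK : ln s <= ln K0 + ln al by rewrite -lnM ?posrE// ler_ln ?posrE// mulr_gt0.
have := HA s s0 s2; have [] := HB s s0 s2.
have sl := sqrt_ln s0.
have A0 : 0 < Phi 0 (sg s) by apply: Phi_gt0'; exact: sig_pos.
have gE : secular 1 s = s / 2 * (2 * m + Phi 0 (sg s) / Phi 1 (sg s)).
  rewrite /secular powRN1_sqr /gs subrr; have : Phi 1 (sg s) != 0 by rewrite gt_eqF// Phi_gt0'// sig_pos.
  by move: (Phi 0 _) (Phi 1 _) => A B B0; field; rewrite B0 gt_eqF.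
rewrite gE -/b.
have q0 : 0 <= s `^ (1 / 2) by exact: powR_ge0.
have q1 : s `^ (1 / 2) <= 1.
  by have h := @le_powR R (1 / 2) s 1; rewrite powR1 in h; apply: h => //; lra.
have L0 : 0 <= - ln s by rewrite oppr_ge0 ln_le0.
move=> B1 B2 B3; rewrite ler_norml => /andP[AL1 AL2] eqh.
have l1 : 1 <= - ln al.
  apply: le_trans lT; have := normr_ge0 (ln K0); have := normr_ge0 (ln (2 * v)).
  have := expR_gt0 (1 : R); move: TE C4E C5E C30; slra.
have nl : `|ln al| = - ln al by rewrite ler0_norm//; move: l1; slra.
rewrite nl.
have [eta etaE] : exists eta, eta = 2 * m + Phi 0 (sg s) / Phi 1 (sg s) + ln s by eexists.
have etaC : `|eta| <= C3.
  have B0 : 0 < Phi 1 (sg s) by exact: lt_le_trans B3.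
  have -> : eta = 2 * m + (Phi 0 (sg s) + ln s) + Phi 0 (sg s) * (1 - Phi 1 (sg s)) / Phi 1 (sg s).
    by rewrite etaE; field; rewrite gt_eqF.
  have t1 : 0 <= Phi 0 (sg s) * (1 - Phi 1 (sg s)) / Phi 1 (sg s).
    by rewrite divr_ge0 ?(ltW B0)// mulr_ge0 ?(ltW A0)//; move: B2; slra.
  have t2 : Phi 0 (sg s) * (1 - Phi 1 (sg s)) / Phi 1 (sg s) <= (2 + C1) * C2 / b.
    apply: ler_pM; rewrite ?invr_ge0 ?(ltW B0)//.
    - by rewrite mulr_ge0 ?(ltW A0)//; move: B2; slra.
    - apply: (@le_trans _ _ ((- ln s + C1) * (C2 * s `^ (1 / 2)))).
        by apply: ler_pM => //; [exact: ltW|move: B2; slra|move: AL2; slra].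
      have h1 := ler_wpM2l (ltW C20) sl; have h2 := ler_wpM2l (ltW (mulr_gt0 C10 C20)) q1; move: h1 h2; slra.
    - by rewrite lef_pV2 ?posrE.
  rewrite ler_norml C3E; apply/andP; move: t1 t2 AL1 AL2 m0' C10; slra.
have eqs : s * (- ln s + eta) = 2 * (al * v * (1 + d)) by rewrite -eqh etaE; field; rewrite gt_eqF// (lt_le_trans b0 B3).
clear HA HB B1 B2 B3 AL1 AL2 A0 gE sl q0 q1 etaE eqh.
have l0 : 0 < - ln al by move: l1; slra.
have K1 := ler_norm (ln K0); have K2 := normr_ge0 (ln K0).
have V1 := ler_norm (- ln (2 * v)); rewrite normrN in V1; have V2 := normr_ge0 (ln (2 * v)).
have e10 := expR_gt0 (1 : R).
move: etaC; rewrite ler_norml => /andP[et1 et2].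
have den : - ln al / 2 <= - ln s + eta by move: lT TE C4E C5E lK et1 K1 C30 V2 e10; slra.
have Y0 : 0 < - ln s + C3 by move: den et2 l0; slra.
have lY : - ln s + C3 <= - ln al + C5 + ln (- ln s + C3).
  have h : 2 * v * al <= s * (- ln s + C3).
    have h1 := ler_wpM2l (ltW s0) et2; have h2 := mulr_ge0 (mulr_ge0 (ltW al0) (ltW v0)) d0; move: h1 h2 eqs; slra.
  have v2 : 0 < 2 * v by rewrite mulr_gt0.
  have := h; rewrite -ler_ln ?posrE ?mulr_gt0// !lnM ?posrE ?mulr_gt0//; move=> h'.
  move: h'; rewrite -[ln 2 + ln v]lnM ?posrE//; move: C5E V1; slra.
(* Bootstrap: the logarithm on the right of [lY] is at most half of the left side. *)
have Y4 : - ln s + C3 <= 4 * (- ln al).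
  by have := ln_le_half Y0; move: lY lT TE C4E K2 C30 e10; slra.
have lnY : ln (- ln s + C3) <= ln 4 + ln (- ln al).
  by rewrite -lnM ?posrE// ler_ln ?posrE// mulr_gt0.
have lnl1 : 1 <= ln (- ln al).
  rewrite -[leLHS](expRK 1) ler_ln ?posrE//; apply: le_trans lT; move: TE C4E C5E C30 K2 V2; slra.
have dl : d * (- ln al) <= D0.
  have h1 : al * (- ln al) <= 1.
    have := @ln_sublinear R al^-1; rewrite invr_gt0 lnV ?posrE// => /(_ al0)/ltW h.
    by have := ler_wpM2l (ltW al0) h; rewrite mulfV ?gt_eqF.
  have h2 := ler_wpM2r (ltW l0) dD; have h3 := ler_wpM2l D00 h1; move: h2 h3; slra.
have dl0 : 0 <= d * (- ln al) by rewrite mulr_ge0// ltW.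
have ln40 : 0 <= ln 4 :> R by rewrite ln_ge0// ler1n.
have num : `|- ln al - (- ln s + eta) + d * (- ln al)| <= (C6 + 1) * ln (- ln al).
  have h : `|- ln al - (- ln s + eta) + d * (- ln al)| <= C6 + ln (- ln al).
    by rewrite ler_norml; apply/andP; move: lK K1 K2 et1 et2 dl dl0 C6E C5E V2 C30 ln40 lnl1 lY lnY D0'; slra.
  apply: le_trans h _; have C60 : 0 <= C6 by move: C6E C5E C30 V2 K2 ln40 D0'; slra.
  have h := ler_wpM2l C60 lnl1; move: h; slra.
have dn0 : 0 < - ln s + eta by move: den l0; slra.
exists ((- ln al - (- ln s + eta) + d * (- ln al)) / (- ln s + eta)); split; last first.
  rewrite mulNr; congr (- _).
  transitivity (2 * (al * v * (1 + d)) / (- ln s + eta)); first by rewrite -eqs mulfK// gt_eqF.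
  have z1 : ln al != 0 by rewrite lt_eqF//; move: l0; slra.
  move: (- ln s + eta) dn0 => D D1.
  by field; rewrite z1 gt_eqF.
rewrite normrM [X in _ * X]ger0_norm ?invr_ge0 ?(ltW dn0)//.
have n0 : 0 <= (C6 + 1) * ln (- ln al) by exact: le_trans (normr_ge0 _) num.
rewrite ler_pdivrMr//; apply: le_trans num _.
have h := ler_wpM2l n0 den.
have -> : 2 * (C6 + 1) * (ln (- ln al) / - ln al) * (- ln s + eta)
   = (C6 + 1) * ln (- ln al) * (- ln s + eta) * 2 / (- ln al).
  by field; move: l0; slra.
rewrite ler_pdivlMr//; move: h; slra.
Qed.

(** Perturbation of a quotient; the deviations are one-sided because [Phi] decreases in its
    argument. *)
Lemma quot_bound A B L1 L0 E1 E0 b : 0 < b -> b <= B -> 0 < L0 -> 0 <= L1 - A -> L1 - A <= E1 ->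
  0 <= L0 - B -> L0 - B <= E0 -> 0 < L1 -> `|A / B - L1 / L0| <= (E1 + L1 / L0 * E0) / b.
Proof.
move=> b0 bB L00 h1 h2 h3 h4 L10; have B0 : 0 < B by exact: lt_le_trans bB.
have -> : A / B - L1 / L0 = (- (L1 - A) + L1 / L0 * (L0 - B)) / B by field; rewrite !gt_eqF.
have r0 : 0 < L1 / L0 by rewrite divr_gt0.
have h5 := ler_wpM2l (ltW r0) h4; have h6 := mulr_ge0 (ltW r0) h3.
rewrite normrM normfV (gtr0_norm B0); apply: ler_pM => //.
- by rewrite invr_ge0 ltW.
- by rewrite ler_norml; apply/andP; split; lra.
- by rewrite lef_pV2 ?posrE.
Qed.

Lemma sig_lin s al : 0 < s -> s <= K0 * al -> sg s <= K0 * (c ^+ 2 / 4) * al.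
Proof.
by move=> s0 h; rewrite sig_scale [leRHS]mulrAC; exact: (ler_wpM2r (ltW csq4_gt0) h).
Qed.

(** * The regime [0 < mu < 1] *)

Section MuLessOne.
Variable mu : R.
Hypotheses (mu0 : 0 < mu) (mu1 : mu < 1).
Local Ltac slra_lt := clear -m0 c0 v0 K00 D00 mu0 mu1; intros; try split; lra.

(** Reflection turns the index [mu - 1] into the positive [1 - mu] and releases the power [s^mu].
    The powers of [c] cancel, so the leading term does not depend on where the matching is done. *)
Lemma secular_lt1 s : 0 < s -> secular mu s =
  m * s + 2 `^ (1 - 2 * mu) * s `^ mu * (Phi (1 - mu) (sg s) / Phi mu (sg s)).
Proof.
move=> s0; have B0 : Phi mu (sg s) != 0 by rewrite gt_eqF// Phi_gt0'// sig_pos.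
rewrite /secular /gs (_ : mu - 1 = - (1 - mu)); last by ring.
rewrite (Phi_refl _ (sig_pos s0)) (_ : - (1 - mu) = mu - 1); last by ring.
have -> : s / 2 * c ^+ 2 * (sg s `^ (mu - 1) * Phi (1 - mu) (sg s)) = 2 * sg s `^ mu * Phi (1 - mu) (sg s).
  rewrite -(powRS mu (sig_pos s0)) (_ : s / 2 * c ^+ 2 = 2 * sg s); first by ring.
  by rewrite /sig; field.
have -> : sg s `^ mu = s `^ mu * (c `^ mu) ^+ 2 * ((2 `^ mu)^-1) ^+ 2.
  rewrite sig_scale (_ : c ^+ 2 / 4 = c * c * (2^-1 * 2^-1)); last by field.
  have i0 : 0 <= 2^-1 :> R by rewrite invr_ge0.
  rewrite !powRM ?mulr_ge0 ?(ltW s0) ?(ltW c0)//.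
  have -> : 2^-1 `^ mu = (2 `^ mu)^-1 :> R by rewrite -(powR_inv1 (_ : 0 <= 2))// -powRrM mulN1r powRN.
  by rewrite !expr2 mulrA.
have -> : 2 `^ (1 - 2 * mu) = 2 * ((2 `^ mu)^-1) ^+ 2 :> R.
  rewrite (_ : 1 - 2 * mu = 1 + (- mu + - mu)); last by ring.
  by rewrite !powRDx// powRr1// powRN expr2.
rewrite powRN; have t0 : 2 `^ mu != 0 :> R by rewrite gt_eqF// powR_gt0.
have cm0 : c `^ mu != 0 by rewrite gt_eqF// powR_gt0.
by field; rewrite B0 t0 cm0.
Qed.

(** In the variable [U = s^mu] the equation is [U (B0 + ep) = al v (1 + d)], where [B0 = 2^(1 - 2
    mu) Gamma (1 - mu) / Gamma mu] and [ep = O(U + U^(1/mu - 1))]. The second order comes from [m s]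
    and from [Phi (1 - mu)], the first from [Phi mu]. The constant [c_mu] is [B0] to the power
    [- 1 / mu]. *)
Lemma asym_lt1 : exists C a1 : R, 0 < a1 /\ forall al s d, 0 < al -> al < a1 -> 0 < s -> s <= K0 * al ->
  0 <= d -> d <= D0 * al -> secular mu s = al * v * (1 + d) ->
  exists e, `|e| <= C * al `^ (Num.min 1 (1 / mu - 1)) /\
    - s = - c_mu mu * (al * v) `^ (1 / mu) * (1 + e).
Proof.
have mu0' := mu0; have mu1' := mu1; have D0' := D00; have m0' := m0; have v0' := v0.
have s10 : 0 < (c ^+ 2 / 4)^-1 by rewrite invr_gt0 csq4_gt0.
have n0 : 0 < 1 - mu by lra.
have n1 : 1 - mu < 1 by lra.
have [L1 L1E] : exists x, x = Phi (1 - mu) 0 by eexists.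
have [L0 L0E] : exists x, x = Phi mu 0 by eexists.
have [b bE] : exists x, x = Phi mu 1 by eexists.
have [b1 b1E] : exists x, x = Phi (1 - mu) 1 by eexists.
have [ka kaE] : exists x : R, x = 2 `^ (1 - 2 * mu) by eexists.
have L10 : 0 < L1 by rewrite L1E; exact: Phi_gt0.
have L00 : 0 < L0 by rewrite L0E; exact: Phi_gt0.
have b0 : 0 < b by rewrite bE Phi_at1_gt0.
have b10 : 0 < b1 by rewrite b1E Phi_at1_gt0.
have ka0 : 0 < ka by rewrite kaE powR_gt0.
have [r0 r0E] : exists x, x = L1 / L0 by eexists.
have r00 : 0 < r0 by rewrite r0E divr_gt0.
have [B0 B0E] : exists x, x = ka * r0 by eexists.
have B00 : 0 < B0 by rewrite B0E mulr_gt0.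
have [Q1 Q1E] : exists x, x = L0 / (1 - mu) * (c ^+ 2 / 4) `^ (1 - mu) by eexists.
have [Q0 Q0E] : exists x, x = L1 / mu * (c ^+ 2 / 4) `^ mu by eexists.
have Q10 : 0 <= Q1 by rewrite Q1E mulr_ge0 ?powR_ge0// divr_ge0// ltW.
have Q00 : 0 <= Q0 by rewrite Q0E mulr_ge0 ?powR_ge0// divr_ge0// ltW.
have [Ce CeE] : exists x, x = ka * (Q1 + r0 * Q0) / b + m by eexists.
have rQ0 : 0 <= r0 * Q0 by rewrite mulr_ge0// ltW.
have Ce0 : 0 <= Ce.
  by rewrite CeE addr_ge0 ?(ltW m0)// divr_ge0 ?(ltW b0)// mulr_ge0 ?(ltW ka0)// addr_ge0.
have [bb bbE] : exists x, x = ka * (b1 / L0) by eexists.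
have bb0 : 0 < bb by rewrite bbE mulr_gt0// divr_gt0.
have [K1 K1E] : exists x, x = v * (1 + D0) / bb by eexists.
have K10 : 0 < K1 by rewrite K1E divr_gt0// mulr_gt0//; lra.
pose p := 1 / mu; have p1 : 1 <= p by rewrite /p ler_pdivlMr// mul1r ltW.
have pm : p * mu = 1 by rewrite /p divfK// gt_eqF.
have q0 : 0 <= p - 1 by lra.
pose kk := Num.min 1 (p - 1).
have [C1 C1E] : exists x, x = (D0 * B0 + Ce * (K1 `^ (p - 1) + K1)) / bb by eexists.
have Kp0 := powR_ge0 K1 (p - 1).
have C10 : 0 <= C1.
  rewrite C1E divr_ge0 ?(ltW bb0)// addr_ge0//; first by rewrite mulr_ge0// ltW.
  by rewrite mulr_ge0// addr_ge0// ltW.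
have [Y YE] : exists x, x = (1 + D0) * B0 / bb + 1 by eexists.
exists (p * Y `^ (p - 1) * C1), (Num.min 1 ((c ^+ 2 / 4)^-1 / K0)).
split; first by rewrite !lt_min ltr01 divr_gt0.
move=> al s d al0; rewrite !lt_min => /andP[al1 al2] s0 sK d0 dD eqh.
have s1 : s <= (c ^+ 2 / 4)^-1.
  by apply: le_trans sK _; move: al2; rewrite ltr_pdivlMr// => /ltW; rewrite mulrC.
have g0 := sig_pos s0; have g1 := sig_le1 s1.
have PB0 : 0 < Phi mu (sg s) by exact: Phi_gt0'.
have PA0 : 0 < Phi (1 - mu) (sg s) by exact: Phi_gt0'.
have hA : 0 <= L1 - Phi (1 - mu) (sg s) by rewrite subr_ge0 L1E; exact: Phi_le_Gamma.
have hB : 0 <= L0 - Phi mu (sg s) by rewrite subr_ge0 L0E; exact: Phi_le_Gamma.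
have hA2 : L1 - Phi (1 - mu) (sg s) <= Q1 * s `^ (1 - mu).
  have := Phi_near0_lt1 n0 n1 g0; rewrite (_ : 1 - (1 - mu) = mu); last by ring.
  rewrite -L1E -L0E Q1E [X in X `^ (1 - mu)]sig_scale powRM ?(ltW s0) ?(ltW csq4_gt0)//; slra_lt.
have hB2 : L0 - Phi mu (sg s) <= Q0 * s `^ mu.
  have := Phi_near0_lt1 mu0 mu1 g0.
  rewrite -L1E -L0E Q0E [X in X `^ mu]sig_scale powRM ?(ltW s0) ?(ltW csq4_gt0)//; slra_lt.
have bB : b <= Phi mu (sg s) by rewrite bE; exact: Phi_ge_at1.
have q := quot_bound b0 bB L00 hA hA2 hB hB2 L10; rewrite -r0E in q.
have lowr : b1 / L0 <= Phi (1 - mu) (sg s) / Phi mu (sg s).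
  apply: ler_pM; rewrite ?invr_ge0 ?(ltW b10) ?(ltW L00)//.
    by rewrite b1E; exact: Phi_ge_at1.
  by rewrite lef_pV2 ?posrE// -subr_ge0.
have [r rE] : exists r, r = Phi (1 - mu) (sg s) / Phi mu (sg s) - r0 by eexists.
rewrite -rE in q.
have U0 : 0 < s `^ mu by rewrite powR_gt0.
have w0 : 0 <= s `^ (1 - mu) by exact: powR_ge0.
have [U UE] : exists U, U = s `^ mu by eexists.
have [w wE] : exists w, w = s `^ (1 - mu) by eexists.
have sUw : s = U * w by rewrite UE wE -powRDx// addrC subrK powRr1// ltW.
have wU : w = U `^ (p - 1).
  by rewrite wE UE -powRrM; congr (_ `^ _); rewrite mulrBr mulr1 mulrC pm.
have sUp : s = U `^ p by rewrite UE -powRrM mulrC pm powRr1// ltW.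
rewrite -UE in U0 q; rewrite -wE in w0 q.
have [ep epE] : exists ep, ep = ka * r + m * w by eexists.
have sE : U * (B0 + ep) = al * v * (1 + d).
  rewrite -eqh (secular_lt1 s0) -UE -kaE epE rE B0E {3}sUw; ring.
have epb : `|ep| <= Ce * (w + U).
  have h1 : `|ka * r| <= ka * (Q1 + r0 * Q0) / b * (w + U).
    rewrite normrM (gtr0_norm ka0) -[leRHS]mulrA -mulrA ler_wpM2l ?(ltW ka0)//; apply: le_trans q _.
    rewrite [leRHS]mulrCA [leLHS]mulrC; apply: ler_wpM2l; first by rewrite invr_ge0 ltW.
    have := mulr_ge0 Q10 (ltW U0); have := mulr_ge0 rQ0 w0; slra_lt.
  rewrite epE; apply: le_trans (ler_normD _ _) _; rewrite CeE.
  rewrite (ger0_norm (mulr_ge0 (ltW m0) w0)); have := mulr_ge0 (ltW m0) (ltW U0); move: h1; slra_lt.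
have dn : bb <= B0 + ep.
  have -> : B0 + ep = ka * (Phi (1 - mu) (sg s) / Phi mu (sg s)) + m * w by rewrite epE rE B0E; ring.
  have := ler_wpM2l (ltW ka0) lowr; rewrite -bbE; have := mulr_ge0 (ltW m0) w0; slra_lt.
have dn0 : 0 < B0 + ep by exact: lt_le_trans dn.
have dD1 : d <= D0 by apply: le_trans dD _; rewrite ler_piMr// ltW.
have UK : U <= K1 * al.
  have : U * bb <= al * v * (1 + D0).
    apply: (@le_trans _ _ (al * v * (1 + d))); first by rewrite -sE ler_pM2l.
    by rewrite ler_wpM2l ?mulr_ge0 ?(ltW al0) ?(ltW v0)// lerD2l.
  by rewrite -ler_pdivlMr// K1E => /le_trans; apply; rewrite le_eqVlt; apply/orP; left; apply/eqP; ring.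
have ak1 : al <= al `^ kk.
  rewrite -[leLHS](powRr1 (ltW al0)); apply: (@ger_powR R al); first by rewrite al0 ltW.
  by rewrite ge_min lexx.
have ak2 : al `^ (p - 1) <= al `^ kk.
  by apply: (@ger_powR R al); [rewrite al0 ltW|rewrite ge_min lexx orbT].
have wK : w <= K1 `^ (p - 1) * al `^ kk.
  rewrite wU; apply: le_trans (le_powR q0 (ltW U0) UK) _.
  by rewrite powRM ?(ltW K10) ?(ltW al0)// ler_wpM2l.
have UK2 : U <= K1 * al `^ kk by apply: le_trans UK _; rewrite ler_wpM2l// ltW.
(* [U = al v / B0 * X] with [X] near 1; raising to the power [1 / mu >= 1] keeps the order, as that
   power is Lipschitz on [(0, Y]]. *)
pose X := (1 + d) * B0 / (B0 + ep).
have X0 : 0 < X by rewrite divr_gt0// mulr_gt0//; move: d0; slra_lt.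
have X1 : `|X - 1| <= C1 * al `^ kk.
  have -> : X - 1 = (d * B0 - ep) / (B0 + ep) by rewrite /X; field; rewrite gt_eqF.
  rewrite normrM normfV (gtr0_norm dn0) ler_pdivrMr//.
  have num : `|d * B0 - ep| <= C1 * bb * al `^ kk.
    rewrite C1E divfK ?gt_eqF//; apply: le_trans (ler_normB _ _) _.
    rewrite (ger0_norm (mulr_ge0 d0 (ltW B00))).
    have h1 := ler_wpM2r (ltW B00) (le_trans dD (ler_wpM2l D00 ak1)).
    have h2 := ler_wpM2l Ce0 (lerD wK UK2); move: h1 h2 epb; slra_lt.
  apply: le_trans num _; rewrite mulrAC ler_wpM2l// mulr_ge0 ?powR_ge0//.
have XY : X <= Y.
  have : X <= (1 + D0) * B0 / bb.
    apply: ler_pM; rewrite ?invr_ge0 ?(ltW dn0)//.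
    - by rewrite mulr_ge0 ?(ltW B00)//; move: d0; slra_lt.
    - by rewrite ler_wpM2r ?(ltW B00)// lerD2l.
    - by rewrite lef_pV2 ?posrE.
  rewrite YE; slra_lt.
have Y1 : 1 <= Y.
  have : 0 <= (1 + D0) * B0 / bb by rewrite divr_ge0 ?(ltW bb0)// mulr_ge0 ?(ltW B00)//; move: D0'; slra_lt.
  rewrite YE; slra_lt.
exists (X `^ p - 1); split.
  have := powR_lip p1 X0 ltr01 XY Y1; rewrite powR1 => /le_trans; apply.
  rewrite -[leRHS]mulrA; apply: ler_wpM2l; last exact: X1.
  by apply: mulr_ge0; [exact: le_trans ler01 p1|exact: powR_ge0].
rewrite addrC subrK {1}sUp.
have -> : U = al * v / B0 * X.
  rewrite /X; have -> : U = al * v * (1 + d) / (B0 + ep) by rewrite -sE mulfK// gt_eqF.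
  by field; rewrite !gt_eqF.
have av : 0 <= al * v by rewrite mulr_ge0 ?ltW.
rewrite powRM ?(ltW X0)//; last by rewrite divr_ge0// ltW.
rewrite powRM// ?invr_ge0 ?(ltW B00)// /c_mu -!Phi_Gamma -L1E -L0E.
have -> : 2 `^ (2 * mu - 1) * L0 / L1 = B0^-1.
  rewrite (_ : 2 * mu - 1 = - (1 - 2 * mu)); last by ring.
  by rewrite powRN -kaE B0E r0E; field; rewrite !gt_eqF.
rewrite -/p; ring.
Qed.

End MuLessOne.

(** Supplies the left end for the intermediate value theorem. For [mu = 0] the decay to 0 is only
    logarithmic; otherwise the decay estimate of [Phi (mu - 1)] leaves a positive power of [s]. *)
Lemma secular_small mu eps S : 0 <= mu -> 0 < eps -> 0 < S ->
  exists s, [/\ 0 < s, s < S & secular mu s < eps].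
Proof.
move=> mu0 e0 S0; have m0' := m0.
have s10 : 0 < (c ^+ 2 / 4)^-1 by rewrite invr_gt0 csq4_gt0.
suff [T T0 HT] : exists2 T, 0 < T & forall s, 0 < s -> s <= (c ^+ 2 / 4)^-1 -> s <= T ->
    c `^ (- mu) ^+ 2 * gs c mu s <= eps / 4.
  pose s := Num.min (S / 2) (Num.min (c ^+ 2 / 4)^-1 (Num.min T (eps / (4 * m)))).
  have s0 : 0 < s by rewrite !lt_min s10 T0 !divr_gt0// mulr_gt0.
  exists s; split => //; first by rewrite gt_min (_ : S / 2 < S)//; lra.
  have h1 : s <= (c ^+ 2 / 4)^-1 by rewrite !ge_min lexx orbT.
  have h2 : s <= T by rewrite !ge_min lexx !orbT.
  have h3 : s <= eps / (4 * m) by rewrite !ge_min lexx !orbT.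
  have := HT s s0 h1 h2; move: h3; rewrite ler_pdivlMr ?mulr_gt0// /secular; lra.
have [-> |mu1] := eqVneq mu 0.
  have [C1 C10 HA] := Phi0_log; have [C2 C20 HB] := Phi1_sqrt.
  exists (expR (- (C1 + 8 / eps))); first exact: expR_gt0.
  move=> s s0 s1 sT; have := HA s s0 s1; have [_ B1 _] := HB s s0 s1.
  rewrite ler_norml => /andP[AL1 _].
  have lT : C1 + 8 / eps <= - ln s.
    have : ln s <= - (C1 + 8 / eps) by rewrite -[leRHS]expRK ler_ln ?posrE ?expR_gt0.
    lra.
  have gE : gs c 0 s = 2 * Phi 1 (sg s) / Phi 0 (sg s).
    have := Phi_rec 0 (sig_pos s0); rewrite add0r mul0r add0r => ->.
    by rewrite /gs; congr (_ / _); rewrite [X in 2 * (X * _)]/sig; field.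
  rewrite gE oppr0 powRr0 expr1n mul1r.
  have A8 : 8 / eps <= Phi 0 (sg s) by lra.
  have e8 : 0 < 8 / eps by rewrite divr_gt0.
  have A0 : 0 < Phi 0 (sg s) by exact: lt_le_trans A8.
  rewrite ler_pdivrMr//; move: A8; rewrite ler_pdivrMr// => A8.
  have := ler_wpM2l (_ : 0 <= 4^-1 :> R) A8; rewrite invr_ge0 => h; have := h (ler0n _ _); lra.
have mu2 : 0 < mu by rewrite lt_neqAle eq_sym mu1.
(* [p = 1 - th] must exceed [1 - mu], so that the shifted index is positive, and stay below 1, so
   that [s * s^(- p)] tends to 0. *)
pose th := Num.min mu 1 / 2; pose p := 1 - th.
have mn0 : 0 < Num.min mu 1 by rewrite lt_min mu2 ltr01.
have th0 : 0 < th by rewrite divr_gt0.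
have th1 : th <= 1 / 2 by rewrite ler_wpM2r// ge_min lexx orbT.
have thm : th < mu.
  have : Num.min mu 1 <= mu by rewrite ge_min lexx.
  by rewrite /th; lra.
have p0 : 0 < p by rewrite /p; lra.
have np : 0 < mu - 1 + p by rewrite /p; lra.
pose Q := c `^ (- mu) ^+ 2 * (2 * (p `^ p * Phi (mu - 1 + p) 0)) / Phi mu 1.
have Q0 : 0 < Q.
  rewrite divr_gt0 ?Phi_at1_gt0// mulr_gt0 ?exprn_gt0 ?powR_gt0// mulr_gt0// mulr_gt0 ?powR_gt0//.
  exact: Phi_gt0.
exists ((eps / (4 * Q)) `^ th^-1 / (c ^+ 2 / 4)).
  by rewrite divr_gt0 ?csq4_gt0// powR_gt0// divr_gt0// mulr_gt0.
move=> s s0 s1 sT; have g0 := sig_pos s0.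
have gth : sg s `^ th <= eps / (4 * Q).
  have eQ : 0 <= eps / (4 * Q).
    by apply: divr_ge0; [exact: ltW|apply: mulr_ge0 => //; exact: ltW].
  rewrite -[leRHS](powRr1 eQ) -[X in _ <= _ `^ X](mulVf (lt0r_neq0 th0)) [leRHS]powRrM.
  by apply: le_powR; rewrite ?(ltW th0) ?(ltW g0)// sig_scale -ler_pdivlMr// csq4_gt0.
have PB0 : 0 < Phi mu (sg s) by exact: Phi_gt0'.
have gb : c `^ (- mu) ^+ 2 * gs c mu s <= Q * sg s `^ th.
  have h1 := Phi_decay p0 np g0.
  have h2 : Phi mu 1 <= Phi mu (sg s) by apply: Phi_ge_at1 => //; exact: sig_le1.
  have -> : gs c mu s = 2 * sg s * Phi (mu - 1) (sg s) / Phi mu (sg s).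
    by rewrite /gs; congr (_ * _ / _); rewrite /sig; field.
  have -> : Q * sg s `^ th = c `^ (- mu) ^+ 2 * (2 * sg s * (p `^ p * sg s `^ (- p) * Phi (mu - 1 + p) 0) / Phi mu 1).
    rewrite (_ : th = 1 + - p); last by rewrite /p; ring.
    by rewrite (powRDx 1 (- p) g0) (powRr1 (ltW g0)) /Q; ring.
  apply: ler_wpM2l; first exact: sqr_ge0.
  have A0 : 0 < Phi (mu - 1) (sg s) by exact: Phi_gt0'.
  apply: ler_pM.
  - by apply: mulr_ge0; [apply: mulr_ge0 => //|]; exact: ltW.
  - by rewrite invr_ge0 ltW.
  - by apply: ler_wpM2l => //; apply: mulr_ge0 => //; exact: ltW.
  - by rewrite lef_pV2 ?posrE// Phi_at1_gt0.
apply: le_trans gb _; apply: le_trans (ler_wpM2l (ltW Q0) gth) _.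
by rewrite le_eqVlt; apply/orP; left; apply/eqP; field; rewrite gt_eqF.
Qed.

(** * The regime [mu > 1] *)

Section MuGreaterOne.
Variable mu : R.
Hypothesis mu1 : 1 < mu.
Local Ltac slra_gt := clear -m0 c0 v0 K00 D00 mu1; intros; try split; lra.

(** The integral of [psi0^2 r] over [(c, oo)], where [psi0] is a pure power. *)
Definition tailc : R := c `^ (- mu) ^+ 2 * c ^+ 2 / (2 * (mu - 1)).

Lemma secular_gt1 s : 0 < s -> s <= (c ^+ 2 / 4)^-1 ->
  m * s <= secular mu s /\ secular mu s <= (m + c `^ (- mu) ^+ 2 * c ^+ 2 / 2 * (Phi (mu - 1) 0 / Phi mu 1)) * s.
Proof.
move=> s0 s1; have m1 : 0 < mu - 1 by have := mu1; lra.
have P0 : 0 <= c `^ (- mu) ^+ 2 by exact: sqr_ge0.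
have A0 : 0 < Phi (mu - 1) (sg s) by apply: Phi_gt0'; exact: sig_pos.
have B0 : 0 < Phi mu (sg s) by apply: Phi_gt0'; exact: sig_pos.
have sE : secular mu s = m * s + c `^ (- mu) ^+ 2 * c ^+ 2 / 2 * (Phi (mu - 1) (sg s) / Phi mu (sg s)) * s.
  by rewrite /secular /gs; field; rewrite gt_eqF.
have h : Phi (mu - 1) (sg s) / Phi mu (sg s) <= Phi (mu - 1) 0 / Phi mu 1.
  apply: ler_pM; rewrite ?invr_ge0 ?(ltW A0) ?(ltW B0)//.
    by apply: Phi_le_Gamma => //; exact: sig_pos.
  by rewrite lef_pV2 ?posrE ?Phi_at1_gt0//; apply: Phi_ge_at1; [exact: sig_pos|exact: sig_le1].
have k0 : 0 <= c `^ (- mu) ^+ 2 * c ^+ 2 / 2 by rewrite divr_ge0// mulr_ge0// sqr_ge0.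
have r0 : 0 <= Phi (mu - 1) (sg s) / Phi mu (sg s) by rewrite divr_ge0 ?ltW.
have h1 := ler_wpM2r (ltW s0) (ler_wpM2l k0 h); have h2 := mulr_ge0 (mulr_ge0 k0 r0) (ltW s0).
rewrite sE; split; lra.
Qed.

(** The secular function is linear to leading order, with slope [m + tailc] because
    [Gamma mu = (mu - 1) Gamma (mu - 1)]. The deviation of [Phi mu] from its value at 0 is [O(al)],
    so the error is governed by the rate [E1] for index [mu - 1]. *)
Lemma asym_gt1_core : exists2 C, 0 < C & forall al s d E1, 0 < al -> 0 < s -> s <= K0 * al ->
  s <= (c ^+ 2 / 4)^-1 -> 0 <= d -> d <= D0 * al -> secular mu s = al * v * (1 + d) ->
  Phi (mu - 1) 0 - Phi (mu - 1) (sg s) <= E1 ->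
  exists e, `|e| <= C * (al + E1) /\ - s = - (al * v / (m + tailc)) * (1 + e).
Proof.
have m1 : 0 < mu - 1 by have := mu1; lra.
have m00 : 0 < mu by lra.
pose L1 := Phi (mu - 1) 0; pose L0 := Phi mu 0; pose b := Phi mu 1.
have L10 : 0 < L1 by apply: Phi_gt0.
have L00 : 0 < L0 by apply: Phi_gt0.
have b0 : 0 < b by exact: Phi_at1_gt0.
have Lr : L0 = (mu - 1) * L1 by have := Gamma_rec m1; rewrite subrK.
pose P := c `^ (- mu) ^+ 2 * c ^+ 2 / 2.
have P0 : 0 < P by rewrite divr_gt0// mulr_gt0 ?exprn_gt0 ?powR_gt0.
have TE : tailc = P * (L1 / L0) by rewrite /tailc /P Lr; field; rewrite !gt_eqF.
pose N := m + P * (L1 / L0); have N0 : 0 < N by rewrite addr_gt0// mulr_gt0// divr_gt0.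
pose k := K0 * (c ^+ 2 / 4); have k0 : 0 < k by rewrite mulr_gt0// csq4_gt0.
pose C := (D0 * N + P * (L1 / L0 * (k * L1)) / b + P / b) / m.
have C0 : 0 < C.
  have h1 : 0 <= D0 * N by rewrite mulr_ge0// ltW.
  have h2 : 0 < P * (L1 / L0 * (k * L1)) / b by rewrite divr_gt0// mulr_gt0// mulr_gt0 ?divr_gt0 ?mulr_gt0.
  have h3 : 0 < P / b by rewrite divr_gt0.
  by rewrite divr_gt0//; lra.
exists C => // al s d E1 al0 s0 sK s1 d0 dD eqh hE.
have B0 : 0 < Phi mu (sg s) by apply: Phi_gt0'; exact: sig_pos.
have [lo _] := secular_gt1 s0 s1.
have hA : 0 <= L1 - Phi (mu - 1) (sg s) by rewrite subr_ge0; apply: Phi_le_Gamma => //; exact: sig_pos.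
have hB : 0 <= L0 - Phi mu (sg s) by rewrite subr_ge0; apply: Phi_le_Gamma => //; exact: sig_pos.
have hB2 : L0 - Phi mu (sg s) <= k * al * L1.
  apply: le_trans (Phi_near0_gt1 mu1 (sig_pos s0)) _; rewrite ler_wpM2r ?(ltW L10)//.
  exact: sig_lin.
have bB : b <= Phi mu (sg s) by apply: Phi_ge_at1; [exact: sig_pos|exact: sig_le1].
have q := quot_bound b0 bB L00 hA hE hB hB2 L10.
have [r rE] : exists r, r = Phi (mu - 1) (sg s) / Phi mu (sg s) - L1 / L0 by eexists.
rewrite -rE in q.
have sE : secular mu s = s * (N + P * r).
  by rewrite rE /secular /gs /N /P; field; rewrite !gt_eqF.
have dn : m <= N + P * r.
  by move: lo; rewrite sE mulrC ler_pM2l.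
have dn0 : 0 < N + P * r by exact: lt_le_trans dn.
exists ((d * N - P * r) / (N + P * r)); split; last first.
  have -> : s = al * v * (1 + d) / (N + P * r) by rewrite -eqh sE mulfK// gt_eqF.
  by rewrite TE -/N mulNr; congr (- _); field; rewrite !gt_eqF.
rewrite normrM normfV (gtr0_norm dn0).
have E10 : 0 <= E1 by exact: le_trans hE.
have num : `|d * N - P * r| <= C * m * (al + E1).
  have -> : C * m = D0 * N + P * (L1 / L0 * (k * L1)) / b + P / b by rewrite /C divfK// gt_eqF.
  apply: le_trans (ler_normB _ _) _; rewrite ger0_norm; last by rewrite mulr_ge0// ltW.
  rewrite normrM (gtr0_norm P0).
  have h1 := ler_wpM2r (ltW N0) dD; have h2 := ler_wpM2l (ltW P0) q.
  have h3 : 0 <= D0 * N * E1 by rewrite mulr_ge0// mulr_ge0// ltW.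
  have h4 : 0 <= P * (L1 / L0 * (k * L1)) / b * E1.
    by rewrite mulr_ge0// ltW// divr_gt0// mulr_gt0// mulr_gt0 ?divr_gt0 ?mulr_gt0.
  have h5 : 0 <= P / b * al by apply: mulr_ge0; [apply: divr_ge0|]; exact: ltW.
  have h6 : P * ((E1 + L1 / L0 * (k * al * L1)) / b) = P / b * E1 + P * (L1 / L0 * (k * L1)) / b * al by ring.
  rewrite h6 in h2; lra.
have cm : 0 <= C * (al + E1) by rewrite mulr_ge0 ?(ltW C0)// addr_ge0// ltW.
rewrite ler_pdivrMr//; apply: le_trans num _; have := ler_wpM2l cm dn; lra.
Qed.

(** The index [mu - 1] is below, at or above 1, and the rate at which [Phi (mu - 1)] reaches its
    value at 0 is accordingly [s^(mu - 1)], [s |ln s|] or [s]. *)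
Lemma asym_gt1 : exists C a1 : R, 0 < a1 /\ forall al s d, 0 < al -> al < a1 -> 0 < s -> s <= K0 * al ->
  0 <= d -> d <= D0 * al -> secular mu s = al * v * (1 + d) ->
  exists e, `|e| <= C * (if mu == 2 then al * `|ln al| else al `^ (Num.min 1 (mu - 1))) /\
    - s = - (al * v / (m + tailc)) * (1 + e).
Proof.
have mu1' := mu1; have D0' := D00.
have s10 : 0 < (c ^+ 2 / 4)^-1 by rewrite invr_gt0 csq4_gt0.
pose k := K0 * (c ^+ 2 / 4); have k0 : 0 < k by rewrite mulr_gt0// csq4_gt0.
have [C C0 core] := asym_gt1_core.
suff [C' [a2 [a20 C'0 rate]]] : exists C' a2 : R, [/\ 0 < a2, 0 <= C' & forall al s d, 0 < al -> al < a2 -> al < 1 -> 0 < s ->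
    s <= K0 * al -> s <= (c ^+ 2 / 4)^-1 -> 0 <= d -> d <= D0 * al -> secular mu s = al * v * (1 + d) ->
    al + (Phi (mu - 1) 0 - Phi (mu - 1) (sg s)) <=
      C' * (if mu == 2 then al * `|ln al| else al `^ (Num.min 1 (mu - 1)))].
  exists (C * C'), (Num.min a2 (Num.min 1 ((c ^+ 2 / 4)^-1 / K0))).
  split; first by rewrite !lt_min a20 ltr01 divr_gt0.
  move=> al s d al0; rewrite !lt_min => /andP[al1 /andP[al2 al3]] s0 sK d0 dD eqh.
  have s1 : s <= (c ^+ 2 / 4)^-1.
    by apply: le_trans sK _; move: al3; rewrite ltr_pdivlMr// => /ltW; rewrite mulrC.
  have [e [he se]] := core al s d _ al0 s0 sK s1 d0 dD eqh (lexx _).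
  exists e; split => //; apply: le_trans he _; rewrite -mulrA ler_wpM2l ?(ltW C0)//.
  exact: (rate al s d).
have [mu2|mu2] := eqVneq mu 2.
  have mE : mu - 1 = 1 by rewrite mu2; ring.
  pose N' := m + c `^ (- mu) ^+ 2 * c ^+ 2 / 2 * (Phi (mu - 1) 0 / Phi mu 1).
  have N'0 : 0 < N'.
    rewrite addr_gt0// mulr_gt0 ?divr_gt0 ?mulr_gt0 ?exprn_gt0 ?powR_gt0 ?Phi_at1_gt0//.
    by apply: Phi_gt0 => // _; lra.
  (* Passing from [ln s] to [ln al] needs a lower bound on [s]; it comes from the linear upper bound
     on the secular function. *)
  pose q := v / N' * (c ^+ 2 / 4); have q0 : 0 < q by rewrite mulr_gt0 ?csq4_gt0 ?divr_gt0.
  have F0 := Phi_at1_gt0 0.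
  exists (1 + k * (Phi 0 1 + 2 + `|ln q|)), (expR (-1)); split; first exact: expR_gt0.
    by have := normr_ge0 (ln q) => h; have := mulr_ge0 (ltW k0) (_ : 0 <= Phi 0 1 + 2 + `|ln q|); move=> h'; have := h' _; lra.
  move=> al s d al0 al1 al2 s0 sK s1 d0 dD eqh.
  have l1 : 1 <= - ln al.
    have : ln al <= -1 by rewrite -[leRHS]expRK ler_ln ?posrE ?expR_gt0// ltW.
    slra_gt.
  have nl : `|ln al| = - ln al by rewrite ler0_norm//; move: l1; slra_gt.
  rewrite nl mE Gamma1.
  have [_ up] := secular_gt1 s0 s1; rewrite eqh -/N' in up.
  have slo : q * al <= sg s.
    rewrite sig_scale /q mulrAC ler_wpM2r ?(ltW csq4_gt0)// mulrAC ler_pdivrMr// (mulrC s).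
    by apply: le_trans up; rewrite mulrDr mulr1 (mulrC v) lerDl mulr_ge0// mulr_ge0// ltW.
  have lsg : - ln (sg s) <= `|ln q| - ln al.
    have : ln (q * al) <= ln (sg s) by rewrite ler_ln// posrE; [exact: mulr_gt0|exact: sig_pos].
    rewrite lnM ?posrE//; have := ler_norm (- ln q); rewrite normrN; slra_gt.
  have h1 := Phi1_near0 (sig_pos s0) (sig_le1 s1).
  have h2 : Phi 0 1 + 1 - ln (sg s) <= (Phi 0 1 + 2 + `|ln q|) * (- ln al).
    have nq := normr_ge0 (ln q).
    have : 0 <= Phi 0 1 + 1 + `|ln q| by move: nq F0; slra_gt.
    move=> h; have := ler_wpM2l h l1; move: l1 lsg; slra_gt.
  have g0 : 0 <= (Phi 0 1 + 2 + `|ln q|) * (- ln al).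
    by apply: mulr_ge0; [have := normr_ge0 (ln q); move: F0; slra_gt|move: l1; slra_gt].
  have h3 := ler_wpM2l (ltW (sig_pos s0)) h2.
  have h4 := ler_wpM2r g0 (sig_lin s0 sK); rewrite -/k in h4.
  have h5 := ler_wpM2l (ltW al0) l1; move: h1 h3 h4 h5; slra_gt.
have m1 : 0 < mu - 1 by lra.
have [mu3|mu3] := ltP mu 2.
  have mn : Num.min 1 (mu - 1) = mu - 1 by apply/min_idPr; lra.
  pose Q := Phi (1 - (mu - 1)) 0 / (mu - 1).
  have Q0 : 0 < Q by rewrite divr_gt0// Phi_gt0// => _; lra.
  exists (1 + Q * k `^ (mu - 1)), 1; split => //.
    by have := mulr_ge0 (ltW Q0) (powR_ge0 k (mu - 1)); lra.
  move=> al s d al0 _ al1 s0 sK s1 d0 dD eqh; rewrite mn.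
  have m1' : mu - 1 < 1 by lra.
  have h1 := Phi_near0_lt1 m1 m1' (sig_pos s0); rewrite -/Q in h1.
  have h2 : sg s `^ (mu - 1) <= k `^ (mu - 1) * al `^ (mu - 1).
    rewrite -powRM ?(ltW k0) ?(ltW al0)//; apply: le_powR; rewrite ?(ltW m1) ?(ltW (sig_pos s0))//.
    exact: sig_lin.
  have h3 : al <= al `^ (mu - 1) by apply: ger1_powR; rewrite ?al0 ?ltW.
  have h4 := ler_wpM2l (ltW Q0) h2; move: h1 h3 h4; slra_gt.
have mu4 : 2 < mu by rewrite lt_neqAle eq_sym mu2.
have mn : Num.min 1 (mu - 1) = 1 by apply/min_idPl; lra.
pose Q := Phi (mu - 1 - 1) 0; have Q0 : 0 < Q by apply: Phi_gt0 => // _; lra.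
exists (1 + Q * k), 1; split => //; first by have := mulr_ge0 (ltW Q0) (ltW k0); lra.
move=> al s d al0 _ al1 s0 sK s1 d0 dD eqh; rewrite mn powRr1 ?(ltW al0)//.
have m2 : 1 < mu - 1 by lra.
have h1 := Phi_near0_gt1 m2 (sig_pos s0); rewrite -/Q in h1.
have h2 := ler_wpM2r (ltW Q0) (sig_lin s0 sK); rewrite -/k in h2; move: h1 h2; slra_gt.
Qed.

End MuGreaterOne.

End Asymptotics.

(** * Existence of the root *)

Section Root.
Variable R : realType.
Local Notation leb := (@lebesgue_measure R).
Local Notation Rp := (@Rp R).
Local Notation wJ := (wintegrable Rp).
Implicit Types (x y e s al q : R).

(** The primitive is continued by a constant up to [c], so that the half-line form of the
    fundamental theorem applies to the truncated power. *)
Lemma power_tail (c q : R) : 0 < c -> 0 < q ->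
  J Rp (fun x => if x <= c then 0 else x `^ (- q - 1)) /\
  I Rp (fun x => if x <= c then 0 else x `^ (- q - 1)) = c `^ (- q) / q.
Proof.
move=> c0 q0; pose g x := if x <= c then - (c `^ (- q) / q) else - q^-1 * x `^ (- q).
pose f x : R := if x <= c then 0 else x `^ (- q - 1).
have hg : hasDeriv g f.
  have := hd_glue c0 (hd_cst (- (c `^ (- q) / q))) (hd_scale (- q^-1) (hd_powR (- q))) _.
  move=> /(_ _)/hd_eq; apply => // [|x _]; first by ring.
  by rewrite /f; case: ifP => // _; field; rewrite gt_eqF.
have f0 x : 0 < x -> 0 <= f x by move=> _; rewrite /f; case: ifP => // _; exact: powR_ge0.
have gneg x : - g x = if x <= c then c `^ (- q) / q else x `^ (- q) / q.
  by rewrite /g; case: ifP => _; rewrite ?opprK// mulNr opprK mulrC.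
have gb x : 0 < x -> 0 <= - g x /\ - g x <= c `^ (- q) / q.
  move=> x0; rewrite gneg; case: ifP => h; first by rewrite lexx divr_ge0 ?powR_ge0 ?ltW.
  rewrite divr_ge0 ?powR_ge0 ?(ltW q0)//; split => //; rewrite ler_wpM2r ?invr_ge0 ?(ltW q0)//.
  by rewrite !powRN lef_pV2 ?posrE ?powR_gt0// le_powR ?(ltW q0) ?(ltW c0)// ltW// ltNge h.
have [|j _] := @J_exhaust R f (c `^ (- q) / q) f0 (hd_L1 hg).
  move=> n; have n0 : 0 < n.+1%:R :> R by [].
  have i0 : 0 < n.+1%:R^-1 :> R by rewrite invr_gt0.
  rewrite (hd_I hg) //; last by rewrite (@le_trans _ _ 1)// ?invf_le1// ler1n.
  by have [h1 h2] := gb _ n0; have [h3 h4] := gb _ i0; lra.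
split => //; pose C := q^-1 + c `^ (- q) ^+ 2 / q.
have C1 : q^-1 <= C by rewrite /C lerDl divr_ge0 ?sqr_ge0 ?ltW.
have C2 : c `^ (- q) ^+ 2 / q <= C by rewrite /C lerDr invr_ge0 ltW.
rewrite (@I_Rp_FTC R g f (- (c `^ (- q) / q)) C q hg j q0) ?opprK//.
- move=> t t1; have t0 : 0 < t by apply: lt_le_trans t1.
  rewrite -normrN ger0_norm; last by have [] := gb t t0.
  apply: (@le_trans _ _ (q^-1 / t `^ q)); last by rewrite ler_wpM2r// invr_ge0 powR_ge0.
  rewrite -powRN [leRHS]mulrC gneg; case: ifP => // h; rewrite ler_wpM2r ?invr_ge0 ?(ltW q0)//.
  by rewrite !powRN lef_pV2 ?posrE ?powR_gt0// le_powR ?(ltW q0) ?(ltW t0).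
- move=> t t0 t1; have C0 : 0 <= C by apply: le_trans C1; rewrite invr_ge0 ltW.
  have [tc|ct] := leP t c; first by rewrite /g tc addNr normr0 mulr_ge0 ?powR_ge0.
  have [h1 h2] := gb t t0.
  apply: (@le_trans _ _ (c `^ (- q) / q)).
    by rewrite ler_norml; apply/andP; split; lra.
  apply: (@le_trans _ _ (c `^ (- q) ^+ 2 / q * c `^ q)).
    by rewrite powRN le_eqVlt; apply/orP; left; apply/eqP; field; rewrite !gt_eqF ?powR_gt0.
  apply: ler_pM; rewrite ?powR_ge0 ?divr_ge0 ?sqr_ge0 ?(ltW q0)//.
  by apply: le_powR; exact: ltW.
Qed.

Variables (W psi0 dpsi0 V : R -> R) (c mu a M : R).
Hypothesis H : model W psi0 dpsi0 c mu a M.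
Hypothesis Hd : forall x, c < x -> dpsi0 x = - mu * x `^ (- mu - 1).
Hypothesis HV : in_calV W V.
Hypothesis Vc : forall x, c <= x -> V x = 0.

Let c0 : 0 < c. Proof. exact: md_c H. Qed.
Let mu0 : 0 <= mu. Proof. exact: md_mu H. Qed.

Definition inner_mass : R := wint (inner_part c (fun x => psi0 x ^+ 2)).

Lemma inner_mass_wJ : wJ (inner_part c (fun x => psi0 x ^+ 2)).
Proof.
have := inn_wJ c (domt_L2 (Psi_DT H (@ltr01 R))); apply: wJ_eq => x _.
by rewrite /inner_part; case: ifP => //= ->.
Qed.

Lemma inner_mass_gt0 : 0 < inner_mass.
Proof.
have c2 : 0 < c / 2 by have := c0; lra.
have c2c : c / 2 <= c by have := c0; lra.
have [b b0 hb] := hd_pos_lb (md_loc H).1 c2 c2c (md_pos H).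
have mi : measurable (`[c / 2, c]%classic : set R) by exact: measurable_itv.
have sub := @itv_Rp R (c / 2) c c2.
apply: (@lt_le_trans _ _ (I `[c / 2, c] (fun=> b ^+ 2 * (c / 2)))).
  have h : c / 2 < c by have := c0; lra.
  rewrite /I Rintegral_cst//= lebesgue_measure_itv/= lte_fin ifT// -EFinD/=.
  by apply: mulr_gt0; [apply: mulr_gt0 => //; exact: exprn_gt0|rewrite subr_gt0].
apply: le_trans (I_subset mRp mi sub inner_mass_wJ _); last first.
  by move=> x /RpP x0; rewrite /inner_part; case: ifP => _; rewrite ?mul0r// mulr_ge0 ?sqr_ge0// ltW.
apply: I_le => //; [exact: J_cst|exact: (J_set mRp mi sub inner_mass_wJ)|].
move=> x; rewrite /= in_itv/= => /andP[h1 h2]; rewrite /inner_part h2.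
apply: ler_pM; rewrite ?sqr_ge0 ?(ltW c2)//; apply: ler_sq; first exact: ltW.
exact: hb.
Qed.

Lemma norm_psi0 : 1 < mu -> wint (fun x => psi0 x ^+ 2) = inner_mass + tailc c mu.
Proof.
move=> mu1; have q0 : 0 < 2 * mu - 2 by lra.
have [j e] := power_tail c0 q0.
have eq x : 0 < x -> outer_part c (fun x => psi0 x ^+ 2) x * x = if x <= c then 0 else x `^ (- (2 * mu - 2) - 1).
  move=> x0; rewrite /outer_part; case: ifP => h; first by rewrite mul0r.
  have cx : c <= x by rewrite ltW// ltNge h.
  rewrite (md_psi0 H cx) (_ : - (2 * mu - 2) - 1 = - mu + - mu + 1); last by ring.
  by rewrite !powRDx// powRr1 ?(ltW x0)// expr2.
have jo : wJ (outer_part c (fun x => psi0 x ^+ 2)).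
  by apply: (J_eq mRp _ j) => x /RpP x0; rewrite eq.
have -> : wint (fun x => psi0 x ^+ 2) = inner_mass + wint (outer_part c (fun x => psi0 x ^+ 2)).
  rewrite -(wint_add inner_mass_wJ jo); apply: wint_eq => x _.
  by rewrite /inner_part /outer_part; case: ifP; rewrite ?addr0 ?add0r.
congr (_ + _); have -> : wint (outer_part c (fun x => psi0 x ^+ 2)) = I Rp (fun x => if x <= c then 0 else x `^ (- (2 * mu - 2) - 1)).
  by apply: I_eq => x /RpP x0; rewrite eq.
rewrite e.
rewrite /tailc (_ : - (2 * mu - 2) = - mu + - mu + 2); last by ring.
rewrite (powRDx (- mu + - mu) 2 c0) (powRDx (- mu) (- mu) c0) (powR_mulrn 2 (ltW c0)) expr2.
by field; lra.
Qed.

Lemma secular_cont x : 0 < x -> {for x, continuous (secular inner_mass c mu)}.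
Proof.
move=> x0; have g0 : 0 < sig x c by exact: sig_gt0.
have cs : {for x, continuous (fun s => sig s c)}.
  by apply: cvgM; [apply: cvgM; [exact: cvg_id|exact: cvg_cst]|exact: cvg_cst].
have cP nu : {for x, continuous (fun s => Phi nu (sig s c))}.
  by apply: (@continuous_comp _ _ _ (fun s => sig s c) (Phi nu)) => //; exact: Phi_cont.
apply: cvgD; first by apply: cvgM; [exact: cvg_cst|exact: cvg_id].
apply: cvgM; first exact: cvg_cst.
apply: cvgM; last by apply: cvgV; [rewrite gt_eqF// Phi_gt0'|exact: cP].
apply: cvgM; last exact: cP.
by apply: cvgM; [apply: cvgM; [exact: cvg_id|exact: cvg_cst]|exact: cvg_cst].
Qed.

(** The secular function minus [al v] minus the correction [rho] changes sign between a tiny [s1]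
    and [K0 al]. Since [rho >= 0] and [rho = O(al^2)], it can be written as [al v d] with
    [0 <= d <= D0 al]. *)
Lemma root_exists (v := wint (fun x => V x * psi0 x ^+ 2)) : 0 < v ->
  exists a1 K0 D0 : R, [/\ 0 < a1, 0 < K0, 0 <= D0 & forall al, 0 < al -> al < a1 ->
    exists s d, [/\ 0 < s, s <= K0 * al, 0 <= d /\ d <= D0 * al,
      secular inner_mass c mu s = al * v * (1 + d) & neg_eig W V al = [set - s]]].
Proof.
move=> v0; have m0 := inner_mass_gt0.
have [a0 [C [eta [a00 C0 He Hl Hv]]]] := inner_solution H HV.
pose rho al s := source psi0 dpsi0 V c al s (eta al s).
(* At [s = K0 al] the term [m s] alone equals [2 al v], which leaves room for the correction. *)
have [K0 K0E] : exists K0, K0 = 2 * v / inner_mass by eexists.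
have K00 : 0 < K0 by rewrite K0E divr_gt0// mulr_gt0.
have [Q QE] : exists Q, Q = C * (1 + K0) ^+ 2 by eexists.
have Q0 : 0 < Q by rewrite QE mulr_gt0// exprn_gt0//; lra.
(* [(2 * K0)^-1] keeps [s] below 1, where the Lipschitz bound holds; [v / Q] keeps the correction
   below [al v]. *)
exists (Num.min (Num.min a0 1) (Num.min (2 * K0)^-1 (v / Q))), K0, (Q / v).
split => //.
- by rewrite !lt_min a00 ltr01 invr_gt0 divr_gt0// mulr_gt0.
- by rewrite divr_ge0 ?ltW.
move=> al al0; rewrite !lt_min => /andP[/andP[h1 h2] /andP[h3 h4]].
have ala : al <= a0 by exact: ltW.
have s2 : K0 * al < 1.
  have : al * (2 * K0) < 1 by rewrite -ltr_pdivlMr ?mulr_gt0// div1r.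
  have := mulr_gt0 al0 K00; lra.
have alQ : Q * al < v by move: h4; rewrite ltr_pdivlMr// mulrC.
have S0 : 0 < K0 * al by rewrite mulr_gt0.
have av0 : 0 < al * v by rewrite mulr_gt0.
have [s1 [s10 s1S hs1]] := secular_small m0 c0 mu0 av0 S0.
pose F s := secular inner_mass c mu s - al * v - rho al s.
have rb s : 0 <= s -> s <= K0 * al -> 0 <= rho al s /\ rho al s <= Q * al ^+ 2.
  move=> s0 sK; have [_ _ r1 r2] := He al s al0 ala s0; split => //; apply: le_trans r2 _.
  rewrite (_ : Q * al ^+ 2 = C * (al + K0 * al) ^+ 2); last by rewrite QE; ring.
  apply: ler_wpM2l; first exact: ltW.
  by apply: ler_sq; [apply: addr_ge0 => //; exact: ltW|lra].
have cF x : 0 < x -> x < 1 -> {for x, continuous F}.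
  move=> x0 x1; apply: cvgB; first by apply: cvgB; [exact: secular_cont|exact: cvg_cst].
  apply/cvgrPdist_le => /= e e0.
  pose r := Num.min (Num.min x (1 - x)) (e / C).
  have r0 : 0 < r by rewrite !lt_min x0 divr_gt0// subr_gt0 x1.
  exists r => //= y; rewrite /ball_/= !lt_min => /andP[/andP[yx y1] ye].
  have [y0 y2] : 0 <= y /\ y <= 1.
    by move: yx y1; rewrite !ltr_norml => /andP[? ?] /andP[? ?]; split; lra.
  apply: le_trans (Hl al x y al0 ala (ltW x0) (ltW x1) y0 y2) _.
  by move: ye; rewrite ltr_pdivlMr// => /ltW; rewrite mulrC.
have F1 : F s1 <= 0.
  by have [r1 _] := rb s1 (ltW s10) (ltW s1S); rewrite /F; lra.
have F2 : 0 <= F (K0 * al).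
  have [_ r1] := rb (K0 * al) (ltW S0) (lexx _); rewrite /F /secular.
  have g0 : 0 <= c `^ (- mu) ^+ 2 * gs c mu (K0 * al).
    apply: mulr_ge0; first exact: sqr_ge0.
    have sg0 : 0 < sig (K0 * al) c by exact: sig_gt0.
    apply: divr_ge0; last by rewrite ltW// Phi_gt0'.
    apply: mulr_ge0; last by rewrite ltW// Phi_gt0'.
    by apply: mulr_ge0; [apply: divr_ge0 => //; exact: ltW|exact: sqr_ge0].
  have e : inner_mass * (K0 * al) = 2 * (al * v) by rewrite K0E; field; rewrite gt_eqF.
  have e2 : Q * al ^+ 2 <= al * v.
    by rewrite expr2 mulrA [leRHS]mulrC; apply: ler_wpM2r; exact: ltW.
  by rewrite e; lra.
have [||s] := @IVT R F s1 (K0 * al) 0 (ltW s1S).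
- apply: continuous_in_subspaceT => x; rewrite inE/= in_itv/= => /andP[x1 x2].
  by apply: cF; [exact: lt_le_trans x1|exact: le_lt_trans s2].
- by rewrite ge_min F1 le_max F2 orbT.
rewrite in_itv/= => /andP[ss1 ss2] Fs.
have s0 : 0 < s by exact: lt_le_trans ss1.
have [r1 r2] := rb s (ltW s0) ss2.
exists s, (rho al s / (al * v)); split => //.
- split; first by apply: divr_ge0 => //; exact: ltW.
  rewrite ler_pdivrMr//; apply: le_trans r2 _.
  by rewrite le_eqVlt; apply/orP; left; apply/eqP; field; rewrite gt_eqF.
- rewrite mulrDr mulr1 mulrCA mulfV ?gt_eqF// mulr1; move: Fs; rewrite /F; lra.
have [xe he _ _] := He al s al0 ala (ltW s0).
have eg : neg_eig W V al (- s).
  apply: (eigen_root H Hd HV Vc s0 xe he); rewrite (md_psi0 H (lexx c)).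
  move: Fs; rewrite /F /secular /inner_mass -/v /rho; lra.
apply/seteqP; split => [l hl|l ->//].
exact: (neg_eig_unique H HV Vc Hv al0 ala hl eg).
Qed.

End Root.

(** Fixes the smoothing parameter: the mass of the bump is made to exceed [a], so the enlarged form
    bound is still below 1. *)
Lemma step_constant (R : realType) (a : R) : 0 <= a -> a < 1 ->
  exists r : R, [/\ 0 < r, 0 < stepm r & a / stepm r < 1].
Proof.
move=> a0 a1; pose t := (1 - a) / 5.
have t0 : 0 < t by rewrite /t; lra.
have t1 : t < 1 / 2 by rewrite /t; lra.
have h := stepm_lb t0 t1.
have h2 : a < (1 - 2 * t) ^+ 2.
  have -> : (1 - 2 * t) ^+ 2 = a + (1 - a) * (9 - 4 * a) / 25 by rewrite /t; field.
  rewrite ltrDl divr_gt0// mulr_gt0//; lra.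
have s0 : 0 < stepm (t ^+ 2) by apply: lt_le_trans h; exact: le_lt_trans h2.
exists (t ^+ 2); split => //; first exact: exprn_gt0.
by rewrite ltr_pdivrMr// mul1r; exact: lt_le_trans h.
Qed.

(* The derivative in [weak_sol] is only determined almost everywhere; beyond [c] we fix its
   pointwise value. *)
Lemma model_of_weak_sol (R : realType) (W : R -> R) (RR mu a M : R) (psi0 dpsi : R -> R) (c : R) :
  0 < RR -> RR <= c -> 0 <= mu -> locL1 W ->
  (forall r, RR <= r -> W r = mu ^+ 2 / r ^+ 2) ->
  0 <= a -> a < 1 -> 0 <= M ->
  (forall psi, Cc_inf psi ->
     wint (fun x => negp W x * psi x ^+ 2)
     <= a * wint (fun x => (derive1 psi x) ^+ 2) + M * wint (fun x => psi x ^+ 2)) ->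
  in_domloc W psi0 dpsi ->
  (forall phi dphi b, in_domt W phi dphi -> (forall x, b <= x -> phi x = 0) ->
      tform W phi dphi psi0 dpsi = 0) ->
  (forall r, 0 < r -> 0 < psi0 r) -> (forall r, RR <= r -> psi0 r = r `^ (- mu)) ->
  exists a', model W psi0 (fun x => if x <= c then dpsi x else - mu * x `^ (- mu - 1)) c mu a' M.
Proof.
move=> RR0 Rc mu0 LW WR a0 a1 M0 Hb [hp loc] weak ps pR.
have c0 : 0 < c by exact: lt_le_trans Rc.
have [r [r0 s0 ar]] := step_constant a0 a1.
set d := fun x => if x <= c then dpsi x else - mu * x `^ (- mu - 1).
have hd : hasDeriv psi0 d.
  have hg := @hd_glue R c _ _ _ _ c0 hp (hd_powR (- mu)) (pR c Rc).
  apply: (hd_eq hg) => // x x0; case: ifP => // h; rewrite pR//.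
  by apply: le_trans Rc _; rewrite ltW// ltNge h.
(* Two derivatives of one function agree almost everywhere, so the weak equation survives the change
   of representative. *)
have [Z [mZ Z0 dZ]] := hd_unique hd hp.
have md := locL1_meas (hd_L1 hd).
exists (a / stepm r); split => //.
- by move=> x cx; apply: WR; exact: le_trans cx.
- by rewrite divr_ge0// ltW.
- move=> u du A B A0 AB hu uA uB du2.
  exact: (negp_bound_ac LW a0 M0 r0 s0 A0 AB Hb hu uA uB du2).
- split => // b b0; have [j1 j2 j3] := loc b b0; split => //.
  have mi : measurable (`]0, b]%classic : set R) by exact: measurable_itv.
  have sub : `]0, b]%classic `<=` @Rp R by move=> x; rewrite /= in_itv/= => /andP[h _]; apply/RpP.
  pose K := (mu * c `^ (- mu - 1)) ^+ 2.
  have jK : J `]0, b] (fun=> K * b).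
    apply: (J_set (measurable_itv _) mi _ (J_cst 0 b (K * b))) => x.
    by rewrite /= !in_itv/= => /andP[/ltW -> ->].
  apply: (J_le mi _ _ (J_add mi j2 jK)).
    apply: (measurable_funS mRp sub); apply: measurable_funM; last exact: m_id.
    exact: measurable_funX.
  move=> x; rewrite /= in_itv/= => /andP[x0 xb].
  have e0 : 0 <= dpsi x ^+ 2 * x by rewrite mulr_ge0 ?sqr_ge0 ?ltW.
  have K0 : 0 <= K by exact: sqr_ge0.
  rewrite ger0_norm; last by rewrite mulr_ge0 ?sqr_ge0 ?ltW.
  rewrite /d; case: ifP => h; first by rewrite lerDl mulr_ge0// ltW.
  apply: (@le_trans _ _ (K * b)); last by rewrite lerDr.
  have cx : c < x by rewrite ltNge h.
  apply: ler_pM; rewrite ?sqr_ge0 ?(ltW x0)// mulNr sqrrN; apply: ler_sq.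
    by rewrite mulr_ge0 ?powR_ge0.
  rewrite ler_wpM2l// (_ : - mu - 1 = - (mu + 1)); last by ring.
  by rewrite !powRN lef_pV2 ?posrE ?powR_gt0// le_powR ?(ltW c0) ?(ltW cx)//; lra.
- move=> phi dphi b hphi hb; rewrite -(weak phi dphi b hphi hb).
  have mphi := domt_meas hphi; have mdphi := domt_dmeas hphi.
  have mW := locL1_meas LW; have mp := hd_meas hp; have mdp := locL1_meas (hd_L1 hp).
  apply: (wint_ae mZ Z0).
  + by apply: measurable_funD; apply: measurable_funM => //; apply: measurable_funM.
  + by apply: measurable_funD; apply: measurable_funM => //; apply: measurable_funM.
  + by move=> x x0 nz; rewrite (dZ x x0 nz).
- by move=> x cx; apply: pR; exact: le_trans cx.
Qed.

Theorem theorem1p6 (R : realType) (W : R -> R) (RR mu a M : R)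
    (psi0 V : R -> R) :
  (* standing assumption (a) *)
  0 < RR -> 0 <= mu -> locL1 W ->
  (forall r, RR <= r -> W r = mu ^+ 2 / r ^+ 2) ->
  (* standing assumption (b) *)
  0 <= a -> a < 1 -> 0 <= M ->
  (forall psi, Cc_inf psi ->
     wint (fun x => negp W x * psi x ^+ 2)
     <= a * wint (fun x => (derive1 psi x) ^+ 2) + M * wint (fun x => psi x ^+ 2)) ->
  (* standing assumption (c) *)
  (forall psi, Cc_inf psi ->
     0 <= wint (fun x => (derive1 psi x) ^+ 2 + W x * psi x ^+ 2)) ->
  (* positive weak solution psi0 with psi0(r) = r^{-mu} for r >= R *)
  weak_sol W psi0 -> (forall r, 0 < r -> 0 < psi0 r) ->
  (forall r, RR <= r -> psi0 r = r `^ (- mu)) ->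
  (* V in \mathcal V with v > 0 *)
  in_calV W V ->
  0 < wint (fun x => V x * psi0 x ^+ 2) ->
  let v := wint (fun x => V x * psi0 x ^+ 2) in
  exists alpha0, 0 < alpha0 /\
  exists lam : R -> R,
    (forall alpha, 0 < alpha < alpha0 -> neg_eig W V alpha = [set lam alpha]) /\
    exists C alpha1, 0 < alpha1 /\ forall alpha, 0 < alpha < alpha1 ->
      exists e : R,
        [/\ mu = 0 ->
              `|e| <= C * alpha /\
              lam alpha = - expR (- (2 / (alpha * v)) * (1 + e)),
            0 < mu < 1 ->
              `|e| <= C * alpha `^ (Num.min 1 (1 / mu - 1)) /\
              lam alpha = - c_mu mu * (alpha * v) `^ (1 / mu) * (1 + e),
            mu = 1 ->
              `|e| <= C * (ln `|ln alpha| / `|ln alpha|) /\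
              lam alpha = - (2 * alpha * v / `|ln alpha|) * (1 + e) &
            1 < mu ->
              `|e| <= C * (if mu == 2 then alpha * `|ln alpha|
                           else alpha `^ (Num.min 1 (mu - 1))) /\
              lam alpha = - (alpha * v / wint (fun x => psi0 x ^+ 2)) * (1 + e)].
Proof.
move=> RR0 mu0 LW WR a0 a1 M0 Hb _ [dpsi [dl weak]] ps pR HV v0 v.
have [_ [b Vb] _ _] := HV.
(* Beyond both the radius where [W] and [psi0] become explicit and the support of [V]. *)
pose c := Num.max RR b.
have Rc : RR <= c by rewrite le_max lexx.
have c0 : 0 < c by exact: lt_le_trans Rc.
have [a' H] := model_of_weak_sol RR0 Rc mu0 LW WR a0 a1 M0 Hb dl weak ps pR.
set dpsi0 := fun x => _ in H.
have Hd x : c < x -> dpsi0 x = - mu * x `^ (- mu - 1).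
  by move=> cx; rewrite /dpsi0 ifF//; apply/negbTE; rewrite -ltNge.
have Vc x : c <= x -> V x = 0 by move=> cx; apply: Vb; apply: le_trans cx; rewrite le_max lexx orbT.
have [al1 [K0 [D0 [al10 K00 D00 HR]]]] := root_exists H Hd HV Vc v0.
pose m := inner_mass psi0 c; have m0 : 0 < m := inner_mass_gt0 H.
(* The eigenvalue has to be a function of the coupling; outside the range its value is the default
   0. *)
have /choice[sr Hsr] : forall al, exists s, 0 < al -> al < al1 -> exists d,
    [/\ 0 < s, s <= K0 * al, 0 <= d /\ d <= D0 * al,
      secular m c mu s = al * v * (1 + d) & neg_eig W V al = [set - s]].
  move=> al; have [[h1 h2]|h] := pselect (0 < al /\ al < al1).
    by have [s [d hs]] := HR al h1 h2; exists s => _ _; exists d.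
  by exists 0 => h1 h2; exfalso; apply: h.
exists al1; split => //; exists (fun al => - sr al); split.
  by move=> al /andP[h1 h2]; have [d []] := Hsr al h1 h2.
(* For a given [mu] only one of the four clauses is not vacuous; this transfers the matching
   asymptotic lemma to the chosen root, whichever error statement [P] it proves. *)
have red (nu : R) (P : R -> R -> R -> R -> Prop) : mu = nu ->
    (exists C a2 : R, 0 < a2 /\ forall al s d, 0 < al -> al < a2 -> 0 < s -> s <= K0 * al ->
      0 <= d -> d <= D0 * al -> secular m c nu s = al * v * (1 + d) -> exists e, P C al s e) ->
    exists C a2 : R, 0 < a2 /\ forall al, 0 < al < a2 -> exists e, P C al (sr al) e.
  move=> <- [C [a2 [a20 h]]]; exists C, (Num.min a2 al1); split; first by rewrite lt_min a20.
  move=> al /andP[h1]; rewrite lt_min => /andP[h2 h3].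
  by have [d [s0 sK [d0 dD] eqs _]] := Hsr al h1 h3; exact: (h al (sr al) d).
have [mu_0|mu_n0] := eqVneq mu 0.
  have [C [a2 [a20 h]]] := red _ _ mu_0 (asym_mu0 m0 c0 v0 K00 D00).
  exists C, a2; split => // al hal; have [e he] := h al hal.
  by exists e; split => // h'; exfalso; move: h'; clear -mu_0; lra.
have mu_p : 0 < mu by rewrite lt_neqAle eq_sym mu_n0.
have [mu_1|mu_1|mu_1] := ltgtP mu 1.
- have [C [a2 [a20 h]]] := red _ _ erefl (asym_lt1 m0 c0 v0 K00 D00 mu_p mu_1).
  exists C, a2; split => // al hal; have [e he] := h al hal.
  by exists e; split => // h'; exfalso; move: h'; clear -mu_1 mu_p; lra.
- have := asym_gt1 m0 c0 v0 K00 D00 mu_1; rewrite -(norm_psi0 H mu_1) => /(red _ _ erefl)[C [a2 [a20 h]]].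
  exists C, a2; split => // al hal; have [e he] := h al hal.
  by exists e; split => // h'; exfalso; move: h'; clear -mu_1; lra.
- have [C [a2 [a20 h]]] := red _ _ mu_1 (asym_mu1 m0 c0 v0 K00 D00).
  exists C, a2; split => // al hal; have [e he] := h al hal.
  by exists e; split => // h'; exfalso; move: h'; clear -mu_1; lra.
Qed.
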